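(* Let $\Omega\subset\mathbb{R}^n$ be a bounded $(\varepsilon,\infty)$-domain with $\varepsilon\in(0,1]$ and $\{\rho_\nu\}_{\nu\in(0,\nu_0)}$ a $\nu_0$-radial decreasing approximation of the identity on $\mathbb{R}^n$ with $\nu_0\in(0,\infty)$. Let $1<r\leq\alpha<\infty$ and $p\in[1,r]$. Then $f\in W^{1,M_r^\alpha}(\Omega)$ if and only if $f\in M_r^\alpha(\Omega)$ and $$\liminf_{\nu\to0^+}\left\|\left[\int_\Omega\frac{|f(\cdot)-f(y)|^p}{|\cdot-y|^p}\rho_\nu(|\cdot-y|)\,dy\right]^{\frac1p}\right\|_{M_r^\alpha(\Omega)}<\infty;$$ moreover, there exist two constants $C_1,C_2\in(0,\infty)$, depending only on $\alpha$, $r$, $n$, $p$, and $\Omega$, such that, for such $f$, $$C_1\left\|\,|\nabla f|\,\right\|_{M_r^\alpha(\Omega)}\leq\liminf_{\nu\to0^+}\left\|\left[\int_\Omega\frac{|f(\cdot)-f(y)|^p}{|\cdot-y|^p}\rho_\nu(|\cdot-y|)\,dy\right]^{\frac1p}\right\|_{M_r^\alpha(\Omega)}$$ $$\leq\limsup_{\nu\to0^+}\left\|\left[\int_\Omega\frac{|f(\cdot)-f(y)|^p}{|\cdot-y|^p}\rho_\nu(|\cdot-y|)\,dy\right]^{\frac1p}\right\|_{M_r^\alpha(\Omega)}\leq C_2\left\|\,|\nabla f|\,\right\|_{M_r^\alpha(\Omega)}.$$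
   Context: Morrey space. For $0<r\le\alpha<\infty$, $M_r^\alpha(\mathbb{R}^n)$ is the set of all measurable functions $f$ on $\mathbb{R}^n$ with $$\|f\|_{M_r^\alpha(\mathbb{R}^n)}:=\sup_{x\in\mathbb{R}^n}\sup_{R\in(0,\infty)}|B(x,R)|^{\frac1\alpha-\frac1r}\|f\|_{L^r(B(x,R))}<\infty.$$ For open $\Omega\subset\mathbb{R}^n$, $M_r^\alpha(\Omega)$ is the set of measurable $f$ on $\Omega$ that are restrictions to $\Omega$ of some $g\in M_r^\alpha(\mathbb{R}^n)$, with $\|f\|_{M_r^\alpha(\Omega)}:=\inf\{\|g\|_{M_r^\alpha(\mathbb{R}^n)}: f=g|_\Omega\}$ (equivalently, the $M_r^\alpha(\mathbb{R}^n)$ norm of the extension of $f$ by zero; it is $\infty$ if $f\notin M_r^\alpha(\Omega)$). $W^{1,M_r^\alpha}(\Omega)$ is the set of $f\in M_r^\alpha(\Omega)$ whose first-order weak partial derivatives all exist and belong to $M_r^\alpha(\Omega)$; $\nabla f$ is the weak gradient. For $\varepsilon\in(0,1]$, an open set $\Omega\subset\mathbb{R}^n$ is an $(\varepsilon,\infty)$-domain if, for any $x,y\in\Omega$ with $x\ne y$, there is a rectifiable curve $\Gamma$ lying in $\Omega$, connecting $x$ and $y$, with Euclidean length $\ell(\Gamma)\le\varepsilon^{-1}|x-y|$ and $\mathrm{dist}(z,\partial\Omega)\ge\frac{\varepsilon|x-z||y-z|}{|x-y|}$ for any point $z$ on $\Gamma$. A $\nu_0$-radial decreasing approximation of the identity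 on $\mathbb{R}^n$ is a family $\{\rho_\nu\}_{\nu\in(0,\nu_0)}$ of nonnegative locally integrable functions on $(0,\infty)$ such that each $\rho_\nu$ is decreasing on $(0,\infty)$, $\int_0^\infty\rho_\nu(r)r^{n-1}\,dr=1$ for every $\nu\in(0,\nu_0)$, and $\lim_{\nu\to0^+}\int_\delta^\infty\rho_\nu(r)r^{n-1}\,dr=0$ for every $\delta\in(0,\infty)$. *)

(* Defs.v *)
From HB Require Import structures.
From mathcomp Require Import all_boot all_order all_algebra.
From mathcomp Require Import all_classical all_reals all_analysis.
From mathcomp Require Import measurable_realfun.

Set Implicit Arguments.
Unset Strict Implicit.
Unset Printing Implicit Defensive.
Import Order.TTheory GRing.Theory Num.Theory.
Import numFieldNormedType.Exports.

Local Open Scope classical_set_scope.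
Local Open Scope ring_scope.

(* The ambient space is R^(n+1), represented by 'rV[R]_n.+1, so that the
   dimension is positive.  Functions on a subset Omega are represented by total
   functions of which only the values on Omega are used. *)

Section euclidean.
Context (R : realType) (n : nat).
Local Notation E := 'rV[R]_n.+1.
Implicit Types (x y : E) (A : set E).

(* The norm `|x| of the library on 'rV[R]_n.+1 is the sup norm; it induces the
   same topology and the same bounded sets as enorm. *)
Definition enorm x : R := Num.sqrt (\sum_i x 0 i ^+ 2).

Definition eball x (rad : R) : set E := [set y | enorm (y - x) < rad].

Definition frontier A : set E := closure A `\` interior A.

(* +oo when A is empty *)
Definition edist x A : \bar R := ereal_inf [set (enorm (x - z))%:E | z in A].

Definition curve_length (g : R -> E) : \bar R :=
  ereal_sup [set (\sum_(0 <= k < size s)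
                   enorm (g (nth 1 (0 :: s) k.+1) - g (nth 1 (0 :: s) k)))%:E
            | s in itv_partition 0 1].

Definition eps_infty_domain (eps : R) (Omega : set E) : Prop :=
  open Omega /\
  forall x y, Omega x -> Omega y -> x <> y ->
  exists g : R -> E,
    [/\ {within `[0, 1], continuous g}, g 0 = x, g 1 = y,
        g @` `[0, 1] `<=` Omega
      & [/\ (curve_length g < +oo)%E,
         (curve_length g <= (eps^-1 * enorm (x - y))%:E)%E
       & forall z, (g @` `[0, 1]) z ->
         ((eps * enorm (x - z) * enorm (y - z) / enorm (x - y))%:E
            <= edist z (frontier Omega))%E ]].

End euclidean.

Section lebesgue.
Context (R : realType) (n : nat).
Local Notation E := 'rV[R]_n.+1.

Definition box (B : E * E) : set E :=
  [set x | forall i, B.1 0 i < x 0 i <= B.2 0 i].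

Definition box_volume (B : E * E) : R := \prod_i (B.2 0 i - B.1 0 i).

Definition box_cover (A : set E) : set (nat -> E * E) :=
  [set B : nat -> E * E | (forall k i, (B k).1 0 i <= (B k).2 0 i) /\
           A `<=` \bigcup_k box (B k)].

Definition lebesgue_outer (A : set E) : \bar R :=
  ereal_inf [set (\sum_(k <oo) (box_volume (B k))%:E)%E | B in box_cover A].

Local Open Scope ereal_scope.

Lemma box_cover_ge0 A B k : box_cover A B -> 0 <= (box_volume (B k))%:E.
Proof.
by move=> [B0 _]; rewrite lee_fin; apply: prodr_ge0 => i _; rewrite subr_ge0.
Qed.

Lemma lebesgue_outer_ge0 A : 0 <= lebesgue_outer A.
Proof.
apply: le_ereal_inf_tmp => _ [B AB <-].
by apply: nneseries_ge0 => k _ _; exact: box_cover_ge0 AB.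
Qed.

Lemma lebesgue_outer0 : lebesgue_outer set0 = 0.
Proof.
apply/eqP; rewrite eq_le lebesgue_outer_ge0 andbT.
apply: ereal_inf_lbound; exists (fun=> (0%R, 0%R)).
  by split=> // k i; rewrite lexx.
apply: eseries0 => k _ _; congr (_%:E).
by rewrite /box_volume big_ord_recl /= subrr mul0r.
Qed.

Lemma le_lebesgue_outer : {homo lebesgue_outer : A B / A `<=` B >-> A <= B}.
Proof.
move=> A B AB; apply/ereal_inf_le_tmp => _ [C [C0 BC] <-].
by exists C => //; split => //; exact: subset_trans AB BC.
Qed.

Lemma lebesgue_outer_sigma_subadditive : sigma_subadditive lebesgue_outer.
Proof.
move=> A; have [[i ioo]|] := pselect (exists i, lebesgue_outer (A i) = +oo).
  rewrite (eseries_pinfty _ _ ioo) ?leey// => k _.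
  by rewrite -ltNye (lt_le_trans _ (lebesgue_outer_ge0 _)).
rewrite -forallNE => Aoo.
suff add2e (e : {posnum R}) :
    lebesgue_outer (\bigcup_k A k) <=
    \sum_(i <oo) lebesgue_outer (A i) + e%:num%:E.
  by apply/lee_addgt0Pr => _/posnumP[].
rewrite (le_trans _ (epsilon_trick _ _ _))//; last first.
  by move=> k; exact: lebesgue_outer_ge0.
pose P k (B : nat -> E * E) := box_cover (A k) B /\
  \sum_(j <oo) (box_volume (B j))%:E <=
    lebesgue_outer (A k) + (e%:num / (2 ^ k.+1)%:R)%:E.
have [G PG] : {G : nat -> nat -> E * E & forall k, P k (G k)}.
  apply: (@choice _ _ P) => k; rewrite /P /lebesgue_outer.
  set S := (X in ereal_inf X).
  have Sfin : ereal_inf S \is a fin_num.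
    rewrite ge0_fin_numE ?lebesgue_outer_ge0// ltey; apply/eqP; exact: Aoo.
  have en1 : (0 < e%:num / (2 ^ k.+1)%:R)%R by [].
  have [_ [B AB <-] muB] := lb_ereal_inf_adherent en1 Sfin.
  by exists B; split => //; exact/ltW.
pose vol (i : nat * nat) := (box_volume (G i.1 i.2))%:E.
have vol_ge0 i : 0 <= vol i by exact: box_cover_ge0 (PG i.1).1.
apply: (@le_trans _ _ (\esum_(i in setT) vol i)).
  apply: ereal_inf_lbound.
  have /card_esym/ppcard_eqP[f] := card_nat2.
  exists (fun k => G (f k).1 (f k).2).
    split=> [k i|t [i _]]; first exact: (PG (f k).1).1.1.
    move=> /(PG i).1.2[j _ Gt]; exists (f^-1%FUN (i, j)) => //=.
    by rewrite invK ?inE.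
  rewrite -(esum_pred_image vol f xpredT) ?[fun=> _]set_true//.
  by rewrite image_eq.
rewrite (_ : esum _ _ = \sum_(i <oo) \sum_(j <oo) vol (i, j)); last first.
  pose J : nat -> set (nat * nat) := fun i => [set (i, j) | j in setT].
  rewrite (_ : setT = \bigcup_k J k); last first.
    by rewrite predeqE => -[a b]; split => // _; exists a => //; exists b.
  rewrite esum_bigcupT //=; last first.
    apply/trivIsetP => i j _ _ ij.
    rewrite predeqE => -[k m] /=; split => //= -[] [_] _ [<-{k} _].
    by move=> [m' _] [] /esym/eqP; rewrite (negbTE ij).
  rewrite -(image_id [set: nat]) -fun_true esum_pred_image//; last first.
    by move=> k _; exact: esum_ge0.
  apply: eq_eseriesr => /= j _.
  rewrite -(esum_pred_image vol (pair j) predT)//=; last first.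
    by move=> ? ? _ _; exact: (@can_inj _ _ _ snd).
  by congr esum; rewrite predeqE => -[a b]; split; move=> [i _ <-]; exists i.
apply: lee_nneseries => [k _ _|k _].
- by apply: nneseries_ge0 => m _ _; exact: (vol_ge0 (k, m)).
- exact: (PG k).2.
Qed.

HB.instance Definition _ := isOuterMeasure.Build R E lebesgue_outer
  lebesgue_outer0 lebesgue_outer_ge0 le_lebesgue_outer
  lebesgue_outer_sigma_subadditive.

(* R^(n+1) with the complete sigma-algebra of Lebesgue measurable sets *)
Definition lebesgue_space := caratheodory_type lebesgue_outer.
HB.instance Definition _ := Measurable.on lebesgue_space.

Definition lebn : set lebesgue_space -> \bar R := lebesgue_outer.
HB.instance Definition _ := isMeasure.Build _ lebesgue_space R lebn
  (caratheodory_measure0 lebesgue_outer) (@caratheodory_measure_ge0 _ _ lebesgue_outer)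
  (@caratheodory_measure_sigma_additive _ _ lebesgue_outer).

End lebesgue.

Arguments lebn {R n} _.

Section morrey.
Context (R : realType) (n : nat).
Local Notation E := 'rV[R]_n.+1.
Local Notation L := (lebesgue_space R n).
Local Open Scope ereal_scope.
Implicit Types (Omega : set E) (alpha r : R) (g f : E -> \bar R).

Definition morrey_norm alpha r g : \bar R :=
  ereal_sup [set lebn (eball xr.1 xr.2) `^ (alpha^-1 - r^-1) *
                 'N[lebn]_(r%:E)[g \_ (eball xr.1 xr.2)]
            | xr in [set xr : E * R | (0 < xr.2)%R]].

Definition morrey alpha r : set (E -> \bar R) :=
  [set g | measurable_fun [set: L] g /\
           morrey_norm alpha r g < +oo].

Definition morrey_extension Omega alpha r f : set (E -> \bar R) :=
  [set g | morrey alpha r g /\ forall x, Omega x -> g x = f x].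

Definition morrey_on Omega alpha r : set (E -> \bar R) :=
  [set f | exists g, morrey_extension Omega alpha r f g].

(* +oo (the infimum of the empty set) when f has no extension *)
Definition morrey_norm_on Omega alpha r f : \bar R :=
  ereal_inf [set morrey_norm alpha r g
            | g in morrey_extension Omega alpha r f].

End morrey.

Section sobolev.
Context (R : realType) (n : nat).
Local Notation E := 'rV[R]_n.+1.
Local Notation L := (lebesgue_space R n).
Implicit Types (Omega : set E) (f g phi : E -> R).

Definition partial (i : 'I_n.+1) phi : E -> R := 'D_(delta_mx 0 i) phi.

Fixpoint Ck (k : nat) phi : Prop :=
  continuous phi /\
  match k with
  | 0 => True
  | k'.+1 => forall i, (forall x, derivable phi x (delta_mx 0 i)) /\
                       Ck k' (partial i phi)
  end.

Definition test_function Omega phi : Prop :=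
  [/\ forall k, Ck k phi,
      compact (closure [set x | phi x != 0])
    & closure [set x | phi x != 0] `<=` Omega].

(* The library's locally_integrable is restricted to functions on R. *)
Definition locally_integrable_on Omega f : Prop :=
  measurable_fun (Omega : set L) (f : L -> R) /\
  forall K : set E, K `<=` Omega -> compact K ->
    (\int[lebn]_(x in K) `|f x|%:E < +oo)%E.

Definition weak_partial Omega (i : 'I_n.+1) f g : Prop :=
  [/\ locally_integrable_on Omega f, locally_integrable_on Omega g
    & forall phi, test_function Omega phi ->
      (\int[lebn]_(x in Omega) (f x * partial i phi x)%:E =
       - \int[lebn]_(x in Omega) (g x * phi x)%:E)%E].

(* Weak gradients are only unique up to almost everywhere equality. *)
Definition weak_gradient Omega f (G : E -> E) : Prop :=
  forall i, weak_partial Omega i f (fun x => G x 0 i).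

Definition sobolev_morrey Omega (alpha r : R) : set (E -> R) :=
  [set f | morrey_on Omega alpha r (EFin \o f) /\
    exists2 G : E -> E, weak_gradient Omega f G &
      forall i, morrey_on Omega alpha r (fun x => (G x 0 i)%:E)].

End sobolev.

Section bbm.
Context (R : realType) (n : nat).
Local Notation E := 'rV[R]_n.+1.

(* In R^(n+1) the radial weight is s ^+ n.  "Decreasing" is meant in the wide
   sense.  Only the values rho nu s with nu in ]0, nu0[ and s > 0 are
   relevant. *)
Definition radial_decreasing_approx_id (nu0 : R) (rho : R -> R -> R) : Prop :=
  [/\ forall nu, nu \in `]0, nu0[ ->
        [/\ forall s, 0 < s -> 0 <= rho nu s,
            locally_integrable `]0, +oo[ (rho nu),
            forall s t, 0 < s -> s <= t -> rho nu t <= rho nu s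
          & (\int[lebesgue_measure]_(s in [set` `]0, +oo[%R])
               (rho nu s * s ^+ n)%:E = 1)%E]
    & forall delta, 0 < delta ->
        (\int[lebesgue_measure]_(s in [set` `]delta, +oo[%R])
           (rho nu s * s ^+ n)%:E)%E @[nu --> 0^'+] --> 0%E].

Definition bbm_function (Omega : set E) (p : R) (rho_nu : R -> R) (f : E -> R)
    (x : E) : \bar R :=
  ((\int[lebn]_(y in Omega)
      (`|f x - f y| `^ p / enorm (x - y) `^ p * rho_nu (enorm (x - y)))%:E)
   `^ p^-1)%E.

End bbm.

(* Main.v *)
(** Upper bound.  Mollify f at scale d.  On an (eps,oo)-domain two points x and y are joined by
    a curve on which the distance to the boundary is comparable with the distance to {x, y}, and
    telescoping the mollifications of f at the corresponding scales along the curve bounds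
    |f x - f y| by the sum of two truncated Riesz potentials of |grad f|,
    sum_k 2^(-k) t times the average of |grad f| on a ball of radius ~ 2^(-k) t around x (or y),
    t = |x - y|.  By Jensen's inequality and Tonelli's theorem the L^r norm on a ball A of the
    difference quotient with increment z is then bounded by the supremum over v of the L^r norms
    of grad f on A + v, and this supremum is controlled by the Morrey norm because all translates
    of A are balls of the same radius.  Integrating against rho_nu(|z|) preserves the bound.

    Lower bound.  A mollification F of f is C^1, so |F(x + z) - F(x)| >= c |D_i F(x)| |z| for all
    small z in a fixed cone; as rho_nu concentrates at 0, the energy density of F controls
    |D_i F|^p, and by Jensen's inequality it is at most the mollification of the energy density
    of f.  Letting first nu and then the mollification scale tend to 0 (Fatou's lemma) gives the
    bound for grad f.

    Existence of the weak gradient.  The derivatives D_i F are bounded in L^r with r > 1.  Weak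
    compactness is replaced by an elementary argument: along almost minimizers of the strictly
    convex functional u |-> int sqrt(1 + u^2) over the convex hulls of the tails, midpoint
    convexity gives a Cauchy sequence in L^1, and its limit is the weak derivative. *)

From HB Require Import structures.
Require Import Defs.
From mathcomp Require Import all_boot all_order all_algebra.
From mathcomp Require Import all_classical all_reals all_analysis.
From mathcomp Require Import measurable_realfun.
From mathcomp Require Import lra.

Set Implicit Arguments.
Unset Strict Implicit.
Unset Printing Implicit Defensive.
Import Order.TTheory GRing.Theory Num.Theory.
Import numFieldNormedType.Exports.

Local Open Scope classical_set_scope.
Local Open Scope ring_scope.

(** * Lebesgue measure on the Borel sets *)

(** The exponent r of the theorem is called q in the lemmas. A function in the Morrey space of Omega
    is only Lebesgue measurable and matters only on Omega, whereas translations and Tonelli's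
    theorem act on Borel functions on the whole space. Every argument therefore runs on a Borel
    version that vanishes outside Omega, and its result is carried back across null sets.
    Mollifiers, averages and the domain condition use the sup norm, whose balls are cubes; passing
    to the Euclidean norm costs factors that depend on n only. Omega is not extended: estimates of a
    mollification are used only where its cube stays in Omega. This is why the chain along a curve
    uses radii proportional to the distance to its end point, and why the lower bound works on inner
    sets. Both halves estimate L^q integrals over a set uniformly over all its translates, the form
    in which a Morrey bound survives convolution. Polar coordinates are replaced by averaging a
    decreasing profile over dyadic intervals of radii. The constants have to be chosen before eps,
    so one constant describing the domain is first extracted from Omega alone. *)

Section borel_space.
Context (R : realType) (n : nat).
Local Notation E := 'rV[R]_n.+1.

Definition coord_sets : set (set E) :=
  [set A | exists i (B : set R), measurable B /\ A = [set x : E | B (x 0 i)]].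

(* The arguments work on the Borel sigma-algebra because they use Tonelli's theorem on R^N x R^N:
   addition is not measurable from the product of two Lebesgue sigma-algebras. *)
Definition borel_space := g_sigma_algebraType coord_sets.

End borel_space.

(** * Affine maps and half-space cuts for the outer measure *)

Section outer.
Context (R : realType) (n : nat).
Local Notation E := 'rV[R]_n.+1.
Local Open Scope ereal_scope.

(** A box cover of [A] is pulled back box by box: each side is divided by [t], so each volume gains
    the factor t^-(n+1). *)
Lemma lebesgue_outer_affine_le (t : R) (v : E) (A : set E) : (0 < t)%R ->
  lebesgue_outer [set x | A (t *: x + v)%R] <=
  (t ^- n.+1)%:E * lebesgue_outer A.
Proof.
move=> t0; have tn0 : (0 < t ^- n.+1)%R by rewrite invr_gt0 exprn_gt0.
rewrite muleC -lee_pdivrMr //; apply: le_ereal_inf_tmp => _ [B [B0 AB] <-].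
rewrite lee_pdivrMr //.
pose C k : E * E := (t^-1 *: ((B k).1 - v), t^-1 *: ((B k).2 - v))%R.
apply: (@le_trans _ _ (\sum_(k <oo) (box_volume (C k))%:E)).
  apply: ereal_inf_lbound; exists C => //; split.
    move=> k i; rewrite !mxE ler_pM2l ?invr_gt0// lerD2r; exact: B0.
  move=> x /AB [k _ Bk]; exists k => // i; rewrite !mxE.
  have := Bk i; rewrite !mxE => /andP[h1 h2]; apply/andP; split.
    by rewrite ltr_pdivrMl// ltrBlDr.
  by rewrite ler_pdivlMl// lerBrDr.
rewrite muleC -nneseriesZl//; last first.
  by move=> k _; apply: (@box_cover_ge0 _ _ A); split.
rewrite le_eqVlt; apply/orP; left; apply/eqP; apply: eq_eseriesr => k _.
rewrite -EFinM; congr EFin; rewrite /box_volume.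
rewrite (eq_bigr (fun i => t^-1 * ((B k).2 0 i - (B k).1 0 i))%R); last first.
  by move=> i _; rewrite !mxE; lra.
by rewrite big_split/= prodr_const card_ord exprVn.
Qed.

(** The reverse inequality is the previous one for the inverse map, which has factor [t^-1] and
    shift -v/t. *)
Lemma lebesgue_outer_affine (t : R) (v : E) (A : set E) : (0 < t)%R ->
  lebesgue_outer [set x | A (t *: x + v)%R] =
  (t ^- n.+1)%:E * lebesgue_outer A.
Proof.
move=> t0; apply/eqP; rewrite eq_le lebesgue_outer_affine_le//=.
have tn0 : (0 < t ^- n.+1)%R by rewrite invr_gt0 exprn_gt0.
have ti0 : (0 < t^-1)%R by rewrite invr_gt0.
rewrite muleC -lee_pdivlMr// muleC.
have := @lebesgue_outer_affine_le t^-1 (- (t^-1 *: v))%R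
  [set x | A (t *: x + v)%R] ti0.
rewrite [X in lebesgue_outer X](_ : _ = A); last first.
  rewrite -[RHS](_ : [set x | A x] = _)//; apply/seteqP.
  by split=> x /=; rewrite scalerDr scalerN !scalerA divff ?gt_eqF// !scale1r subrK.
by rewrite exprVn.
Qed.

(** Cutting every box of a cover at height [a] gives covers of the two parts with the same total
    volume, because half-open boxes split exactly. This is Caratheodory's criterion for coordinate
    half-spaces. *)
Lemma lebesgue_outer_halfspace (i : 'I_n.+1) (a : R) (X : set E) :
  lebesgue_outer (X `&` [set x | (x 0 i <= a)%R]) +
  lebesgue_outer (X `&` ~` [set x | (x 0 i <= a)%R]) <= lebesgue_outer X.
Proof.
apply: le_ereal_inf_tmp => _ [B [B0 XB] <-].
(* The cut height is clamped to the side of the box, so that both pieces are boxes; one of them is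
   degenerate when the hyperplane misses the box. *)
pose c k := (Num.min ((B k).2 0 i) (Num.max ((B k).1 0 i) a))%R.
have c1 k : ((B k).1 0 i <= c k)%R.
  by rewrite le_min B0 le_max lexx.
have c2 k : (c k <= (B k).2 0 i)%R by rewrite ge_min lexx.
pose upd (x : E) (s : R) : E := (\row_j (if j == i then s else x 0 j))%R.
pose C k := ((B k).1, upd (B k).2 (c k)).
pose D k := (upd (B k).1 (c k), (B k).2).
have vC k : (box_volume (B k) = box_volume (C k) + box_volume (D k))%R.
  rewrite /box_volume (bigD1 i)//= [X in (_ = X + _)%R](bigD1 i)//=.
  rewrite [X in (_ = _ + X)%R](bigD1 i)//= !mxE eqxx.
  have -> : (\prod_(j < n.+1 | j != i) ((upd (B k).2 (c k)) 0 j - (B k).1 0 j) =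
            \prod_(j < n.+1 | j != i) ((B k).2 0 j - (B k).1 0 j))%R.
    by apply: eq_bigr => j /negbTE ji; rewrite !mxE ji.
  have -> : (\prod_(j < n.+1 | j != i) ((B k).2 0 j - (upd (B k).1 (c k)) 0 j) =
            \prod_(j < n.+1 | j != i) ((B k).2 0 j - (B k).1 0 j))%R.
    by apply: eq_bigr => j /negbTE ji; rewrite !mxE ji.
  by lra.
have CX : box_cover (X `&` [set x | (x 0 i <= a)%R]) C.
  split=> [k j|x [/XB[k _ Bx] /= xa]].
    by rewrite !mxE; case: eqP => [->|_]; [exact: c1|exact: B0].
  exists k => // j; rewrite !mxE; have /andP[h1 h2] := Bx j.
  rewrite h1/=; case: eqP => // ji; subst j.
  by rewrite le_min h2/= le_max xa orbT.
have DX : box_cover (X `&` ~` [set x | (x 0 i <= a)%R]) D.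
  split=> [k j|x [/XB[k _ Bx] /= /negP]].
    by rewrite !mxE; case: eqP => [->|_]; [exact: c2|exact: B0].
  rewrite -ltNge => xa; exists k => // j; rewrite !mxE; have /andP[h1 h2] := Bx j.
  rewrite h2 andbT; case: eqP => // ji; subst j.
  by rewrite gt_min; apply/orP; right; rewrite gt_max h1 xa.
rewrite (eq_eseriesr (fun k _ => congr1 EFin (vC k))).
under eq_eseriesr do rewrite EFinD.
rewrite nneseriesD; last 2 first.
- by move=> k _ _; exact: box_cover_ge0 CX.
- by move=> k _ _; exact: box_cover_ge0 DX.
by apply: leeD; apply: ereal_inf_lbound; [exists C|exists D].
Qed.

End outer.

(** * Borel sets are Lebesgue measurable; the measure restricted to them *)

Section borel_measurability.
Context (R : realType) (n : nat).
Local Notation E := 'rV[R]_n.+1.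
Local Notation L := (lebesgue_space R n).
Local Notation B := (borel_space R n).

Lemma measurable_coord (i : 'I_n.+1) :
  measurable_fun [set: B] (fun x : B => (x : E) 0 i).
Proof.
by move=> _ A mA; rewrite setTI; apply: sub_sigma_algebra; exists i, A.
Qed.

Lemma measurable_coord_lebesgue (i : 'I_n.+1) :
  measurable_fun [set: L] (fun x : L => (x : E) 0 i).
Proof.
apply: (measurability (@RGenOInfty.G R)); first exact: RGenOInfty.measurableE.
move=> _ [_ [a ->] <-]; rewrite setTI.
rewrite [X in measurable X](_ : _ = ~` [set x : E | (x 0 i <= a)%R]); last first.
  apply/seteqP; split=> x /=; rewrite in_itv/= andbT ltNge; first by move/negP.
  by move/negP.
apply: measurableC; apply: le_caratheodory_measurable => X.
exact: lebesgue_outer_halfspace.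
Qed.

Lemma measurable_to_borel d (T : measurableType d) (f : T -> B) :
  (forall i, measurable_fun [set: T] (fun t => (f t : E) 0 i)) ->
  measurable_fun [set: T] f.
Proof.
move=> mf; apply: (@measurability _ _ _ B setT f (@coord_sets R n)) => //.
by move=> _ [_ [i [C [mC ->]]] <-]; exact: mf.
Qed.

Lemma measurable_borel_lebesgue (A : set E) :
  measurable (A : set B) -> measurable (A : set L).
Proof.
move=> mA; have := @measurable_to_borel _ L (fun x : L => x : B)
  measurable_coord_lebesgue measurableT A mA.
by rewrite setTI.
Qed.

(** The identity, typed as a map between the two sigma-algebras, so that integrals for [lebn] and
    [lebB] can be compared by push-forward. *)
Definition borel_of_lebesgue : L -> B := fun x => x.

Lemma measurable_borel_of_lebesgue : measurable_fun [set: L] borel_of_lebesgue.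
Proof. exact: measurable_to_borel measurable_coord_lebesgue. Qed.

Definition lebB : set B -> \bar R := @lebesgue_outer R n.

Let lebB0 : lebB set0 = 0%E. Proof. exact: lebesgue_outer0. Qed.
Let lebB_ge0 A : (0 <= lebB A)%E. Proof. exact: lebesgue_outer_ge0. Qed.
Let lebB_sigma_additive : semi_sigma_additive lebB.
Proof.
move=> F mF tF mUF.
by have := @measure_semi_sigma_additive _ _ _ (@lebn R n) F
  (fun i => measurable_borel_lebesgue (mF i)) tF (measurable_borel_lebesgue mUF).
Qed.

HB.instance Definition _ := isMeasure.Build _ B R lebB lebB0 lebB_ge0
  lebB_sigma_additive.

End borel_measurability.
Arguments lebB {R n} _.
Arguments borel_of_lebesgue {R n} _.

(** * Sup norm, Euclidean norm and measurability of open sets *)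

Section sup_norm.
Context (R : realType) (n : nat).
Local Notation E := 'rV[R]_n.+1.
Local Notation B := (borel_space R n).
Implicit Types x y : E.

Lemma norm_coord_le x i : `|x 0 i| <= `|x|.
Proof.
rewrite /Num.norm/= mx_normrE.
by apply: (le_trans _ (le_bigmax _ (fun ij : 'I_1 * 'I_n.+1 => `|x ij.1 ij.2|)
  (0, i))).
Qed.

Lemma norm_lt_coordP x (r : R) : 0 < r -> (`|x| < r) <-> (forall i, `|x 0 i| < r).
Proof.
move=> r0; split=> [xr i|xr]; first exact: le_lt_trans (norm_coord_le x i) xr.
rewrite /Num.norm/= mx_normrE; apply/bigmax_ltP; split=> // -[a b] _ /=.
by rewrite (ord1 a).
Qed.

Lemma norm_le_coordP x (r : R) : 0 <= r -> (`|x| <= r) <-> (forall i, `|x 0 i| <= r).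
Proof.
move=> r0; split=> [xr i|xr]; first exact: le_trans (norm_coord_le x i) xr.
rewrite /Num.norm/= mx_normrE; apply/bigmax_leP; split=> // -[a b] _ /=.
by rewrite (ord1 a).
Qed.

Lemma measurable_norm_lt (q : E) (r : R) :
  measurable ([set y : E | `|y - q| < r] : set B).
Proof.
have [r0|r0] := ltP 0 r; last first.
  rewrite [X in measurable X](_ : _ = set0)//; apply/seteqP; split=> // y /=.
  by rewrite ltNge (le_trans r0).
rewrite [X in measurable X](_ : _ =
    \bigcap_(i in [set: 'I_n.+1]) [set y : E | `|y 0 i - q 0 i| < r]); last first.
  apply/seteqP; split=> y /=.
    by move/norm_lt_coordP => /(_ r0) h i _ /=; have := h i; rewrite !mxE.
  by move=> h; apply/norm_lt_coordP => // i; rewrite !mxE; exact: h.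
apply: fin_bigcap_measurable => // i _; apply: sub_sigma_algebra.
exists i, (ball_ Num.norm (q 0 i) r); split.
  exact: measurable_ball.
by apply/seteqP; split=> y /=; rewrite distrC.
Qed.

(** The open set is the union of the countably many cubes with rational centre and radius 1/(m+1)
    that it contains. *)
Lemma measurable_open_borel (U : set E) : open U -> measurable (U : set B).
Proof.
move=> oU; pose Q : set ('rV[rat]_n.+1 * nat) :=
  [set qm | [set y : E | `|y - map_mx ratr qm.1| < qm.2.+1%:R^-1] `<=` U].
rewrite [X in measurable X](_ : _ = \bigcup_(qm in Q)
   [set y : E | `|y - map_mx ratr qm.1| < qm.2.+1%:R^-1]); last first.
  apply/seteqP; split=> [x Ux|x [qm Qqm /=]]; last exact: Qqm.
  have /nbhs_ballP[e /= e0 eU] : nbhs x U by exact: open_nbhs_nbhs.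
  (* Twice this radius is below [e], so a rational cube that contains [x] stays in the cube of
     radius [e] around [x]. *)
  have [m me] : exists m, m.+1%:R^-1 < e / 2.
    have [m] := ltr_add_invr (divr_gt0 e0 (ltr0n _ 2)).
    by rewrite add0r => ?; exists m.
  have m0 : (0 : R) < m.+1%:R^-1 by rewrite invr_gt0.
  have qi i : {q : rat | `|x 0 i - ratr q| < m.+1%:R^-1}.
    apply: cid.
    have /rat_in_itvoo[q] : (x 0 i - m.+1%:R^-1 < x 0 i + m.+1%:R^-1)%R.
      by rewrite ltrD2l gtrN.
    by rewrite in_itv/= => qx; exists q; rewrite distrC ltr_distl.
  exists (\row_i projT1 (qi i), m) => /=.
    move=> y /= ym; apply: eU; rewrite mx_norm_ball /ball_/=.
    rewrite distrC (splitr e).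
    rewrite (_ : y - x = (y - map_mx ratr (\row_i projT1 (qi i))) +
        (map_mx ratr (\row_i projT1 (qi i)) - x)); last by rewrite addrA subrK.
    rewrite (le_lt_trans (ler_normD _ _))// ltrD// ?(lt_trans ym)//.
    rewrite (lt_trans _ me)//; apply/norm_lt_coordP => // i.
    by rewrite !mxE distrC; exact: projT2 (qi i).
  by apply/norm_lt_coordP => // i; rewrite !mxE; exact: projT2 (qi i).
rewrite bigcup_mkcond; apply: countable_bigcupT_measurable => [|qm].
  exact: countableP.
by case: ifP => _; [exact: measurable_norm_lt|exact: measurable0].
Qed.

Lemma continuous_measurable_borel (f : E -> R) :
  continuous f -> measurable_fun [set: B] (f : B -> R).
Proof.
move=> cf; apply: (measurability (@RGenOInfty.G R)); first exact: RGenOInfty.measurableE.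
move=> _ [_ [a ->] <-]; rewrite setTI; apply: measurable_open_borel.
by apply: open_comp => // ? _; exact: cf.
Qed.

Lemma enorm_ge0 x : 0 <= enorm x. Proof. exact: sqrtr_ge0. Qed.

Lemma norm_le_enorm x : `|x| <= enorm x.
Proof.
apply/norm_le_coordP => [|i]; first exact: enorm_ge0.
rewrite -sqrtr_sqr ler_sqrt; last by apply: sumr_ge0 => j _; exact: sqr_ge0.
by rewrite (bigD1 i)//= lerDl sumr_ge0// => j _; exact: sqr_ge0.
Qed.

(** The factor [n.+1] instead of its square root avoids roots; it only enters constants that may
    depend on the dimension. *)
Lemma enorm_le_norm x : enorm x <= n.+1%:R * `|x|.
Proof.
rewrite -(@ger0_norm _ (_ * _)) ?mulr_ge0// -sqrtr_sqr ler_sqrt ?sqr_ge0//.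
apply: (@le_trans _ _ (\sum_(i < n.+1) `|x| ^+ 2)).
  apply: ler_sum => i _; rewrite -[x 0 i ^+ 2]real_normK ?num_real//.
  by rewrite ler_sqr ?nnegrE// norm_coord_le.
rewrite sumr_const card_ord exprMn -[_ *+ _]mulr_natl ler_wpM2r ?sqr_ge0//.
by rewrite expr2 -natrM ler_nat leq_pmulr.
Qed.

Lemma continuous_coord (i : 'I_n.+1) : continuous (fun x : E => x 0 i).
Proof. exact: coord_continuous. Qed.

Lemma continuous_enorm : continuous (@enorm R n).
Proof.
move=> x; apply: (@continuous_comp _ _ _ (fun x : E => \sum_i x 0 i ^+ 2)
  Num.sqrt); last exact: sqrt_continuous.
apply: (@continuous_big R _ +%R) => [|i _ {}x]; first exact: add_continuous.
apply: (@continuous_comp _ _ _ (fun x : E => x 0 i)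
  (fun s : R => s ^+ 2)); [exact: continuous_coord|exact: exprn_continuous].
Qed.

Lemma measurable_enorm : measurable_fun [set: B] (@enorm R n : B -> R).
Proof. exact: continuous_measurable_borel continuous_enorm. Qed.

Lemma enormZ (t : R) x : enorm (t *: x) = `|t| * enorm x.
Proof.
rewrite /enorm -[`|t|]sqrtr_sqr -sqrtrM ?sqr_ge0//.
congr Num.sqrt; rewrite mulr_sumr; apply: eq_bigr => i _.
by rewrite !mxE exprMn.
Qed.

Lemma enormN x : enorm (- x) = enorm x.
Proof. by rewrite -scaleN1r enormZ normrN normr1 mul1r. Qed.

End sup_norm.

(** * A lower bound for the outer measure of the unit cube *)

Section unit_box.
Context (R : realType).

(* Integrating out one coordinate at a time replaces each indicator by the length of the
   corresponding side. *)
Lemma box_sum_ge1 (N : nat) (c : nat -> R) (a b : nat -> nat -> R) :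
  (forall k, 0 <= c k) -> (forall k i, a k i <= b k i) ->
  (forall x : nat -> R, (forall i, 0 < x i <= 1) ->
     (1 <= \sum_(k <oo)
        (c k * \prod_(i < N) (a k i < x i <= b k i)%R%:R)%:E)%E) ->
  (1 <= \sum_(k <oo) (c k * \prod_(i < N) (b k i - a k i))%:E)%E.
Proof.
elim: N c => [|N IH] c c0 ab H.
  have := H (fun=> 1); rewrite ltr01 lexx => /(_ (fun=> isT)).
  by move=> /le_trans; apply; apply: lee_nneseries => k *; rewrite !big_ord0 mulr1 ?lee_fin.
under eq_eseriesr do rewrite big_ord_recr/= [X in _ * X]mulrC mulrA.
apply: IH => // [k|x x01].
  by rewrite mulr_ge0// subr_ge0.
pose g k (s : R) : \bar R := ((c k * \prod_(i < N) (a k i < x i <= b k i)%R%:R)%:E *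
  (\1_[set` `]a k N, b k N]] s)%:E)%E.
have g0 k s : (0 <= g k s)%E.
  by rewrite mule_ge0 ?lee_fin// mulr_ge0// prodr_ge0.
have mg k : measurable_fun [set` `]0, 1 : R]] (g k).
  apply: emeasurable_funM; first exact: measurable_cst.
  apply/measurable_EFinP; apply: measurable_funTS; exact: measurable_indic.
have : (\int[lebesgue_measure]_(s in [set` `]0%R, 1%R : R]]) cst 1 s <=
        \int[lebesgue_measure]_(s in [set` `]0%R, 1%R : R]]) \sum_(k <oo) g k s)%E.
  apply: ge0_le_integral => //.
  - exact: (@ge0_emeasurable_sum _ _ _ _ g xpredT).
  move=> s /=; rewrite in_itv/= => s01.
  have := H (fun i => if i == N then s else x i).
  move=> /(_ _)/le_trans; apply.
    by move=> i; case: ifP => // _; exact: x01.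
  apply: lee_nneseries => [k _ _|k _].
    by rewrite lee_fin mulr_ge0// prodr_ge0.
  rewrite /g -EFinM lee_fin big_ord_recr/= eqxx indicE mem_setE/= in_itv/=.
  rewrite mulrA; have -> // : \prod_(i < N) (a k i < x i <= b k i)%R%:R =
      \prod_(i < N) (a k i < (if nat_of_ord i == N then s else x i) <= b k i)%R%:R :> R.
  by apply: eq_bigr => i _; rewrite ifF//; apply/negbTE; rewrite neq_ltn ltn_ord.
rewrite integral_cst//= lebesgue_measure_itv/= lte01 mul1e sube0.
rewrite integral_nneseries//.
move=> /le_trans; apply; apply: lee_nneseries => [k _ _|k _].
  by apply: integral_ge0 => s _; exact: g0.
rewrite /g ge0_integralZl//; last 2 first.
- by apply/measurable_EFinP; apply: measurable_funTS; exact: measurable_indic.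
- by rewrite lee_fin mulr_ge0// prodr_ge0.
rewrite [X in (_ <= X)%E](_ : _ = ((c k * \prod_(i < N) (a k i < x i <= b k i)%R%:R)%:E *
   (b k N - a k N)%:E)%E); last by rewrite -EFinM; congr EFin; lra.
apply: lee_pmul => //.
- by rewrite lee_fin mulr_ge0// prodr_ge0.
- by apply: integral_ge0 => s _; rewrite lee_fin.
rewrite integral_indic// (le_trans (measureIl _ _ _))//.
rewrite [leLHS](@lebesgue_measure_itv R `]a k N, b k N])/= lte_fin; case: ifP => //.
by rewrite lee_fin subr_ge0.
Qed.

Context (n : nat).
Local Notation E := 'rV[R]_n.+1.

(** The source of the lower bounds on measures of cubes and balls. For each point of the unit cube,
    the box of the cover that contains it contributes 1 to the sum required by [box_sum_ge1]. *)
Lemma lebesgue_outer_unit_box_ge1 :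
  (1 <= lebesgue_outer [set x : E | forall i, (0 < x 0 i <= 1)%R])%E.
Proof.
apply: le_ereal_inf_tmp => _ [B [B0 AB] <-].
pose a k i : R := (B k).1 0 (inord i); pose b k i : R := (B k).2 0 (inord i).
have := @box_sum_ge1 n.+1 (fun=> 1) a b (fun=> ler01) (fun k i => B0 k _).
rewrite [X in (1 <= X)%E](_ : _ = \sum_(k <oo) (box_volume (B k))%:E)%E; last first.
  apply: eq_eseriesr => k _; rewrite mul1r; congr EFin.
  by apply: eq_bigr => i _; rewrite /a /b inord_val.
apply=> x x01.
have /AB[k _ Bk] : [set x : E | forall i, (0 < x 0 i <= 1)%R] (\row_i x i).
  by move=> i; rewrite !mxE; exact: x01.
have t0 j : (0 <= (1 * \prod_(i < n.+1) (a j i < x i <= b j i)%R%:R)%:E :> \bar R)%E.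
  by rewrite mul1r lee_fin prodr_ge0.
apply: (@le_trans _ _ (\sum_(0 <= j < k.+1)
   (1 * \prod_(i < n.+1) (a j i < x i <= b j i)%R%:R)%:E)%E); last first.
  by apply: nneseries_lim_ge => j _ _; exact: t0.
rewrite big_nat_recr//= -[X in (X <= _)%E]add0e leeD ?sume_ge0//.
rewrite mul1r big1// => i _; rewrite /a /b inord_val.
by have := Bk i; rewrite mxE => ->.
Qed.

End unit_box.

(** * Outer regularity, change of variables and Borel representatives *)

Section lebesgue_borel.
Context (R : realType) (n : nat).
Local Notation E := 'rV[R]_n.+1.
Local Notation L := (lebesgue_space R n).
Local Notation B := (borel_space R n).
Local Open Scope ereal_scope.

Lemma lebesgue_outer_box_le (a b : E) : (forall i, a 0%R i <= b 0%R i)%R ->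
  lebesgue_outer (box (a, b)) <= (box_volume (a, b))%:E.
Proof.
(* The cover is continued by the degenerate box at 0, which is empty and has volume 0. *)
move=> ab; pose C k : E * E := if k is 0%N then (a, b) else (0, 0)%R.
have CA : box_cover (box (a, b)) C.
  by split=> [[|k] i|x abx]; rewrite //= ?mxE//; exists 0%N.
apply: (@le_trans _ _ (\sum_(k <oo) (box_volume (C k))%:E)).
  by apply: ereal_inf_lbound; exists C.
rewrite nneseries_recl//=; last by move=> k _; exact: box_cover_ge0 CA.
rewrite -[leRHS]adde0 leeD2l// eseries0// => -[//|k] _ _.
by rewrite /box_volume big_ord_recl/= !mxE subrr mul0r.
Qed.

(** The volume is continuous in the amount [h] by which the right ends are moved; this room turns
    half-open boxes into open ones at small cost. *)
Lemma box_enlarge (a b : E) (e : R) : (forall i, a 0 i <= b 0 i)%R -> (0 < e)%R ->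
  exists2 h, (0 < h)%R & (box_volume (a, b + const_mx h) <= box_volume (a, b) + e)%R.
Proof.
move=> ab e0.
have c0 : (\prod_i (b 0 i - a 0 i + h))%R @[h --> (0:R)%R] -->
          (\prod_i (b 0 i - a 0 i + 0))%R.
  apply: (@cvg_big R _ *%R) => [|i _]; first exact: mul_continuous.
  by apply: cvgD; [exact: cvg_cst|exact: cvg_id].
move/cvgrPdist_lt : c0 => /(_ _ e0) [d /= d0 dP].
exists (d / 2)%R; first by rewrite divr_gt0.
have := dP (d / 2)%R; rewrite /= sub0r normrN gtr0_norm ?divr_gt0//.
rewrite ltr_pdivrMr// ltr_pMr// ltr1n => /(_ isT) /ltW.
rewrite distrC ler_distl => /andP[_].
rewrite /box_volume /= [X in (_ <= X + e)%R -> _](eq_bigr (fun i => b 0 i - a 0 i)%R); last first.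
  by move=> i _; rewrite addr0.
move=> /(le_trans _); apply; rewrite le_eqVlt; apply/orP; left; apply/eqP.
by apply: eq_bigr => i _; rewrite !mxE addrAC.
Qed.

(** Half of [e] pays for a nearly optimal cover; the other half, split geometrically, pays for
    widening its boxes to open ones. *)
Lemma lebesgue_outer_open (A : set E) (e : R) : (0 < e)%R ->
  exists U : set E, [/\ open U, A `<=` U & lebesgue_outer U <= lebesgue_outer A + e%:E].
Proof.
move=> e0.
have [Aoo|Afin] := eqVneq (lebesgue_outer A) +oo.
  by exists setT; split=> //; [exact: openT|rewrite Aoo addye// leey].
have Af : lebesgue_outer A \is a fin_num.
  by rewrite ge0_fin_numE ?lebesgue_outer_ge0// ltey.
have e20 : (0 < e / 2)%R by rewrite divr_gt0.
have [_ [B [B0 AB] <-] Be] := lb_ereal_inf_adherent e20 Af.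
have hk k : {h : R | (0 < h)%R /\ (box_volume ((B k).1, (B k).2 + const_mx h) <=
    box_volume (B k) + (e / 2) / (2 ^ k.+1)%:R)%R}.
  apply: cid; have [|h h0 hB] := @box_enlarge (B k).1 (B k).2
    ((e / 2) / (2 ^ k.+1)%:R)%R (B0 k).
    by rewrite divr_gt0// ltr0n expn_gt0.
  by exists h; split=> //; move: hB; case: (B k).
pose h k := projT1 (hk k).
have h0 k : (0 < h k)%R by exact: (projT2 (hk k)).1.
pose O k : set E := [set x | forall i, ((B k).1 0 i < x 0 i < (B k).2 0 i + h k)%R].
have oO k : open (O k).
  rewrite openE => x Ox.
  suff : \forall y \near (x : E), forall i, ((B k).1 0 i < (y : E) 0 i < (B k).2 0 i + h k)%R by [].
  apply: (@filter_forall _ _ (fun i (y : E) => ((B k).1 0 i < y 0 i < (B k).2 0 i + h k)%R) (nbhs (x : E))) => i.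
  apply: (@open_nbhs_nbhs _ x [set y : E | (B k).1 0 i < y 0 i < (B k).2 0 i + h k]%R).
  split; last exact: Ox.
  rewrite [X in open X](_ : _ = (fun x : E => x 0%R i) @^-1`
    `](B k).1 0%R i, ((B k).2 0 i + h k)%R[%classic).
    by apply: open_comp => [y _|]; [exact: continuous_coord|exact: interval_open].
  by apply/seteqP; split=> y /=; rewrite in_itv.
exists (\bigcup_k O k); split.
- exact: bigcup_open.
- move=> x /AB[k _ Bx]; exists k => // i; have /andP[-> /= Bx2] := Bx i.
  by rewrite (le_lt_trans Bx2)// ltrDl.
apply: (le_trans (lebesgue_outer_sigma_subadditive O)).
apply: (@le_trans _ _ (\sum_(k <oo) ((box_volume (B k))%:E +
    (e / 2 / (2 ^ k.+1)%:R)%:E))).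
  apply: lee_nneseries => [k _ _|k _]; first exact: lebesgue_outer_ge0.
  apply: (@le_trans _ _ (box_volume ((B k).1, (B k).2 + const_mx (h k))%R)%:E).
    apply: (le_trans _ (lebesgue_outer_box_le _)).
      apply: le_lebesgue_outer => x Ox i; rewrite !mxE/=.
      by have /andP[-> /ltW] := Ox i.
    by move=> i; rewrite !mxE ler_wpDr// ltW.
  by rewrite -EFinD lee_fin; exact: (projT2 (hk k)).2.
apply: (le_trans (epsilon_trick _ _ _)).
- by move=> k; apply: (@box_cover_ge0 _ _ A).
- exact: ltW.
rewrite -[X in _ <= _ + X](_ : (e / 2)%:E + (e / 2)%:E = e%:E); last first.
  by rewrite -EFinD -splitr.
by rewrite addeA leeD2r// ltW.
Qed.

Lemma lebB_cube_le (q : E) (r : R) : (0 < r)%R ->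
  lebB [set y : E | (`|y - q| < r)%R] <= ((2 * r) ^+ n.+1)%:E.
Proof.
move=> r0; apply: (@le_trans _ _ (box_volume (q - const_mx r, q + const_mx r)%R)%:E).
  apply: (le_trans _ (lebesgue_outer_box_le _)).
    apply: le_lebesgue_outer => y /= /norm_lt_coordP => /(_ r0) yq i.
    have := yq i; rewrite !mxE ltr_distl => /andP[-> /ltW ->] //.
  by move=> i; rewrite !mxE lerD2l ge0_cp// ltW.
rewrite lee_fin /box_volume (eq_bigr (fun=> 2 * r)%R); last first.
  by move=> i _; rewrite !mxE; lra.
by rewrite prodr_const card_ord.
Qed.

Lemma lebB_affine (t : R) (v : E) (A : set E) : (0 < t)%R ->
  lebB [set x | A (t *: x + v)%R] = (t ^- n.+1)%:E * lebB A.
Proof. exact: lebesgue_outer_affine. Qed.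

(** The cube of radius [r] contains an affine copy of the unit cube of side [r]; the factor 2^(n+1)
    lost in this way is harmless. *)
Lemma lebB_cube_ge (q : E) (r : R) : (0 < r)%R ->
  (r ^+ n.+1)%:E <= lebB [set y : E | (`|y - q| < r)%R].
Proof.
move=> r0; set Q := (X in lebB X).
have : 1 <= lebB [set x | Q (r *: x + (q - const_mx (r / 2)))%R].
  apply: (le_trans (@lebesgue_outer_unit_box_ge1 R n)).
  apply: le_lebesgue_outer => x /= x01; apply/norm_lt_coordP => // i.
  have /andP[xi0 xi1] := x01 i; rewrite !mxE.
  rewrite (_ : _ - _ = r * (x 0 i - 2^-1))%R; last by lra.
  rewrite normrM gtr0_norm// gtr_pMr// ltr_norml; apply/andP; split; lra.
rewrite lebB_affine// lee_pdivlMl ?exprn_gt0// mule1.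
by [].
Qed.

Lemma sigma_finite_lebB : sigma_finite [set: B] (@lebB R n).
Proof.
exists (fun k => [set y : E | (`|y - 0| < k.+1%:R)%R]).
  apply/seteqP; split=> // y _; exists (Num.truncn `|y|) => //=.
  by rewrite subr0 truncnS_gt.
move=> k; split; first exact: measurable_norm_lt.
by apply: (le_lt_trans (lebB_cube_le _ _)); rewrite ?ltr0n// ltry.
Qed.

HB.instance Definition _ := @Measure_isSigmaFinite.Build _ B R (@lebB R n) sigma_finite_lebB.

Lemma measurable_affine (t : R) (v : E) :
  measurable_fun [set: B] ((fun x : E => t *: x + v)%R : B -> B).
Proof.
apply: measurable_to_borel => i; under eq_fun do rewrite !mxE.
apply: measurable_funD => //; apply: measurable_funM => //.
exact: measurable_coord.
Qed.

(** The push-forward under the affine map and the scaled measure agree on all Borel sets by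
    [lebB_affine]. *)
Lemma ge0_integral_affine (t : R) (v : E) (f : E -> \bar R) : (0 < t)%R ->
  measurable_fun [set: B] (f : B -> \bar R) -> (forall x, 0 <= f x) ->
  \int[lebB]_x f (t *: (x : E) + v)%R = (t ^- n.+1)%:E * \int[lebB]_x f x.
Proof.
move=> t0 mf f0; have mphi := measurable_affine t v.
have := @ge0_integral_pushforward _ _ B B R _ mphi (@lebB R n) setT f measurableT mf
  (fun x _ => f0 x).
rewrite preimage_setT /comp => <-.
have tn0 : (0 <= t ^- n.+1)%R by rewrite invr_ge0 exprn_ge0// ltW.
rewrite -(@ge0_integral_mscale _ B R (@lebB R n) setT measurableT (NngNum tn0) f)//.
by apply: eq_measure_integral => A mA _; exact: lebB_affine.
Qed.

Lemma ge0_integral_shift (v : E) (f : E -> \bar R) :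
  measurable_fun [set: B] (f : B -> \bar R) -> (forall x, 0 <= f x) ->
  \int[lebB]_x f ((x : E) + v)%R = \int[lebB]_x f x.
Proof.
move=> mf f0; have := @ge0_integral_affine 1 v f ltr01 mf f0.
by rewrite expr1n invr1 mul1e => <-; apply: eq_integral => x _; rewrite scale1r.
Qed.

(** [lebB] is the push-forward of [lebn] under the identity from the Lebesgue to the Borel
    sigma-algebra. *)
Lemma ge0_integral_lebn (D : set E) (f : E -> \bar R) :
  measurable (D : set B) -> measurable_fun (D : set B) (f : B -> \bar R) ->
  (forall x, D x -> 0 <= f x) ->
  \int[lebn]_(x in D) f x = \int[lebB]_(x in D) f x.
Proof.
move=> mD mf f0.
have /= <- := @ge0_integral_pushforward _ _ L B R _ (@measurable_borel_of_lebesgue R n)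
   (@lebn R n) D f mD mf (fun x Dx => f0 x (set_mem Dx)).
by apply: (@eq_measure_integral _ B) => [|?]; first exact: measurable_borel_of_lebesgue.
Qed.

Lemma integral_lebn (D : set E) (f : E -> \bar R) :
  measurable (D : set B) -> measurable_fun (D : set B) (f : B -> \bar R) ->
  \int[lebn]_(x in D) f x = \int[lebB]_(x in D) f x.
Proof.
move=> mD mf; rewrite integralE [RHS]integralE; congr (_ - _).
  apply: ge0_integral_lebn => //; exact: measurable_funepos.
apply: ge0_integral_lebn => //; exact: measurable_funeneg.
Qed.

(** Outer regularity: intersect open supersets of measure at most 1/(k+1). *)
Lemma lebesgue_hull_null (A : set E) : lebesgue_outer A = 0 ->
  exists2 C : set B, measurable C & A `<=` C /\ lebB C = 0.
Proof.
move=> A0.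
have /choice[U UP] : forall k : nat, exists U : set E,
    [/\ open U, A `<=` U & lebesgue_outer U <= (k.+1%:R^-1)%:E].
  move=> k; have k0 : (0 < k.+1%:R^-1 :> R)%R by rewrite invr_gt0.
  by have [U] := lebesgue_outer_open A k0; rewrite A0 add0e; exists U.
exists (\bigcap_k U k).
  by apply: bigcap_measurable => // k _; apply: measurable_open_borel; case: (UP k).
split; first by move=> x Ax k _; case: (UP k) => _ + _; exact.
apply/eqP; rewrite eq_le measure_ge0 andbT; apply/lee_addgt0Pr => e e0.
have [k ke] := ltr_add_invr e0; rewrite add0r in ke.
apply: (@le_trans _ _ (lebesgue_outer (U k))).
  by apply: le_lebesgue_outer => x; exact.
by case: (UP k) => _ _ /le_trans; apply; rewrite add0e lee_fin ltW.
Qed.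

(** The same intersection of open sets. Finiteness allows the measure of the difference to be
    computed by subtraction, and the null difference is covered by a Borel null set in turn. *)
Lemma lebesgue_hull_fin (A : set E) : measurable (A : set L) -> lebn A < +oo ->
  exists C Z : set B, [/\ measurable C, measurable Z, lebB Z = 0,
    A `<=` C & C `\` A `<=` Z].
Proof.
move=> mA Aoo.
have /choice[U UP] : forall k : nat, exists U : set E,
    [/\ open U, A `<=` U & lebesgue_outer U <= lebesgue_outer A + (k.+1%:R^-1)%:E].
  move=> k; have k0 : (0 < k.+1%:R^-1 :> R)%R by rewrite invr_gt0.
  exact: lebesgue_outer_open.
have mC : measurable (\bigcap_k U k : set B).
  by apply: bigcap_measurable => // k _; apply: measurable_open_borel; case: (UP k).
have AC : A `<=` \bigcap_k U k by move=> x Ax k _; case: (UP k) => _ + _; exact.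
have mC' := measurable_borel_lebesgue mC.
have Af : lebn A \is a fin_num by rewrite ge0_fin_numE.
have : lebesgue_outer ((\bigcap_k U k) `\` A) = 0.
  have : lebn ((\bigcap_k U k) `\` A) = 0; last by [].
  have CA : lebn (\bigcap_k U k) <= lebn A.
    apply/lee_addgt0Pr => e e0; have [k ke] := ltr_add_invr e0; rewrite add0r in ke.
    apply: (@le_trans _ _ (lebesgue_outer (U k))).
      by apply: le_lebesgue_outer => x; exact.
    by case: (UP k) => _ _ /le_trans; apply; rewrite leeD2l// lee_fin ltW.
  rewrite measureD//; last exact: le_lt_trans CA Aoo.
  rewrite (setIidr AC); apply/eqP; rewrite eq_le; apply/andP; split.
    by rewrite leeBlDr// add0e.
  rewrite sube_ge0 ?Af//; apply: le_measure => //; rewrite inE//.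
move=> /lebesgue_hull_null[Z mZ [CZ Z0]].
by exists (\bigcap_k U k), Z.
Qed.

(** Reduction to finite measure by cutting with the cubes of radius k+1 around 0. *)
Lemma lebesgue_hull (A : set E) : measurable (A : set L) ->
  exists C Z : set B, [/\ measurable C, measurable Z, lebB Z = 0,
    A `<=` C & C `\` A `<=` Z].
Proof.
move=> mA; pose Q k : set E := [set y : E | (`|y - 0| < k.+1%:R)%R].
have mQ k : measurable (Q k : set B) by exact: measurable_norm_lt.
have /choice[C CP] : forall k, exists CZ : set B * set B,
  [/\ measurable CZ.1, measurable CZ.2, lebB CZ.2 = 0,
    A `&` Q k `<=` CZ.1 & CZ.1 `\` (A `&` Q k) `<=` CZ.2].
  move=> k; have [|//|C [Z CZ]] := @lebesgue_hull_fin (A `&` Q k).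
  - by apply: measurableI => //; exact: measurable_borel_lebesgue.
  - apply: (le_lt_trans (le_lebesgue_outer (@subIsetr _ A (Q k)))).
    by apply: (le_lt_trans (lebB_cube_le _ _)); rewrite ?ltr0n// ltry.
  - by exists (C, Z).
exists (\bigcup_k (C k).1), (\bigcup_k (C k).2); split.
- by apply: bigcup_measurable => k _; case: (CP k).
- by apply: bigcup_measurable => k _; case: (CP k).
- apply/eqP; rewrite eq_le measure_ge0 andbT.
  apply: (le_trans (lebesgue_outer_sigma_subadditive _)).
  by rewrite eseries0// => k _ _; case: (CP k).
- move=> x Ax; exists (Num.truncn `|x|) => //.
  case: (CP (Num.truncn `|x|)) => _ _ _ + _; apply; split=> //=.
  by rewrite /Q/= subr0 truncnS_gt.
- move=> x [[k _ Ckx] nAx]; exists k => //.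
  by case: (CP k) => _ _ _ _; apply; split=> // -[].
Qed.

(** Each superlevel set at a rational level differs from a Borel set by a subset of a Borel null
    set. Off the union [Z] of these countably many null sets, all superlevel sets are traces of
    Borel sets. *)
Lemma borel_representative (f : E -> R) : measurable_fun [set: L] (f : L -> R) ->
  exists Z : set B, [/\ measurable Z, lebB Z = 0 &
    measurable_fun [set: B] (f \_ (~` Z) : B -> R)].
Proof.
move=> mf; pose S (q : rat) : set E := [set x : E | (ratr q < f x)%R].
have mS q : measurable (S q : set L).
  rewrite [X in measurable X](_ : _ = setT `&` f @^-1` `]ratr q, +oo[%classic).
    exact: mf.
  by rewrite setTI; apply/seteqP; split=> x /=; rewrite in_itv/= andbT.
have /choice[C CP] : forall q, exists CZ : set B * set B,
  [/\ measurable CZ.1, measurable CZ.2, lebB CZ.2 = 0,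
    S q `<=` CZ.1 & CZ.1 `\` S q `<=` CZ.2].
  by move=> q; have [C [Z CZ]] := lebesgue_hull (mS q); exists (C, Z).
have [enumq enumqP] : exists g : nat -> option rat, forall q, exists k, g k = Some q.
  by exists unpickle => q; exists (pickle q); exact: pickleK.
pose Z := \bigcup_k (if enumq k is Some q then (C q).2 else set0).
have mZ : measurable Z.
  apply: bigcup_measurable => k _; case: (enumq k) => [q|] //.
  by case: (CP q).
have CZ q : (C q).2 `<=` Z by move=> x Cx; have [k kq] := enumqP q; exists k => //; rewrite kq.
exists Z; split => //.
  apply/eqP; rewrite eq_le measure_ge0 andbT.
  apply: (le_trans (lebesgue_outer_sigma_subadditive _)).
  rewrite eseries0// => k _ _; case: (enumq k) => [q|]; last exact: lebesgue_outer0.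
  by case: (CP q).
apply: (measurability (@RGenOInfty.G R)); first exact: RGenOInfty.measurableE.
move=> _ [_ [a ->] <-]; rewrite setTI.
(* On [Z] the restricted function takes the default value 0, so [Z] belongs to a superlevel set
   exactly when the level is negative. *)
rewrite [X in measurable X](_ : _ =
  (\bigcup_k (if enumq k is Some q then
      if (a < ratr q)%R then (C q).1 else set0 else set0) `\` Z) `|`
  (if (a < 0)%R then Z else set0)); last first.
  apply/seteqP; split=> x.
    rewrite /preimage/= in_itv/= andbT patchE; case: ifPn => [/set_mem nZx ax|].
      left; split=> //; have /rat_in_itvoo[q] := ax.
      rewrite in_itv/= => /andP[aq qf]; have [k kq] := enumqP q; exists k => //.
      by rewrite kq aq; case: (CP q) => _ _ _ + _; exact.
    by rewrite notin_setE /= => /contrapT Zx; rewrite /point/= => a0; right; rewrite a0.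
  rewrite /preimage/= in_itv/= andbT patchE => -[[[k _]]|].
    case: (enumq k) => [q|//]; case: ifPn => // aq Cqx nZx.
    rewrite ifT; last exact: mem_set.
    apply: (lt_trans aq); apply: contrapT => nS; apply: nZx; apply: (CZ q).
    by case: (CP q) => _ _ _ _; apply; split.
  case: ifPn => // a0 Zx; rewrite ifF//; apply/negbTE; rewrite notin_setE.
  by move=> /(_ Zx).
apply: measurableU.
  apply: measurableD => //; apply: bigcup_measurable => k _.
  by case: (enumq k) => [q|] //; case: ifP => // _; case: (CP q).
by case: ifP.
Qed.

End lebesgue_borel.

Lemma measurable_patch d1 d2 (T1 : measurableType d1) (T2 : measurableType d2)
    (f : T1 -> T2) (D : set T1) : measurable D ->
  measurable_fun D f -> measurable_fun setT (f \_ D).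
Proof. by move=> mD; apply: (measurable_restrictT _ mD).1. Qed.

(** * Integral inequalities and radial kernels *)

Section curried_tonelli.
Context d1 d2 (T1 : measurableType d1) (T2 : measurableType d2) (R : realType).
Variables (m1 : {sigma_finite_measure set T1 -> \bar R}).
Variables (m2 : {sigma_finite_measure set T2 -> \bar R}).
Variable F : T1 -> T2 -> \bar R.
Hypothesis mF : measurable_fun setT (fun p : T1 * T2 => F p.1 p.2).
Hypothesis F0 : forall x y, (0 <= F x y)%E.
Local Open Scope ereal_scope.

Lemma measurable_section2 x : measurable_fun setT (F x).
Proof.
by apply: (measurableT_comp (f := fun p : T1 * T2 => F p.1 p.2) (g := pair x)) => //;
  exact: measurable_pair1.
Qed.

Lemma measurable_section1 y : measurable_fun setT (F ^~ y).
Proof.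
by apply: (measurableT_comp (f := fun p : T1 * T2 => F p.1 p.2) (g := pair^~ y)) => //;
  exact: measurable_pair2.
Qed.

Lemma measurable_integral2 : measurable_fun setT (fun x => \int[m2]_y F x y).
Proof.
exact: (@measurable_fun_fubini_tonelli_F _ _ _ _ _ m2 (fun p : T1 * T2 => F p.1 p.2) mF
  (fun p => F0 _ _)).
Qed.

Lemma measurable_integral1 : measurable_fun setT (fun y => \int[m1]_x F x y).
Proof.
exact: (@measurable_fun_fubini_tonelli_G _ _ _ _ _ m1 (fun p : T1 * T2 => F p.1 p.2) mF
  (fun p => F0 _ _)).
Qed.

Lemma integral_swap : \int[m1]_x \int[m2]_y F x y = \int[m2]_y \int[m1]_x F x y.
Proof.
exact: (@fubini_tonelli _ _ _ _ _ m1 m2 (fun p : T1 * T2 => F p.1 p.2) mF (fun p => F0 _ _)).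
Qed.

End curried_tonelli.

(** * Jensen's inequality for powers *)

Section power_mean.
Context (R : realType).

(** The tangent of t^q at [l] lies below the graph. This is Young's inequality with the exponents q
    and q/(q-1); the case q = 1 is treated apart, as the second exponent degenerates. *)
Lemma young_powR (q t l : R) : 1 <= q -> 0 <= t -> 0 <= l ->
  q * l `^ (q - 1) * t <= t `^ q + (q - 1) * l `^ q.
Proof.
move=> q1 t0 l0; have [->|qn1] := eqVneq q 1.
  by rewrite subrr powRr0 !powRr1// mul1r mul1r mul0r addr0.
have {qn1}q1 : 1 < q by rewrite lt_neqAle eq_sym qn1.
have q0 : 0 < q by lra.
pose q' := q / (q - 1).
have qq : q^-1 + q'^-1 = 1.
  rewrite /q' invf_div -[X in X + _]div1r -mulrDl (addrC 1) subrK divff//.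
  by rewrite gt_eqF.
have := @conjugate_powR R t (l `^ (q - 1)) q q' t0 (powR_ge0 _ _).
rewrite q0 => /(_ isT).
have q'0 : 0 < q' by rewrite divr_gt0// subr_gt0.
move=> /(_ q'0 qq); rewrite -powRrM /q' mulrC (mulrC (q - 1)) mulfVK ?gt_eqF ?subr_gt0// => H.
rewrite -mulrA; apply: (le_trans (ler_wpM2l (ltW q0) H)).
rewrite mulrDr mulrCA divff ?gt_eqF// mulr1 lerD2l.
by rewrite invf_div mulrCA [q * _]mulrC divfK ?gt_eqF// mulrC.
Qed.

Local Open Scope ereal_scope.

Lemma young_poweR (q l : R) (t : \bar R) : (1 <= q)%R -> 0 <= t -> (0 <= l)%R ->
  (q * l `^ (q - 1))%:E * t <= t `^ q + ((q - 1) * l `^ q)%:E.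
Proof.
move=> q1; case: t => [t| |//]; last first.
  by move=> _ l0; rewrite poweRyr ?gt_eqF ?(lt_le_trans _ q1)// addye// leey.
move=> t0 l0; rewrite poweR_EFin -EFinM -EFinD lee_fin; apply: young_powR => //.
Qed.

Lemma ler_poweR (q : R) (x y : \bar R) : (0 <= q)%R -> 0 <= x -> x <= y ->
  x `^ q <= y `^ q.
Proof.
move=> q0 x0 xy; apply: gt0_ler_poweR => //; rewrite in_itv/= leey andbT//.
exact: le_trans xy.
Qed.

(** Jensen's inequality for a weight of mass at most [K] instead of 1, which costs K^(q-1). The
    integrals may be infinite: the tangent inequality at [l] is integrated first and [l] is chosen
    afterwards, so no mean value has to exist beforehand. *)
Lemma jensen_poweR d (T : measurableType d) (mu : {measure set T -> \bar R})
    (h : T -> \bar R) (k : T -> R) (K q : R) :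
  measurable_fun setT h -> measurable_fun setT k ->
  (forall x, 0 <= h x) -> (forall x, (0 <= k x)%R) -> (0 < K)%R -> (1 <= q)%R ->
  \int[mu]_x (k x)%:E <= K%:E ->
  (\int[mu]_x (h x * (k x)%:E)) `^ q <=
    (K `^ (q - 1))%:E * \int[mu]_x (h x `^ q * (k x)%:E).
Proof.
move=> mh mk h0 k0 K0 q1 kK.
have q0 : (0 < q)%R by exact: lt_le_trans q1.
set m := \int[mu]_x (h x * _); set S := \int[mu]_x (h x `^ q * _).
have mk' : measurable_fun setT (EFin \o k) by exact/measurable_EFinP.
have mhk : measurable_fun setT (fun x => h x * (k x)%:E) by exact: emeasurable_funM.
have mhq : measurable_fun setT (fun x => h x `^ q * (k x)%:E).
  apply: emeasurable_funM => //.
  by apply: (measurableT_comp (measurable_poweR _)).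
have m0 : 0 <= m by apply: integral_ge0 => x _; rewrite mule_ge0// lee_fin.
have S0 : 0 <= S by apply: integral_ge0 => x _; rewrite mule_ge0 ?poweR_ge0// lee_fin.
have main l : (0 <= l)%R ->
    (q * l `^ (q - 1))%:E * m <= S + ((q - 1) * l `^ q * K)%:E.
  move=> l0.
  have c0 : (0 <= q * l `^ (q - 1))%R by rewrite mulr_ge0 ?powR_ge0// ltW.
  have c1 : (0 <= (q - 1) * l `^ q)%R by rewrite mulr_ge0 ?powR_ge0// subr_ge0.
  rewrite -ge0_integralZl//; last by move=> x _; rewrite mule_ge0// lee_fin.
  apply: (@le_trans _ _ (\int[mu]_x (h x `^ q * (k x)%:E +
      ((q - 1) * l `^ q)%:E * (k x)%:E))).
    apply: ge0_le_integral => //.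
    - by move=> x _; rewrite !mule_ge0 ?lee_fin.
    - exact: measurable_funeM.
    - by apply: emeasurable_funD => //; exact: measurable_funeM.
    move=> x _; rewrite muleA -muleDl//; last first.
      by rewrite ge0_adde_def// inE ?poweR_ge0// lee_fin.
    by rewrite lee_wpmul2r ?lee_fin// young_poweR.
  rewrite ge0_integralD//; last 3 first.
  - by move=> x _; rewrite mule_ge0 ?poweR_ge0 ?lee_fin.
  - by move=> x _; rewrite mule_ge0 ?lee_fin.
  - exact: measurable_funeM.
  rewrite leeD2l// ge0_integralZl//; last first.
    by move=> x _; rewrite lee_fin.
  by rewrite (EFinM _ K) lee_wpmul2l.
(* If the left integral is infinite, the tangent at 1 forces the right one to be infinite. *)
have [moo|mfin] := eqVneq m +oo.
  have := main 1%R ler01; rewrite moo powR1 mulr1 mulry gtr0_sg// mul1e.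
  case: (S) S0 => [s| |] _ //.
  by move=> _; rewrite mulry gtr0_sg ?powR_gt0// mul1e leey.
have mf : m \is a fin_num by rewrite ge0_fin_numE// ltey.
have [m00|mn0] := eqVneq m 0.
  by rewrite m00 poweR0r ?gt_eqF// mule_ge0// lee_fin powR_ge0.
(* For a weight of mass exactly [K] this is the mean of [h], the optimal point of tangency. *)
pose l := (fine m / K)%R.
have m'0 : (0 < fine m)%R by rewrite fine_gt0// lt_neqAle eq_sym mn0 m0/= ltey.
have l0 : (0 < l)%R by rewrite divr_gt0.
have /= := main l (ltW l0).
rewrite -(fineK mf) -EFinM poweR_EFin.
have powS a : (0 < a)%R -> (a `^ q = a `^ (q - 1) * a)%R.
  move=> a0; rewrite -[X in (_ = _ * X)%R](powRr1 (ltW a0)) -powRD ?subrK//.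
  by rewrite (gt_eqF a0) implybT.
have lq : (l `^ q * K = l `^ (q - 1) * fine m)%R.
  by rewrite powS// -mulrA /l divfK ?gt_eqF.
rewrite -[((q - 1) * _ * K)%R]mulrA lq -leeBlDr// -EFinB.
rewrite [X in X%:E <= _](_ : _ = l `^ (q - 1) * fine m)%R; last by lra.
move=> H; rewrite -lee_pdivrMl ?powR_gt0// -EFinM; apply: le_trans H.
rewrite lee_fin powS// mulrA ler_wpM2r ?(ltW m'0)//.
rewrite /l powRM ?invr_ge0 ?(ltW K0) ?(ltW m'0)// mulrC.
by rewrite -(powR_inv1 (ltW K0)) -powRrM mulN1r powRN.
Qed.

End power_mean.

(** * From convergence in L1 to convergence almost everywhere *)

Section ae_subsequence.
Local Open Scope ereal_scope.
Context d (T : measurableType d) (R : realType) (mu : {measure set T -> \bar R}).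

Lemma summable_ae_cvg0 (u : nat -> T -> R) :
  (forall k, measurable_fun setT (u k)) -> (forall k x, 0 <= u k x)%R ->
  \sum_(k <oo) \int[mu]_x (u k x)%:E < +oo ->
  {ae mu, forall x, \sum_(k <oo) (u k x)%:E < +oo}.
Proof.
move=> mu_ u0 fin.
have mS : measurable_fun setT (fun x => \sum_(k <oo) (u k x)%:E).
  apply: (@ge0_emeasurable_sum _ _ _ _ (fun k x => (u k x)%:E) xpredT).
    by move=> k x _ _; rewrite lee_fin.
  by move=> k _; exact/measurable_EFinP.
have S0 x : 0 <= \sum_(k <oo) (u k x)%:E.
  by apply: nneseries_ge0 => k _ _; rewrite lee_fin.
have : mu.-integrable setT (fun x => \sum_(k <oo) (u k x)%:E).
  apply/integrableP; split=> //.
  under eq_integral do rewrite gee0_abs//.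
  rewrite integral_nneseries//.
    by move=> k; exact/measurable_EFinP.
  by move=> k x _; rewrite lee_fin.
move/(integrable_ae measurableT); apply: filterS => x /(_ I).
by rewrite ge0_fin_numE.
Qed.

Lemma nneseries_cvg0 (u : nat -> R) : (forall k, 0 <= u k)%R ->
  \sum_(k <oo) (u k)%:E < +oo -> u k @[k --> \oo] --> 0%R.
Proof.
move=> u0 fin.
have u0' k : 0 <= (u k)%:E by rewrite lee_fin.
have := @nneseries_tail_cvg R (fun k => (u k)%:E) xpredT fin (fun k _ => u0' k).
move=> tail.
have : (u k)%:E @[k --> \oo] --> 0.
  apply: (@squeeze_cvge _ _ _ _ (cst 0) _ (fun N => \sum_(N <= k <oo) (u k)%:E)).
  - apply: nearW => N /=; rewrite u0'/=.
    apply: (@le_trans _ _ (\sum_(N <= k < N.+1) (u k)%:E)).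
      by rewrite big_nat1.
    exact: nneseries_lim_ge.
  - exact: cvg_cst.
  - exact: tail.
by move/fine_cvg.
Qed.

Lemma geometric_sum_lty : \sum_(k <oo) ((2^-1 : R) ^+ k)%:E < +oo.
Proof.
rewrite (_ : \sum_(k <oo) _ = limn (fun n => (series (geometric 1 (2^-1 : R)) n)%:E)).
  rewrite EFin_lim; first by rewrite ltry.
  by apply: is_cvg_geometric_series; rewrite ger0_norm// invf_lt1// ltr1n.
congr (limn _); apply/funext => N; rewrite /series/= sumEFin; congr EFin.
by apply: eq_bigr => i _; rewrite mul1r.
Qed.

(** The k-th index is chosen so that the L1 distance is at most 2^-k; the distances are then
    summable almost everywhere. The condition [k <= s k] keeps the subsequence cofinal, so that
    every prescribed scale is eventually passed. *)
Lemma L1_cvg_ae_subsequence (h : nat -> T -> R) (g : T -> R) :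
  (forall k, measurable_fun setT (h k)) -> measurable_fun setT g ->
  (forall e : R, (0 < e)%R -> exists N, forall k, (N <= k)%N ->
    \int[mu]_x `|h k x - g x|%:E <= e%:E) ->
  exists s : nat -> nat, (forall k, k <= s k)%N /\
    {ae mu, forall x, h (s k) x @[k --> \oo] --> g x}.
Proof.
move=> mh mg hg.
have /choice[s sP] : forall k : nat, exists j, (k <= j)%N /\
    \int[mu]_x `|h j x - g x|%:E <= ((2^-1 : R) ^+ k)%:E.
  move=> k; have [|N NP] := hg (2^-1 ^+ k)%R; first by rewrite exprn_gt0.
  by exists (maxn N k); split; [exact: leq_maxr|apply: NP; exact: leq_maxl].
exists s; split; first by move=> k; exact: (sP k).1.
have := @summable_ae_cvg0 (fun k x => `|h (s k) x - g x|%R).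
move=> /(_ _ _ _)/filterS; apply.
- move=> x /nneseries_cvg0 - /(_ (fun k => normr_ge0 _)) h0.
  apply/cvgrPdist_le => e e0; move/cvgrPdist_le: h0 => /(_ e e0).
  by apply: filterS => k; rewrite sub0r normrN normr_id distrC.
- by move=> k; apply: measurableT_comp => //; exact: measurable_funB.
- by [].
- apply: le_lt_trans geometric_sum_lty.
  by apply: lee_nneseries => k *; [exact: integral_ge0|exact: (sP k).2].
Qed.

End ae_subsequence.

(** * Radial integrals without polar coordinates *)

Section radial.
Context (R : realType) (n : nat).
Local Notation E := 'rV[R]_n.+1.
Local Notation B := (borel_space R n).
Local Notation lambda := (@lebesgue_measure R).

Lemma measurable_lt_indic d (T : measurableType d) (f g : T -> R) :
  measurable_fun setT f -> measurable_fun setT g ->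
  measurable_fun setT (fun t => (f t < g t)%R%:R : R).
Proof.
move=> mf mg; rewrite (_ : (fun _ => _) = \1_[set t | f t < g t]).
  apply: measurable_indic.
  have mt : measurable [set true] by [].
  by have := measurable_fun_ltr mf mg measurableT mt; rewrite setTI.
by apply/funext => t; rewrite indicE; congr (nat_of_bool _)%:R; rewrite mem_setE.
Qed.

(** The inverse is written as s (s^2)^-1, which is right at 0 as well, where both sides are 0. *)
Lemma measurable_inv (D : set R) : measurable_fun D (fun s : R => s^-1).
Proof.
apply: measurable_funTS.
rewrite (_ : (fun s : R => s^-1) = (fun s => s * (s ^+ 2) `^ (-1))).
  apply: measurable_funM => //; apply: (@measurableT_comp _ _ _ _ _ _ (@powR R ^~ (-1))).
    exact: measurable_powR.
  exact: exprn_measurable.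
apply/funext => s; rewrite powR_inv1 ?sqr_ge0// expr2.
have [->|s0] := eqVneq s 0; first by rewrite invr0 !mul0r.
by rewrite invfM mulrA divff// mul1r.
Qed.

(** Vanishing for [s <= 0] makes the radial function vanish at the origin, so that no value at 0 has
    to be controlled. *)
Definition radial_profile (phi : R -> R) :=
  [/\ measurable_fun setT phi, forall s, 0 <= phi s, forall s, s <= 0 -> phi s = 0
    & forall s t, 0 < s -> s <= t -> phi t <= phi s].

Local Open Scope ereal_scope.

Lemma dyadic_weight_ge0 (a s : R) : (0 <= a)%R ->
  (0 <= (a / 2 < s)%R%:R * (s < a)%R%:R * s^-1)%R.
Proof.
move=> a0; case: (ltP (a / 2)%R s) => s1; last by rewrite !mul0r.
by rewrite !mulr_ge0// invr_ge0 ltW// (le_lt_trans _ s1)// divr_ge0.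
Qed.

(** The integral is log 2; on an interval of length a/2 the crude bound 1/s >= 1/a suffices. *)
Lemma integral_inv_dyadic (a : R) : (0 < a)%R ->
  2^-1%:E <= \int[lambda]_s ((a / 2 < s)%R%:R * (s < a)%R%:R * s^-1)%:E.
Proof.
move=> a0; have a20 : (0 < a / 2)%R by rewrite divr_gt0.
pose D : set R := [set` `](a / 2)%R, a[].
have mD : measurable D by exact: measurable_itv.
have a2a : (a / 2 < a)%R by rewrite ltr_pdivrMr// ltr_pMr// ltr1n.
apply: (@le_trans _ _ (\int[lambda]_(s in D) cst a^-1%:E s)).
  have -> : \int[lambda]_(s in D) cst a^-1%:E s = a^-1%:E * (a - a / 2)%:E.
    rewrite integral_cst//; congr mule.
    by rewrite [LHS](@lebesgue_measure_itv R `](a / 2)%R, a[)/= lte_fin a2a -EFinB.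
  rewrite -EFinM lee_fin.
  rewrite (_ : (a - a / 2) = a / 2)%R; last by lra.
  by rewrite mulrA mulVf ?gt_eqF// mul1r.
rewrite integral_mkcond; apply: ge0_le_integral => //.
- by move=> s _; rewrite erestrict_ge0// => t _; rewrite lee_fin invr_ge0 ltW.
- exact: (measurable_patch mD (measurable_cst _)).
- apply/measurable_EFinP; apply: measurable_funM.
    by apply: measurable_funM; apply: measurable_lt_indic.
  exact: measurable_inv.
move=> s _; rewrite patchE; case: ifPn => [|_].
  rewrite inE/D/= in_itv/= => /andP[s1 s2].
  by rewrite s1 s2 !mul1r lee_fin lef_pV2 ?posrE ?ltW// (lt_trans a20).
by rewrite lee_fin dyadic_weight_ge0// ltW.
Qed.

(** As [phi] decreases, phi(|z|) is at most the integral of 2 phi(s)/s over |z|/2 < s < |z|. After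
    Tonelli's theorem, the points z that see a given s lie in the sup-norm cube of radius 2s, of
    volume at most (4s)^(n+1), whence the constant. *)
Lemma radial_integral_le (phi : R -> R) : radial_profile phi ->
  \int[lebB]_z (phi (enorm (z : E)))%:E <=
  (2 * 4 ^+ n.+1)%:E * \int[lambda]_(s in `]0%R, +oo[) (phi s * s ^+ n)%:E.
Proof.
move=> [mphi phi0 phiN phid].
pose F (z : E) (s : R) : \bar R :=
  ((enorm z / 2 < s)%R%:R * (s < enorm z)%R%:R * s^-1 * (2 * phi s))%:E.
have F0 z s : 0 <= F z s.
  by rewrite lee_fin; apply: mulr_ge0; [exact: dyadic_weight_ge0 (enorm_ge0 z)|exact: mulr_ge0].
have mF : measurable_fun setT (fun p : B * R => F p.1 p.2).
  apply/measurable_EFinP; apply: measurable_funM; last first.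
    apply: measurable_funM => //; exact: measurableT_comp.
  apply: measurable_funM; last first.
    by apply: (measurableT_comp (@measurable_inv _)).
  have me : measurable_fun setT (fun p : B * R => enorm (p.1 : E)).
    by apply: (measurableT_comp (@measurable_enorm R n)).
  apply: measurable_funM; apply: measurable_lt_indic => //.
  by apply: measurable_funM.
apply: (@le_trans _ _ (\int[lebB]_z \int[lambda]_s F (z : E) s)).
  apply: ge0_le_integral => //.
  - by move=> z _; rewrite lee_fin.
  - apply/measurable_EFinP; apply: (measurableT_comp mphi).
    exact: measurable_enorm.
  - exact: (measurable_integral2 lambda mF F0).
  move=> z _; have [z0|z0] := leP (enorm (z : E)) 0%R.
    by rewrite phiN// integral_ge0.
  apply: (@le_trans _ _ (\int[lambda]_s (((enorm (z : E) / 2 < s)%R%:R *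
      (s < enorm (z : E))%R%:R * s^-1)%:E * (2 * phi (enorm (z : E)))%:E))).
    rewrite ge0_integralZr//; last 3 first.
    - apply/measurable_EFinP; apply: measurable_funM; last exact: measurable_inv.
      by apply: measurable_funM; apply: measurable_lt_indic.
    - by move=> s _; rewrite lee_fin dyadic_weight_ge0// ltW.
    - by rewrite lee_fin mulr_ge0.
    apply: (le_trans _ (lee_wpmul2r _ (integral_inv_dyadic z0))).
      by rewrite -EFinM mulrA mulVf// mul1r.
    by rewrite lee_fin mulr_ge0.
  apply: ge0_le_integral => //.
  - move=> s _; apply: mule_ge0; rewrite lee_fin; last exact: mulr_ge0.
    by rewrite dyadic_weight_ge0// ltW.
  - apply: emeasurable_funM => //; apply/measurable_EFinP; apply: measurable_funM.
      by apply: measurable_funM; apply: measurable_lt_indic.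
    exact: measurable_inv.
  - exact: (measurable_section2 mF).
  move=> s _; rewrite -EFinM lee_fin.
  case: (ltP (enorm (z : E) / 2)%R s) => s1; last by rewrite !mul0r.
  case: (ltP s (enorm (z : E)))%R => s2; last by rewrite mulr0 !mul0r.
  have s0 : (0 < s)%R by apply: lt_trans s1; rewrite divr_gt0.
  by rewrite ler_wpM2l// ?mulr_ge0 ?invr_ge0 ?(ltW s0)// ler_wpM2l// phid// ltW.
rewrite (integral_swap (@lebB R n) lambda mF F0).
rewrite [leRHS](_ : _ = \int[lambda]_(s in `]0%R, +oo[)
    ((2 * 4 ^+ n.+1)%:E * (phi s * s ^+ n)%:E)); last first.
  rewrite ge0_integralZl//.
  - apply/measurable_EFinP; apply: measurable_funTS; apply: measurable_funM => //.
  - move=> s /=; rewrite in_itv/= andbT => s0.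
    by rewrite lee_fin mulr_ge0// exprn_ge0// ltW.
rewrite [leRHS]integral_mkcond; apply: ge0_le_integral => //.
- by move=> s _; rewrite integral_ge0.
- exact: (measurable_integral1 (@lebB R n) mF F0).
- apply: measurable_patch => //; apply: measurable_funeM.
  apply/measurable_EFinP; apply: measurable_funTS; apply: measurable_funM => //.
move=> s _; rewrite patchE; case: ifPn => [|].
  rewrite inE/= in_itv/= andbT => s0.
  apply: (@le_trans _ _ (\int[lebB]_z ((s^-1 * (2 * phi s))%:E *
      (\1_[set y : E | (`|y - 0| < 2 * s)%R] z)%:E))).
    apply: ge0_le_integral => //.
    - exact: (measurable_section1 mF).
    - apply: measurable_funeM; apply/measurable_EFinP.
      by apply: measurable_indic; exact: measurable_norm_lt.
    move=> z _; rewrite /F -EFinM lee_fin indicE.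
    have sp : (0 <= s^-1 * (2 * phi s))%R by rewrite !mulr_ge0// invr_ge0 ltW.
    rewrite -mulrA mulrC; apply: ler_wpM2l => //.
    case: (ltP (enorm (z : E) / 2)%R s) => s1; last by rewrite mul0r.
    rewrite mul1r; case: (ltP s (enorm (z : E))) => // s2.
    rewrite mem_set//= subr0; apply: (le_lt_trans (norm_le_enorm (z : E))).
    by rewrite mulrC -ltr_pdivrMr.
  rewrite ge0_integralZl//; last 2 first.
  - apply/measurable_EFinP; apply: measurable_indic; exact: measurable_norm_lt.
  - by rewrite lee_fin !mulr_ge0// invr_ge0 ltW.
  rewrite integral_indic//; last exact: measurable_norm_lt.
  rewrite setIT (le_trans (lee_wpmul2l _ (lebB_cube_le 0%R _)))//.
  - by rewrite lee_fin !mulr_ge0// invr_ge0 ltW.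
  - by rewrite mulr_gt0.
  rewrite -!EFinM lee_fin (_ : (2 * (2 * s) = 4 * s)%R); last by lra.
  rewrite exprMn [(s ^+ n.+1)%R]exprS.
  have aux (i f a b : R) : (i * (2 * f) * (a * (s * b)) = (i * s) * (2 * a * (f * b)))%R by lra.
  rewrite aux.
  by rewrite mulVf ?gt_eqF// mul1r.
rewrite notin_setE/= in_itv/= andbT => /negP; rewrite -leNgt => s0.
rewrite integral0_eq// => z _; rewrite /F ltNge (le_trans s0) ?mul0r//.
by rewrite divr_ge0// enorm_ge0.
Qed.

(** The same averaging from the other side: phi(|z|) dominates the integral of phi(s)/s over |z| < s
    < 2|z|. For given s the relevant part of the cone is s times its part in the shell 1/2 < |z| <
    1, so its measure is s^(n+1) times that of the latter. *)
Lemma radial_cone_integral_ge (phi : R -> R) (d : R) (K : set E) :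
  radial_profile phi -> measurable (K : set B) ->
  (forall (t : R) z, (0 < t)%R -> K z -> K (t *: z)) -> (0 < d)%R ->
  lebB (K `&` [set z : E | (2^-1 < enorm z)%R /\ (enorm z < 1)%R]) *
    \int[lambda]_(s in `]0%R, d[) (phi s * s ^+ n)%:E <=
  \int[lebB]_(z in K `&` [set z : E | (enorm z < d)%R]) (phi (enorm (z : E)))%:E.
Proof.
move=> [mphi phi0 phiN phid] mK Kcone d0.
set kappa := lebB _.
have men : measurable_fun setT (fun z : B => enorm (z : E)).
  exact: measurable_enorm.
have mlt (c : R) : measurable ([set z : E | (enorm z < c)%R] : set B).
  rewrite [X in measurable X](_ : _ = setT `&` (fun z : B => enorm (z : E)) @^-1` `]-oo, c[%classic).
    exact: men.
  by rewrite setTI; apply/seteqP; split=> z /=; rewrite in_itv.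
have mgt (c : R) : measurable ([set z : E | (c < enorm z)%R] : set B).
  rewrite [X in measurable X](_ : _ = setT `&` (fun z : B => enorm (z : E)) @^-1` `]c, +oo[%classic).
    exact: men.
  by rewrite setTI; apply/seteqP; split=> z /=; rewrite in_itv/= andbT.
have mA (s : R) : measurable (K `&` [set z : E | (s / 2 < enorm z)%R /\ (enorm z < s)%R] : set B).
  by apply: measurableI => //; exact: (measurableI _ _ (mgt _) (mlt _)).
pose F (z : E) (s : R) : \bar R :=
  ((\1_K z * (s < d)%R%:R * ((s / 2 < enorm z)%R%:R * (enorm z < s)%R%:R * s^-1)) * phi s)%:E.
have w0 z s : (0 <= \1_K z * (s < d)%R%:R * ((s / 2 < enorm z)%R%:R * (enorm z < s)%R%:R * s^-1))%R.
  apply: mulr_ge0 => //; case: (ltP (enorm z) s) => zs; last by rewrite mulr0 mul0r.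
  by rewrite mulr_ge0// invr_ge0 ltW// (le_lt_trans (enorm_ge0 z)).
have F0 z s : 0 <= F z s by rewrite lee_fin mulr_ge0.
have mF : measurable_fun setT (fun p : B * R => F p.1 p.2).
  have me : measurable_fun setT (fun p : B * R => enorm (p.1 : E)).
    by apply: (measurableT_comp men).
  apply/measurable_EFinP; apply: measurable_funM; last exact: measurableT_comp.
  apply: measurable_funM.
    apply: measurable_funM; last exact: measurable_lt_indic.
    by apply: (@measurableT_comp _ _ _ _ _ _ (\1_K : B -> R)) => //; exact: measurable_indic.
  apply: measurable_funM; last first.
    by apply: (measurableT_comp (@measurable_inv _)).
  apply: measurable_funM; apply: measurable_lt_indic => //.
  by apply: measurable_funM.
apply: (@le_trans _ _ (\int[lebB]_z \int[lambda]_s F (z : E) s)); last first.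
  rewrite [leRHS]integral_mkcond; apply: ge0_le_integral => //.
  - by move=> z _; exact: integral_ge0.
  - exact: (measurable_integral2 lambda mF F0).
  - apply: measurable_patch; first exact: (measurableI _ _ mK (mlt _)).
    apply/measurable_EFinP; apply: measurable_funTS; exact: (measurableT_comp mphi).
  move=> z _; rewrite patchE.
  have [z0|z0] := leP (enorm (z : E)) 0%R.
    have -> : \int[lambda]_s F z s = 0.
      rewrite integral0_eq// => s _; rewrite /F.
      case: (ltP (enorm (z : E)) s) => zs; last by rewrite !(mulr0, mul0r).
      rewrite [(s / 2 < _)%R]ltNge (le_trans z0) ?mul0r ?mulr0 ?mul0r//.
      by rewrite divr_ge0// ltW// (le_lt_trans (enorm_ge0 (z : E))).
    by case: ifP => // _; rewrite lee_fin.
  case: ifPn => [|zK]; last first.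
    rewrite integral0_eq// => s _; rewrite /F.
    move: zK; rewrite notin_setE/= => /not_andP[zK|].
      by rewrite indicE memNset// !mul0r.
    move=> /negP; rewrite -leNgt => dz.
    case: (ltP s d) => sd; last by rewrite !(mulr0, mul0r).
    by rewrite [(_ < s)%R]ltNge (le_trans (ltW sd) dz) !(mulr0, mul0r).
  move=> _.
  pose D : set R := [set` `](enorm (z : E)), (2 * enorm (z : E))%R[].
  have mD : measurable D by exact: measurable_itv.
  apply: (@le_trans _ _ (\int[lambda]_(s in D)
      cst (phi (enorm (z : E)) * (enorm (z : E))^-1)%:E s)).
    rewrite [leRHS]integral_mkcond; apply: ge0_le_integral => //.
    - exact: (measurable_section2 mF).
    - exact: (measurable_patch mD (measurable_cst _)).
    move=> s _; rewrite patchE; case: ifPn => [|].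
      rewrite inE/D/= in_itv/= => /andP[s1 s2].
      have s0 : (0 < s)%R by exact: lt_trans s1.
      rewrite lee_fin mulrC ler_pM//; first exact: phid (ltW s1).
      rewrite -[leRHS]mul1r ler_pM//.
      - by rewrite mulr_ge0// invr_ge0 ltW.
      - by rewrite indicE; case: (z \in K); case: (s < d)%R; rewrite /= ?(mulr0, mul0r, mulr1).
      rewrite s1 mulr1 -[leRHS]mul1r ler_pM ?invr_ge0 ?(ltW s0)//.
        by case: (_ < _)%R.
      by rewrite lef_pV2 ?posrE// ltW.
    rewrite notin_setE/D/= in_itv/= => /negP; rewrite negb_and -!leNgt => /orP[s1|s2].
      by rewrite /F [(_ < s)%R]ltNge s1 !(mulr0, mul0r).
    rewrite /F (_ : (s / 2 < enorm (z : E))%R = false) ?(mulr0, mul0r)//.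
    by apply/negbTE; rewrite -leNgt ler_pdivlMr// mulrC.
  rewrite integral_cst// [X in _ * X](_ : _ = (enorm (z : E))%:E).
    by rewrite -EFinM mulfVK ?gt_eqF.
  rewrite [LHS](@lebesgue_measure_itv R `](enorm (z : E)), (2 * enorm (z : E))%R[)/= lte_fin.
  rewrite ltr_pMl// ltr1n/= -EFinB; congr EFin; lra.
rewrite (integral_swap (@lebB R n) lambda mF F0).
have k0 : 0 <= kappa by exact: measure_ge0.
have -> : kappa * \int[lambda]_(s in `]0%R, d[) (phi s * s ^+ n)%:E =
    \int[lambda]_(s in `]0%R, d[) (kappa * (phi s * s ^+ n)%:E).
  rewrite ge0_integralZl//.
  - apply/measurable_EFinP; apply: measurable_funTS; apply: measurable_funM => //.
  - move=> s /=; rewrite in_itv/= => /andP[s0 _].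
    by rewrite lee_fin mulr_ge0// exprn_ge0// ltW.
rewrite [leLHS]integral_mkcond; apply: ge0_le_integral => //.
- move=> s _; rewrite erestrict_ge0// => t /=; rewrite in_itv/= => /andP[t0 _].
  by rewrite mule_ge0// lee_fin mulr_ge0// exprn_ge0// ltW.
- apply: measurable_patch => //; apply: measurable_funeM.
  apply/measurable_EFinP; apply: measurable_funTS; apply: measurable_funM => //.
- exact: (measurable_integral1 (@lebB R n) mF F0).
move=> s _; rewrite patchE; case: ifPn => [|_]; last exact: integral_ge0.
rewrite inE/= in_itv/= => /andP[s0 sd].
rewrite (_ : (fun z => F z s) = (fun z : B => (s^-1 * phi s)%:E *
    (\1_(K `&` [set z : E | (s / 2 < enorm z)%R /\ (enorm z < s)%R]) z)%:E)); last first.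
  apply/funext => z; rewrite /F sd mulr1 -EFinM indicI; congr EFin.
  rewrite /= [\1_[set z : E | _] z]indicE (_ : (z \in [set z : E | _]) =
    (s / 2 < enorm (z : E))%R && (enorm (z : E) < s)%R); last first.
    by apply/idP/andP => [|?]; [move/set_mem|exact/mem_set].
  by case: (s / 2 < _)%R; case: (_ < s)%R; rewrite /= !(mulr0, mul0r, mulr1, mul1r)//; lra.
rewrite ge0_integralZl//; last 2 first.
- by apply/measurable_EFinP; apply: measurable_indic.
- by rewrite lee_fin mulr_ge0// invr_ge0 ltW.
rewrite integral_indic// setIT.
have := @lebB_affine R n s 0%R (K `&` [set z : E | (s / 2 < enorm z)%R /\ (enorm z < s)%R]) s0.
rewrite [X in lebB X = _ -> _](_ : _ = K `&` [set z : E | (2^-1 < enorm z)%R /\ (enorm z < 1)%R]).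
  rewrite -/kappa => ->; rewrite muleAC -EFinM (_ : _ * _ = s^-1 * phi s)%R//.
  have sn : (s ^+ n.+1 != 0)%R by rewrite expf_neq0 ?gt_eqF.
  rewrite exprS invfM -mulrA [((s ^+ n)^-1 * _)%R]mulrCA mulVf ?mulr1//.
  by rewrite expf_neq0 ?gt_eqF.
apply/seteqP; split=> z /=; rewrite addr0 enormZ (gtr0_norm s0) ltr_pM2l// gtr_pMr//.
  by move=> [Kz zz]; split=> //; have := Kcone s^-1%R _ _ Kz;
    rewrite scalerA mulVf ?gt_eqF// scale1r; apply; rewrite invr_gt0.
by move=> [Kz zz]; split=> //; exact: Kcone.
Qed.

End radial.

(** * Smooth kernels and mollification *)

Section line_derivative.
Context (R : realType) (V : normedModType R).

(** Reduces a directional derivative to an ordinary one on a line, so that one-variable theorems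
    apply. *)
Lemma is_derive_line (f : V -> R) (x v : V) (t d : R) :
  is_derive t 1 (fun s : R => f (s *: v + x)) d <-> is_derive (t *: v + x) v f d.
Proof.
pose g1 := fun h : R => h^-1 *: (f ((h *: 1 + t) *: v + x) - f (t *: v + x)).
pose g2 := fun h : R => h^-1 *: (f (h *: v + (t *: v + x)) - f (t *: v + x)).
have g12 : g1 = g2.
  by apply/funext => h; rewrite /g1 /g2 scalerDl addrA [h *: 1]mulr1.
split=> -[df Df]; split.
- by have : cvg (g1 @ 0^') by []; rewrite g12.
- by have : lim (g1 @ 0^') = d by []; rewrite g12.
- by have : cvg (g2 @ 0^') by []; rewrite -g12.
- by have : lim (g2 @ 0^') = d by []; rewrite -g12.
Qed.

Lemma is_derive_scale_dir (f : R -> R) (x a d : R) :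
  is_derive x 1 f d -> is_derive x a f (a * d).
Proof.
move=> [df Df]; have dif : differentiable f x by exact/derivable1_diffP.
split; first exact: diff_derivable.
rewrite deriveE// -[a]mulr1 -[a * 1]/(a *: 1) linearZ/= -deriveE// Df.
by rewrite [a *: 1]mulr1.
Qed.

End line_derivative.

(** * The flat function exp(-1/s) and its derivatives *)

Section flat_exponential.
Context (R : realType).

(* [flat j s] is [s ^- j * exp (- 1 / s)] for [s > 0]; this family is closed
   under differentiation up to linear combinations. *)
Definition flat (j : nat) (s : R) : R :=
  if 0 < s then s ^- j * expR (- s^-1) else 0.

Lemma flat_ge0 j s : 0 <= flat j s.
Proof.
rewrite /flat; case: ifP => // s0; rewrite mulr_ge0 ?expR_ge0//.
by rewrite invr_ge0 exprn_ge0// ltW.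
Qed.

Lemma flat0_le1 s : flat 0 s <= 1.
Proof.
rewrite /flat; case: ifP => // s0; rewrite expr0 invr1 mul1r expR_le1.
by rewrite lerNl oppr0 invr_ge0 ltW.
Qed.

Lemma flat_gt0 j s : 0 < s -> 0 < flat j s.
Proof. by move=> s0; rewrite /flat s0 mulr_gt0 ?expR_gt0// invr_gt0 exprn_gt0. Qed.

Lemma flat_le0 j s : s <= 0 -> flat j s = 0.
Proof. by move=> s0; rewrite /flat ltNge s0. Qed.

(** The bound exp(u) >= u^(j+1)/(j+1)! at u = 1/s. *)
Lemma flat_le_linear j s : `|flat j s| <= j.+1`!%:R * `|s|.
Proof.
have [s0|s0] := ltP 0 s; last by rewrite flat_le0// normr0 mulr_ge0.
rewrite ger0_norm ?flat_ge0// (gtr0_norm s0) /flat s0.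
have si0 : 0 <= s^-1 by rewrite invr_ge0 ltW.
have := @expR_ge1Dxn R s^-1 j si0.
move=> /(le_trans (_ : s^-1 ^+ j.+1 / j.+1`!%:R <= _)).
rewrite lerDr ler01 => /(_ isT) H.
have f0 : (0 : R) < j.+1`!%:R by rewrite ltr0n fact_gt0.
rewrite expRN ler_pdivrMr ?expR_gt0//.
apply: (@le_trans _ _ (j.+1`!%:R * s * (s^-1 ^+ j.+1 / j.+1`!%:R))).
  have aux (a b c d : R) : a * b * (c * d) = (a * d) * (b * c) by lra.
  by rewrite aux divff ?gt_eqF// mul1r exprS mulrA mulfV ?gt_eqF// mul1r exprVn.
by rewrite ler_wpM2l// mulr_ge0// ltW.
Qed.

Lemma flat_is_derive j (s : R) :
  is_derive s 1 (flat j) (- (j%:R * flat j.+1 s) + flat j.+2 s).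
Proof.
have [s0|s0|s0] := ltrgtP 0 s.
- apply: (@near_eq_is_derive R R^o R^o (fun s => s^-1 ^+ j * expR (- s^-1))).
    near=> u; rewrite /flat ifT ?exprVn//.
    by near: u; exact: lt_nbhsr.
  have sn0 : s != 0 by rewrite gt_eqF.
  have dV : is_derive s 1 (fun u : R => u^-1) (- s ^- 2 *: 1).
    exact: (@is_deriveV _ id s 1 1 sn0).
  have dE : is_derive s 1 (fun u : R => expR (- u^-1)) (expR (- s^-1) * s ^- 2).
    apply: (@is_derive1_comp R expR (fun u : R => - u^-1)).
    have dN := @is_deriveN R R^o R^o (fun u : R => u^-1) s 1 _ dV.
    by rewrite scaleNr opprK [_ *: 1]mulr1 in dN.
  have dX := @is_deriveX R R^o (fun u : R => u^-1) j s 1 _ dV.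
  have eX : (fun u : R => u^-1) ^+ j = (fun u => u^-1 ^+ j).
    by apply/funext => u; rewrite fctE.
  rewrite eX in dX.
  have dM := @is_deriveM R R^o (fun u : R => u^-1 ^+ j) _ s 1 _ _ dX dE.
  apply: (@is_derive_eq R R^o R^o _ _ _ _ _ dM).
  rewrite /flat s0 /= [_ *: 1]mulr1 -!exprVn /GRing.scale/=.
  move: (s^-1) (expR _) => v e.
  case: j {dX dM eX} => [|j]; first by rewrite expr0; lra.
  rewrite /= ![v ^+ _.+1]exprS expr0; move: (v ^+ j) => w; lra.
- rewrite !flat_le0 ?ltW// mulr0 oppr0 addr0.
  apply: (@near_eq_is_derive R R^o R^o (cst 0) _ s 1 0).
  by near=> u; rewrite flat_le0// ltW//; near: u; exact: lt_nbhsl.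
- rewrite -s0 !flat_le0// mulr0 oppr0 addr0.
  have C : h^-1 *: (flat j (h *: 1 + 0) - flat j 0) @[h --> (0:R)^'] --> (0 : R).
    apply/cvgrPdist_le => e e0; near=> h.
    rewrite sub0r normrN addr0 [h *: 1]mulr1 [flat j 0]flat_le0// subr0.
    apply: (@le_trans _ _ (j.+2`!%:R * `|h|)).
      have [h0|h0] := ltP 0 h; last by rewrite flat_le0// scaler0 normr0 mulr_ge0.
      (* For positive h the difference quotient at 0 is the next member of the family, which the
         linear bound sends to 0. *)
      rewrite (_ : h^-1 *: flat j h = flat j.+1 h); first exact: flat_le_linear.
      by rewrite /flat h0 /GRing.scale/= mulrA exprS invfM.
    rewrite mulrC -ler_pdivlMr ?ltr0n ?fact_gt0//; apply/ltW.
    near: h; apply: dnbhs0_lt.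
    by rewrite divr_gt0// ltr0n fact_gt0.
  by split; [apply/cvg_ex; exists 0|exact: cvg_lim].
Unshelve. all: by end_near. Qed.

Lemma flat_continuous j : continuous (flat j).
Proof.
move=> s; apply/differentiable_continuous/derivable1_diffP.
by have [] := flat_is_derive j s.
Qed.

End flat_exponential.

(** * Bump functions and the mean value theorem along coordinate axes *)

Section smooth.
Context (R : realType) (n : nat).
Local Notation E := 'rV[R]_n.+1.
Local Notation e_ i := (delta_mx 0 i : E).

(* Only an algebra of smooth functions that contains the bump functions and is closed under
   partial derivatives is needed, so smoothness is not defined by derivatives of all orders. *)
Inductive smooth : (E -> R) -> Prop :=
| smooth_flat j i a b : smooth (fun x => flat j (a * x 0 i + b))
| smooth_cst c : smooth (fun=> c)
| smoothD f g : smooth f -> smooth g -> smooth (fun x => f x + g x)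
| smoothM f g : smooth f -> smooth g -> smooth (fun x => f x * g x).

Lemma smooth_derive f : smooth f -> forall i, exists2 g, smooth g &
  forall x, is_derive x (e_ i) f (g x).
Proof.
elim=> {f} [j k a b|c|f g _ IHf _ IHg|f g Sf IHf Sg IHg] i.
- pose c : R := a * (i == k)%:R.
  exists (fun x => c * ((- j%:R) * flat j.+1 (a * x 0 k + b) + flat j.+2 (a * x 0 k + b))).
    by apply: smoothM; [exact: smooth_cst|apply: smoothD; [apply: smoothM; [exact: smooth_cst|]|]; exact: smooth_flat].
  move=> x; have -> : x = 0 *: e_ i + x by rewrite scale0r add0r.
  apply/is_derive_line.
  rewrite (_ : (fun s => _) = (fun s : R => flat j (s *: c + (a * x 0 k + b)))); last first.
    apply/funext => s; rewrite !mxE !eqxx/= /c eq_sym /GRing.scale/=; congr flat.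
    by lra.
  apply/is_derive_line; rewrite !scale0r !add0r mulNr.
  exact/is_derive_scale_dir/flat_is_derive.
- by exists (fun=> 0); [exact: smooth_cst|move=> x; exact: is_derive_cst].
- have [f' Sf' df] := IHf i; have [g' Sg' dg] := IHg i.
  exists (fun x => f' x + g' x); first exact: smoothD.
  by move=> x; exact: is_deriveD.
- have [f' Sf' df] := IHf i; have [g' Sg' dg] := IHg i.
  exists (fun x => f x * g' x + g x * f' x).
    by apply: smoothD; exact: smoothM.
  by move=> x; exact: is_deriveM.
Qed.

Lemma smooth_continuous f : smooth f -> continuous f.
Proof.
elim=> {f} [j k a b|c|f g _ IHf _ IHg|f g Sf IHf Sg IHg] x.
- apply: (@continuous_comp _ _ _ (fun x : E => a * x 0 k + b) (flat j)); last exact: flat_continuous.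
  have h : (fun y : E => a * y 0 k + b) y @[y --> x] --> a * x 0 k + b.
    exact: (cvgD (cvgM (cvg_cst a) (@continuous_coord R n k x)) (cvg_cst b)).
  exact: h.
- exact: (@cst_continuous E R c).
- exact: (cvgD (IHf x) (IHg x)).
- exact: (cvgM (IHf x) (IHg x)).
Qed.

Lemma smooth_partial f i : smooth f -> smooth (partial i f).
Proof.
move=> /smooth_derive/(_ i)[g Sg dg]; rewrite (_ : partial i f = g)//.
by apply/funext => x; have [] := dg x.
Qed.

Lemma smooth_derivable f i x : smooth f -> derivable f x (e_ i).
Proof. by move=> /smooth_derive/(_ i)[g Sg dg]; have [] := dg x. Qed.

Lemma smooth_is_derive f i x : smooth f -> is_derive x (e_ i) f (partial i f x).
Proof. by move=> Sf; apply: DeriveDef => //; exact: smooth_derivable. Qed.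

Lemma smooth_Ck k f : smooth f -> Ck k f.
Proof.
elim: k f => [|k IH] f Sf /=; first by split=> //; exact: smooth_continuous.
split; first exact: smooth_continuous.
move=> i; split; first by move=> x; exact: smooth_derivable.
by apply: IH; exact: smooth_partial.
Qed.

Lemma smooth_affine f (a : R) (v : E) : smooth f -> smooth (fun x => f (a *: x + v)).
Proof.
elim=> {f} [j k c b|c|f g _ IHf _ IHg|f g Sf IHf Sg IHg].
- rewrite (_ : (fun x : E => _) = (fun x : E => flat j ((c * a) * x 0 k + (c * v 0 k + b)))).
    exact: smooth_flat.
  by apply/funext => x; rewrite !mxE; congr flat; lra.
- exact: smooth_cst.
- exact: (@smoothD (fun x => f (a *: x + v)) (fun x => g (a *: x + v))).
- exact: (@smoothM (fun x => f (a *: x + v)) (fun x => g (a *: x + v))).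
Qed.

Lemma smooth_prod (I : Type) (s : seq I) (F : I -> E -> R) :
  (forall i, smooth (F i)) -> smooth (fun x => \prod_(i <- s) F i x).
Proof.
move=> SF; elim: s => [|i s IH].
  by rewrite (_ : (fun=> _) = fun=> 1); [exact: smooth_cst|apply/funext => x; rewrite big_nil].
rewrite (_ : (fun=> _) = fun x => F i x * \prod_(j <- s) F j x).
  exact: smoothM.
by apply/funext => x; rewrite big_cons.
Qed.

(** Positive exactly on the open unit cube of the sup norm. The coefficients 1 and -1 match the
    affine arguments allowed by [smooth_flat], and the product over a list permits induction. *)
Definition raw_bump (x : E) : R :=
  \prod_(i <- enum 'I_n.+1) (flat 0 (1 * x 0 i + 1) * flat 0 ((-1) * x 0 i + 1)).

Lemma smooth_raw_bump : smooth raw_bump.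
Proof. by apply: smooth_prod => i; apply: smoothM; exact: smooth_flat. Qed.

Lemma raw_bump_ge0 x : 0 <= raw_bump x.
Proof. by apply: prodr_ge0 => i _; rewrite mulr_ge0 ?flat_ge0. Qed.

Lemma raw_bump_le1 x : raw_bump x <= 1.
Proof.
rewrite /raw_bump; elim: (enum _) => [|i s IH]; first by rewrite big_nil.
rewrite big_cons mulr_ile1 ?mulr_ge0 ?flat_ge0//.
  by apply: prodr_ge0 => j _; rewrite mulr_ge0 ?flat_ge0.
by rewrite mulr_ile1 ?flat_ge0 ?flat0_le1.
Qed.

Lemma raw_bump_gt0 x : `|x| < 1 -> 0 < raw_bump x.
Proof.
move=> /norm_lt_coordP - /(_ ltr01) x1; apply: prodr_gt0 => i _.
by have := x1 i; rewrite ltr_norml => /andP[h1 h2]; rewrite mulr_gt0 ?flat_gt0//; lra.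
Qed.

Lemma raw_bump_eq0 x : 1 <= `|x| -> raw_bump x = 0.
Proof.
move=> x1; have [i xi] : exists i, 1 <= `|x 0 i|.
  apply: contrapT => /forallNP H; have : `|x| < 1.
    by apply/norm_lt_coordP => // i; rewrite ltNge; apply/negP.
  by rewrite ltNge x1.
rewrite /raw_bump (bigD1_seq i) ?mem_enum ?enum_uniq//=.
suff -> : flat 0 (1 * x 0 i + 1) * flat 0 (-1 * x 0 i + 1) = 0 by rewrite mul0r.
move: xi; rewrite ler_normr => /orP[h|h].
  by rewrite [X in _ * X]flat_le0 ?mulr0//; lra.
by rewrite flat_le0 ?mul0r//; lra.
Qed.

(** The path from [q] to [q'] changes one coordinate at a time, so partial derivatives along the
    axes suffice. All intermediate points stay in the closed sup-norm ball of radius |q' - q| around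
    [q]. *)
Lemma mvt_coord (F : E -> R) (q q' : E) :
  (forall x i, derivable F x (e_ i)) ->
  exists xi : 'I_n.+1 -> E, (forall i, `|xi i - q| <= `|q' - q|) /\
    F q' - F q = \sum_i (q' 0 i - q 0 i) * partial i F (xi i).
Proof.
move=> dF.
pose P (k : nat) : E := \row_j (if (j < k)%N then q' 0 j else q 0 j).
have line (x : E) (i : 'I_n.+1) (d : R) : exists t : R, `|t| <= `|d| /\
    F (d *: e_ i + x) - F x = d * partial i F (t *: e_ i + x).
  pose g (s : R) := F (s *: e_ i + x).
  have dg (s : R) : is_derive s 1 g (partial i F (s *: e_ i + x)).
    by apply/is_derive_line; apply: DeriveDef.
  have cg a b : {within `[a, b], continuous g}.
    apply: derivable_within_continuous => s _; by have [] := dg s.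
  have g0 : g 0 = F x by rewrite /g scale0r add0r.
  have [d0|d0|d0] := ltrgtP 0 d.
  - have [t] := MVT d0 (fun s _ => dg s) (cg _ _).
    rewrite in_itv/= => /andP[t0 td] gd; exists t; split.
      by rewrite !ger0_norm ?ltW// (lt_trans t0).
    by rewrite -g0 -/(g d) gd subr0 mulrC.
  - have [t] := MVT d0 (fun s _ => dg s) (cg _ _).
    rewrite in_itv/= => /andP[t0 td] gd; exists t; split.
      by rewrite !ltr0_norm// lerN2 ltW.
    by rewrite -g0 -/(g d) -opprB gd sub0r mulrN opprK mulrC.
  - by exists 0; rewrite -d0 !scale0r !add0r subrr mul0r.
have step (i : 'I_n.+1) : P i.+1 = (q' 0 i - q 0 i) *: e_ i + P i.
  apply/rowP => j; rewrite !mxE eqxx/= ltnS leq_eqVlt.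
  have [->|ji] := eqVneq j i; first by rewrite eqxx ltnn/= mulr1 subrK.
  by rewrite -val_eqE/= in ji; rewrite (negbTE ji)/= mulr0 add0r.
have /choice[t tP] : forall i : 'I_n.+1, exists t : R, `|t| <= `|q' 0 i - q 0 i| /\
    F (P i.+1) - F (P i) = (q' 0 i - q 0 i) * partial i F (t *: e_ i + P i).
  by move=> i; have [t tP] := line (P i) i (q' 0 i - q 0 i); exists t; rewrite step.
exists (fun i => t i *: e_ i + P i); split.
  move=> i; apply/norm_le_coordP => // j; rewrite !mxE eqxx/=.
  have qj : `|q' 0 j - q 0 j| <= `|q' - q|.
    by have := norm_coord_le (q' - q) j; rewrite !mxE.
  have [->|ji] := eqVneq j i.
    rewrite ltnn/= mulr1 addrK (le_trans (tP i).1)//.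
    by have := norm_coord_le (q' - q) i; rewrite !mxE.
  rewrite mulr0 add0r; case: ifP => // _; by rewrite subrr normr0.
rewrite -(eq_bigr _ (fun i _ => (tP i).2)) (_ : q' = P n.+1); last first.
  by apply/rowP => j; rewrite mxE ltn_ord.
rewrite [in LHS](_ : q = P 0%N); last by apply/rowP => j; rewrite mxE.
by rewrite -(big_mkord xpredT (fun i => F (P i.+1) - F (P i))) telescope_sumr.
Qed.

Lemma mvt_coord_le (F : E -> R) (M : R) (q q' : E) :
  (forall x i, derivable F x (e_ i)) ->
  (forall x i, `|x - q| <= `|q' - q| -> `|partial i F x| <= M) ->
  `|F q' - F q| <= n.+1%:R * M * `|q' - q|.
Proof.
move=> dF FM; have [xi [xiq ->]] := mvt_coord q q' dF.
apply: (le_trans (ler_norm_sum _ _ _)).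
apply: (@le_trans _ _ (\sum_(i < n.+1) M * `|q' - q|)).
  apply: ler_sum => i _; rewrite normrM mulrC ler_pM// ?FM//.
  by have := norm_coord_le (q' - q) i; rewrite !mxE.
by rewrite sumr_const card_ord -mulrA mulr_natl.
Qed.

Lemma bounded_of_support (f : E -> R) (r : R) : continuous f ->
  (forall x, r < `|x| -> f x = 0) -> exists2 M, 0 < M & forall x, `|f x| <= M.
Proof.
move=> cf f0.
have cK : compact [set x : E | `|x| <= r].
  apply: bounded_closed_compact.
    exists r; split; first exact: num_real.
    by move=> s rs x /= xr; rewrite (le_trans xr)// ltW.
  rewrite [X in closed X](_ : _ = (fun x : E => `|x|) @^-1` `]-oo, r]%classic).
    by apply: closed_comp => [x _|]; [exact: norm_continuous|exact: interval_closed].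
  by apply/seteqP; split=> x /=; rewrite in_itv.
have [M [_ MP]] : bounded_set (f @` [set x : E | `|x| <= r]).
  apply: compact_bounded; apply: continuous_compact => //.
  exact: continuous_subspaceT.
exists (`|M| + 1); first by rewrite ltr_wpDl.
move=> x; have [xr|xr] := ltP r `|x|; first by rewrite f0// normr0 addr_ge0.
apply: (MP (`|M| + 1)); last by exists x.
by rewrite (le_lt_trans (ler_norm M))// ltrDl.
Qed.

(** The strict inequality describes an open set on which [f] vanishes, so its derivatives vanish
    there too. *)
Lemma partial_support (f : E -> R) (r : R) i :
  (forall x, r < `|x| -> f x = 0) -> forall x, r < `|x| -> partial i f x = 0.
Proof.
move=> f0 x rx; rewrite /partial (@near_eq_derive _ _ _ f (cst 0)) ?derive_cst//.
near=> y; apply: f0; near: y.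
have : nbhs x ((fun y : E => `|y|) @^-1` `]r, +oo[%classic).
  apply: open_nbhs_nbhs; split; last by rewrite /= in_itv/= andbT.
  by apply: open_comp => [y _|]; [exact: norm_continuous|exact: interval_open].
by apply: filterS => y; rewrite /= in_itv/= andbT.
Unshelve. all: by end_near. Qed.

End smooth.

(** * Regularity of integrals against a translated smooth kernel *)

Section correlation.
Context (R : realType) (n : nat).
Local Notation E := 'rV[R]_n.+1.
Local Notation B := (borel_space R n).
Local Notation e_ i := (delta_mx 0 i : E).

Definition smooth_in (r : R) (phi : E -> R) :=
  smooth phi /\ forall x, r < `|x| -> phi x = 0.

Lemma smooth_in_partial r phi i : smooth_in r phi -> smooth_in r (partial i phi).
Proof. by move=> [Sp p0]; split; [exact: smooth_partial|exact: partial_support]. Qed.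

Lemma smooth_in_bounded r phi : smooth_in r phi ->
  exists2 M, 0 < M & forall x, `|phi x| <= M.
Proof.
by move=> [Sp p0]; apply: (@bounded_of_support _ _ _ r) => //; exact: smooth_continuous.
Qed.

Lemma smooth_in_partial_bounded r phi : smooth_in r phi ->
  exists2 M, 0 < M & forall i x, `|partial i phi x| <= M.
Proof.
move=> Sp; have /choice[M MP] : forall i, exists M, 0 < M /\ forall x, `|partial i phi x| <= M.
  by move=> i; have [M M0 MP] := smooth_in_bounded (smooth_in_partial i Sp); exists M.
exists (\sum_i M i); first by rewrite big_ord_recl ltr_wpDr ?sumr_ge0// => [i _|]; [rewrite ltW//|]; exact: (MP _).1.
move=> i x; rewrite (le_trans ((MP i).2 x))// (bigD1 i)//= lerDl.
by apply: sumr_ge0 => j _; rewrite ltW// (MP j).1.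
Qed.

Lemma smooth_in_lipschitz r phi : smooth_in r phi ->
  exists2 M, 0 < M & forall x y, `|phi x - phi y| <= M * `|x - y|.
Proof.
move=> Sp; have [M M0 MP] := smooth_in_partial_bounded Sp.
exists (n.+1%:R * M); first by rewrite mulr_gt0// ltr0n.
move=> x y; apply: mvt_coord_le => [z i|z i _]; last exact: MP.
by apply: smooth_derivable; exact: Sp.1.
Qed.

Lemma measurable_smooth phi : smooth phi -> measurable_fun [set: B] (phi : B -> R).
Proof. by move=> Sp; apply: continuous_measurable_borel; exact: smooth_continuous. Qed.

(** A correlation rather than a convolution: the kernel is not reflected. For the even mollification
    kernel the two agree. *)
Definition corr (phi f : E -> R) (u : E) : R :=
  \int[@lebB R n]_y (phi ((y : E) - u) * f y).

Definition L1 (f : E -> R) := (@lebB R n).-integrable setT (EFin \o f).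

Lemma L1_measurable f : L1 f -> measurable_fun [set: B] (f : B -> R).
Proof. by move=> /integrableP[/measurable_EFinP]. Qed.

Lemma measurable_shift_fun (f : E -> R) (v : E) : measurable_fun [set: B] (f : B -> R) ->
  measurable_fun [set: B] ((fun y : E => f (y + v)) : B -> R).
Proof.
move=> mf; rewrite (_ : (fun y : E => f (y + v)) = f \o (fun y : E => 1 *: y + v)).
  exact: (measurableT_comp mf (measurable_affine 1 v)).
by apply/funext => y /=; rewrite scale1r.
Qed.

Lemma integrable_boundedM (phi f : E -> R) (M : R) :
  measurable_fun [set: B] (phi : B -> R) -> (forall x, `|phi x| <= M) ->
  L1 f -> L1 (fun y => phi y * f y).
Proof.
move=> mp pM intf; have mf := L1_measurable intf.
apply: (@le_integrable _ B R (@lebB R n) setT measurableT _ (fun y => M%:E * (EFin \o f) y)%E).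
- by apply/measurable_EFinP; exact: measurable_funM.
- move=> y _ /=; rewrite !normrM lee_fin ler_wpM2r//.
  by rewrite (le_trans (pM y))// ler_norm.
- exact: integrableZl.
Qed.

Lemma integrable_corr (phi f : E -> R) (M : R) u :
  measurable_fun [set: B] (phi : B -> R) -> (forall x, `|phi x| <= M) ->
  L1 f -> L1 (fun y => phi (y - u) * f y).
Proof.
move=> mp pM; apply: integrable_boundedM; first exact: measurable_shift_fun.
by move=> x; exact: pM.
Qed.

Lemma le_norm_corr (phi f : E -> R) (M : R) u :
  measurable_fun [set: B] (phi : B -> R) -> (forall x, `|phi x| <= M) ->
  L1 f -> (`|corr phi f u|%:E <= \int[@lebB R n]_y `|phi ((y : E) - u) * f y|%:E)%E.
Proof.
move=> mp pM intf; have intp := integrable_corr u mp pM intf.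
have /= := @EFin_normr_Rintegral _ B R (@lebB R n) setT _ measurableT intp.
rewrite /corr => ->; apply: (le_trans (le_abse_integral _ _ _)) => //.
exact: measurable_int intp.
Qed.

(** Differentiation under the integral along the line through [u], with dominating function M|f|.
    The minus sign arises because [u] is subtracted in the kernel. *)
Lemma corr_is_derive r phi f u i : smooth_in r phi -> L1 f ->
  is_derive u (e_ i) (corr phi f) (- corr (partial i phi) f u).
Proof.
move=> Sp intf; have mp := measurable_smooth Sp.1.
have [M0 _ bM0] := smooth_in_bounded Sp.
have [M M_0 bM] := smooth_in_partial_bounded Sp.
pose F (s : R) (y : E) : R := phi (y - (s *: e_ i + u)) * f y.
have dF (s : R) (y : E) : is_derive s 1 (F ^~ y) (- partial i phi (y - (s *: e_ i + u)) * f y).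
  have dphi : is_derive s 1 (fun s : R => phi (y - (s *: e_ i + u)))
      (- partial i phi (y - (s *: e_ i + u))).
    pose g (t : R) := phi (t *: e_ i + (y - u)).
    have sg : - s *: e_ i + (y - u) = y - (s *: e_ i + u) by rewrite scaleNr addrCA -opprD.
    have dg : is_derive (- s) 1 g (partial i phi (y - (s *: e_ i + u))).
      by apply/is_derive_line; rewrite sg; apply: smooth_is_derive; exact: Sp.1.
    have := @is_derive1_comp R g (fun s : R => - s) s _ _ dg (is_deriveNid _ _).
    rewrite mulrN1; congr (is_derive _ _ _ _); apply/funext => t /=.
    by rewrite /g scaleNr addrCA -opprD.
  have dM := @is_deriveM R R^o (fun s : R => phi (y - (s *: e_ i + u))) (cst (f y)) s 1 _ _ dphi
    (is_derive_cst _ _ _).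
  apply: (@is_derive_eq R R^o R^o _ _ _ _ _ dM).
  by rewrite scaler0 add0r /GRing.scale/= mulrC.
have I0 : [set` `](-1 : R), 1[] (0 : R) by rewrite /= in_itv/= ltrN10 ltr01.
have intF (s : R) : [set` `](-1 : R), 1[] s -> (@lebB R n).-integrable setT (EFin \o F s).
  by move=> _; exact: (integrable_corr _ mp bM0).
have derF (s : R) (y : B) : [set` `](-1 : R), 1[] s -> setT y -> derivable (F ^~ y) s 1.
  by move=> _ _; have [] := dF s y.
have d1F (s : R) (y : E) : partial1of2 F s y = - partial i phi (y - (s *: e_ i + u)) * f y.
  by rewrite partial1of2E; have [_ ->] := dF s y.
have intG : (@lebB R n).-integrable setT (EFin \o (fun y : E => M * `|f y|)).
  have := @integrableZl _ B R (@lebB R n) setT measurableT M _ (integrable_abse intf).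
  by apply: eq_integrable.
have G0 (y : B) : 0 <= M * `|f y| by rewrite mulr_ge0// ltW.
have Gub (s : R) (y : B) : [set` `](-1 : R), 1[] s -> setT y -> `|partial1of2 F s y| <= M * `|f y|.
  by move=> _ _; rewrite d1F normrM normrN ler_wpM2r.
have der := @derivable_under_integral R _ B (@lebB R n) F setT measurableT 0 (-1) 1 I0 intF derF
  _ G0 intG Gub.
have val := @differentiation_under_integral R _ B (@lebB R n) F setT measurableT 0 (-1) 1 I0 intF derF
  _ G0 intG Gub.
rewrite [X in is_derive X](_ : u = 0 *: e_ i + u); last by rewrite scale0r add0r.
apply/is_derive_line; split; first exact: der.
rewrite -derive1E [LHS]val /corr -mulN1r -RintegralZl//.
  by apply: eq_Rintegral => y _; rewrite d1F scale0r add0r mulN1r mulNr.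
apply: (integrable_corr _ (M := M)) => //.
exact: measurable_smooth (smooth_partial _ Sp.1).
Qed.

Lemma corr_lipschitz r phi f : smooth_in r phi -> L1 f ->
  exists2 M, 0 <= M & forall u u', `|corr phi f u - corr phi f u'| <= M * `|u - u'|.
Proof.
move=> Sp intf; have mp := measurable_smooth Sp.1.
have [M0 _ bM0] := smooth_in_bounded Sp.
have [M M_0 lip] := smooth_in_lipschitz Sp.
have intfa : L1 (fun y => `|f y|) by exact: integrable_abse intf.
exists (M * \int[@lebB R n]_y `|f y|).
  by rewrite mulr_ge0 ?(ltW M_0)// Rintegral_ge0.
move=> u u'; rewrite /corr -RintegralB//; last 2 first.
  exact: (integrable_corr _ mp bM0).
  exact: (integrable_corr _ mp bM0).
have intd : L1 (fun y => phi (y - u) * f y - phi (y - u') * f y).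
  apply: (integrableB measurableT (integrable_corr u mp bM0 intf) (integrable_corr u' mp bM0 intf)).
apply: (le_trans (le_normr_Rintegral _ _)) => //.
rewrite mulrAC -RintegralZl//.
apply: le_Rintegral => //.
- exact: integrable_abse intd.
- exact: (integrableZl measurableT _ intfa).
move=> y _; rewrite -mulrBl normrM ler_wpM2r// (le_trans (lip _ _))//.
by rewrite opprD addrACA subrr add0r opprK addrC distrC.
Qed.

Lemma lipschitz_continuous (f : E -> R) M :
  (forall x y, `|f x - f y| <= M * `|x - y|) -> continuous f.
Proof.
move=> lip; suff H (x : E) : f y @[y --> x] --> f x by exact: H.
apply/(@cvgrPdist_le _ _ _ (nbhs x) (nbhs_filter x) f (f x)) => e e0.
have M0 : 0 < `|M| + 1 by rewrite ltr_wpDl.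
near=> y; apply: (le_trans (lip x y)).
apply: (@le_trans _ _ ((`|M| + 1) * `|x - y|)).
  by rewrite ler_wpM2r// (le_trans (ler_norm M))// lerDl.
rewrite mulrC -ler_pdivlMr//; near: y.
apply: (@cvgr_dist_le _ _ _ (nbhs x) _ id x) => //.
by rewrite divr_gt0.
Unshelve. all: by end_near. Qed.

Lemma corr_continuous r phi f : smooth_in r phi -> L1 f -> continuous (corr phi f).
Proof. by move=> Sp intf; have [M _ lip] := corr_lipschitz Sp intf; exact: lipschitz_continuous lip. Qed.

End correlation.

(** * The mollification kernel and its elementary bounds *)

Section mollifier.
Context (R : realType) (n : nat).
Local Notation E := 'rV[R]_n.+1.
Local Notation B := (borel_space R n).
Local Notation mu := (@lebB R n).
Local Notation e_ i := (delta_mx 0 i : E).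
Implicit Types (f g : E -> R) (d : R).

Lemma measurable_vsub (disp : measure_display) (T : measurableType disp) (f g : T -> E) :
  measurable_fun setT (f : T -> B) -> measurable_fun setT (g : T -> B) ->
  measurable_fun setT ((fun t => f t - g t) : T -> B).
Proof.
move=> mf mg; apply: measurable_to_borel => i; under eq_fun do rewrite !mxE.
by apply: measurable_funB; apply: (measurableT_comp (@measurable_coord R n i)).
Qed.

Lemma measurable_vadd (disp : measure_display) (T : measurableType disp) (f g : T -> E) :
  measurable_fun setT (f : T -> B) -> measurable_fun setT (g : T -> B) ->
  measurable_fun setT ((fun t => f t + g t) : T -> B).
Proof.
move=> mf mg; apply: measurable_to_borel => i; under eq_fun do rewrite !mxE.
by apply: measurable_funD; apply: (measurableT_comp (@measurable_coord R n i)).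
Qed.

Lemma measurable_raw_bump : measurable_fun [set: B] (@raw_bump R n : B -> R).
Proof. exact: measurable_smooth (smooth_raw_bump _ _). Qed.

Definition bump_mass : R := fine (\int[mu]_x (raw_bump (x : E))%:E)%E.

(** The mass is finite since the bump is at most the indicator of the unit cube, and positive since
    the bump is positive on that cube, which has positive measure. *)
Lemma bump_massE : (\int[mu]_x (raw_bump (x : E))%:E = bump_mass%:E)%E /\ 0 < bump_mass.
Proof.
have m0 : (0 <= \int[mu]_x (raw_bump (x : E))%:E)%E.
  by apply: integral_ge0 => x _; rewrite lee_fin raw_bump_ge0.
have mr : measurable_fun [set: B] (fun x : B => (raw_bump (x : E))%:E).
  by apply/measurable_EFinP; exact: measurable_raw_bump.
have fin : (\int[mu]_x (raw_bump (x : E))%:E < +oo)%E.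
  apply: (@le_lt_trans _ _ (\int[mu]_x (\1_[set y : E | `|y - 0| < 1] x)%:E)%E).
    apply: ge0_le_integral => //.
    - by move=> x _; rewrite lee_fin raw_bump_ge0.
    - by apply/measurable_EFinP; apply: measurable_indic; exact: measurable_norm_lt.
    move=> x _; rewrite lee_fin indicE; case: (ltP `|x : E| 1) => x1.
      by rewrite mem_set/= ?subr0// raw_bump_le1.
    by rewrite raw_bump_eq0.
  rewrite integral_indic ?setIT; last exact: measurable_norm_lt.
    by apply: (le_lt_trans (lebB_cube_le _ _)); rewrite ?ltry.
  exact: measurableT.
have pos : (0 < \int[mu]_x (raw_bump (x : E))%:E)%E.
  rewrite lt_neqAle m0 andbT eq_sym; apply/eqP => int0.
  have := @ae_eq_integral_abs _ B R mu setT measurableT (fun x : B => (raw_bump (x : E))%:E) mr.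
  case=> + _; rewrite (_ : integral _ _ _ = 0%E); last first.
    by rewrite -[RHS]int0; apply: eq_integral => x _; rewrite gee0_abs// lee_fin raw_bump_ge0.
  move=> /(_ erefl)[N [mN N0 sub]].
  have : (mu [set y : E | (`|y - 0| < 1)%R] <= mu N)%E.
    apply: le_measure; rewrite ?inE//; first exact: measurable_norm_lt.
    move=> y /=; rewrite subr0 => y1; apply: sub => /= /(_ I) [] /eqP.
    by rewrite gt_eqF// raw_bump_gt0.
  rewrite N0; apply/negP; rewrite -ltNge.
  by apply: (lt_le_trans _ (lebB_cube_ge _ _)) => //; rewrite lte_fin expr1n.
rewrite /bump_mass fineK; last by rewrite ge0_fin_numE.
by split=> //; apply: fine_gt0; rewrite pos fin.
Qed.

Definition moll_kernel d (w : E) : R :=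
  (bump_mass^-1 * d ^- n.+1) * raw_bump (d^-1 *: w).

Lemma moll_kernel_ge0 d w : 0 < d -> 0 <= moll_kernel d w.
Proof.
move=> d0; rewrite mulr_ge0 ?raw_bump_ge0// mulr_ge0// invr_ge0 ?exprn_ge0 ?ltW//.
exact: bump_massE.2.
Qed.

Lemma moll_kernel_le d w : 0 < d -> moll_kernel d w <= bump_mass^-1 * d ^- n.+1.
Proof.
move=> d0; rewrite ler_piMr ?raw_bump_le1// mulr_ge0// invr_ge0 ?exprn_ge0 ?ltW//.
exact: bump_massE.2.
Qed.

Lemma moll_kernel_norm_le d w : 0 < d -> `|moll_kernel d w| <= bump_mass^-1 * d ^- n.+1.
Proof. by move=> d0; rewrite ger0_norm ?moll_kernel_ge0// moll_kernel_le. Qed.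

Lemma moll_kernel_eq0 d w : 0 < d -> d <= `|w| -> moll_kernel d w = 0.
Proof.
move=> d0 dw; rewrite /moll_kernel raw_bump_eq0 ?mulr0//.
by rewrite normrZ ger0_norm ?invr_ge0 ?(ltW d0)// ler_pdivlMl// mulr1.
Qed.

Lemma smooth_moll_kernel d : 0 < d -> smooth_in d (moll_kernel d).
Proof.
move=> d0; split; last by move=> x dx; rewrite moll_kernel_eq0// ltW.
apply: smoothM; first exact: smooth_cst.
rewrite (_ : (fun x => _) = (fun x : E => raw_bump (d^-1 *: x + 0))).
  exact: smooth_affine (smooth_raw_bump _ _).
by apply/funext => x; rewrite addr0.
Qed.

Lemma measurable_moll_kernel d : 0 < d -> measurable_fun [set: B] (moll_kernel d : B -> R).
Proof. by move=> d0; apply: measurable_smooth; exact: (smooth_moll_kernel d0).1. Qed.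

Lemma moll_kernelN d w : moll_kernel d (- w) = moll_kernel d w.
Proof.
rewrite /moll_kernel; congr (_ * _); rewrite scalerN; move: (d^-1 *: w) => {w}w.
rewrite /raw_bump; apply: eq_bigr => i _; rewrite !mxE.
by rewrite mulrC; congr (flat 0 _ * flat 0 _); lra.
Qed.

Lemma integral_moll_kernel d u : 0 < d ->
  (\int[mu]_y (moll_kernel d ((y : E) - u))%:E = 1)%E.
Proof.
move=> d0; have [massE m0] := bump_massE.
have di0 : 0 < d^-1 by rewrite invr_gt0.
have mr : measurable_fun [set: B] (fun x : E => (raw_bump x)%:E : \bar R).
  by apply/measurable_EFinP; exact: measurable_raw_bump.
have r0 (x : E) : (0 <= (raw_bump x)%:E :> \bar R)%E by rewrite lee_fin raw_bump_ge0.
have mk : measurable_fun [set: B] (fun x : E => (moll_kernel d x)%:E : \bar R).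
  by apply/measurable_EFinP; exact: measurable_moll_kernel.
have := @ge0_integral_shift R n (- u) (fun w : E => (moll_kernel d w)%:E) mk.
move=> ->; last by move=> w; rewrite lee_fin moll_kernel_ge0.
rewrite /moll_kernel; under eq_integral do rewrite EFinM.
have c0 : 0 <= bump_mass^-1 * d ^- n.+1.
  by rewrite mulr_ge0// invr_ge0 ?exprn_ge0 ?ltW.
have := @ge0_integral_affine R n d^-1 0 (fun w : E => (raw_bump w)%:E) di0 mr r0.
rewrite massE => h0.
have h : (\int[mu]_x (raw_bump (d^-1 *: (x : E)))%:E = (d^-1 ^- n.+1)%:E * bump_mass%:E)%E.
  by rewrite -h0; apply: eq_integral => x _; rewrite addr0.
rewrite ge0_integralZl//; last first.
  apply/measurable_EFinP; rewrite (_ : (fun x => _) = (fun x : E => raw_bump (d^-1 *: x + 0))).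
    exact: measurable_smooth (smooth_affine _ _ (smooth_raw_bump _ _)).
  by apply/funext => x; rewrite addr0.
rewrite h -!EFinM; congr EFin; rewrite exprVn invrK.
by rewrite [X in _ * X]mulrC mulrACA mulVf ?gt_eqF// mul1r mulVf// gt_eqF// exprn_gt0.
Qed.

Lemma integral_moll_kernel_sym d y : 0 < d ->
  (\int[mu]_u (moll_kernel d (y - (u : E)))%:E = 1)%E.
Proof.
move=> d0; rewrite -(integral_moll_kernel y d0); apply: eq_integral => u _.
by rewrite -moll_kernelN opprB.
Qed.

Definition moll d f : E -> R := corr (moll_kernel d) f.

Lemma integrable_moll d f u : 0 < d -> L1 f ->
  L1 (fun y => moll_kernel d (y - u) * f y).
Proof.
move=> d0; apply: integrable_corr; first exact: measurable_moll_kernel.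
by move=> x; exact: moll_kernel_norm_le.
Qed.

Lemma moll_continuous d f : 0 < d -> L1 f -> continuous (moll d f).
Proof. by move=> d0; apply: corr_continuous; exact: smooth_moll_kernel. Qed.

Lemma moll_derivable d f i u : 0 < d -> L1 f -> derivable (moll d f) u (e_ i).
Proof. by move=> d0 L1f; have [] := corr_is_derive u i (smooth_moll_kernel d0) L1f. Qed.

Lemma partial_moll_continuous d f i : 0 < d -> L1 f -> continuous (partial i (moll d f)).
Proof.
move=> d0 L1f; have Sk := smooth_moll_kernel d0.
have -> : partial i (moll d f) = fun u => - corr (partial i (moll_kernel d)) f u.
  apply/funext => u; have dc := corr_is_derive u i Sk L1f.
  by rewrite /partial /moll derive_val.
by move=> u; exact: (cvgN (corr_continuous (smooth_in_partial i Sk) L1f (x:=u))).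
Qed.

Lemma measurable_partial_moll d f i : 0 < d -> L1 f ->
  measurable_fun [set: B] (partial i (moll d f) : B -> R).
Proof. by move=> d0 L1f; apply: continuous_measurable_borel; exact: partial_moll_continuous. Qed.

Lemma measurable_moll d f : 0 < d -> L1 f -> measurable_fun [set: B] (moll d f : B -> R).
Proof. by move=> d0 L1f; apply: continuous_measurable_borel; exact: moll_continuous. Qed.

Lemma le_norm_moll d f u : 0 < d -> L1 f ->
  (`|moll d f u|%:E <= \int[mu]_y (moll_kernel d ((y : E) - u) * `|f y|)%:E)%E.
Proof.
move=> d0 L1f; have := @le_norm_corr R n (moll_kernel d) f _ u (measurable_moll_kernel d0)
   (fun x => moll_kernel_norm_le x d0) L1f.
move=> /le_trans; apply; rewrite le_eqVlt; apply/orP; left; apply/eqP.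
by apply: eq_integral => y _; rewrite normrM ger0_norm// moll_kernel_ge0.
Qed.

Lemma moll_le_average d f u : 0 < d -> L1 f ->
  (`|moll d f u|%:E <= (bump_mass^-1 * d ^- n.+1)%:E *
     \int[mu]_(y in [set y : E | (`|y - u| < d)%R]) `|f y|%:E)%E.
Proof.
move=> d0 L1f; apply: (le_trans (le_norm_moll u d0 L1f)).
have mQ := @measurable_norm_lt R n u d.
have mf := L1_measurable L1f.
have mfa : measurable_fun setT (fun y : B => `|f y|%:E).
  by apply/measurable_EFinP; exact: measurableT_comp.
have c0 : 0 <= bump_mass^-1 * d ^- n.+1.
  by rewrite mulr_ge0// invr_ge0 ?exprn_ge0 ?ltW// bump_massE.2.
rewrite -ge0_integralZl//; last exact: measurable_funTS.
rewrite [leRHS]integral_mkcond; apply: ge0_le_integral => //.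
- by move=> y _; rewrite lee_fin mulr_ge0 ?moll_kernel_ge0.
- apply/measurable_EFinP; apply: measurable_funM; last exact: measurableT_comp.
  exact: measurable_shift_fun (measurable_moll_kernel d0).
- by apply: measurable_patch => //; apply: measurable_funeM; exact: measurable_funTS.
move=> y _; rewrite patchE; case: ifPn => [_|].
  by rewrite -EFinM lee_fin ler_wpM2r// moll_kernel_le.
rewrite notin_setE/= => /negP; rewrite -leNgt => dy.
by rewrite moll_kernel_eq0// mul0r.
Qed.

(** By Tonelli's theorem and the unit mass of the kernel in the variable [u]. This contraction
    property is what makes density arguments work. *)
Lemma integral_norm_moll d f : 0 < d -> L1 f ->
  (\int[mu]_u `|moll d f u|%:E <= \int[mu]_y `|f y|%:E)%E.
Proof.
move=> d0 L1f; have mf := L1_measurable L1f.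
have mk := measurable_moll_kernel d0.
pose F (u y : E) : \bar R := (moll_kernel d (y - u) * `|f y|)%:E.
have F0 u y : (0 <= F u y)%E by rewrite lee_fin mulr_ge0 ?moll_kernel_ge0.
have mF : measurable_fun setT (fun p : B * B => F p.1 p.2).
  apply/measurable_EFinP; apply: measurable_funM.
    by apply: (measurableT_comp mk); apply: measurable_vsub.
  by apply: measurableT_comp => //; exact: measurableT_comp.
apply: (@le_trans _ _ (\int[mu]_u \int[mu]_y F (u : E) (y : E))%E).
  apply: ge0_le_integral => //.
  - apply/measurable_EFinP; apply: measurableT_comp => //; exact: measurable_moll.
  - exact: (measurable_integral2 mu mF F0).
  - by move=> u _; exact: le_norm_moll.
rewrite (integral_swap mu mu mF F0); apply: ge0_le_integral => //.
- by move=> y _; exact: integral_ge0.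
- exact: (measurable_integral1 mu mF F0).
- by apply/measurable_EFinP; exact: measurableT_comp.
move=> y _; rewrite /F; under eq_integral do rewrite EFinM.
rewrite ge0_integralZr//.
- by rewrite integral_moll_kernel_sym// mul1e.
- apply/measurable_EFinP; apply: (measurableT_comp mk).
  by apply: measurable_vsub => //; exact: measurable_cst.
- by move=> u _; rewrite lee_fin moll_kernel_ge0.
Qed.

Lemma L1_moll d f : 0 < d -> L1 f -> L1 (moll d f).
Proof.
move=> d0 L1f; apply/integrableP; split.
  by apply/measurable_EFinP; exact: measurable_moll.
apply: (le_lt_trans (integral_norm_moll d0 L1f)).
by have /integrableP[_] := L1f.
Qed.

Lemma L1B f g : L1 f -> L1 g -> L1 (fun x => f x - g x).
Proof. by move=> L1f L1g; have := integrableB measurableT L1f L1g. Qed.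

Lemma L1D f g : L1 f -> L1 g -> L1 (fun x => f x + g x).
Proof. by move=> L1f L1g; have := integrableD measurableT L1f L1g. Qed.

Lemma L1Z (c : R) f : L1 f -> L1 (fun x => c * f x).
Proof. by move=> L1f; have := integrableZl measurableT c L1f. Qed.

Lemma mollB d f g u : 0 < d -> L1 f -> L1 g ->
  moll d (fun x => f x - g x) u = moll d f u - moll d g u.
Proof.
move=> d0 L1f L1g; rewrite /moll /corr -RintegralB//; last 2 first.
- exact: integrable_moll.
- exact: integrable_moll.
by apply: eq_Rintegral => y _; rewrite mulrBr.
Qed.

Lemma mollZ d c f u : 0 < d -> L1 f -> moll d (fun x => c * f x) u = c * moll d f u.
Proof.
move=> d0 L1f; rewrite /moll /corr -RintegralZl//; last exact: integrable_moll.
by apply: eq_Rintegral => y _; rewrite mulrCA.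
Qed.

Lemma mollD d f g u : 0 < d -> L1 f -> L1 g ->
  moll d (fun x => f x + g x) u = moll d f u + moll d g u.
Proof.
move=> d0 L1f L1g; rewrite /moll /corr -RintegralD//; last 2 first.
- exact: integrable_moll.
- exact: integrable_moll.
by apply: eq_Rintegral => y _; rewrite mulrDr.
Qed.

End mollifier.

(** * Convergence of mollifications in L1 *)

Section mollifier_limit.
Import HBSimple.
Context (R : realType) (n : nat).
Local Notation E := 'rV[R]_n.+1.
Local Notation B := (borel_space R n).
Local Notation mu := (@lebB R n).
Implicit Types (f g : E -> R).

Definition L1dist f g : \bar R := (\int[mu]_x `|f x - g x|%:E)%E.

Lemma measurable_L1dist f g : L1 f -> L1 g ->
  measurable_fun [set: B] (fun x : B => `|f x - g x|%:E).
Proof.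
move=> L1f L1g; apply/measurable_EFinP; apply: measurableT_comp => //.
by apply: measurable_funB; exact: L1_measurable.
Qed.

Lemma L1dist_triangle g f h : L1 f -> L1 g -> L1 h ->
  (L1dist f h <= L1dist f g + L1dist g h)%E.
Proof.
move=> L1f L1g L1h; rewrite /L1dist -ge0_integralD//.
- apply: ge0_le_integral => //.
  + exact: measurable_L1dist.
  + by apply: emeasurable_funD; exact: measurable_L1dist.
  by move=> x _; rewrite -EFinD lee_fin -[leLHS]/(`|f x - h x|) ler_distD.
- exact: measurable_L1dist.
- exact: measurable_L1dist.
Qed.

Lemma L1dist_moll d f g : 0 < d -> L1 f -> L1 g ->
  (L1dist (moll d f) (moll d g) <= L1dist f g)%E.
Proof.
move=> d0 L1f L1g; rewrite /L1dist.
under eq_integral do rewrite -mollB//.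
by apply: integral_norm_moll => //; exact: L1B.
Qed.

Variable d : nat -> R.
Hypothesis d_gt0 : forall k, 0 < d k.
Hypothesis d_cvg0 : d k @[k --> \oo] --> (0 : R).

Let moll_conv f := L1 f /\ forall e : R, 0 < e -> exists N, forall k, (N <= k)%N ->
  (L1dist (moll (d k) f) f <= e%:E)%E.

(** As mollification contracts L1, the functions for which it converges form a closed set; the error
    is split into thirds. *)
Let moll_conv_closed f : L1 f ->
  (forall e : R, 0 < e -> exists2 g, moll_conv g & (L1dist f g <= e%:E)%E) ->
  moll_conv f.
Proof.
move=> L1f H; split=> // e e0; have e3 : 0 < e / 3 by rewrite divr_gt0.
have [g [L1g /(_ _ e3)[N NP]] fg] := H _ e3.
exists N => k /NP gk; have L1mf := L1_moll (d_gt0 k) L1f; have L1mg := L1_moll (d_gt0 k) L1g.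
apply: (le_trans (L1dist_triangle L1mf L1mg L1f)).
rewrite (_ : e = e / 3 + (e / 3 + e / 3)); last by lra.
rewrite EFinD; apply: leeD; first exact: (le_trans (L1dist_moll _ _ _)).
apply: (le_trans (L1dist_triangle L1mg L1g L1f)); rewrite EFinD; apply: leeD => //.
by rewrite /L1dist; under eq_integral do rewrite distrC.
Qed.

Let moll_convZ c f : moll_conv f -> moll_conv (fun x => c * f x).
Proof.
move=> [L1f H]; split; first exact: L1Z.
move=> e e0; have c0 : 0 < `|c| + 1 by rewrite ltr_wpDl.
have [|N NP] := H (e / (`|c| + 1)); first by rewrite divr_gt0.
exists N => k /NP gk; rewrite /L1dist.
under eq_integral do rewrite mollZ// -mulrBr normrM EFinM.
rewrite ge0_integralZl//; last by apply: measurable_L1dist => //; exact: L1_moll.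
apply: (@le_trans _ _ ((`|c| + 1)%:E * (e / (`|c| + 1))%:E)%E).
  by apply: lee_pmul => //; [exact: integral_ge0|rewrite lee_fin lerDl].
by rewrite -EFinM mulrCA divff ?mulr1 ?gt_eqF.
Qed.

Let moll_convD f g : moll_conv f -> moll_conv g -> moll_conv (fun x => f x + g x).
Proof.
move=> [L1f Hf] [L1g Hg]; split; first exact: L1D.
move=> e e0; have e2 : 0 < e / 2 by rewrite divr_gt0.
have [N1 N1P] := Hf _ e2; have [N2 N2P] := Hg _ e2.
exists (maxn N1 N2) => k; rewrite geq_max => /andP[/N1P fk /N2P gk].
rewrite [e]splitr EFinD; apply: le_trans (leeD fk gk); rewrite /L1dist.
have L1mf := L1_moll (d_gt0 k) L1f; have L1mg := L1_moll (d_gt0 k) L1g.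
rewrite -ge0_integralD//; [|exact: measurable_L1dist..].
apply: ge0_le_integral => //.
- by apply: measurable_L1dist; [apply: L1_moll|]; rewrite ?d_gt0//; apply: L1D.
- by apply: emeasurable_funD; exact: measurable_L1dist.
move=> x _; rewrite -EFinD lee_fin mollD// opprD addrACA.
exact: ler_normD.
Qed.

Let L1_indic (A : set E) : measurable (A : set B) -> (mu A < +oo)%E -> L1 (\1_A).
Proof. move=> mA fA; apply/integrableP; split; first by apply/measurable_EFinP; exact: measurable_indic.
rewrite (_ : integral _ _ _ = \int[mu]_x (\1_A x)%:E)%E; last first.
  by apply: eq_integral => x _ /=; rewrite ger0_norm// indicE.
by rewrite integral_indic ?setIT. Qed.

(** Scheffe's argument. On [U] the mollified indicator is eventually 1 at each point, and off [U]
    the indicator is 0, so the positive part of their difference tends to 0 under the dominating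
    function [u]. The negative part is controlled because mollification does not increase the
    integral; boundary points thus cause no trouble. *)
Let moll_conv_open (U : set E) : open U -> (mu U < +oo)%E -> moll_conv (\1_U).
Proof.
move=> oU fU; have mU := measurable_open_borel oU.
have L1U : L1 (\1_U) := L1_indic mU fU.
split=> //; pose u : E -> R := \1_U; pose q k (x : E) := Num.max 0 (u x - moll (d k) u x).
have L1m k : L1 (moll (d k) u) by exact: L1_moll.
have mq k : measurable_fun [set: B] (EFin \o q k : B -> \bar R).
  apply/measurable_EFinP; apply: measurable_maxr; first exact: measurable_cst.
  by apply: measurable_funB; exact: L1_measurable.
have m0 k x : 0 <= moll (d k) u x.
  by apply: Rintegral_ge0 => y _; rewrite mulr_ge0 ?moll_kernel_ge0// /u indicE.
have q0 k x : 0 <= q k x by rewrite le_max lexx.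
have qu k x : q k x <= u x.
  by rewrite /q ge_max lerBlDl lerDr m0 /u indicE andbT.
have q_cvg (x : E) : (EFin \o q k) x @[k --> \oo] --> 0%:E.
  have [Ux|Ux] := pselect (U x); last first.
    apply: cvg_near_cst; apply: nearW => k; congr EFin; apply/eqP.
    rewrite eq_le q0 andbT; apply: (le_trans (qu k x)).
    by rewrite /u indicE memNset.
  have /(nbhs_ballP) [e /= e0 eU] : nbhs x U by exact: open_nbhs_nbhs.
  apply: cvg_near_cst; move/cvgrPdist_lt: d_cvg0 => /(_ _ e0).
  apply: filterS => k; rewrite sub0r normrN gtr0_norm// => dk.
  rewrite /= /q (_ : moll _ _ _ = 1) ?/u ?indicE ?mem_set ?subrr ?maxxx//.
  rewrite /moll /corr /Rintegral -[RHS]/(fine (1%:E)) -(integral_moll_kernel x (d_gt0 k)).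
  congr fine; apply: eq_integral => y _; congr EFin; rewrite /u indicE.
  have [yx|yx] := ltP (`|y - x|) (d k); last by rewrite moll_kernel_eq0// mul0r.
  rewrite mem_set ?mulr1//; apply: eU; rewrite -ball_normE/= distrC.
  exact: lt_trans dk.
have dom : {ae mu, forall (x : B) k, setT x -> (`|(EFin \o q k) x| <= (EFin \o u) x)%E}.
  by apply: aeW => x k _; rewrite /= lee_fin ger0_norm.
have ae_cvg : {ae mu, forall x : B, setT x -> (EFin \o q k) x @[k --> \oo] --> 0%:E}.
  by apply: aeW => x _; exact: q_cvg.
have [_ _ /= int_q] := @dominated_convergence _ B R mu setT measurableT
  (fun k => EFin \o q k) (cst 0%E) (EFin \o u) mq (measurable_cst _)
  ae_cvg L1U dom.
move=> e e0.
have {}int_q : (\int[mu]_x (q k x)%:E)%E @[k --> \oo] --> 0%E.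
  by move: int_q; rewrite integral0; apply.
have /fine_cvgP[fq /cvgrPdist_lt/(_ (e / 2))] := int_q.
rewrite divr_gt0// => /(_ isT) cq; have [N _ NP] := (filterI fq cq).
exists N => k /NP[/= fk]; rewrite sub0r normrN ger0_norm; last first.
  by apply: fine_ge0; apply: integral_ge0 => x _; rewrite lee_fin.
move=> qk; rewrite /L1dist.
have fu : (\int[mu]_x (u x)%:E)%E \is a fin_num by exact: integrable_fin_num.
have u0 x : 0 <= u x by rewrite /u indicE.
have le_int : (\int[mu]_x (moll (d k) u x)%:E <= \int[mu]_x (u x)%:E)%E.
  have := integral_norm_moll (d_gt0 k) L1U.
  under eq_integral do rewrite ger0_norm//.
  by under [X in (_ <= X)%E -> _]eq_integral do rewrite ger0_norm//.
have fm : (\int[mu]_x (moll (d k) u x)%:E)%E \is a fin_num.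
  exact: (integrable_fin_num measurableT (L1m k)).
(* With a the mollification and b the indicator: |a - b| + b = a + 2 max(0, b - a). *)
have key : (\int[mu]_x (`|moll (d k) u x - u x|%:E + (u x)%:E) =
            \int[mu]_x ((moll (d k) u x)%:E + 2%:E * (q k x)%:E))%E.
  apply: eq_integral => x _; rewrite -EFinM -!EFinD; congr EFin; rewrite /q.
  have [a0|a0] := leP 0 (u x - moll (d k) u x).
    by rewrite ler0_norm; lra.
  by rewrite gtr0_norm; lra.
have mEu : measurable_fun [set: B] (fun x : B => (u x)%:E).
  by apply/measurable_EFinP; exact: L1_measurable.
have mEm : measurable_fun [set: B] (fun x : B => (moll (d k) u x)%:E).
  by apply/measurable_EFinP; exact: L1_measurable.
have mEq : measurable_fun [set: B] (fun x : B => (2%:E * (q k x)%:E)%E).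
  exact: measurable_funeM (mq k).
have mEd : measurable_fun [set: B] (fun x : B => `|moll (d k) u x - u x|%:E).
  exact: measurable_L1dist.
have q20 (x : B) : [set: B] x -> (0 <= 2%:E * (q k x)%:E)%E.
  by move=> _; rewrite mule_ge0// lee_fin.
rewrite !ge0_integralD// in key; last by move=> x _; rewrite lee_fin.
rewrite ge0_integralZl// in key; last by move=> x _; rewrite lee_fin.
have : (L1dist (moll (d k) u) u + \int[mu]_x (u x)%:E <= e%:E + \int[mu]_x (u x)%:E)%E.
  rewrite /L1dist key addeC; apply: leeD => //.
  rewrite -(fineK fk) -EFinM lee_fin; rewrite ltW//.
  by move: qk; set z := fine _; lra.
by rewrite leeD2rE.
exact: (mq k).
by move=> x _; rewrite lee_fin.
Qed.

Let moll_conv_indic (A : set E) : measurable (A : set B) -> (mu A < +oo)%E ->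
  moll_conv (\1_A).
Proof.
move=> mA fA; apply: moll_conv_closed; first exact: L1_indic.
move=> e e0; have [U [oU AU Ue]] := lebesgue_outer_open A e0.
have fU : (mu U < +oo)%E.
  by apply: (le_lt_trans Ue); rewrite lte_add_pinfty// ltry.
exists (\1_U); first exact: moll_conv_open.
have mU := measurable_open_borel oU.
rewrite /L1dist (_ : integral _ _ _ = \int[mu]_x (\1_(U `\` A) x)%:E)%E; last first.
  apply: eq_integral => x _; congr EFin; rewrite !indicE in_setD.
  have [Ax|Ax] := boolP (x \in A).
    by rewrite (mem_set (AU _ (set_mem Ax))) subrr normr0.
  by rewrite sub0r normrN andbT; case: (x \in U); rewrite ?normr0 ?normr1.
rewrite integral_indic ?setIT//; last exact: measurableD.
rewrite measureD// (setIidr AU).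
by rewrite leeBlDl ?ge0_fin_numE.
Qed.

(** From open sets to Borel sets of finite measure by outer regularity, then to simple functions by
    linearity, and to all of L1 by density. *)
Lemma moll_cvg_L1 f : L1 f -> forall e : R, 0 < e -> exists N, forall k, (N <= k)%N ->
  (\int[mu]_x `|moll (d k) f x - f x|%:E <= e%:E)%E.
Proof.
move=> L1f; suff [] : moll_conv f by [].
apply: moll_conv_closed => // e e0.
have [g_ [intg _ gcvg]] := approximation_sfun_integrable measurableT L1f.
have /fine_cvgP[fg /cvgrPdist_le/(_ _ e0) cg] := gcvg.
have [N _ /(_ N (leqnn N))[/= fgN cgN]] := filterI fg cg.
exists (fun x : E => g_ N (x : B)); last first.
  rewrite /L1dist -(fineK fgN) lee_fin; move: cgN; rewrite sub0r normrN.
  exact/le_trans/ler_norm.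
have : L1 (g_ N) by exact: intg.
move: (g_ N) => {intg gcvg fg cg fgN cgN g_} g L1g.
have zero : moll_conv (cst 0).
  split; first exact: integrable0.
  move=> e' e'0; exists 0%N => k _; rewrite /L1dist integral0_eq ?lee_fin ?ltW// => x _.
  rewrite /moll /corr /Rintegral integral0_eq ?subrr ?normr0// => y _.
  by rewrite /= mulr0.
have [s gE] : exists s : seq R,
    [eta g] = fun x : E => \sum_(r <- s) r * \1_(g @^-1` [set r]) x.
  eexists; apply/funext => x; rewrite [LHS]fimfunE fsbig_finite//.
rewrite [X in moll_conv X]gE => {gE}; elim: s => [|r s IH].
  by rewrite (_ : (fun _ => _) = cst 0)//; apply/funext => x; rewrite big_nil.
rewrite (_ : (fun _ => _) = fun x => r * \1_(g @^-1` [set r]) x +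
    \sum_(r <- s) r * \1_(g @^-1` [set r]) x); last first.
  by apply/funext => x; rewrite big_cons.
apply: moll_convD => //.
(* The level set of the value 0 may have infinite measure, so this term is settled before its
   indicator is considered. *)
have [->|r0] := eqVneq r 0.
  by rewrite (_ : (fun _ => _) = cst 0)//; apply/funext => x; rewrite mul0r.
apply/moll_convZ/moll_conv_indic; first exact: measurable_sfunP.
have mr : measurable (g @^-1` [set r] : set B) by exact: measurable_sfunP.
have : (\int[mu]_x (`|r| * \1_(g @^-1` [set r]) x)%:E < +oo)%E.
  have /integrableP[_] := L1g; apply: le_lt_trans; apply: ge0_le_integral => //.
  - by apply/measurable_EFinP; apply: measurable_funM => //; exact: measurable_indic.
  - by apply: measurableT_comp => //; apply/measurable_EFinP; exact: L1_measurable.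
  move=> x _; rewrite indicE /= lee_fin; case: (boolP (_ \in _)) => [|_].
    by rewrite inE /= => ->; rewrite mulr1.
  by rewrite mulr0.
under eq_integral do rewrite EFinM.
rewrite ge0_integralZl//; last first.
  by apply/measurable_EFinP; exact: measurable_indic.
rewrite integral_indic ?setIT//.
rewrite !ltey; apply: contra => /eqP moo; rewrite [X in (_ * X)%E]moo.
by rewrite mulry gtr0_sg ?normr_gt0// mul1e.
Qed.

End mollifier_limit.

(** * Commuting mollifications, weak derivatives and masses of cubes *)

Section mollifier_calculus.
Context (R : realType) (n : nat).
Local Notation E := 'rV[R]_n.+1.
Local Notation B := (borel_space R n).
Local Notation mu := (@lebB R n).
Local Notation e_ i := (delta_mx 0 i : E).
Implicit Types (f g h : E -> R) (d e : R) (u q : E).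

Lemma integral_shift (v : E) (f : E -> \bar R) :
  measurable_fun [set: B] (f : B -> \bar R) ->
  (\int[mu]_x f ((x : E) + v)%R = \int[mu]_x f x)%E.
Proof.
move=> mf; rewrite integralE [RHS]integralE.
have mp : measurable_fun [set: B] (f^\+%E : B -> \bar R) by exact: measurable_funepos.
have mn : measurable_fun [set: B] (f^\-%E : B -> \bar R) by exact: measurable_funeneg.
have p := ge0_integral_shift v mp (funepos_ge0 _).
have m := ge0_integral_shift v mn (funeneg_ge0 _).
by rewrite -p -m; congr (_ - _)%E; apply: eq_integral => x _; rewrite ?funeposE ?funenegE.
Qed.

Lemma moll_shift d f u : 0 < d -> L1 f ->
  moll d f u = \int[mu]_w (moll_kernel d (w : E) * f (w + u)).
Proof.
move=> d0 L1f; rewrite /moll /corr /Rintegral; congr fine.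
rewrite -(@integral_shift u (fun y => (moll_kernel d (y - u) * f y)%:E)).
  by apply: eq_integral => w _; rewrite addrK.
by apply/measurable_EFinP; exact: L1_measurable (integrable_moll u d0 L1f).
Qed.

Lemma L1_shift f u : L1 f -> L1 (fun w => f (w + u)).
Proof.
move=> L1f; have mf := L1_measurable L1f; apply/integrableP; split.
  by apply/measurable_EFinP; exact: measurable_shift_fun.
have := @ge0_integral_shift R n u (fun y : E => `|f y|%:E) _ (fun x => normr_ge0 _).
move=> /= ->; last by apply/measurable_EFinP; exact: measurableT_comp.
by have /integrableP[] := L1f.
Qed.

Lemma integrable_moll_shift d f u : 0 < d -> L1 f ->
  L1 (fun w => moll_kernel d w * f (w + u)).
Proof.
move=> d0 L1f; apply: (@integrable_boundedM R n _ _ _ (measurable_moll_kernel d0)).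
  by move=> x; exact: moll_kernel_norm_le.
exact: L1_shift.
Qed.

Lemma L1_moll_kernel d : 0 < d -> L1 (@moll_kernel R n d).
Proof.
move=> d0; apply/integrableP; split.
  by apply/measurable_EFinP; exact: measurable_moll_kernel.
rewrite (_ : integral _ _ _ = 1%E) ?ltry//.
rewrite -(integral_moll_kernel (0 : E) d0); apply: eq_integral => y _.
by rewrite subr0 /= ger0_norm// moll_kernel_ge0.
Qed.

Lemma moll_mollE d e f u : 0 < d -> 0 < e -> L1 f ->
  ((moll d (moll e f) u)%:E =
   \int[mu]_w \int[mu]_v (moll_kernel d (w : E) * (moll_kernel e (v : E) * f (v + w + u)))%:E)%E.
Proof.
move=> d0 e0 L1f; rewrite moll_shift//; last exact: L1_moll.
rewrite /Rintegral fineK; last first.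
  apply: integrable_fin_num => //; apply: integrable_moll_shift => //; exact: L1_moll.
apply: eq_integral => w _; rewrite moll_shift// EFinM.
have L1s : L1 (fun v => moll_kernel e v * f (v + (w + u))) by exact: integrable_moll_shift.
rewrite /Rintegral fineK; last exact: integrable_fin_num.
have := integralZl measurableT L1s (moll_kernel d w) => /= <-.
by apply: eq_integral => v _; rewrite -EFinM addrA.
Qed.

(** Both sides are the same double integral. Fubini's theorem applies because one kernel is bounded
    by a constant, the other has mass 1 and [f] is integrable. *)
Lemma moll_comm d e f u : 0 < d -> 0 < e -> L1 f ->
  moll d (moll e f) u = moll e (moll d f) u.
Proof.
move=> d0 e0 L1f; suff h : ((moll d (moll e f) u)%:E = (moll e (moll d f) u)%:E)%E.
  exact: (congr1 (@fine R) h).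
apply: (etrans (moll_mollE u d0 e0 L1f)); apply: esym.
apply: (etrans (moll_mollE u e0 d0 L1f)); apply: esym.
have mf := L1_measurable L1f; have mk := @measurable_moll_kernel R n.
pose F (p : B * B) : \bar R :=
  (moll_kernel d (p.1 : E) * (moll_kernel e (p.2 : E) * f ((p.2 : E) + p.1 + u)))%:E.
have mF : measurable_fun setT F.
  apply/measurable_EFinP; apply: measurable_funM.
    exact: (measurableT_comp (mk d d0)).
  apply: measurable_funM; first exact: (measurableT_comp (mk e e0)).
  apply: (measurableT_comp mf); apply: measurable_vadd; last exact: measurable_cst.
  exact: measurable_vadd.
have iF : (mu \x mu)%E.-integrable setT F.
  apply/(integrable12ltyP mu mu mF).
  have [I If] : exists I : R, (\int[mu]_y `|f y|%:E = I%:E)%E.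
    exists (fine (\int[mu]_y `|f y|%:E)%E); rewrite fineK// ge0_fin_numE ?integral_ge0//.
    by have /integrableP[] := L1f.
  pose c := (bump_mass R n)^-1 * e ^- n.+1.
  have c0 : 0 <= c by rewrite (le_trans _ (moll_kernel_le 0 e0))// moll_kernel_ge0.
  apply: (@le_lt_trans _ _ (\int[mu]_w ((moll_kernel d (w : E))%:E * (c * I)%:E))%E).
    apply: ge0_le_integral => //.
    - by move=> w _; exact: integral_ge0.
    - apply: (@measurable_integral2 _ _ B B R mu (fun w v => `|F (w, v)|%E)).
        rewrite (_ : (fun p : B * B => _) = (fun p => `|F p|%E)); last by apply/funext => -[].
        exact: measurableT_comp.
      by move=> *.
    - under eq_fun do rewrite -EFinM.
      by apply/measurable_EFinP; apply: measurable_funM; [exact: mk|exact: measurable_cst].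
    move=> w _; rewrite /F /=.
    under eq_integral do rewrite normrM (ger0_norm (moll_kernel_ge0 _ d0)) EFinM.
    rewrite ge0_integralZl//; last 2 first.
    - apply/measurable_EFinP/measurableT_comp => //; apply: measurable_funM; first exact: mk.
      rewrite (_ : (fun _ => _) = (fun v => f (v + (w + u)))); last first.
        by apply/funext => v; rewrite addrA.
      exact: measurable_shift_fun.
    - by rewrite lee_fin moll_kernel_ge0.
    rewrite lee_wpmul2l ?lee_fin ?moll_kernel_ge0// EFinM -If.
    have mfa : measurable_fun setT (fun y : B => `|f y|%:E).
      by apply/measurable_EFinP; exact: measurableT_comp.
    rewrite -(@ge0_integral_shift R n (w + u) _ mfa)//.
    have mfs : measurable_fun setT (fun y : B => `|f ((y : E) + (w + u))|%:E).
      apply/measurable_EFinP; apply: measurableT_comp => //; exact: measurable_shift_fun.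
    rewrite -ge0_integralZl//; apply: ge0_le_integral => //.
    - apply/measurable_EFinP/measurableT_comp => //; apply: measurable_funM; first exact: mk.
      rewrite (_ : (fun _ => _) = (fun v => f (v + (w + u)))); last first.
        by apply/funext => v; rewrite addrA.
      exact: measurable_shift_fun.
    - exact: measurable_funeM.
    by move=> v _; rewrite -EFinM lee_fin normrM addrA ler_wpM2r// moll_kernel_norm_le.
  rewrite ge0_integralZr//; last 3 first.
  - by apply/measurable_EFinP; exact: mk.
  - by move=> w _; rewrite lee_fin moll_kernel_ge0.
  - by rewrite lee_fin mulr_ge0// -lee_fin -If integral_ge0.
  have -> : (\int[mu]_w (moll_kernel d (w : E))%:E = 1)%E.
    by rewrite -(integral_moll_kernel (0 : E) d0); apply: eq_integral => y _; rewrite subr0.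
  by rewrite mul1e ltry.
apply: (etrans (Fubini iF)).
apply: eq_integral => v _; apply: eq_integral => w _.
by rewrite /F /= mulrCA [(v : E) + w]addrC.
Qed.

(** The kernel is a probability density on the cube of radius [e], so the average deviates from [c]
    no more than the values do. *)
Lemma moll_osc e h q c M : 0 < e -> L1 h ->
  (forall y, `|y - q| < e -> `|h y - c| <= M) -> `|moll e h q - c| <= M.
Proof.
move=> e0 L1h hM.
have L1k : L1 (fun y => moll_kernel e (y - q)) by exact: L1_shift (L1_moll_kernel e0).
have int1 : \int[mu]_y (moll_kernel e ((y : E) - q)) = 1.
  by rewrite /Rintegral integral_moll_kernel.
have L1kc : L1 (fun y => moll_kernel e (y - q) * c).
  by have := L1Z c L1k; rewrite (_ : (fun _ => _) = fun y => moll_kernel e (y - q) * c)//;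
    apply/funext => y; rewrite mulrC.
have L1kh := integrable_moll q e0 L1h.
have -> : moll e h q - c = \int[mu]_y (moll_kernel e ((y : E) - q) * (h y - c)).
  rewrite -[X in _ - X]mul1r -int1 -RintegralZr// /moll /corr -RintegralB//.
  by apply: eq_Rintegral => y _; rewrite mulrBr.
have L1khc : L1 (fun y => moll_kernel e (y - q) * (h y - c)).
  by have := L1B L1kh L1kc; rewrite (_ : (fun _ => _) = fun y => moll_kernel e (y - q) * (h y - c))//;
    apply/funext => y; rewrite mulrBr.
apply: (le_trans (le_normr_Rintegral measurableT L1khc)).
have L1kM : L1 (fun y => moll_kernel e (y - q) * M).
  by have := L1Z M L1k; rewrite (_ : (fun _ => _) = fun y => moll_kernel e (y - q) * M)//;
    apply/funext => y; rewrite mulrC.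
rewrite -[leRHS]mul1r -int1 -RintegralZr//; apply: le_Rintegral => //.
  by have := integrable_norm L1khc.
move=> y _; rewrite normrM ger0_norm ?moll_kernel_ge0//.
have [yq|yq] := ltP `|(y : E) - q| e.
  by rewrite ler_wpM2l ?moll_kernel_ge0// hM.
by rewrite moll_kernel_eq0// !mul0r.
Qed.

(** The integration by parts identity alone, for the Borel measure; integrability is tracked
    separately. *)
Definition weak_test (Omega : set E) (i : 'I_n.+1) f g :=
  forall phi, test_function Omega phi ->
  (\int[mu]_(x in Omega) (f x * partial i phi x)%:E =
   - \int[mu]_(x in Omega) (g x * phi x)%:E)%E.

Lemma partial_shift i f u y : partial i (fun z => f (z - u)) y = partial i f (y - u).
Proof.
have e : (fun t : R => t^-1 *: (((fun z : E => f (z - u)) \o shift y) (t *: e_ i) - f (y - u))) =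
         (fun t => t^-1 *: ((f \o shift (y - u)) (t *: e_ i) - f (y - u))).
  by apply/funext => t /=; rewrite addrA.
by rewrite /partial /derive e.
Qed.

Lemma test_function_moll_kernel (Omega : set E) d u : 0 < d ->
  (forall y, `|y - u| <= d -> Omega y) -> test_function Omega (fun y => moll_kernel d (y - u)).
Proof.
move=> d0 sub; have [Sk _] := smooth_moll_kernel n d0.
have cl : closure [set y | moll_kernel d (y - u) != 0] `<=` [set y | `|y - u| <= d].
  have clK : closed [set y : E | `|y - u| <= d].
    rewrite (_ : [set _ | _] = (fun y : E => `|y - u|) @^-1` [set t | t <= d]); last by [].
    apply: closed_comp; last exact: closed_le.
    move=> y _; apply: (@continuous_comp _ _ _ (fun y : E => y - u) (@Num.norm R E)).
    by apply: continuousB => //; exact: cst_continuous.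
  exact: norm_continuous.
  rewrite [X in _ `<=` X](_ : _ = closure [set y : E | `|y - u| <= d]); last first.
    by rewrite -(closure_id _).1.
  apply: closure_subset => y /=; apply: contra_neqP => /negP; rewrite -ltNge => dy.
  by rewrite moll_kernel_eq0// ltW.
split.
- move=> k; apply: smooth_Ck.
  rewrite (_ : (fun _ => _) = (fun y => moll_kernel d (1 *: y + - u))).
    exact: smooth_affine.
  by apply/funext => y; rewrite scale1r.
- apply: bounded_closed_compact; last exact: closed_closure.
  exists (d + `|u|); split; first exact: num_real.
  move=> M dM y /cl /= yd; rewrite -[y](subrK u) (le_trans (ler_normD _ _))// ltW//.
  by apply: le_lt_trans dM; rewrite lerD2r.
- by move=> y /cl /=; exact: sub.
Qed.

(** The translated kernel is a test function as long as its cube lies in [Omega], and testing with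
    it moves the derivative onto [g]. Since [g'] has to agree with [g] only on the cube, a locally
    integrable weak derivative can be replaced by an integrable truncation. *)
Lemma moll_weak_partial (Omega : set E) i f g g' d u : open Omega ->
  0 < d -> L1 f -> L1 g' -> weak_test Omega i f g ->
  (forall y, `|y - u| <= d -> Omega y) -> (forall y, `|y - u| < d -> g' y = g y) ->
  is_derive u (e_ i) (moll d f) (moll d g' u).
Proof.
move=> oO d0 L1f L1g' W sub gg'.
have Sk := smooth_moll_kernel n d0.
have mO := measurable_open_borel oO.
apply: (@is_derive_eq R E R^o _ _ _ _ _ (corr_is_derive u i Sk L1f)).
have := W _ (test_function_moll_kernel d0 sub).
have out y : ~ Omega y -> d < `|y - u|.
  by move=> Oy; rewrite ltNge; apply/negP => /sub.
rewrite integral_mkcond [X in _ = (- X)%E -> _]integral_mkcond.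
rewrite [X in X = _](_ : _ = \int[mu]_y (partial i (moll_kernel d) ((y : E) - u) * f y)%:E)%E; last first.
  apply: eq_integral => y _; rewrite patchE partial_shift mulrC; case: ifPn => // /negP yO.
  rewrite (smooth_in_partial i Sk).2 ?mul0r//; apply: out => Oy; apply: yO.
  by rewrite inE.
rewrite [X in _ = (- X)%E](_ : _ = \int[mu]_y (moll_kernel d ((y : E) - u) * g' y)%:E)%E; last first.
  apply: eq_integral => y _; rewrite patchE mulrC.
  have [yd|yd] := ltP `|(y : E) - u| d.
    by rewrite mem_set ?gg'//; apply: sub; exact: ltW.
  by rewrite moll_kernel_eq0// !mul0r; case: ifP.
rewrite /moll /corr /Rintegral => ->; rewrite fineN opprK//.
Qed.

(** Cubes of the sup norm match the support of the mollification kernel. *)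
Definition mass g q (s : R) : R := \int[mu]_(y in [set y : E | `|y - q| < s]) g y.

Lemma massE g q s : L1 g ->
  ((mass g q s)%:E = \int[mu]_(y in [set y : E | (`|y - q| < s)%R]) (g y)%:E)%E.
Proof.
move=> L1g; have mQ := @measurable_norm_lt R n q s.
rewrite /mass /Rintegral fineK//; apply: integrable_fin_num => //.
exact: integrableS L1g.
Qed.

Lemma mass_ge0 g q s : (forall y, 0 <= g y) -> 0 <= mass g q s.
Proof. by move=> g0; apply: Rintegral_ge0. Qed.

Lemma le_mass g q q' s s' : L1 g -> (forall y, 0 <= g y) -> `|q - q'| + s <= s' ->
  mass g q s <= mass g q' s'.
Proof.
move=> L1g g0 ss; rewrite -lee_fin !massE//; apply: ge0_subset_integral => //.
- exact: measurable_norm_lt.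
- exact: measurable_norm_lt.
- by apply: measurable_funTS; apply/measurable_EFinP; exact: L1_measurable.
- by move=> y _; rewrite lee_fin.
- move=> y /= yq; apply: (@lt_le_trans _ _ (`|q - q'| + s)) => //.
  by apply: (le_lt_trans (ler_distD q _ _)); rewrite addrC ltrD2l.
Qed.

End mollifier_calculus.

Lemma halving_arith (R : realType) (N b t z e d m m' : R) : 0 <= N -> 0 <= b -> 0 <= t -> 0 <= z ->
  0 <= e -> e <= d -> 0 <= m -> m <= m' ->
  N * (b * t * m) * e + N * (b * (z * t) * m) * d <= N * b * (1 + z) * (t * d * m').
Proof.
move=> N0 b0 t0 z0 e0 ed m0 mm'.
have p0 : 0 <= N * b * t by rewrite !mulr_ge0.
have h3 : N * b * t * e * m <= N * b * t * d * m'.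
  by apply: ler_pM => //; [exact: mulr_ge0|exact: ler_wpM2l].
have h4 : N * b * t * z * d * m <= N * b * t * z * d * m'.
  by rewrite ler_wpM2l// !mulr_ge0// (le_trans e0).
lra.
Qed.

(** * Changing the centre or the radius of a mollification *)

Section mollifier_steps.
Context (R : realType) (n : nat).
Local Notation E := 'rV[R]_n.+1.
Local Notation e_ i := (delta_mx 0 i : E).
Variables (Omega : set E) (f : E -> R) (G : 'I_n.+1 -> E -> R) (g : E -> R).
Hypotheses (oO : open Omega) (L1f : L1 f) (L1G : forall i, L1 (G i)) (L1g : L1 g).
Hypotheses (Gg : forall i y, `|G i y| <= g y).
Hypothesis weakG : forall i, weak_test Omega i f (G i).

Let g0 y : 0 <= g y.
Proof. exact: le_trans (Gg 0 y). Qed.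

Let bm := bump_mass R n.

Lemma partial_moll_le i (d : R) (u : E) : 0 < d -> (forall y, `|y - u| <= d -> Omega y) ->
  `|partial i (moll d f) u| <= bm^-1 * d ^- n.+1 * mass g u d.
Proof.
move=> d0 sub.
have dF := moll_weak_partial oO d0 L1f (L1G i) (@weakG i) sub (fun _ _ => erefl).
have bm0 : 0 <= bm^-1 * d ^- n.+1.
  by rewrite mulr_ge0// invr_ge0 ?exprn_ge0 ?(ltW d0)// ltW// (bump_massE R n).2.
rewrite /partial derive_val -lee_fin; apply: (le_trans (moll_le_average _ d0 (L1G i))).
rewrite [leRHS]EFinM massE//; apply: lee_wpmul2l; first by rewrite lee_fin.
have mQ := @measurable_norm_lt R n u d.
apply: ge0_le_integral => //.
- apply: measurable_funTS; apply/measurable_EFinP/measurableT_comp => //; exact: L1_measurable.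
- by apply: measurable_funTS; apply/measurable_EFinP; exact: L1_measurable.
by move=> y _; rewrite lee_fin.
Qed.

Lemma moll_step_gen (d D : R) (q q' : E) : 0 < d -> `|q' - q| <= D ->
  (forall y, `|y - q| <= D + d -> Omega y) ->
  `|moll d f q' - moll d f q| <= n.+1%:R * (bm^-1 * d ^- n.+1 * mass g q (D + d)) * D.
Proof.
move=> d0 qD sub.
have bm0 : 0 <= bm^-1 * d ^- n.+1.
  by rewrite mulr_ge0// invr_ge0 ?exprn_ge0 ?(ltW d0)// ltW// (bump_massE R n).2.
apply: (@le_trans _ _ (n.+1%:R * (bm^-1 * d ^- n.+1 * mass g q (D + d)) * `|q' - q|)).
  apply: mvt_coord_le => x i; first by apply: moll_derivable.
  move=> xq; apply: (le_trans (partial_moll_le i d0 _)).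
    move=> y yx; apply: sub; rewrite -(subrK x y) -addrA addrC.
    by rewrite (le_trans (ler_normD _ _))// lerD// (le_trans xq).
  apply: ler_wpM2l => //; apply: le_mass => //.
  by rewrite lerD2r (le_trans xq).
by apply: ler_wpM2l => //; rewrite mulr_ge0// mulr_ge0// mass_ge0.
Qed.

(** The summands 1 and 2^(n+1) come from the kernel bounds at the scales d and d/2. *)
Definition step_const : R := n.+1%:R * bm^-1 * (1 + 2 ^+ n.+1).

Lemma step_const_gt0 : 0 < step_const.
Proof.
have two0 : 0 < 1 + (2 : R) ^+ n.+1 by rewrite ltr_wpDr// exprn_ge0.
by rewrite /step_const !mulr_gt0// invr_gt0 (bump_massE R n).2.
Qed.

(** [f] itself has no pointwise derivative, so the two scales are compared through a double
    mollification. Mollifying the C^1 function [moll d f] at scale d/2 changes it little, so does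
    mollifying [moll (d / 2) f] at scale d, and the two results agree by [moll_comm]. *)
Lemma moll_halving (d : R) (q : E) : 0 < d ->
  (forall y, `|y - q| <= 2 * d -> Omega y) ->
  `|moll d f q - moll (d / 2) f q| <= step_const * (d ^- n.+1 * d * mass g q (2 * d)).
Proof.
move=> d0 sub; set e := d / 2; have e0 : 0 < e by rewrite divr_gt0.
have de : d = e + e by rewrite -splitr.
have sub' y : `|y - q| <= e + d -> Omega y.
  by move=> h; apply: sub; apply: (le_trans h); rewrite mulrDl mul1r lerD2r; lra.
have bm0 : 0 <= bm^-1 by rewrite invr_ge0 ltW// (bump_massE R n).2.
set m := mass g q (e + d).
have h1 : `|moll e (moll d f) q - moll d f q| <= n.+1%:R * (bm^-1 * d ^- n.+1 * m) * e.
  apply: moll_osc => //; first exact: L1_moll.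
  by move=> y yq; apply: moll_step_gen => //; exact: ltW.
have h2 : `|moll d (moll e f) q - moll e f q| <= n.+1%:R * (bm^-1 * e ^- n.+1 * m) * d.
  apply: moll_osc => //; first exact: L1_moll.
  move=> y yq; rewrite /m [in mass _ _ _]addrC; apply: moll_step_gen => //; first exact: ltW.
  by move=> z; rewrite [d + e]addrC; exact: sub'.
have ed : e <= d by rewrite de lerDl ltW.
have m2 : m <= mass g q (2 * d).
  by apply: le_mass => //; rewrite subrr normr0 add0r mulrDl mul1r lerD2r.
have m0 : 0 <= m by exact: mass_ge0.
have eE : e ^- n.+1 = 2 ^+ n.+1 * d ^- n.+1.
  by rewrite /e expr_div_n invf_div.
have dn0 : 0 <= d ^- n.+1 by rewrite invr_ge0 exprn_ge0// ltW.
apply: (@le_trans _ _ (n.+1%:R * (bm^-1 * d ^- n.+1 * m) * e + n.+1%:R * (bm^-1 * e ^- n.+1 * m) * d)).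
  rewrite (_ : moll d f q - moll e f q =
     - (moll e (moll d f) q - moll d f q) + (moll d (moll e f) q - moll e f q)).
    by rewrite (le_trans (ler_normD _ _))// normrN lerD.
  by rewrite (moll_comm _ d0 e0 L1f) opprB addrA subrK.
rewrite eE /step_const -/bm.
by apply: halving_arith => //; first [exact: exprn_ge0|exact: ltW].
Qed.

End mollifier_steps.

(** * Pointwise estimate on uniform domains *)

Section curves.
Context (R : realType) (n : nat).
Local Notation E := 'rV[R]_n.+1.

Definition partition_sum (gam : R -> E) (s : seq R) : R :=
  \sum_(0 <= k < size s) `|gam (nth 1 (0 :: s) k.+1) - gam (nth 1 (0 :: s) k)|.

Lemma partition_sum_rcons (gam : R -> E) s t :
  partition_sum gam (rcons s t) = partition_sum gam s + `|gam t - gam (last 0 s)|.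
Proof.
rewrite /partition_sum size_rcons big_nat_recr//=; congr (_ + _).
  apply: eq_big_nat => k /andP[_ ks]; rewrite -[rcons s t]/(behead (rcons (0 :: s) t)).
  rewrite nth_behead -[0 :: behead _]/(rcons (0 :: s) t) !nth_rcons/= ltnS ks.
  by rewrite (ltn_trans ks).
rewrite nth_rcons ltnn eqxx; congr (`|_ - gam _|).
rewrite -[0 :: rcons s t]/(rcons (0 :: s) t) nth_rcons/= ltnSn.
by rewrite (last_nth 1) .
Qed.

Lemma itv_partition_rcons (s : seq R) (t t' : R) : itv_partition 0 t s -> t < t' ->
  itv_partition 0 t' (rcons s t').
Proof.
move=> [st /eqP lst] tt'; split; last by rewrite last_rcons.
by rewrite rcons_path st lst.
Qed.

(** Continuous induction on the parameter. The set of t for which some partition of [0,t] carries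
    the estimate contains its supremum and can be extended beyond it by the local bound, so it
    reaches 1. *)
Lemma local_lipschitz_curve (gam : R -> E) (h : E -> R) (K V : R) :
  0 <= K ->
  (forall t, 0 <= t <= 1 -> exists2 del, 0 < del & forall s, 0 <= s <= 1 -> `|s - t| < del ->
    `|h (gam s) - h (gam t)| <= K * `|gam s - gam t|) ->
  (forall s, itv_partition 0 1 s -> partition_sum gam s <= V) ->
  `|h (gam 1) - h (gam 0)| <= K * V.
Proof.
move=> K0 loc varV.
pose P (t : R) := exists s, itv_partition 0 t s /\
  `|h (gam t) - h (gam 0)| <= K * partition_sum gam s.
suff [s [ps hs]] : P 1 by apply: (le_trans hs); rewrite ler_wpM2l// varV.
have ext t t' : P t -> t < t' -> `|h (gam t') - h (gam t)| <= K * `|gam t' - gam t| -> P t'.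
  move=> [s [ps hs]] tt' htt'; exists (rcons s t'); split; first exact: itv_partition_rcons ps tt'.
  rewrite partition_sum_rcons (_ : last 0 s = t); last by apply/eqP; case: ps.
  by apply: (le_trans (ler_distD (h (gam t)) _ _)); rewrite mulrDr addrC lerD.
have P0 : P 0.
  exists [::]; split; first by split.
  by rewrite subrr normr0 /partition_sum big_geq// mulr0.
pose A := [set t : R | 0 <= t <= 1 /\ P t].
have A0 : A 0 by split; rewrite ?lexx ?ler01.
have ubA : ubound A 1 by move=> t [/andP[]].
have supA : has_sup A by split; [exists 0|exists 1].
set tau := sup A.
have tau01 : 0 <= tau <= 1.
  by rewrite (ub_le_sup _ A0)/= ?ge_sup//; [exists 0|exact: supA.2].
have [del del0 Hd] := loc _ tau01.
have [t [t01 Pt] ttau] := sup_adherent del0 supA.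
have tle : t <= tau by apply: ub_le_sup => //; exact: supA.2.
have Ptau : P tau.
  have [ttau'|] := ltP t tau; last by move=> h1; have -> : tau = t by apply/le_anti; rewrite h1 tle.
  apply: (ext t) => //; rewrite distrC [X in _ <= _ * X]distrC.
  by apply: Hd => //; rewrite ler0_norm ?subr_le0//; move: ttau; rewrite -/tau; lra.
have [tau1|tau1] := ltP tau 1; last first.
  by have -> : 1 = tau by apply/le_anti; rewrite tau1; case/andP: tau01.
pose t' := Num.min 1 (tau + del / 2).
have tt' : tau < t' by rewrite lt_min tau1 ltrDl divr_gt0.
have : t' <= tau.
  apply: ub_le_sup; first exact: supA.2.
  have t'01 : 0 <= t' <= 1.
    by rewrite ge_min lexx andbT (le_trans _ (ltW tt'))//; case/andP: tau01.
  split=> //; apply: (ext tau) => //; apply: Hd => //.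
  have : t' <= tau + del / 2 by rewrite ge_min lexx orbT.
  by rewrite gtr0_norm ?subr_gt0//; move: del0; lra.
by rewrite leNgt tt'.
Qed.

(** The sup-norm form of an (eps,oo)-domain: the distance to the boundary is expressed by a cube
    contained in [Omega], the length by partition sums. *)
Definition uniform_domain (c : R) (Omega : set E) :=
  forall x y, Omega x -> Omega y -> x <> y -> exists gam : R -> E,
  [/\ gam 0 = x, gam 1 = y,
      (forall t e, 0 <= t <= 1 -> 0 < e -> exists2 del, 0 < del &
         forall s, 0 <= s <= 1 -> `|s - t| < del -> `|gam s - gam t| < e),
      (forall s, itv_partition 0 1 s -> partition_sum gam s <= `|x - y| / c) &
      forall t z, 0 <= t <= 1 -> Omega (gam t) /\
        (`|z - gam t| < c * `|x - gam t| * `|y - gam t| / `|x - y| -> Omega z)].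

Lemma within_continuous01 (gam : R -> E) : {within `[0, 1], continuous gam} ->
  forall t e, 0 <= t <= 1 -> 0 < e -> exists2 del, 0 < del &
     forall s, 0 <= s <= 1 -> `|s - t| < del -> `|gam s - gam t| < e.
Proof.
move=> /subspace_continuousP cg t e t01 e0.
have /cg : `[0, 1]%classic t by rewrite /= in_itv.
move/cvgrPdist_lt/(_ _ e0); rewrite near_withinE => /nbhs_ballP[del /= del0 H].
exists del => // s s01 st; rewrite distrC; apply: H; last by rewrite /= in_itv.
by rewrite -ball_normE/= distrC.
Qed.

(** The frontier point belongs to the supremum of the parameters up to which the segment lies in
    [Omega]: it is a limit of points of [Omega] and, as [Omega] is open and [z] is outside, not in
    [Omega]. *)
Lemma frontier_segment (Omega : set E) (x z : E) : open Omega -> Omega x -> ~ Omega z ->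
  exists w, frontier Omega w /\ exists2 t, 0 <= t <= 1 & w = x + t *: (z - x).
Proof.
move=> oO Ox Oz; pose w (t : R) := x + t *: (z - x).
pose A := [set t : R | 0 <= t <= 1 /\ forall s, 0 <= s <= t -> Omega (w s)].
have A0 : A 0.
  split; rewrite ?lexx ?ler01// => s s0; have -> : s = 0 by apply/le_anti; rewrite andbC.
  by rewrite /w scale0r addr0.
have supA : has_sup A by split; [exists 0|exists 1 => t [/andP[]]].
set tau := sup A.
have tau01 : 0 <= tau <= 1.
  rewrite (ub_le_sup _ A0)/= ?ge_sup//; [exists 0|by move=> t [/andP[]]|exact: supA.2].
  by [].
have cw t e : 0 < e -> exists2 del, 0 < del & forall s, `|s - t| < del -> `|w s - w t| < e.
  move=> e0; exists (e / (`|z - x| + 1)); first by rewrite divr_gt0// ltr_wpDl.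
  move=> s st; rewrite /w opprD addrACA subrr add0r -scalerBl normrZ.
  apply: (@le_lt_trans _ _ (`|s - t| * (`|z - x| + 1))).
    by rewrite ler_wpM2l// lerDl.
  by rewrite -ltr_pdivlMr// ltr_wpDl.
have below s : 0 <= s -> s < tau -> Omega (w s).
  move=> s0 st; have ts0 : 0 < tau - s by rewrite subr_gt0.
  have [t [t01 Pt] ttau] := sup_adherent ts0 supA.
  by apply: Pt; rewrite s0/= ltW//; move: ttau; rewrite -/tau; lra.
exists (w tau); split; last by exists tau.
split.
- move=> U /nbhs_ballP[e /= e0 eU]; have [del del0 H] := cw tau _ e0.
  have [tau0|tau0] := ltP 0 tau; last first.
    exists (w tau); split; last by apply: eU; exact: ballxx.
    have -> : tau = 0 by apply/le_anti; rewrite tau0; case/andP: tau01.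
    by rewrite /w scale0r addr0.
  pose s := Num.max 0 (tau - del / 2).
  have st : s < tau by rewrite gt_max tau0/= ltrBlDr ltrDl divr_gt0.
  exists (w s); split; first by apply: below => //; rewrite le_max lexx.
  apply: eU; rewrite -ball_normE/= distrC; apply: H.
  have : tau - del / 2 <= s by rewrite le_max lexx orbT.
  by rewrite ltr0_norm ?subr_lt0//; move: del0; lra.
- move=> /interior_subset Ow.
  have /nbhs_ballP[e /= e0 eU] : nbhs (w tau) Omega by exact: open_nbhs_nbhs.
  have [del del0 H] := cw tau _ e0.
  have [tau1|tau1] := ltP tau 1; last first.
    apply: Oz; move: Ow; have -> : tau = 1 by apply/le_anti; rewrite tau1 andbT; case/andP: tau01.
    by rewrite /w scale1r addrC subrK.
  pose t' := Num.min 1 (tau + del / 2).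
  have tt' : tau < t' by rewrite lt_min tau1 ltrDl divr_gt0.
  have t'd : t' <= tau + del / 2 by rewrite ge_min lexx orbT.
  have : t' <= tau; last by rewrite leNgt tt'.
  apply: ub_le_sup; first exact: supA.2.
  split; first by rewrite ge_min lexx andbT (le_trans _ (ltW tt'))//; case/andP: tau01.
  move=> s /andP[s0 st']; have [stau|stau] := ltP s tau; first exact: below.
  apply: eU; rewrite -ball_normE/= distrC; apply: H.
  by rewrite ger0_norm ?subr_ge0//; move: del0 t'd st'; lra.
Qed.

(** A segment from [x] that leaves [Omega] meets the frontier no farther from [x] than its end
    point. An empty frontier, at distance +oo, is covered as well. *)
Lemma edist_ball (Omega : set E) (x z : E) (a : R) : open Omega -> Omega x ->
  (a%:E <= Defs.edist x (frontier Omega))%E -> enorm (z - x) < a -> Omega z.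
Proof.
move=> oO Ox ax zx; apply: contrapT => Oz.
have [w [Fw [t t01 wE]]] := frontier_segment oO Ox Oz.
have : (Defs.edist x (frontier Omega) <= (enorm (x - w))%:E)%E.
  by apply: ereal_inf_lbound; exists w.
apply/negP; rewrite -ltNge; apply: lt_le_trans ax; rewrite lte_fin.
apply: le_lt_trans zx; rewrite wE opprD addrA subrr add0r enormN enormZ.
case/andP: t01 => t0 t1; rewrite ger0_norm// ler_piMl//; exact: enorm_ge0.
Qed.

(** One factor [n.+1] is lost in the Euclidean norm of [z - gam t], the other in that of [x - y]. *)
Lemma uniform_eps_domain (eps : R) (Omega : set E) : 0 < eps -> eps_infty_domain eps Omega ->
  uniform_domain (eps / n.+1%:R ^+ 2) Omega.
Proof.
move=> eps0 [oO H] x y Ox Oy xy; have [gam [cg g0 g1 gO [_ glen gd]]] := H x y Ox Oy xy.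
have N0 : (0 : R) < n.+1%:R by rewrite ltr0n.
have N1 : (1 : R) <= n.+1%:R by rewrite ler1n.
have xy0 : 0 < `|x - y| by rewrite normr_gt0 subr_eq0; apply/eqP.
have exy0 : 0 < enorm (x - y) by apply: lt_le_trans xy0 (norm_le_enorm _).
exists gam; split=> //.
- exact: within_continuous01.
- move=> s ps; have : ((\sum_(0 <= k < size s)
       enorm (gam (nth 1 (0 :: s) k.+1) - gam (nth 1 (0 :: s) k)))%:E <=
       (eps^-1 * enorm (x - y))%:E)%E.
    by apply: le_trans glen; apply: ereal_sup_ubound; exists s.
  rewrite lee_fin => h; rewrite /partition_sum.
  apply: (@le_trans _ _ (eps^-1 * enorm (x - y))).
    by apply: le_trans h; apply: ler_sum => k _; exact: norm_le_enorm.
  rewrite invf_div mulrC [leRHS]mulrA ler_pM2r ?invr_gt0//.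
  apply: (le_trans (enorm_le_norm _)); rewrite mulrC ler_wpM2l//.
  by rewrite expr2 ler_peMr// ltW.
move=> t z t01; have gt : (gam @` `[0, 1]) (gam t) by exists t => //; rewrite /= in_itv.
have Ogt := gO _ gt; split=> // zt.
apply: (edist_ball oO Ogt (gd _ gt)).
apply: (le_lt_trans (enorm_le_norm _)); rewrite mulrC -ltr_pdivlMr//.
apply: (lt_le_trans zt).
rewrite (_ : _ / n.+1%:R ^+ 2 * _ * _ / _ =
   eps * `|x - gam t| * `|y - gam t| * (n.+1%:R * `|x - y|)^-1 / n.+1%:R); last first.
  rewrite expr2 !invfM; move: (_ ^-1) (_ ^-1) => a b; lra.
rewrite ler_pM2r ?invr_gt0//; apply: ler_pM.
- by rewrite !mulr_ge0// ltW.
- by rewrite invr_ge0 mulr_ge0// ltW.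
- apply: ler_pM; [by rewrite mulr_ge0// ltW|by []|by rewrite ler_pM2l// norm_le_enorm|].
  exact: norm_le_enorm.
- by rewrite lef_pV2 ?posrE ?mulr_gt0//; exact: enorm_le_norm.
Qed.

End curves.

Lemma combine_bounds (R : realType) (u v : \bar R) (p q : R) : (0 <= u)%E -> (0 <= v)%E ->
  0 <= p -> 0 <= q ->
  (p%:E * u + (q%:E * u + p%:E * v) <= (p + q)%:E * (u + v))%E.
Proof.
move=> u0 v0 p0 q0.
rewrite ge0_muleDr// EFinD !ge0_muleDl ?lee_fin// -addeA leeD2l// leeD2l// leeDl//.
by rewrite mule_ge0// lee_fin.
Qed.

Section riesz_terms.
Context (R : realType) (n : nat).
Local Notation E := 'rV[R]_n.+1.
Variable g : E -> R.
Hypothesis g0 : forall y, 0 <= g y.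

(** Up to constants, the scale t/2^k times the average of [g] over the cube of radius lam t/2^k: a
    dyadic piece of the Riesz potential of order 1. *)
Definition riesz_term (x : E) (lam t : R) (k : nat) : R :=
  (t / 2 ^+ k) ^- n.+1 * (t / 2 ^+ k) * mass g x (lam * (t / 2 ^+ k)).

Lemma riesz_term_ge0 x lam t k : 0 < t -> 0 <= riesz_term x lam t k.
Proof.
move=> t0; have tk : 0 < t / 2 ^+ k by rewrite divr_gt0// exprn_gt0.
by rewrite !mulr_ge0// ?mass_ge0 ?invr_ge0 ?exprn_ge0// ltW.
Qed.

End riesz_terms.

(** * Chaining mollifications along a curve *)

Section pointwise_estimate.
Context (R : realType) (n : nat).
Local Notation E := 'rV[R]_n.+1.
Variables (Omega : set E) (f : E -> R) (G : 'I_n.+1 -> E -> R) (g : E -> R) (c : R).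
Hypotheses (oO : open Omega) (L1f : L1 f) (L1G : forall i, L1 (G i)) (L1g : L1 g).
Hypotheses (Gg : forall i y, `|G i y| <= g y).
Hypothesis weakG : forall i, weak_test Omega i f (G i).
Hypotheses (c0 : 0 < c) (c1 : c <= 1) (unif : uniform_domain c Omega).

Let S := step_const R n.

Let g0 y : 0 <= g y.
Proof. exact: le_trans (Gg 0 y). Qed.

Let S0 : 0 <= S.
Proof. by rewrite ltW// step_const_gt0. Qed.

Let invX_ge0 (d : R) : 0 < d -> 0 <= d ^- n.+1.
Proof. by move=> d0; rewrite invr_ge0 exprn_ge0// ltW. Qed.

Lemma moll_lipschitz (rad D m : R) (q q' : E) : 0 < rad -> `|q' - q| <= D ->
  (forall y, `|y - q| <= D + rad -> Omega y) -> mass g q (D + rad) <= m ->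
  `|moll rad f q' - moll rad f q| <= S * rad ^- n.+1 * m * D.
Proof.
move=> rad0 qD sub mm.
apply: (le_trans (moll_step_gen oO L1f L1G L1g Gg weakG rad0 qD sub)).
have D0 : 0 <= D by apply: le_trans qD.
have bm0 : 0 <= (bump_mass R n)^-1 by rewrite invr_ge0 ltW// (bump_massE R n).2.
have m0 : 0 <= mass g q (D + rad) by exact: mass_ge0.
rewrite ler_wpM2r// !mulrA; apply: ler_pM => //.
  by rewrite !mulr_ge0// ?invX_ge0//.
rewrite ler_wpM2r ?invX_ge0// /S /step_const ler_peMr ?mulr_ge0//.
by rewrite lerDl exprn_ge0.
Qed.

Lemma partition_dist (gam : R -> E) (V t : R) : 0 <= t <= 1 ->
  (forall s, itv_partition 0 1 s -> partition_sum gam s <= V) ->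
  `|gam t - gam 0| <= V.
Proof.
move=> /andP[t0 t1] H.
have p1 : itv_partition (0 : R) 1 [:: 1] by apply: itv_partition1; exact: ltr01.
have [t0'|] := ltP 0 t; last first.
  move=> t0'; have -> : t = 0 by apply/le_anti; rewrite t0' t0.
  rewrite subrr normr0; apply: le_trans (H _ p1).
  by rewrite /partition_sum sumr_ge0.
have [t1'|t1'] := ltP t 1; last first.
  have -> : t = 1 by apply/le_anti; rewrite t1' t1.
  by have := H _ p1; rewrite /partition_sum big_nat1.
have : itv_partition 0 1 [:: t; 1] by rewrite /itv_partition/= t0' t1'.
move=> /H; rewrite /partition_sum big_nat_recl// big_nat1/=; apply: le_trans.
by rewrite lerDl.
Qed.

(** At a point farther than d/2 from both ends, a b >= (d/4)(a + b) >= (d/4) rho, so the cube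
    granted by the uniform condition has radius at least c d/4. *)
Let curve_arith (d a b rho rad : R) : 0 < d -> 0 < rho -> d / 2 < a -> d / 2 < b ->
  rho <= a + b -> rad <= c * d / 16 -> 2 * rad < c * a * b / rho.
Proof.
move=> d0 rho0 da db rab radc; rewrite ltr_pdivlMr//.
have h : d / 4 * rho <= a * b.
  apply: (@le_trans _ _ (d / 4 * (a + b))); first by rewrite ler_wpM2l// ltW// divr_gt0.
  have ab : 0 <= (a - d / 2) * (b - d / 2) by rewrite mulr_ge0// subr_ge0 ltW.
  have h1 : 0 <= a * (b - d / 2) by rewrite mulr_ge0// ?subr_ge0 ltW//; lra.
  have h2 : 0 <= b * (a - d / 2) by rewrite mulr_ge0// ?subr_ge0 ltW//; lra.
  lra.
apply: (@lt_le_trans _ _ (c * (d / 4 * rho))); last by rewrite -[leRHS]mulrA ler_wpM2l// ltW.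
apply: (@le_lt_trans _ _ (2 * (c * d / 16) * rho)).
  by rewrite ler_wpM2r ?ler_wpM2l// ltW.
have : 0 < c * d * rho by rewrite !mulr_gt0.
lra.
Qed.

(** Every point of the curve has a cube of radius 2 rad in [Omega]: near [u] and [v] by the given
    cubes, elsewhere by the uniform condition. All cubes involved lie in the one of radius |u - v|/c
    + 2 rad around [u], so [moll rad f] is Lipschitz near every point of the curve with the same
    constant. *)
Lemma moll_curve (u v : E) (d rad : R) : 0 < d ->
  (forall z, `|z - u| < d -> Omega z) -> (forall z, `|z - v| < d -> Omega z) ->
  0 < rad -> rad <= c * d / 16 ->
  `|moll rad f u - moll rad f v| <=
    S * rad ^- n.+1 * mass g u (`|u - v| / c + 2 * rad) * (`|u - v| / c).
Proof.
move=> d0 ud vd rad0 radc; set V := `|u - v| / c.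
have V0 : 0 <= V by rewrite divr_ge0// ltW.
set m := mass g u (V + 2 * rad); have m0 : 0 <= m by exact: mass_ge0.
have K0 : 0 <= S * rad ^- n.+1 * m by apply: mulr_ge0 => //; apply: mulr_ge0 => //; exact: invX_ge0.
have [->|/eqP uv] := eqVneq u v; first by rewrite subrr normr0 mulr_ge0.
have Ou : Omega u by apply: ud; rewrite subrr normr0.
have Ov : Omega v by apply: vd; rewrite subrr normr0.
have [gam [gu gv gc gs gb]] := unif Ou Ov uv.
rewrite distrC -[X in moll rad f X - _]gv -[X in _ - moll rad f X]gu.
apply: local_lipschitz_curve => // t t01.
have rho0 : 0 < `|u - v| by rewrite normr_gt0 subr_eq0; apply/eqP.
have rad2 : 2 * rad < d / 2.
  have : c * d <= d by rewrite ler_piMl// ltW.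
  by move: radc d0; lra.
have sub z : `|z - gam t| <= 2 * rad -> Omega z.
  move=> zt; have [h|h] := leP `|u - gam t| (d / 2).
    apply: ud; rewrite (splitr d) (le_lt_trans (ler_distD (gam t) _ _))//.
    by apply: ltr_leD; [exact: le_lt_trans rad2|rewrite distrC].
  have [h'|h'] := leP `|v - gam t| (d / 2).
    apply: vd; rewrite (splitr d) (le_lt_trans (ler_distD (gam t) _ _))//.
    by apply: ltr_leD; [exact: le_lt_trans rad2|rewrite distrC].
  apply: (gb t z t01).2; apply: (le_lt_trans zt).
  apply: (curve_arith (d := d)) => //.
  by rewrite [X in _ <= _ + X]distrC ler_distD.
have [del del0 H] := gc t rad t01 rad0.
exists del => // s s01 st; have hs := H s s01 st.
apply: moll_lipschitz => //.
  by move=> y yt; apply: sub; apply: (le_trans yt); rewrite mulrDl mul1r lerD2r ltW.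
apply: le_mass => //; rewrite lerD//.
  by rewrite -gu; exact: partition_dist.
by rewrite mulrDl mul1r lerD2r ltW.
Qed.

(** Consecutive chain points at distances w and w/2 from the end point both have cubes of radius c
    w/4 in [Omega]; [moll_curve] then allows the mollification radius c (c w/4)/16 = c^2 w/64. *)
Let a := c ^+ 2 / 64.

Let a0 : 0 < a.
Proof. by rewrite divr_gt0// exprn_gt0. Qed.

Let a_le : a <= c / 64.
Proof. by rewrite ler_pM2r ?invr_gt0// expr2 ler_piMl// ltW. Qed.

Let invc1 : 1 <= c^-1.
Proof. by rewrite invf_ge1. Qed.

(** Here 9 = 3 + 6: the part 3/c pays for the chains towards [x] and [y], the part 6/c for the
    passage between their starting points. *)
Definition curve_const : R := S * a ^- n.+1 * (9 / c).

Let C0 := S * a ^- n.+1.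

Let C0_ge0 : 0 <= C0.
Proof. by rewrite mulr_ge0// invX_ge0. Qed.

Lemma curve_const_ge0 : 0 <= curve_const.
Proof. by rewrite mulr_ge0// divr_ge0// ltW. Qed.

Let scale_term (w z D m' l : R) : 0 < w -> 0 <= l -> D <= l * w -> 0 <= z -> z <= m' ->
  S * (a * w) ^- n.+1 * z * D <= C0 * l * (w ^- n.+1 * w * m').
Proof.
move=> w0 l0 Dl z0 zm; rewrite exprMn invfM /C0.
have p0 : 0 <= S * a ^- n.+1 * w ^- n.+1 by apply: mulr_ge0 => //; exact: invX_ge0.
apply: (@le_trans _ _ (S * a ^- n.+1 * w ^- n.+1 * z * (l * w))).
  by rewrite [S * (_ * _)]mulrA; apply: ler_wpM2l => //; exact: mulr_ge0.
rewrite (_ : C0 * l * _ = S * a ^- n.+1 * w ^- n.+1 * m' * (l * w)); last first.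
  rewrite /C0; move: (w ^- _) (a ^- _) => p q; lra.
by apply: ler_wpM2r; [rewrite mulr_ge0// ltW|exact: ler_wpM2l].
Qed.

(** The points lie on the curve at distance s/2^k from [x], by the intermediate value theorem. As s
    is at most |x-y|/2, they remain at distance at least |x-y|/2 from [y], and the uniform condition
    gives them cubes of radius proportional to s/2^k. Each link moves to the next point at fixed
    radius and then halves the radius. *)
Let half_chain (x y : E) (s : R) : Omega x -> Omega y -> 0 < s -> s <= `|x - y| / 2 ->
  exists z : nat -> E, [/\ forall k, `|x - z k| = s / 2 ^+ k,
    (forall k w, `|w - z k| < c * (s / 2 ^+ k) / 2 -> Omega w) &
    forall k, `|moll (a * (s / 2 ^+ k)) f (z k) - moll (a * (s / 2 ^+ k.+1)) f (z k.+1)|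
       <= C0 * (3 / c) * riesz_term g x (10 / c) s k].
Proof.
move=> Ox Oy s0 sxy.
have xy0 : 0 < `|x - y| by apply: lt_le_trans (_ : 0 < 2 * s) _; rewrite ?mulr_gt0//; move: sxy; lra.
have xy : x <> y by move=> xy; move: xy0; rewrite xy subrr normr0 ltxx.
have [gam [gx gy gc gs gb]] := unif Ox Oy xy.
have sk0 k : 0 < s / 2 ^+ k by rewrite divr_gt0// exprn_gt0.
have sk k : s / 2 ^+ k <= s.
  by rewrite ler_pdivrMr ?exprn_gt0// ler_peMr ?(ltW s0)// exprn_ege1// ler1n.
have /choice[tt ttP] : forall k : nat, exists t, 0 <= t <= 1 /\ `|x - gam t| = s / 2 ^+ k.
  move=> k; have [||t] := @IVT R (fun t => `|x - gam t|) 0 1 (s / 2 ^+ k) ler01.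
  - apply/subspace_continuousP => t; rewrite /= in_itv/= => t01.
    apply/cvgrPdist_lt => e e0; rewrite near_withinE.
    have [del del0 H] := gc t e t01 e0.
    apply/nbhs_ballP; exists del => // u; rewrite -ball_normE/= in_itv/= => tu u01.
    apply: (le_lt_trans (ler_dist_dist _ _)).
    by rewrite opprB addrC addrA subrK; apply: H; rewrite // distrC.
  - rewrite gx gy subrr normr0 ge_min (ltW (sk0 k))/= le_max.
    apply/orP; right; apply: (le_trans (sk k)); apply: (le_trans sxy).
    by rewrite ler_pdivrMr// ler_peMr// ler1n.
  - by rewrite in_itv/= => t01 <-; exists t.
pose z k := gam (tt k).
have zx k : `|x - z k| = s / 2 ^+ k by exact: (ttP k).2.
have zb k w : `|w - z k| < c * (s / 2 ^+ k) / 2 -> Omega w.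
  move=> wz; apply: (gb (tt k) w (ttP k).1).2; apply: (lt_le_trans wz).
  rewrite -/(z k) zx ler_pdivlMr//.
  have h : `|x - y| / 2 <= `|y - z k|.
    have := ler_distD (z k) x y; rewrite zx [`|z k - y|]distrC.
    have := sk k; move: sxy; lra.
  rewrite (_ : _ / 2 * _ = c * (s / 2 ^+ k) * (`|x - y| / 2)); last by lra.
  by rewrite ler_wpM2l// mulr_ge0// ltW.
exists z; split=> // k.
set w := s / 2 ^+ k; have w0 : 0 < w by exact: sk0.
have w1 : s / 2 ^+ k.+1 = w / 2 by rewrite exprS invfM /w; lra.
have zz : `|z k - z k.+1| <= 3 / 2 * w.
  have := ler_distD x (z k) (z k.+1); rewrite [`|z k - x|]distrC !zx w1 -/w; lra.
set m' := mass g x (10 / c * w).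
have cw : w <= w / c by rewrite ler_peMr// ltW.
have aw : a * w <= w / 64.
  have : a * w <= 1 / 64 * w; last by lra.
  by rewrite ler_wpM2r ?(ltW w0)// (le_trans a_le)// ler_pM2r ?invr_gt0.
have aw0 : 0 < a * w by exact: mulr_gt0.
have h1 : `|moll (a * w) f (z k) - moll (a * w) f (z k.+1)| <= C0 * (3 / 2 / c) * riesz_term g x (10 / c) s k.
  apply: (le_trans (@moll_curve (z k) (z k.+1) (c * (w / 2) / 2) (a * w) _ _ _ _ _)) => //.
  - by rewrite divr_gt0// mulr_gt0// divr_gt0.
  - move=> u uz; apply: (zb k); apply: (lt_le_trans uz); rewrite -/w.
    by rewrite ler_pM2r ?invr_gt0// ler_pM2l//; move: w0; lra.
  - by move=> u uz; apply: (zb k.+1); rewrite w1.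
  - by rewrite le_eqVlt; apply/orP; left; apply/eqP; rewrite /a expr2; lra.
  apply: scale_term => //.
  - by rewrite divr_ge0// ltW.
  - by rewrite [leRHS]mulrAC ler_pM2r ?invr_gt0.
  - exact: mass_ge0.
  apply: le_mass => //; rewrite distrC zx -/w.
  have : `|z k - z k.+1| / c <= 3 / 2 * w / c by rewrite ler_pM2r ?invr_gt0.
  rewrite -[3 / 2 * w / c]mulrA (_ : 10 / c * w = 10 * (w / c)); last by rewrite mulrAC mulrA.
  by move: cw aw w0; move: (w / c) (a * w) => p q; lra.
have h2 : `|moll (a * w) f (z k.+1) - moll (a * w / 2) f (z k.+1)| <= C0 * 1 * riesz_term g x (10 / c) s k.
  apply: (le_trans (moll_halving oO L1f L1G L1g Gg weakG aw0 _)).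
    move=> u uz; apply: (zb k.+1); apply: (le_lt_trans uz); rewrite w1.
    have : a * w <= c / 64 * w by rewrite ler_wpM2r// ltW.
    have : 0 < c * w by exact: mulr_gt0.
    by move: (a * w) => p; lra.
  rewrite -/S.
  apply: (@le_trans _ _ (S * (a * w) ^- n.+1 * mass g (z k.+1) (2 * (a * w)) * (a * w))).
    by rewrite [_ * (a * w) * _]mulrAC !mulrA.
  apply: scale_term => //; first by move: aw w0; lra.
    exact: mass_ge0.
  apply: le_mass => //; rewrite distrC zx w1.
  rewrite [10 / c * w]mulrAC -mulrA; move: cw aw w0; move: (w / c) (a * w) => p q; lra.
rewrite w1 (_ : a * (w / 2) = a * w / 2); last by rewrite mulrA.
apply: (le_trans (ler_distD (moll (a * w) f (z k.+1)) _ _)).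
apply: (le_trans (lerD h1 h2)); rewrite -mulrDl -mulrDr ler_wpM2r ?riesz_term_ge0//.
by apply: ler_wpM2l => //; clear h1 h2; move: invc1; lra.
Qed.

(** Telescoping along the chain. The final link from [z K] to [x] itself is possible once the scale
    is so small that the cube around [x] lies in [Omega]; the last term of the sum pays for it. *)
Let half_estimate (x y : E) (s : R) : Omega x -> Omega y -> 0 < s -> s <= `|x - y| / 2 ->
  exists z : E, [/\ `|x - z| = s, (forall w, `|w - z| < c * s / 2 -> Omega w) &
    exists K0 : nat, forall K, (K0 <= K)%N ->
      `|moll (a * (s / 2 ^+ K)) f x - moll (a * s) f z| <=
      C0 * (3 / c) * \sum_(k < K.+1) riesz_term g x (10 / c) s k].
Proof.
move=> Ox Oy s0 sxy; have [z [zx zb zz]] := half_chain Ox Oy s0 sxy.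
exists (z 0%N); split; [by rewrite zx expr0 divr1|by move=> w; have := zb 0%N w; rewrite expr0 divr1|].
have tele K : `|moll (a * (s / 2 ^+ K)) f (z K) - moll (a * s) f (z 0%N)| <=
    C0 * (3 / c) * \sum_(k < K) riesz_term g x (10 / c) s k.
  elim: K => [|K IH]; first by rewrite expr0 divr1 subrr normr0 big_ord0 mulr0.
  rewrite big_ord_recr/= mulrDr [leRHS]addrC.
  apply: (le_trans (ler_distD (moll (a * (s / 2 ^+ K)) f (z K)) _ _)).
  by apply: lerD; [rewrite distrC; exact: zz|exact: IH].
have /nbhs_ballP[e /= e0 eO] : nbhs x Omega by exact: open_nbhs_nbhs.
have e20 : 0 < e / 2 by rewrite divr_gt0.
have sk_cvg : s / 2 ^+ k @[k --> \oo] --> (0 : R).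
  rewrite -[X in _ --> X](mulr0 s); apply: cvgM; first exact: cvg_cst.
  under eq_fun do rewrite -exprVn; apply: cvg_expr.
  by rewrite ger0_norm// invf_lt1// ltr1n.
have [K0 _ K0P] : \forall k \near \oo, s / 2 ^+ k < e / 2.
  move/cvgrPdist_lt: sk_cvg => /(_ _ e20); apply: filterS => k.
  by rewrite sub0r normrN; apply: le_lt_trans; exact: ler_norm.
exists K0 => K KK; have {K0P} sK := K0P K KK.
rewrite big_ord_recr/= mulrDr [leRHS]addrC.
apply: (le_trans (ler_distD (moll (a * (s / 2 ^+ K)) f (z K)) _ _)); apply: lerD; last exact: tele.
set w := s / 2 ^+ K; have w0 : 0 < w by rewrite divr_gt0// exprn_gt0.
have cw : w <= w / c by rewrite ler_peMr// ltW.
have aw : a * w <= w / 64.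
  have : a * w <= 1 / 64 * w; last by lra.
  by rewrite ler_wpM2r ?(ltW w0)// (le_trans a_le)// ler_pM2r ?invr_gt0.
have aww : w + a * w <= 2 * w by move: aw w0; lra.
rewrite distrC; apply: (@le_trans _ _ (S * (a * w) ^- n.+1 * mass g x (w + a * w) * w)).
  apply: moll_lipschitz => //; [exact: mulr_gt0|by rewrite distrC zx|].
  move=> u ux; apply: eO; rewrite -ball_normE/= distrC.
  apply: (le_lt_trans ux); apply: (le_lt_trans aww).
  by rewrite mulrC -ltr_pdivlMr.
apply: scale_term => //.
- by rewrite divr_ge0// ltW.
- apply: (le_trans cw); rewrite [leRHS]mulrAC ler_pM2r ?invr_gt0//; move: w0; lra.
- exact: mass_ge0.
apply: le_mass => //; rewrite subrr normr0 add0r (le_trans aww)//.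
rewrite (_ : 10 / c * w = 10 * (w / c)); last by rewrite mulrAC mulrA.
by move: cw w0; move: (w / c) => p; lra.
Qed.

Let riesz x lam t : \bar R := (\sum_(k <oo) (riesz_term g x lam t k)%:E)%E.

Let riesz_ge0 x lam t : 0 < t -> (0 <= riesz x lam t)%E.
Proof. by move=> t0; apply: nneseries_ge0 => k _ _; rewrite lee_fin riesz_term_ge0. Qed.

(** The mollifications converge along one sequence of radii [r], whose terms are eventually of the
    form a s/2^K with K as large as desired. *)
Let half_limit (x z : E) (s : R) (r : nat -> R) : 0 < s ->
  (exists K0 : nat, forall K, (K0 <= K)%N ->
      `|moll (a * (s / 2 ^+ K)) f x - moll (a * s) f z| <=
      C0 * (3 / c) * \sum_(k < K.+1) riesz_term g x (10 / c) s k) ->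
  moll (r k) f x @[k --> \oo] --> f x ->
  (forall K0 : nat, \forall k \near \oo, exists2 K, (K0 <= K)%N & r k = a * (s / 2 ^+ K)) ->
  (`|f x - moll (a * s) f z|%:E <= (C0 * (3 / c))%:E * riesz x (10 / c) s)%E.
Proof.
move=> s0 [K0 H] fx /(_ K0) rK; apply/lee_addgt0Pr => e e0.
have c30 : 0 <= C0 * (3 / c) by rewrite mulr_ge0// divr_ge0// ltW.
move/cvgrPdist_le : fx => /(_ _ e0) fx.
have [k [fk [K KK rE]]] := filter_ex (filterI fx rK).
apply: (@le_trans _ _ (e + C0 * (3 / c) * \sum_(k < K.+1) riesz_term g x (10 / c) s k)%:E).
  rewrite lee_fin (le_trans (ler_distD (moll (r k) f x) _ _))// lerD// rE; exact: H.
rewrite EFinD addeC leeD2r// EFinM lee_wpmul2l ?lee_fin//.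
rewrite -sumEFin -(big_mkord xpredT (fun k => (riesz_term g x (10 / c) s k)%:E)).
by apply: nneseries_lim_ge => j _; rewrite lee_fin riesz_term_ge0.
Qed.

(** The freedom of [s] between |x-y|/4 and |x-y|/2 allows all radii to be taken from one dyadic
    sequence that is common to all pairs of points. *)
Lemma pointwise_estimate (x y : E) (s : R) (r : nat -> R) : Omega x -> Omega y ->
  `|x - y| / 4 <= s -> s <= `|x - y| / 2 -> 0 < s ->
  moll (r k) f x @[k --> \oo] --> f x -> moll (r k) f y @[k --> \oo] --> f y ->
  (forall K0 : nat, \forall k \near \oo, exists2 K, (K0 <= K)%N & r k = a * (s / 2 ^+ K)) ->
  (`|f x - f y|%:E <= curve_const%:E * (riesz x (10 / c) s + riesz y (10 / c) s))%E.
Proof.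
move=> Ox Oy s4 s2 s0 fx fy rK.
have [z [zx zb zz]] := half_estimate Ox Oy s0 s2.
have [|z' [zx' zb' zz']] := half_estimate Oy Ox s0; first by rewrite distrC.
have hx := half_limit s0 zz fx rK; have hy := half_limit s0 zz' fy rK.
have cs : s <= s / c by rewrite ler_peMr// ltW.
have ca : a * s <= s / 64.
  have : a * s <= 1 / 64 * s; last by lra.
  by rewrite ler_wpM2r ?(ltW s0)// (le_trans a_le)// ler_pM2r ?invr_gt0.
have dzz : `|z - z'| <= 6 * s.
  have := ler_distD x z z'; have := ler_distD y x z'.
  by rewrite [`|z - x|]distrC zx zx'; move: s4; lra.
have dzc : `|z - z'| / c <= 6 * (s / c) by rewrite [leRHS]mulrA ler_pM2r ?invr_gt0.
have hm : (`|moll (a * s) f z - moll (a * s) f z'|%:E <= (C0 * (6 / c))%:E * riesz x (10 / c) s)%E.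
  apply: (@le_trans _ _ (C0 * (6 / c) * riesz_term g x (10 / c) s 0)%:E).
    rewrite lee_fin; apply: (le_trans (@moll_curve z z' (c * s / 2) (a * s) _ _ _ _ _)) => //.
    - by rewrite divr_gt0// mulr_gt0.
    - exact: mulr_gt0.
    - have : 0 < c * (c * s) by rewrite !mulr_gt0.
      rewrite /a expr2; lra.
    rewrite /riesz_term expr0 divr1; apply: scale_term => //.
    - by rewrite divr_ge0// ltW.
    - by rewrite -mulrA [c^-1 * s]mulrC.
    - exact: mass_ge0.
    apply: le_mass => //; rewrite distrC zx.
    rewrite (_ : 10 / c * s = 10 * (s / c)); last by rewrite mulrAC mulrA.
    by move: dzc cs ca; move: (_ / c) (s / c) (a * s) => p q o; lra.
  rewrite EFinM lee_wpmul2l//; first by rewrite lee_fin mulr_ge0// divr_ge0// ltW.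
  apply: le_trans (nneseries_lim_ge 1 _); first by rewrite big_nat1.
  by move=> j _; rewrite lee_fin riesz_term_ge0.
apply: (@le_trans _ _ (`|f x - moll (a * s) f z|%:E + (`|moll (a * s) f z - moll (a * s) f z'|%:E +
   `|f y - moll (a * s) f z'|%:E))%E).
  rewrite -!EFinD lee_fin (le_trans (ler_distD (moll (a * s) f z) _ _))// lerD2l.
  by rewrite [`|f y - _|]distrC ler_distD.
apply: (le_trans (leeD hx (leeD hm hy))).
have r0 := riesz_ge0 x (10 / c) s0; have r0' := riesz_ge0 y (10 / c) s0.
have c3 : 0 <= C0 * (3 / c) by rewrite mulr_ge0// divr_ge0// ltW.
have c6 : 0 <= C0 * (6 / c) by rewrite mulr_ge0// divr_ge0// ltW.
have -> : curve_const = C0 * (3 / c) + C0 * (6 / c) by rewrite /curve_const -/C0; lra.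
exact: (combine_bounds r0 r0' c3 c6).
Qed.

End pointwise_estimate.

(** * The upper bound *)

Section series_bound.
Context (R : realType).
Local Open Scope ereal_scope.

Lemma nneseries_le_bound (u : nat -> \bar R) (M : \bar R) : (forall k, 0 <= u k) ->
  (forall K, \sum_(0 <= k < K) u k <= M) -> \sum_(k <oo) u k <= M.
Proof.
by move=> u0 uM; apply: lime_le; [exact: is_cvg_nneseries|exact: nearW].
Qed.

Lemma dyadic_sum_le (t : R) : (0 <= t)%R -> \sum_(k <oo) (t / 2 ^+ k)%:E <= (2 * t)%:E.
Proof.
move=> t0; apply: nneseries_le_bound => [k|K].
  by rewrite lee_fin divr_ge0// exprn_ge0.
suff -> : \sum_(0 <= k < K) (t / 2 ^+ k)%:E = (2 * t - 2 * (t / 2 ^+ K))%:E.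
  by rewrite lee_fin gerBl mulr_ge0// divr_ge0// exprn_ge0.
elim: K => [|K IH]; first by rewrite big_nil expr0 divr1 subrr.
rewrite big_nat_recr//= IH -EFinD exprS invfM; congr EFin.
by move: (_ ^-1)%R => a; lra.
Qed.

Lemma integral_indicl d (T : measurableType d) (mu : {measure set T -> \bar R}) (A : set T)
    (h : T -> \bar R) : \int[mu]_(x in A) h x = \int[mu]_x ((\1_A x)%:E * h x).
Proof.
rewrite integral_mkcond; apply: eq_integral => x _; rewrite patchE indicE.
by case: (x \in A); rewrite ?mul1e ?mul0e.
Qed.

Lemma indic_iff T T' (A : set T) (A' : set T') x y : (A x <-> A' y) ->
  \1_A x = \1_A' y :> R.
Proof.
move=> AA'; rewrite !indicE; congr (_%:R); congr nat_of_bool.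
by apply/idP/idP => /set_mem/AA' h; exact: mem_set.
Qed.

End series_bound.

Lemma cancel_weights (R : realType) (a b c d w : R) : a * b = 1 ->
  c * a * (d * b) * w = d * (c * w).
Proof. by move=> ab; rewrite (_ : _ * w = (a * b) * (d * (c * w))); [rewrite ab mul1r|lra]. Qed.

(** * L^q bounds for the dyadic Riesz potential *)

Section riesz_bound.
Context (R : realType) (n : nat).
Local Notation E := 'rV[R]_n.+1.
Local Notation B := (borel_space R n).
Local Notation mu := (@lebB R n).
Variables (g : E -> R) (q : R).
Hypotheses (L1g : L1 g) (g0 : forall y, 0 <= g y) (q1 : 1 <= q).
Local Open Scope ereal_scope.

Definition riesz (x : E) (lam t : R) : \bar R := \sum_(k <oo) (riesz_term g x lam t k)%:E.

Let mg : measurable_fun [set: B] (g : B -> R).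
Proof. exact: L1_measurable. Qed.

Let Q (s : R) : set E := [set w : E | (`|w - 0| < s)%R].

Let mQ s : measurable (Q s : set B).
Proof. exact: measurable_norm_lt. Qed.

Lemma mass_shiftE x s :
  (mass g x s)%:E = \int[mu]_w ((g ((w : E) + x))%:E * (\1_(Q s) w)%:E).
Proof.
rewrite massE// integral_indicl.
pose F (y : E) := (\1_[set y : E | (`|y - x| < s)%R] y)%:E * (g y)%:E.
have mF : measurable_fun [set: B] (F : B -> \bar R).
  apply: emeasurable_funM; last exact/measurable_EFinP.
  by apply/measurable_EFinP; apply: measurable_indic; exact: measurable_norm_lt.
rewrite -[LHS](ge0_integral_shift x mF); last first.
  by move=> y; rewrite mule_ge0 ?lee_fin// indicE.
apply: eq_integral => w _; rewrite /F muleC; congr (_ * _%:E).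
by apply: indic_iff; rewrite /Q /= addrK subr0.
Qed.

Let mgs x : measurable_fun [set: B] (fun w : B => (g ((w : E) + x))%:E).
Proof. by apply/measurable_EFinP; exact: measurable_shift_fun. Qed.

Lemma mass_jensen x s : (0 < s)%R ->
  (mass g x s)%:E `^ q <= (((2 * s) ^+ n.+1) `^ (q - 1))%:E *
    \int[mu]_w ((g ((w : E) + x))%:E `^ q * (\1_(Q s) w)%:E).
Proof.
move=> s0; rewrite mass_shiftE; apply: jensen_poweR => //.
- by move=> w; rewrite lee_fin.
- by rewrite exprn_gt0// mulr_gt0.
rewrite integral_indic ?setIT//; exact: lebB_cube_le.
Qed.

Let tk0 (t : R) k : (0 < t)%R -> (0 < t / 2 ^+ k)%R.
Proof. by move=> t0; rewrite divr_gt0// exprn_gt0. Qed.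

Let invX_ge0 (d : R) : (0 < d)%R -> (0 <= d ^- n.+1)%R.
Proof. by move=> d0; rewrite invr_ge0 exprn_ge0// ltW. Qed.

(** Jensen's inequality twice: for the sum over k, with counting measure and weights t/2^k of total
    mass at most 2t, and for the integral over each cube. *)
Lemma riesz_jensen x lam t : (0 < t)%R -> (0 < lam)%R ->
  riesz x lam t `^ q <= ((2 * t) `^ (q - 1) * ((2 * lam) ^+ n.+1) `^ (q - 1))%:E *
    \sum_(k <oo) (((t / 2 ^+ k) ^- n.+1 * (t / 2 ^+ k))%:E *
      \int[mu]_w ((g ((w : E) + x))%:E `^ q * (\1_(Q (lam * (t / 2 ^+ k))) w)%:E)).
Proof.
move=> t0 lam0.
pose h (k : nat) : \bar R := ((t / 2 ^+ k) ^- n.+1 * mass g x (lam * (t / 2 ^+ k)))%:E.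
have h0 k : 0 <= h k by rewrite lee_fin mulr_ge0 ?invX_ge0 ?tk0 ?mass_ge0.
pose I k := \int[mu]_w ((g ((w : E) + x))%:E `^ q * (\1_(Q (lam * (t / 2 ^+ k))) w)%:E).
have I0 k : 0 <= I k by apply: integral_ge0 => w _; rewrite mule_ge0 ?poweR_ge0// lee_fin.
have -> : riesz x lam t = \int[counting]_k (h k * (t / 2 ^+ k)%:E).
  rewrite ge0_integral_count; last first.
    by move=> k; rewrite mule_ge0// lee_fin ltW// tk0.
  apply: eq_eseriesr => k _; rewrite /riesz_term /h -EFinM; congr EFin.
  by rewrite mulrAC.
apply: (le_trans (@jensen_poweR _ _ _ _ h (fun k => t / 2 ^+ k)%R (2 * t)%R q _ _ h0 _ _ q1 _)) => //.
- by move=> k; rewrite ltW// tk0.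
- by rewrite mulr_gt0.
- rewrite ge0_integral_count; first exact: dyadic_sum_le (ltW t0).
  by move=> k; rewrite lee_fin ltW// tk0.
rewrite ge0_integral_count; last first.
  by move=> k; rewrite mule_ge0 ?poweR_ge0// lee_fin ltW// tk0.
rewrite EFinM -muleA; apply: lee_wpmul2l; first by rewrite lee_fin powR_ge0.
rewrite -nneseriesZl; last first.
  move=> k _; apply: mule_ge0; last exact: I0.
  by rewrite lee_fin; apply: mulr_ge0; [exact/invX_ge0/tk0|exact/ltW/tk0].
apply: lee_nneseries => [k _ _|k _].
  by rewrite mule_ge0 ?poweR_ge0// lee_fin ltW// tk0.
set w := (t / 2 ^+ k)%R; have w0 : (0 < w)%R by exact: tk0.
have lw0 : (0 < lam * w)%R by exact: mulr_gt0.
have q0 : (0 <= q)%R by exact: le_trans q1.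
have -> : h k `^ q = ((w ^- n.+1) `^ q)%:E * (mass g x (lam * w))%:E `^ q.
  by rewrite /h -/w EFinM poweRM ?lee_fin ?invX_ge0 ?mass_ge0// poweR_EFin.
apply: (@le_trans _ _ (((w ^- n.+1) `^ q)%:E * ((((2 * (lam * w)) ^+ n.+1) `^ (q - 1))%:E * I k) * w%:E)).
  rewrite lee_wpmul2r ?lee_fin ?(ltW w0)// lee_wpmul2l ?lee_fin ?powR_ge0//.
  exact: mass_jensen.
rewrite -/(I k); rewrite muleA -EFinM muleAC -EFinM muleA -EFinM lee_wpmul2r//.
rewrite lee_fin le_eqVlt; apply/orP; left; apply/eqP.
have -> : ((w ^- n.+1) `^ q = w ^- n.+1 * (w ^- n.+1) `^ (q - 1))%R.
  rewrite -[X in (X * _)%R]powRr1 ?invX_ge0// -powRD; first by rewrite addrC subrK.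
  by apply/implyP => _; rewrite invr_neq0// expf_neq0// gt_eqF.
rewrite [(2 * (lam * w))%R]mulrA [((2 * lam * w) ^+ _)%R]exprMn powRM ?exprn_ge0 ?mulr_ge0 ?(ltW lam0) ?(ltW w0)//.
have p1 : ((w ^- n.+1) `^ (q - 1) * (w ^+ n.+1) `^ (q - 1) = 1)%R.
  rewrite -powRM ?invX_ge0 ?exprn_ge0 ?(ltW w0)// mulVf ?powR1// expf_neq0// gt_eqF//.
by apply: cancel_weights p1.
exact: ltW.
Qed.

Lemma measurable_riesz (z : E) lam t : (0 < t)%R ->
  measurable_fun setT (fun x : B => riesz ((x : E) + z)%R lam t).
Proof.
move=> t0; rewrite /riesz.
apply: (@ge0_emeasurable_sum _ _ _ _ (fun k (x : B) => (riesz_term g ((x : E) + z)%R lam t k)%:E) xpredT).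
  by move=> k x _ _; rewrite lee_fin riesz_term_ge0.
move=> k _; rewrite /riesz_term; under eq_fun do rewrite EFinM.
apply: measurable_funeM.
pose H (x w : B) := (g ((w : E) + ((x : E) + z)))%:E * (\1_(Q (lam * (t / 2 ^+ k))) w)%:E.
rewrite (_ : (fun _ => _) = fun x => \int[mu]_w H x w); last first.
  by apply/funext => x; rewrite mass_shiftE.
apply: (@measurable_integral2 _ _ B B R mu H); last first.
  by move=> x w; rewrite mule_ge0// lee_fin.
apply: emeasurable_funM.
  apply/measurable_EFinP; apply: (measurableT_comp mg); apply: measurable_vadd => //.
  by apply: measurable_vadd => //; exact: measurable_cst.
apply/measurable_EFinP.
exact: (measurableT_comp (measurable_indic (mQ (lam * (t / 2 ^+ k)))) measurable_snd).
Qed.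

(** After Tonelli's theorem the integral over x for fixed w is at most [M], because [M] bounds all
    translates. The volume of the k-th cube cancels (t/2^k)^-(n+1), and the remaining weights t/2^k
    sum to at most 2t. *)
Lemma riesz_Lq (A : set E) (M : \bar R) (z : E) lam t : measurable (A : set B) ->
  (forall v, \int[mu]_x ((\1_A x)%:E * (g ((x : E) + v))%:E `^ q) <= M) ->
  (0 < t)%R -> (0 < lam)%R ->
  \int[mu]_x ((\1_A x)%:E * riesz ((x : E) + z)%R lam t `^ q) <=
   ((2 * t * (2 * lam) ^+ n.+1) `^ q)%:E * M.
Proof.
move=> mA AM t0 lam0.
have M0 : 0 <= M.
  by apply: (le_trans _ (AM 0%R)); apply: integral_ge0 => x _; rewrite mule_ge0 ?poweR_ge0.
have q0 : (0 <= q)%R by exact: le_trans q1.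
case: M AM M0 => [m||//]; [set M := m%:E|] => AM M0; last first.
  by rewrite gt0_muley ?leey// lte_fin powR_gt0// !mulr_gt0// exprn_gt0// mulr_gt0.
pose F k (x w : B) : \bar R := (\1_A x)%:E * ((g ((w : E) + ((x : E) + z)))%:E `^ q *
   (\1_(Q (lam * (t / 2 ^+ k))) w)%:E).
have F0 k x w : 0 <= F k x w by rewrite !mule_ge0 ?poweR_ge0 ?lee_fin// indicE.
have mF k : measurable_fun setT (fun p : B * B => F k p.1 p.2).
  apply: emeasurable_funM.
    by apply/measurable_EFinP; exact: (measurableT_comp (measurable_indic mA) measurable_fst).
  apply: emeasurable_funM.
    apply: (measurableT_comp (measurable_poweR q)); apply/measurable_EFinP.
    apply: (measurableT_comp mg); apply: measurable_vadd => //.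
    by apply: measurable_vadd => //; exact: measurable_cst.
  apply/measurable_EFinP.
  exact: (measurableT_comp (measurable_indic (mQ (lam * (t / 2 ^+ k)))) measurable_snd).
set c := ((2 * t) `^ (q - 1) * ((2 * lam) ^+ n.+1) `^ (q - 1))%R.
have c0 : (0 <= c)%R by rewrite mulr_ge0// powR_ge0.
pose b k := ((t / 2 ^+ k) ^- n.+1 * (t / 2 ^+ k))%R.
have b0 k : (0 <= b k)%R by apply: mulr_ge0; [exact/invX_ge0/tk0|exact/ltW/tk0].
have J0 k x : 0 <= \int[mu]_w F k x w by apply: integral_ge0 => w _; exact: F0.
have mJ k : measurable_fun setT (fun x : B => \int[mu]_w F k x w).
  exact: (measurable_integral2 mu (mF k) (F0 k)).
have mterm k : measurable_fun setT (fun x : B => (b k)%:E * \int[mu]_w F k x w).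
  exact: measurable_funeM.
have t_ge0 k x : 0 <= (b k)%:E * \int[mu]_w F k x w by rewrite mule_ge0// lee_fin.
have msum : measurable_fun setT (fun x : B => \sum_(k <oo) ((b k)%:E * \int[mu]_w F k x w)).
  by apply: (@ge0_emeasurable_sum _ _ _ _ _ xpredT).
have mriesz := measurable_riesz z lam t0.
apply: (@le_trans _ _ (\int[mu]_x (c%:E * \sum_(k <oo) ((b k)%:E * \int[mu]_w F k x w)))).
  apply: ge0_le_integral => //.
  - by move=> x _; rewrite mule_ge0 ?poweR_ge0.
  - apply: emeasurable_funM; first by apply/measurable_EFinP.
    exact: (measurableT_comp (measurable_poweR q)).
  - exact: measurable_funeM.
  move=> x _; rewrite indicE; case: (boolP (x \in A)) => xA; last first.
    by rewrite mul0e mule_ge0 ?lee_fin// nneseries_ge0.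
  rewrite mul1e; apply: (le_trans (riesz_jensen _ t0 lam0)).
  rewrite lee_wpmul2l ?lee_fin//; apply: lee_nneseries => [k _ _|k _].
    rewrite mule_ge0 ?lee_fin ?b0//; apply: integral_ge0 => w _.
    by rewrite mule_ge0 ?poweR_ge0 ?lee_fin.
  rewrite lee_wpmul2l ?lee_fin ?b0// le_eqVlt; apply/orP; left; apply/eqP.
  by apply: eq_integral => w _; rewrite /F [\1_A x]indicE xA mul1e.
rewrite ge0_integralZl//; last by move=> x _; rewrite nneseries_ge0.
rewrite integral_nneseries//.
apply: (@le_trans _ _ (c%:E * \sum_(k <oo) ((t / 2 ^+ k)%:E * (((2 * lam) ^+ n.+1)%:E * M)))).
  rewrite lee_wpmul2l ?lee_fin//; apply: lee_nneseries => [k _ _|k _].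
    by apply: integral_ge0.
  rewrite ge0_integralZl ?lee_fin//.
  rewrite (integral_swap mu mu (mF k) (F0 k)).
  apply: (@le_trans _ _ ((b k)%:E * \int[mu]_w ((\1_(Q (lam * (t / 2 ^+ k))) w)%:E * M))).
    rewrite lee_wpmul2l ?lee_fin//; apply: ge0_le_integral => //.
    - by move=> w _; exact: integral_ge0.
    - exact: (measurable_integral1 mu (mF k) (F0 k)).
    - by apply: emeasurable_funM => //; apply/measurable_EFinP.
    move=> w _; rewrite /F.
    under eq_integral do rewrite muleCA [X in _ * X]muleC -?muleA.
    rewrite (_ : \int[mu]_x _ = (\1_(Q (lam * (t / 2 ^+ k))) w)%:E *
       \int[mu]_x ((\1_A x)%:E * (g ((x : E) + (w + z)))%:E `^ q)).
      by rewrite lee_wpmul2l// lee_fin.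
    rewrite -ge0_integralZl//; last first.
    - by move=> x _; rewrite mule_ge0 ?poweR_ge0.
    - apply: emeasurable_funM; first by apply/measurable_EFinP.
      exact: (measurableT_comp (measurable_poweR q) (mgs _)).
    apply: eq_integral => x _; rewrite (_ : (w + (x + z) = x + (w + z))%R); last by rewrite addrCA.
    by rewrite muleCA; congr (_ * _); rewrite muleC.
  rewrite ge0_integralZr//; last by apply/measurable_EFinP.
  rewrite integral_indic ?setIT//.
  set w := (t / 2 ^+ k)%R; have w0 : (0 < w)%R by exact: tk0.
  rewrite muleA [leRHS]muleA; apply: lee_wpmul2r => //.
  apply: (@le_trans _ _ ((b k)%:E * ((2 * (lam * w)) ^+ n.+1)%:E)).
    rewrite lee_wpmul2l ?lee_fin//; apply: lebB_cube_le; exact: mulr_gt0.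
  rewrite -!EFinM lee_fin /b -/w mulrA [((2 * lam * w) ^+ _)%R]exprMn.
  have := mulVf (_ : w ^+ n.+1 != 0)%R; rewrite expf_neq0 ?gt_eqF// => /(_ isT).
  by move=> ww; rewrite [X in (_ * X <= _)%R]mulrC mulrACA ww mul1r.
rewrite (_ : \sum_(k <oo) _ = (\sum_(k <oo) (t / 2 ^+ k)%:E) * (((2 * lam) ^+ n.+1)%:E * M)); last first.
  rewrite [RHS]muleC /M -EFinM -nneseriesZl; first by apply: eq_eseriesr => k _; rewrite muleC.
  by move=> k _; rewrite lee_fin ltW// tk0.
have L0 : (0 <= (2 * lam) ^+ n.+1)%R by rewrite exprn_ge0// mulr_ge0// ltW.
apply: (@le_trans _ _ (c%:E * ((2 * t)%:E * (((2 * lam) ^+ n.+1)%:E * M)))).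
  rewrite lee_wpmul2l ?lee_fin// lee_wpmul2r ?dyadic_sum_le ?(ltW t0)//.
  by rewrite mule_ge0.
rewrite !muleA; apply: lee_wpmul2r => //; rewrite -!EFinM lee_fin le_eqVlt; apply/orP; left; apply/eqP.
have t20 : (0 < 2 * t)%R by rewrite mulr_gt0.
have L20 : (0 < (2 * lam) ^+ n.+1)%R by rewrite exprn_gt0// mulr_gt0.
rewrite powRM ?(ltW t20)// /c.
have pq (y : R) : (0 < y)%R -> (y `^ q = y * y `^ (q - 1))%R.
  move=> y0; rewrite -[X in (X * _)%R]powRr1 ?(ltW y0)// -powRD; first by rewrite addrC subrK.
  by apply/implyP => _; rewrite gt_eqF.
rewrite (pq _ t20) (pq _ L20).
move: (2 * t)%R (_ ^+ _)%R (_ `^ _)%R (_ `^ _)%R => x y u v; lra.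
Qed.

End riesz_bound.

Lemma ae_integral_le_comb d (T : measurableType d) (R : realType) (mu : {measure set T -> \bar R})
    (h u v : T -> \bar R) (K : R) : (0 <= K)%R ->
  measurable_fun setT h -> measurable_fun setT u -> measurable_fun setT v ->
  (forall x, 0 <= h x)%E -> (forall x, 0 <= u x)%E -> (forall x, 0 <= v x)%E ->
  {ae mu, forall x, (h x <= K%:E * u x + K%:E * v x)%E} ->
  (\int[mu]_x h x <= K%:E * \int[mu]_x u x + K%:E * \int[mu]_x v x)%E.
Proof.
move=> K0 mh mu_ mv h0 u0 v0 le_h.
have Ku x : (0 <= K%:E * u x)%E by rewrite mule_ge0.
have Kv x : (0 <= K%:E * v x)%E by rewrite mule_ge0.
rewrite -!ge0_integralZl ?lee_fin// -ge0_integralD//; last 2 first.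
- exact: measurable_funeM.
- exact: measurable_funeM.
apply: ae_ge0_le_integral => //.
- by move=> x _; exact: adde_ge0.
- by apply: emeasurable_funD; exact: measurable_funeM.
by apply: filterS le_h => x hx _.
Qed.

(** * The energy as an integral over increments *)

Section difference_quotients.
Context (R : realType) (n : nat).
Local Notation E := 'rV[R]_n.+1.
Local Notation B := (borel_space R n).
Local Notation mu := (@lebB R n).
Variables (Omega : set E) (f : E -> R).
Hypotheses (oO : open Omega) (mf : measurable_fun [set: B] (f : B -> R)).

(** Indexed by the increment z instead of y = x + z, so that translation estimates apply for fixed
    z. *)
Definition osc (x z : E) : R := \1_Omega x * \1_Omega (x + z) * `|f (x + z) - f x|.

Lemma osc_ge0 x z : 0 <= osc x z.
Proof. by rewrite !mulr_ge0// indicE. Qed.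

Let mO : measurable (Omega : set B).
Proof. exact: measurable_open_borel. Qed.

Lemma measurable_osc : measurable_fun setT (fun a : B * B => osc a.1 a.2).
Proof.
have madd : measurable_fun setT ((fun a : B * B => (a.1 : E) + a.2) : B * B -> B).
  exact: measurable_vadd.
apply: measurable_funM.
  apply: measurable_funM.
    exact: (measurableT_comp (measurable_indic mO) measurable_fst).
  exact: (measurableT_comp (measurable_indic mO) madd).
apply: measurableT_comp => //; apply: measurable_funB.
  exact: (measurableT_comp mf madd).
exact: (measurableT_comp mf measurable_fst).
Qed.

Lemma measurable_osc_left z : measurable_fun [set: B] (fun x : B => osc x z).
Proof.
by apply: (measurableT_comp (f := fun a : B * B => osc a.1 a.2) (g := pair^~ z));
  [exact: measurable_osc|exact: measurable_pair2].
Qed.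

Lemma measurable_osc_quotient (p : R) :
  measurable_fun setT (fun a : B * B => ((osc a.1 a.2 / enorm (a.2 : E)) `^ p)%:E).
Proof.
apply/measurable_EFinP; apply: (measurableT_comp (measurable_powR p)).
apply: measurable_funM; first exact: measurable_osc.
apply: (measurableT_comp (@measurable_inv R setT)).
exact: (measurableT_comp (@measurable_enorm R n) measurable_snd).
Qed.

Definition bbm_integral (p : R) (phi : R -> R) (x : E) : \bar R :=
  (\int[mu]_(y in Omega)
     (`|f x - f y| `^ p / enorm (x - y) `^ p * phi (enorm (x - y)))%:E)%E.

Lemma div_powR (a b p : R) : 0 <= a -> 0 <= b -> (a / b) `^ p = a `^ p / b `^ p.
Proof.
move=> a0 b0; rewrite powRM ?invr_ge0//; congr (_ * _).
by rewrite -(powR_inv1 b0) -powRrM mulN1r powRN.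
Qed.

Lemma measurable_radial (phi : R -> R) : radial_profile phi ->
  measurable_fun [set: B] (fun z : B => phi (enorm (z : E))).
Proof. by case=> mphi _ _ _; apply: (measurableT_comp mphi); exact: measurable_enorm. Qed.

(** The substitution y = x + z; the indicator of [Omega] may be moved inside the p-th power because
    p > 0. *)
Lemma bbm_integralE (p : R) (phi : R -> R) x : 0 < p -> radial_profile phi -> Omega x ->
  bbm_integral p phi x =
  (\int[mu]_z (((osc x (z : E) / enorm (z : E)) `^ p)%:E * (phi (enorm (z : E)))%:E))%E.
Proof.
move=> p0 rphi Ox; rewrite /bbm_integral integral_indicl.
pose F (y : E) := ((\1_Omega y)%:E *
  (`|f x - f y| `^ p / enorm (x - y) `^ p * phi (enorm (x - y)))%:E)%E.
have menx : measurable_fun [set: B] (fun y : B => enorm (x - (y : E))).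
  by apply: (measurableT_comp (@measurable_enorm R n)); apply: measurable_vsub.
have [mphi phi0 _ _] := rphi.
have mF : measurable_fun [set: B] (F : B -> \bar R).
  apply: emeasurable_funM; first by apply/measurable_EFinP; exact: measurable_indic.
  apply/measurable_EFinP; apply: measurable_funM; last exact: (measurableT_comp mphi).
  apply: measurable_funM.
    apply: (measurableT_comp (measurable_powR p)); apply: measurableT_comp => //.
    exact: measurable_funB.
  apply: (measurableT_comp (@measurable_inv R setT)).
  exact: (measurableT_comp (measurable_powR p)).
rewrite -[LHS](ge0_integral_shift x mF); last first.
  by move=> y; rewrite mule_ge0 ?lee_fin ?mulr_ge0 ?invr_ge0 ?powR_ge0// indicE.
apply: eq_integral => z _; rewrite /F /osc.
have -> : x - (z + x) = - z by rewrite opprD addrCA subrr addr0.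
rewrite enormN [x + z]addrC distrC -!EFinM; congr EFin.
rewrite [\1_Omega x]indicE mem_set// mul1r.
have pos : 0 <= \1_Omega (z + x) * `|f (z + x) - f x| by rewrite mulr_ge0// indicE.
rewrite (div_powR p pos (enorm_ge0 _)).
rewrite indicE; case: (_ \in _); first by rewrite !mul1r.
by rewrite !mul0r powR0 ?gt_eqF// !mul0r.
Qed.

End difference_quotients.

Lemma osc_const_arith (R : realType) (q C L t : R) : 0 <= C -> 0 <= L -> 0 <= t ->
  C `^ q * 2 `^ q * (2 * t * L) `^ q + C `^ q * 2 `^ q * (2 * t * L) `^ q =
  2 * (2 * C * (2 * L)) `^ q * t `^ q.
Proof.
move=> C0 L0 t0; have two0 : (0 : R) <= 2 by exact: ler0n.
have L20 : 0 <= 2 * L by exact: mulr_ge0.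
have C20 : 0 <= 2 * C by exact: mulr_ge0.
rewrite (_ : 2 * t * L = 2 * L * t); last by rewrite mulrAC.
rewrite [(2 * L * t) `^ q]powRM// [(2 * C * (2 * L)) `^ q]powRM// [(2 * C) `^ q]powRM//.
by move: (C `^ q) (2 `^ q) ((2 * L) `^ q) (t `^ q) => u v w z; lra.
Qed.

(** * Energy bounds from gradient bounds on all translates *)

Section upper_bound.
Context (R : realType) (n : nat).
Local Notation E := 'rV[R]_n.+1.
Local Notation B := (borel_space R n).
Local Notation mu := (@lebB R n).
Variables (Omega : set E) (f : E -> R) (G : 'I_n.+1 -> E -> R) (g : E -> R) (c D q : R).
Hypotheses (oO : open Omega) (L1f : L1 f) (L1G : forall i, L1 (G i)) (L1g : L1 g).
Hypotheses (Gg : forall i y, `|G i y| <= g y).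
Hypothesis weakG : forall i, weak_test Omega i f (G i).
Hypotheses (c0 : 0 < c) (c1 : c <= 1) (unif : uniform_domain c Omega).
Hypotheses (D0 : 0 < D) (OD : forall x, Omega x -> `|x| <= D) (q1 : 1 <= q).

Let g0 y : 0 <= g y.
Proof. exact: le_trans (Gg 0 y). Qed.

Let mf : measurable_fun [set: B] (f : B -> R).
Proof. exact: L1_measurable. Qed.

Let mO : measurable (Omega : set B).
Proof. exact: measurable_open_borel. Qed.

(** Termwise, with w and v the k-th scales of s and t: w >= v/4 costs the factor 4^(n+1), and w <=
    v/2 places the cube of radius (10/c) w inside that of radius (5/c) v. *)
Let riesz_scale x t s : 0 < s -> t / 4 <= s -> s <= t / 2 ->
  (riesz g x (10 / c) s <= (4 ^+ n.+1)%:E * riesz g x (5 / c) t)%E.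
Proof.
move=> s0 ts st; have t0 : 0 < t by move: s0 st; lra.
rewrite /riesz -nneseriesZl; last by move=> k _; rewrite lee_fin riesz_term_ge0.
apply: lee_nneseries => [k _ _|k _]; first by rewrite lee_fin riesz_term_ge0.
rewrite -EFinM lee_fin /riesz_term [leRHS]mulrA [X in _ <= X * _]mulrA.
have p0 : 0 < (2 : R) ^+ k by rewrite exprn_gt0.
set w := s / 2 ^+ k; set v := t / 2 ^+ k.
have w0 : 0 < w by rewrite divr_gt0.
have v0 : 0 < v by rewrite divr_gt0.
have vw : v / 4 <= w by rewrite /v /w mulrAC ler_pM2r ?invr_gt0.
have wv : w <= v / 2 by rewrite /v /w [leRHS]mulrAC ler_pM2r ?invr_gt0.
apply: ler_pM.
- by rewrite mulr_ge0 ?invr_ge0 ?exprn_ge0// ltW.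
- exact: mass_ge0.
- apply: ler_pM; rewrite ?(ltW w0) ?invr_ge0 ?exprn_ge0 ?(ltW w0)//; last first.
    by move: wv v0; lra.
  have -> (u : R) : 4 ^+ n.+1 / u ^+ n.+1 = (u / 4) ^- n.+1.
    by rewrite expr_div_n invf_div.
  rewrite lef_pV2 ?posrE ?exprn_gt0 ?divr_gt0//.
  by rewrite lerXn2r ?nnegrE ?(ltW w0)// divr_ge0// ltW.
- apply: le_mass => //; rewrite subrr normr0 add0r.
  have : 0 <= c^-1 by rewrite invr_ge0 ltW.
  move=> ci; have := ler_wpM2l ci wv; lra.
Qed.

Definition diff_const : R := curve_const n c * 4 ^+ n.+1.

Lemma diff_const_ge0 : 0 <= diff_const.
Proof. by rewrite mulr_ge0 ?exprn_ge0// curve_const_ge0. Qed.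

(** The least j with D/2^j <= t/2; the lower bound follows from minimality, or from t <= 2D when j =
    0. *)
Let dyadic_scale (t : R) : 0 < t -> t <= 2 * D ->
  exists j : nat, t / 4 <= D / 2 ^+ j /\ D / 2 ^+ j <= t / 2.
Proof.
move=> t0 tD.
have ex : exists j : nat, D / 2 ^+ j <= t / 2.
  have cv : D / 2 ^+ k @[k --> \oo] --> (0 : R).
    rewrite -[X in _ --> X](mulr0 D); apply: cvgM; first exact: cvg_cst.
    under eq_fun do rewrite -exprVn; apply: cvg_expr.
    by rewrite ger0_norm// invf_lt1// ltr1n.
  have t2 : 0 < t / 2 by rewrite divr_gt0.
  move/cvgrPdist_lt : cv => /(_ _ t2)[j _ /(_ j (leqnn j))] /=.
  by rewrite sub0r normrN => h; exists j; rewrite (le_trans (ler_norm _))// ltW.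
have [j jP jmin] := ex_minnP ex; exists j; split=> //.
case: j jP jmin => [|j] jP jmin; first by rewrite expr0 divr1; move: t0 tD; lra.
have : t / 2 < D / 2 ^+ j by rewrite ltNge; apply/negP => /jmin; rewrite ltnn.
by rewrite exprS invfM; move: (2 ^+ j) => P; lra.
Qed.

(** The scales D/2^j do not depend on the pair, so a single almost everywhere convergent subsequence
    of mollifications serves all pairs. This is what allows one exceptional set for all x and y. *)
Lemma ae_pointwise_estimate : exists2 Z : set B, measurable Z /\ mu Z = 0%E &
  forall x y : E, ~ Z x -> ~ Z y -> Omega x -> Omega y -> x <> y ->
  (`|f x - f y|%:E <= diff_const%:E *
     (riesz g x (5 / c) (`|x - y|)%R + riesz g y (5 / c) (`|x - y|)%R))%E.
Proof.
pose d (k : nat) := c ^+ 2 / 64 * (D / 2 ^+ k).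
have d_gt0 k : 0 < d k by rewrite !mulr_gt0 ?invr_gt0 ?exprn_gt0.
have d_cvg : d k @[k --> \oo] --> (0 : R).
  rewrite -[X in _ --> X](mulr0 (c ^+ 2 / 64)); apply: cvgM; first exact: cvg_cst.
  rewrite -[X in _ --> X](mulr0 D); apply: cvgM; first exact: cvg_cst.
  under eq_fun do rewrite -exprVn; apply: cvg_expr.
  by rewrite ger0_norm// invf_lt1// ltr1n.
have [sig [sigk [Z [mZ Z0 Zsub]]]] := L1_cvg_ae_subsequence
  (fun k => measurable_moll (d_gt0 k) L1f) mf (moll_cvg_L1 d_gt0 d_cvg L1f).
exists Z => // x y Zx Zy Ox Oy xy.
have conv z : ~ Z z -> moll (d (sig k)) f z @[k --> \oo] --> f z.
  by move=> Zz; apply: contrapT => h; apply: Zz; exact: Zsub.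
have t0 : 0 < `|x - y| by rewrite normr_gt0 subr_eq0; apply/eqP.
have tD : `|x - y| <= 2 * D.
  by rewrite (le_trans (ler_normB _ _))// mulrDl mul1r lerD// OD.
have [j [js sj]] := dyadic_scale t0 tD.
have s0 : 0 < D / 2 ^+ j by rewrite divr_gt0// exprn_gt0.
have h := @pointwise_estimate R n Omega f G g c oO L1f L1G L1g Gg weakG c0 c1 unif x y
  (D / 2 ^+ j) (fun k => d (sig k)) Ox Oy js sj s0 (conv x Zx) (conv y Zy).
apply: (le_trans (h _)) => {h}.
  move=> K0; exists (K0 + j)%N => // k /= Kk; exists (sig k - j)%N.
    by rewrite leq_subRL ?(leq_trans _ (sigk k))// ?(leq_trans (leq_addl K0 j))// addnC.
  rewrite /d; congr (_ * _); rewrite -mulrA -invfM -exprD subnKC//.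
  by rewrite (leq_trans _ (sigk k))// (leq_trans (leq_addl K0 j)).
have dE : diff_const%:E = ((curve_const n c)%:E * (4 ^+ n.+1)%:E)%E by rewrite -EFinM.
rewrite dE -[leRHS]muleA; apply: lee_wpmul2l; first by rewrite lee_fin curve_const_ge0.
have r0 z t : 0 < t -> (0 <= riesz g z (5 / c) t)%E.
  by move=> t0'; apply: nneseries_ge0 => k _ _; rewrite lee_fin riesz_term_ge0.
by rewrite ge0_muleDr ?r0//; apply: leeD; exact: riesz_scale.
Qed.

Let Lam : R := (2 * (5 / c)) ^+ n.+1.

Definition osc_const : R := 2 * (2 * diff_const * (2 * Lam)) `^ q.

Lemma osc_const_ge0 : 0 <= osc_const.
Proof. by rewrite mulr_ge0// powR_ge0. Qed.

Let poweRD_le (a b : \bar R) : (0 <= a)%E -> (0 <= b)%E ->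
  ((a + b) `^ q <= (2 `^ q)%:E * (a `^ q) + (2 `^ q)%:E * (b `^ q))%E.
Proof.
move=> a0 b0; have q0 : 0 <= q by exact: le_trans q1.
rewrite -!poweR_EFin -!poweRM//.
have two0 (x : \bar R) : (0 <= x -> 0 <= 2%:E * x)%E by move=> x0; rewrite mule_ge0// lee_fin.
have dbl (x : \bar R) : (x + x = 2%:E * x)%E.
  by rewrite (_ : 2%:E = 1 + 1)%E// ge0_muleDl ?lee_fin// mul1e.
have [ab|ba] := leP a b.
  apply: (@le_trans _ _ ((2%:E * b) `^ q)%E); last by rewrite leeDr// poweR_ge0.
  by apply: ler_poweR; rewrite ?adde_ge0// -dbl leeD2r.
apply: (@le_trans _ _ ((2%:E * a) `^ q)%E); last by rewrite leeDl// poweR_ge0.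
by apply: ler_poweR; rewrite ?adde_ge0// -dbl leeD2l// ltW.
Qed.

Let poweRD_scale (C : R) (a b : \bar R) : 0 <= C -> (0 <= a)%E -> (0 <= b)%E ->
  ((C%:E * (a + b)) `^ q <=
    (C `^ q * 2 `^ q)%:E * (a `^ q) + (C `^ q * 2 `^ q)%:E * (b `^ q))%E.
Proof.
move=> C0 a0 b0; rewrite poweRM ?lee_fin ?adde_ge0// poweR_EFin EFinM.
have a1 : (0 <= a `^ q)%E by exact: poweR_ge0.
have b1 : (0 <= b `^ q)%E by exact: poweR_ge0.
have t1 : (0 <= (2 `^ q)%:E :> \bar R)%E by rewrite lee_fin powR_ge0.
have := poweRD_le a0 b0; move: ((a + b) `^ q)%E (a `^ q)%E (b `^ q)%E a1 b1 => s u v u0 v0 h.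
rewrite -!muleA -ge0_muleDr ?mule_ge0//.
by rewrite lee_wpmul2l// lee_fin powR_ge0.
Qed.

(** For fixed z the pointwise estimate holds off the null set [Z] and its translate by -z. The two
    potentials are bounded by [riesz_Lq] with the shifts 0 and z; both have scale |z|, which yields
    |z|^q. *)
Lemma osc_Lq (A : set E) (M : \bar R) (z : E) : measurable (A : set B) -> z <> 0 ->
  (forall v, \int[mu]_x ((\1_A x)%:E * (g ((x : E) + v))%:E `^ q) <= M)%E ->
  (\int[mu]_x ((\1_A x)%:E * (osc Omega f x z)%:E `^ q) <=
    (osc_const * `|z| `^ q)%:E * M)%E.
Proof.
move=> mA z0 AM; set t := `|z|; have t0 : 0 < t by rewrite normr_gt0; apply/eqP.
have [Z [mZ Z0] Zest] := ae_pointwise_estimate.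
have q0 : 0 <= q by exact: le_trans q1.
have lam0 : 0 < 5 / c by rewrite divr_gt0.
set H := riesz g ^~ (5 / c) ^~ t.
have H0 x : (0 <= H x)%E by apply: nneseries_ge0 => k _ _; rewrite lee_fin riesz_term_ge0.
have mH v : measurable_fun setT (fun x : B => H ((x : E) + v)) by exact: measurable_riesz.
have mHq v : measurable_fun setT (fun x : B => ((\1_A x)%:E * H ((x : E) + v)%R `^ q)%E).
  apply: emeasurable_funM; first by apply/measurable_EFinP; exact: measurable_indic.
  exact: (measurableT_comp (measurable_poweR q)).
have Hq0 v x : (0 <= (\1_A x)%:E * H (x + v)%R `^ q)%E by rewrite mule_ge0 ?poweR_ge0 ?lee_fin.
set C := diff_const; have C0 : 0 <= C by exact: diff_const_ge0.
pose K := ((C `^ q) * 2 `^ q)%R; have K0 : 0 <= K by rewrite mulr_ge0// powR_ge0.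
apply: (@le_trans _ _ (K%:E * (\int[mu]_x ((\1_A x)%:E * H ((x : E) + 0)%R `^ q)) +
    K%:E * (\int[mu]_x ((\1_A x)%:E * H ((x : E) + z)%R `^ q)))%E).
  apply: ae_integral_le_comb => //.
  - apply: emeasurable_funM; first by apply/measurable_EFinP; exact: measurable_indic.
    apply: (measurableT_comp (measurable_poweR q)); apply/measurable_EFinP.
    exact: measurable_osc_left.
  - by move=> x; rewrite mule_ge0 ?poweR_ge0 ?lee_fin.
  exists (Z `|` [set x : B | Z ((x : E) + z)]); split.
  - apply: measurableU => //.
    have := measurable_affine 1 z measurableT mZ; rewrite setTI.
    by congr (measurable _); apply/seteqP; split=> x /=; rewrite scale1r.
  - apply/eqP; rewrite -measure_le0; apply: (le_trans (measureU2 _ _ _)) => //.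
      have := measurable_affine 1 z measurableT mZ; rewrite setTI.
      by congr (measurable _); apply/seteqP; split=> x /=; rewrite scale1r.
    rewrite [X in (X + _)%E]Z0 add0e (_ : [set x : B | _] = [set x : E | Z (1 *: x + z)]); last first.
      by apply/seteqP; split=> x /=; rewrite scale1r.
    by have := lebB_affine z Z ltr01; rewrite Z0 mule0 => e; rewrite [leLHS]e.
  move=> x /= nh; apply: contrapT => /not_orP[Zx Zxz]; apply: nh.
  rewrite addr0 [X in (_ <= X + _)%E]muleCA [X in (_ <= _ + X)%E]muleCA.
  rewrite -ge0_muleDr ?mule_ge0 ?poweR_ge0 ?lee_fin//.
  rewrite lee_wpmul2l ?lee_fin//.
  apply: (@le_trans _ _ ((C%:E * (H x + H (x + z)%R)) `^ q)%E).
    rewrite -poweR_EFin; apply: ler_poweR => //; first by rewrite lee_fin osc_ge0.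
    rewrite /osc !indicE; case: (boolP (x \in Omega)) => [/set_mem Ox|_]; last first.
      by rewrite !mul0r mule_ge0 ?lee_fin// adde_ge0.
    case: (boolP ((x : E) + z \in Omega)) => [/set_mem Oxz|_]; last first.
      by rewrite mulr0 mul0r mule_ge0 ?lee_fin// adde_ge0.
    rewrite !mul1r distrC.
    have := Zest x (x + z) Zx Zxz Ox Oxz; rewrite opprD addNKr normrN; apply.
    by move=> /esym/eqP; rewrite -subr_eq0 addrC addKr => /eqP.
  exact: poweRD_scale.
have h v := riesz_Lq L1g g0 q1 v mA AM t0 lam0.
have M0 : (0 <= M)%E.
  by apply: (le_trans _ (AM 0)); apply: integral_ge0 => x _; rewrite mule_ge0 ?poweR_ge0 ?lee_fin.
have K0' : (0 <= K%:E)%E by rewrite lee_fin.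
apply: (le_trans (leeD (lee_wpmul2l K0' (h 0)) (lee_wpmul2l K0' (h z)))).
rewrite !muleA -!EFinM -ge0_muleDl ?lee_fin ?mulr_ge0 ?powR_ge0//.
rewrite lee_wpmul2r// -EFinD lee_fin le_eqVlt; apply/orP; left; apply/eqP.
rewrite -/Lam /osc_const /K -/C.
have L0 : 0 <= Lam by rewrite exprn_ge0// mulr_ge0// ltW.
exact: (osc_const_arith q C0 L0 (ltW t0)).
Qed.

(** The factor 2 4^(n+1) bounds the mass of the radial kernel; it enters once through Jensen's
    inequality and once through the final integration in z. *)
Definition upper_const (p : R) : R :=
  (2 * 4 ^+ n.+1) `^ (q / p - 1) * (2 * 4 ^+ n.+1) * osc_const.

(** Jensen's inequality with weight phi(|z|) raises the exponent from p to q. For fixed z, [osc_Lq]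
    gives |z|^q in the sup norm, which the Euclidean norm in the denominator absorbs. *)
Lemma bbm_Lq (A : set E) (M : \bar R) (p : R) (phi : R -> R) : measurable (A : set B) ->
  1 <= p -> p <= q -> radial_profile phi ->
  (\int[@lebesgue_measure R]_(s in `]0%R, +oo[) (phi s * s ^+ n)%:E <= 1)%E ->
  (forall v, \int[mu]_x ((\1_A x)%:E * (g ((x : E) + v))%:E `^ q) <= M)%E ->
  (\int[mu]_x ((\1_A x)%:E * ((\1_Omega x)%:E * bbm_integral Omega f p phi x `^ (q / p))) <=
    (upper_const p)%:E * M)%E.
Proof.
move=> mA p1 pq rphi phi1 AM.
have p0 : 0 < p by exact: lt_le_trans p1.
have q0 : 0 < q by exact: lt_le_trans q1.
have [_ phi0 _ _] := rphi.
pose CR : R := 2 * 4 ^+ n.+1; have CR0 : 0 < CR by rewrite mulr_gt0// exprn_gt0.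
have intphi : (\int[mu]_z (phi (enorm (z : E)))%:E <= CR%:E)%E.
  apply: (le_trans (radial_integral_le n rphi)); rewrite -[leRHS]mule1.
  by rewrite lee_wpmul2l// lee_fin ltW.
have M0 : (0 <= M)%E.
  by apply: (le_trans _ (AM 0)); apply: integral_ge0 => x _; rewrite mule_ge0 ?poweR_ge0 ?lee_fin.
pose P (x z : E) : R := osc Omega f x z / enorm z.
have P0 x z : 0 <= P x z by rewrite divr_ge0 ?osc_ge0 ?enorm_ge0.
have mP s : measurable_fun setT (fun a : B * B => ((P a.1 a.2) `^ s)%:E).
  exact: measurable_osc_quotient.
have mphi := @measurable_radial R n phi rphi.
pose F (x z : B) : \bar R := ((\1_A x)%:E * (((P x z) `^ q)%:E * (phi (enorm (z : E)))%:E))%E.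
have F0 x z : (0 <= F x z)%E.
  by rewrite !mule_ge0 ?lee_fin ?powR_ge0 ?phi0// indicE.
have mphi2 : measurable_fun setT (fun a : B * B => (phi (enorm (a.2 : E)))%:E).
  by apply/measurable_EFinP; exact: (measurableT_comp mphi measurable_snd).
have mF : measurable_fun setT (fun a : B * B => F a.1 a.2).
  apply: emeasurable_funM.
    by apply/measurable_EFinP; exact: (measurableT_comp (measurable_indic mA) measurable_fst).
  by apply: emeasurable_funM => //; exact: mP.
set c1' := CR `^ (q / p - 1).
have mbbm : measurable_fun setT (fun x : B => ((\1_Omega x)%:E * bbm_integral Omega f p phi x `^ (q / p))%E).
  pose H (x z : B) : \bar R := (((P x z) `^ p)%:E * (phi (enorm (z : E)))%:E)%E.
  rewrite (_ : (fun _ => _) = fun x => ((\1_Omega x)%:E * (\int[mu]_z H x z) `^ (q / p))%E); last first.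
    apply/funext => x; rewrite indicE; case: (boolP (x \in Omega)) => [/set_mem Ox|_].
      by rewrite bbm_integralE.
    by rewrite !mul0e.
  apply: emeasurable_funM; first by apply/measurable_EFinP; exact: measurable_indic.
  apply: (measurableT_comp (measurable_poweR _)).
  apply: (@measurable_integral2 _ _ B B R mu H).
    by apply: emeasurable_funM => //; exact: mP.
  by move=> x z; rewrite mule_ge0 ?lee_fin ?powR_ge0.
apply: (@le_trans _ _ (\int[mu]_x (c1'%:E * \int[mu]_z F x z))%E).
  apply: ge0_le_integral => //.
  - by move=> x _; rewrite !mule_ge0 ?poweR_ge0 ?lee_fin.
  - apply: emeasurable_funM => //; apply/measurable_EFinP; exact: measurable_indic.
  - apply: measurable_funeM; exact: (measurable_integral2 mu mF F0).
  move=> x _; rewrite indicE; case: (boolP (x \in A)) => [xA|_]; last first.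
    by rewrite mul0e mule_ge0 ?lee_fin ?powR_ge0// integral_ge0.
  rewrite mul1e indicE; case: (boolP (x \in Omega)) => [/set_mem Ox|_]; last first.
    by rewrite mul0e mule_ge0 ?lee_fin ?powR_ge0// integral_ge0.
  rewrite mul1e bbm_integralE//.
  have mPx s : measurable_fun setT (fun z : B => ((P x z) `^ s)%:E).
    exact: (measurableT_comp (mP s) (measurable_pair1 x)).
  apply: (le_trans (@jensen_poweR R _ B mu (fun z => ((P x z) `^ p)%:E)
     (fun z => phi (enorm (z : E))) CR (q / p) _ _ _ _ _ _ intphi)) => //.
  - by move=> z; rewrite lee_fin powR_ge0.
  - by rewrite ler_pdivlMr// mul1r.
  rewrite lee_wpmul2l ?lee_fin ?powR_ge0// le_eqVlt; apply/orP; left; apply/eqP.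
  apply: eq_integral => z _; rewrite /F [\1_A x]indicE xA mul1e; congr (_ * _)%E.
  by rewrite poweR_EFin -powRrM mulrC divfK// gt_eqF.
rewrite ge0_integralZl ?lee_fin ?powR_ge0//; last 2 first.
- exact: (measurable_integral2 mu mF F0).
- by move=> x _; exact: integral_ge0.
rewrite (integral_swap mu mu mF F0) /upper_const -/CR -/c1' -mulrA EFinM -muleA.
rewrite lee_wpmul2l ?lee_fin ?powR_ge0//.
apply: (@le_trans _ _ (\int[mu]_z ((phi (enorm (z : E)))%:E * (osc_const%:E * M)))%E).
  apply: ge0_le_integral => //.
  - by move=> z _; exact: integral_ge0.
  - exact: (measurable_integral1 mu mF F0).
  - by apply: emeasurable_funM => //; apply/measurable_EFinP.
  move=> z _; rewrite /F.
  have mPz : measurable_fun setT (fun x : B => ((P x z) `^ q)%:E).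
    exact: (measurableT_comp (mP q) (measurable_pair2 z)).
  have mAP : measurable_fun setT (fun x : B => ((\1_A x)%:E * ((P x z) `^ q)%:E)%E).
    apply: emeasurable_funM => //; apply/measurable_EFinP; exact: measurable_indic.
  under eq_integral do rewrite muleA muleC.
  rewrite ge0_integralZl ?lee_fin//; last first.
    by move=> x _; rewrite mule_ge0 ?lee_fin ?powR_ge0.
  rewrite lee_wpmul2l ?lee_fin//.
  have [z0|/eqP z0] := eqVneq (z : E) 0.
    rewrite integral0_eq; first by rewrite mule_ge0// lee_fin osc_const_ge0.
    move=> x _; rewrite /P /osc z0 addr0 subrr normr0 mulr0 mul0r powR0 ?mule0// gt_eqF//.
  have z0' : 0 < `|z : E| by rewrite normr_gt0; apply/eqP.
  have mosc : measurable_fun setT (fun x : B => ((\1_A x)%:E * (osc Omega f x z)%:E `^ q)%E).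
    apply: emeasurable_funM; first by apply/measurable_EFinP; exact: measurable_indic.
    apply: (measurableT_comp (measurable_poweR q)); apply/measurable_EFinP.
    exact: measurable_osc_left.
  apply: (@le_trans _ _ (\int[mu]_x ((`|z : E| `^ q)^-1%:E *
      ((\1_A x)%:E * (osc Omega f x z)%:E `^ q)))%E).
    apply: ge0_le_integral => //.
    - by move=> x _; rewrite mule_ge0 ?lee_fin ?powR_ge0.
    - exact: measurable_funeM.
    move=> x _; rewrite [leRHS]muleCA; apply: lee_wpmul2l; first by rewrite lee_fin.
    rewrite poweR_EFin -EFinM lee_fin.
    rewrite /P div_powR ?osc_ge0 ?enorm_ge0// mulrC ler_wpM2r ?powR_ge0//.
    rewrite lef_pV2 ?posrE ?powR_gt0 ?(lt_le_trans z0' (norm_le_enorm _))//.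
    by rewrite ge0_ler_powR ?nnegrE ?(ltW q0) ?enorm_ge0// norm_le_enorm.
  rewrite ge0_integralZl ?lee_fin ?invr_ge0 ?powR_ge0//; last first.
    by move=> x _; rewrite mule_ge0 ?poweR_ge0 ?lee_fin.
  have i0 : (0 <= ((`|z : E| `^ q)^-1)%:E)%E by rewrite lee_fin invr_ge0 powR_ge0.
  apply: (le_trans (lee_wpmul2l i0 (osc_Lq mA z0 AM))).
  by rewrite muleA -EFinM mulrCA mulVf ?mulr1// gt_eqF// powR_gt0.
rewrite ge0_integralZr//.
- have -> : ((CR * osc_const)%:E = CR%:E * osc_const%:E)%E by [].
  by rewrite -[leRHS]muleA lee_wpmul2r// mule_ge0// lee_fin osc_const_ge0.
- by apply/measurable_EFinP.
- by move=> z _; rewrite lee_fin.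
- by rewrite mule_ge0// lee_fin osc_const_ge0.
Qed.

End upper_bound.

(** * The lower bound *)

Section fatou_bound.
Local Open Scope ereal_scope.
Context d (T : measurableType d) (R : realType) (mu : {measure set T -> \bar R}).

Lemma le_limn_einf (u : nat -> \bar R) (a : \bar R) :
  (\forall k \near \oo, a <= u k) -> a <= limn_einf u.
Proof.
move=> [N _ NP]; rewrite limn_einf_lim; apply: lime_ge; first exact: is_cvg_einfs.
exists N => // k /= Nk; apply: le_ereal_inf_tmp => _ [m /= km <-].
by apply: NP => /=; exact: leq_trans km.
Qed.

Lemma limn_einf_le (u : nat -> \bar R) (M : \bar R) : (forall k, u k <= M) -> limn_einf u <= M.
Proof.
move=> uM; rewrite limn_einf_lim; apply: lime_le; first exact: is_cvg_einfs.
apply: nearW => k; apply: (le_trans _ (uM k)); apply: ereal_inf_lbound.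
by exists k => //=.
Qed.

Lemma fatou_bound (h : nat -> T -> \bar R) (g : T -> \bar R) (M : \bar R) :
  (forall k, measurable_fun setT (h k)) -> (forall k x, 0 <= h k x) ->
  measurable_fun setT g -> (forall x, 0 <= g x) ->
  {ae mu, forall x, g x <= limn_einf (h^~ x)} ->
  (forall k, \int[mu]_x h k x <= M) -> \int[mu]_x g x <= M.
Proof.
move=> mh h0 mg g0 gh hM.
apply: (@le_trans _ _ (\int[mu]_x limn_einf (h^~ x))).
  apply: ae_ge0_le_integral => //.
  - by move=> x _; apply: le_limn_einf; exact: nearW.
  - rewrite /limn_einf; apply: measurableT_comp => //.
    by apply: measurable_fun_limn_esup => k; apply: measurableT_comp.
  by apply: filterS gh => x gx _.
by apply: (le_trans (@fatou _ _ _ mu setT measurableT h mh (fun k x _ => h0 k x))); exact: limn_einf_le.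
Qed.

End fatou_bound.

Lemma cancel_inverse (R : realType) (u v q p m : R) : p * m = 1 ->
  u * (q * p) * v * m = u * v * q.
Proof. by move=> pm; rewrite (_ : _ * m = u * v * q * (p * m)); [rewrite pm mulr1|lra]. Qed.

(** * Increments of a C^1 function on a cone around a coordinate axis *)

Section cones.
Context (R : realType) (n : nat).
Local Notation E := 'rV[R]_n.+1.
Local Notation B := (borel_space R n).
Local Notation mu := (@lebB R n).
Local Notation e_ i := (delta_mx 0 i : E).

(** The other coordinates are so small that together they contribute at most half as much as the
    leading one. *)
Definition axis_cone (i : 'I_n.+1) : set E :=
  [set z | 0 < z 0 i /\ forall j, j != i -> `|z 0 j| < z 0 i / (2 * n.+1%:R)].

Lemma measurable_axis_cone i : measurable (axis_cone i : set B).
Proof.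
have -> : axis_cone i = [set z : E | 0 < z 0 i] `&`
    \bigcap_(j in [set j | j != i]) [set z : E | `|z 0 j| < z 0 i / (2 * n.+1%:R)].
  by apply/seteqP; split=> z [z0 H]; split.
apply: measurableI.
  have := @measurable_coord R n i measurableT _ (measurable_itv `]0, +oo[); rewrite setTI.
  by congr (measurable _); apply/seteqP; split=> z /=; rewrite in_itv/= andbT.
apply: fin_bigcap_measurable; first exact: finite_finset.
move=> j _.
have m1 : measurable_fun [set: B] (fun z : B => `|(z : E) 0 j|).
  by apply: measurableT_comp => //; exact: measurable_coord.
have m2 : measurable_fun [set: B] (fun z : B => (z : E) 0 i / (2 * n.+1%:R)).
  by apply: measurable_funM; [exact: measurable_coord|exact: measurable_cst].
have mt : measurable [set true] by [].
by have := measurable_fun_ltr m1 m2 measurableT mt; rewrite setTI.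
Qed.

Lemma axis_coneZ i (t : R) z : 0 < t -> axis_cone i z -> axis_cone i (t *: z).
Proof.
move=> t0 [z0 H]; split; rewrite !mxE; first exact: mulr_gt0.
by move=> j ji; rewrite !mxE normrM gtr0_norm// -mulrA ltr_pM2l//; exact: H.
Qed.

Definition cone_mass : R := (8 * n.+1%:R)^-1 ^+ n.+1.

Lemma cone_mass_gt0 : 0 < cone_mass.
Proof. by rewrite exprn_gt0// invr_gt0 mulr_gt0. Qed.

(** The cube of radius 1/(8(n+1)) around 3/4 of the unit vector lies both in the cone and in the
    shell. *)
Lemma axis_cone_mass i :
  (cone_mass%:E <= mu (axis_cone i `&` [set z : E | (2^-1 < enorm z)%R /\ (enorm z < 1)%R]))%E.
Proof.
set r : R := (8 * n.+1%:R)^-1; have N1 : (1 : R) <= n.+1%:R by rewrite ler1n.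
have N0 : (0 : R) < n.+1%:R by rewrite ltr0n.
have r0 : 0 < r by rewrite invr_gt0 mulr_gt0.
have rN : n.+1%:R * r = 8^-1 by rewrite /r invfM mulrCA divff ?mulr1// gt_eqF.
have r8 : r <= 8^-1 by rewrite -rN ler_peMl// ltW.
apply: (le_trans (lebB_cube_ge ((3 / 4) *: e_ i) r0)).
apply: le_measure; rewrite ?inE.
- exact: measurable_norm_lt.
- apply: measurableI; first exact: measurable_axis_cone.
  have := @measurable_enorm R n measurableT _ (measurable_itv `]2^-1, 1[); rewrite setTI.
  by congr (measurable _); apply/seteqP; split=> z /=; rewrite in_itv/= => /andP.
move=> z /= /norm_lt_coordP - /(_ r0) zr.
have zi : `|z 0 i - 3 / 4| < r by have := zr i; rewrite !mxE !eqxx/= mulr1.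
have zj j : j != i -> `|z 0 j| < r.
  by move=> ji; have := zr j; rewrite !mxE (negbTE ji) andbF mulr0 subr0.
have [zi1 zi2] : 5 / 8 < z 0 i /\ z 0 i < 7 / 8.
  by move: zi; rewrite ltr_distl => /andP[a b]; split; move: a b r8; lra.
split; [split|].
- by move: zi1; lra.
- move=> j ji; apply: (lt_le_trans (zj j ji)); rewrite ler_pdivlMr ?mulr_gt0//.
  by rewrite mulrCA [r * _]mulrC rN; move: zi1; lra.
split.
  apply: (lt_le_trans _ (norm_le_enorm _)); apply: (lt_le_trans _ (norm_coord_le z i)).
  by apply: (lt_le_trans _ (ler_norm _)); move: zi1; lra.
have s0 : 0 <= \sum_j z 0 j ^+ 2 by apply: sumr_ge0 => j _; exact: sqr_ge0.
rewrite -(@sqrtr1 R) /enorm ltr_sqrt//.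
rewrite (bigD1 i)//=.
(* As (n+1) r = 1/8 and r <= 1/8, the sum is at most 49/64 + 1/64, which is below 1. *)
apply: (@le_lt_trans _ _ ((7 / 8) ^+ 2 + \sum_(j < n.+1) r ^+ 2)).
  apply: lerD; first by rewrite lerXn2r ?nnegrE ?(ltW zi2)//; move: zi1; lra.
  rewrite [leRHS](bigD1 i)//=; apply: (@le_trans _ _ (\sum_(j < n.+1 | j != i) r ^+ 2)).
    apply: ler_sum => j ji; rewrite -real_normK ?num_real// lerXn2r ?nnegrE ?(ltW r0)//.
    exact/ltW/zj.
  by rewrite lerDr sqr_ge0.
rewrite sumr_const card_ord -[X in _ + X < _]mulr_natl [r ^+ 2]expr2 mulrA rN expr2.
by move: r8 r0; lra.
Qed.

(** [i] is an index of the largest partial derivative at [x], so the leading term has size z_i a.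
    The other first-order terms take away at most half of it by the choice of the cone, and the
    variation of the derivatives at most a quarter. A quarter remains, and the Euclidean norm of z
    is at most (n+1) z_i. *)
Lemma cone_increment (F : E -> R) (x : E) (i : 'I_n.+1) :
  (forall y j, derivable F y (e_ j)) -> (forall j, continuous (partial j F)) ->
  (forall j, `|partial j F x| <= `|partial i F x|) ->
  exists2 d, 0 < d & forall z, axis_cone i z -> `|z| < d ->
    `|partial i F x| / (4 * n.+1%:R) * enorm z <= `|F (x + z) - F x|.
Proof.
move=> dF cF maxi; set a := `|partial i F x|.
have N0 : (0 : R) < n.+1%:R by rewrite ltr0n.
have [a0|a0] := ltP 0 a; last first.
  have -> : a = 0 by apply/le_anti; rewrite a0 normr_ge0.
  by exists 1 => // z _ _; rewrite !mul0r.
have w0 : 0 < a / (4 * n.+1%:R) by rewrite divr_gt0// mulr_gt0.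
have [d d0 dP] : exists2 d, 0 < d & forall j y, `|y - x| < d ->
    `|partial j F y - partial j F x| <= a / (4 * n.+1%:R).
  have /choice[del delP] : forall j, exists del : R, 0 < del /\ forall y, `|y - x| < del ->
      `|partial j F y - partial j F x| <= a / (4 * n.+1%:R).
    move=> j; have := @cvgrPdist_le _ _ _ (nbhs x) (nbhs_filter x) (partial j F) (partial j F x).
    move=> [/(_ (cF j x) _ w0)/nbhs_ballP[del /= del0 H] _]; exists del; split=> // y yx.
    by rewrite distrC; apply: H; rewrite -ball_normE/= distrC.
  exists (\big[Order.min/1]_j del j); first by apply/bigmin_gtP; split=> // j _; exact: (delP j).1.
  move=> j y yx; apply: (delP j).2; apply: (lt_le_trans yx); exact: bigmin_le.
exists d => // z [zi H] zd.
have zj j : `|z 0 j| <= z 0 i.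
  have [->|ji] := eqVneq j i; first by rewrite ger0_norm// ltW.
  apply: (le_trans (ltW (H j ji))); rewrite ler_pdivrMr ?mulr_gt0//.
  have N1 : (1 : R) <= n.+1%:R by rewrite ler1n.
  by rewrite ler_peMr ?(ltW zi)//; move: N1; lra.
have zE : `|z| <= z 0 i by apply/norm_le_coordP => //; exact: ltW.
have [xi [xiP ->]] := mvt_coord x (x + z) dF.
have zx : x + z - x = z by rewrite addrC addKr.
rewrite zx in xiP.
have coord j : (x + z) 0 j - x 0 j = z 0 j by rewrite -{2}zx !mxE.
under eq_bigr do rewrite coord.
have -> : \sum_j z 0 j * partial j F (xi j) =
    z 0 i * partial i F x + (\sum_(j | j != i) z 0 j * partial j F x +
    \sum_j z 0 j * (partial j F (xi j) - partial j F x)).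
  have e : z 0 i * partial i F x + \sum_(j | j != i) z 0 j * partial j F x =
      \sum_j z 0 j * partial j F x by rewrite [RHS](bigD1 i).
  rewrite addrA e -big_split/=; apply: eq_bigr => j _.
  by rewrite -mulrDr addrC subrK.
have cancel_natr (u v k : R) : (u / (k * n.+1%:R) * v) *+ n.+1 = u * v / k.
  rewrite -mulr_natr invfM; exact: (cancel_inverse _ _ _ (mulVf (lt0r_neq0 N0))).
have b1 : `|\sum_(j | j != i) z 0 j * partial j F x| <= z 0 i * a / 2.
  apply: (le_trans (ler_norm_sum _ _ _)).
  apply: (@le_trans _ _ (\sum_(j < n.+1) z 0 i / (2 * n.+1%:R) * a)).
    rewrite [leRHS](bigID (fun j => j != i))/=.
    rewrite -[leLHS]addr0; apply: lerD.
      by apply: ler_sum => j ji; rewrite normrM ler_pM// ltW// H.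
    by apply: sumr_ge0 => j _; rewrite !mulr_ge0// ?invr_ge0 ?mulr_ge0// ltW.
  by rewrite sumr_const card_ord cancel_natr.
have b2 : `|\sum_j z 0 j * (partial j F (xi j) - partial j F x)| <= z 0 i * a / 4.
  apply: (le_trans (ler_norm_sum _ _ _)).
  apply: (@le_trans _ _ (\sum_(j < n.+1) z 0 i / (4 * n.+1%:R) * a)).
    apply: ler_sum => j _; rewrite normrM mulrAC -mulrA ler_pM//; apply: dP.
    exact: le_lt_trans (xiP j) zd.
  by rewrite sumr_const card_ord cancel_natr.
have b3 : `|z 0 i * partial i F x| = z 0 i * a by rewrite normrM gtr0_norm.
apply: (@le_trans _ _ (z 0 i * a / 4)).
  apply: (@le_trans _ _ (a / (4 * n.+1%:R) * (n.+1%:R * z 0 i))).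
    rewrite ler_wpM2l ?(ltW w0)// (le_trans (enorm_le_norm _))// ler_wpM2l//.
  rewrite invfM [n.+1%:R * z 0 i]mulrC mulrA.
  by rewrite (cancel_inverse _ _ _ (mulVf (lt0r_neq0 N0))) [a * _]mulrC.
have := ler_normB (z 0 i * partial i F x + (\sum_(j | j != i) z 0 j * partial j F x +
   \sum_j z 0 j * (partial j F (xi j) - partial j F x)))
  (\sum_(j | j != i) z 0 j * partial j F x +
   \sum_j z 0 j * (partial j F (xi j) - partial j F x)).
rewrite addrK b3; have := ler_normD (\sum_(j | j != i) z 0 j * partial j F x)
   (\sum_j z 0 j * (partial j F (xi j) - partial j F x)).
move: b1 b2; move: (`|_|) (`|_|) (`|_|) (`|_|) => u v w t; lra.
Qed.

End cones.

Section inner_set.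
Context (R : realType) (n : nat).
Local Notation E := 'rV[R]_n.+1.
Local Notation B := (borel_space R n).
Implicit Types (Omega : set E) (t : R).

(** The condition on open cubes makes this set closed, hence compact when [Omega] is bounded. *)
Definition inner_set Omega t : set E := [set x | forall y, `|y - x| < t -> Omega y].

Lemma closed_inner_set Omega t : closed (inner_set Omega t).
Proof.
rewrite -[inner_set _ _]setCK; apply: open_closedC.
rewrite openE => x /= /existsNP[y /not_implyP[yx Oy]].
apply/nbhs_ballP; exists (t - `|y - x|) => /=; first by rewrite subr_gt0.
move=> x'; rewrite -ball_normE/= => xx' /(_ y) H; apply/Oy/H.
rewrite -(subrK x y) -addrA; apply: (le_lt_trans (ler_normD _ _)).
by rewrite -ltrBDl.
Qed.

Lemma measurable_inner_set Omega t : measurable (inner_set Omega t : set B).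
Proof.
rewrite -[X in measurable X]setCK; apply: measurableC; apply: measurable_open_borel.
by apply: closed_openC; exact: closed_inner_set.
Qed.

Lemma inner_set_sub Omega s t : s <= t -> inner_set Omega t `<=` inner_set Omega s.
Proof. by move=> st x H y yx; apply: H; exact: lt_le_trans st. Qed.

Lemma inner_setS Omega t : 0 < t -> inner_set Omega t `<=` Omega.
Proof. by move=> t0 x; apply; rewrite subrr normr0. Qed.

End inner_set.

(** * Derivatives of mollifications bounded by the energy *)

Section lower_bound.
Context (R : realType) (n : nat).
Local Notation E := 'rV[R]_n.+1.
Local Notation B := (borel_space R n).
Local Notation mu := (@lebB R n).
Local Notation e_ i := (delta_mx 0 i : E).
Variables (Omega : set E) (f : E -> R) (p q : R).
Hypotheses (oO : open Omega) (L1f : L1 f) (p1 : 1 <= p) (pq : p <= q).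

Let mf : measurable_fun [set: B] (f : B -> R).
Proof. exact: L1_measurable. Qed.

Let mO : measurable (Omega : set B).
Proof. exact: measurable_open_borel. Qed.

Let p0 : 0 < p. Proof. exact: lt_le_trans p1. Qed.
Let q0 : 0 < q. Proof. exact: lt_le_trans pq. Qed.

Lemma powR_quotient_le (s b a c : R) : 0 <= s -> 0 <= b -> 0 < c -> b <= a ->
  c^-1 `^ s * b `^ s <= (a / c) `^ s.
Proof.
move=> s0 b0 c0 ba; rewrite -powRM ?invr_ge0 ?(ltW c0)// mulrC.
rewrite ge0_ler_powR ?nnegrE ?divr_ge0 ?(ltW c0) ?(le_trans b0 ba)//.
by rewrite ler_wpM2r// invr_ge0 ltW.
Qed.

Lemma exists_max_index (h : 'I_n.+1 -> R) : exists i, forall j, h j <= h i.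
Proof.
exists [arg max_(j > ord0) h j]%O => j.
by case: Order.TotalTheory.arg_maxP => //= l _; apply.
Qed.

Lemma measurable_shift_efun (v : E) (h : E -> \bar R) :
  measurable_fun [set: B] (h : B -> \bar R) ->
  measurable_fun [set: B] (fun w : B => h ((w : E) + v)%R).
Proof.
move=> mh; have e : (fun w : B => h ((w : E) + v)%R) = (h : B -> \bar R) \o (fun w : B => (1 *: (w : E) + v : B)).
  by apply/funext => w /=; rewrite scale1r.
rewrite e; exact: (measurableT_comp mh (measurable_affine 1 v)).
Qed.

Definition osc_energy (phi : R -> R) (x : E) : \bar R :=
  (\int[mu]_z (((osc Omega f x (z : E) / enorm (z : E)) `^ p)%:E * (phi (enorm (z : E)))%:E))%E.

Lemma osc_energy_ge0 phi x : radial_profile phi -> (0 <= osc_energy phi x)%E.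
Proof.
by case=> _ phi0 _ _; apply: integral_ge0 => z _; rewrite mule_ge0 ?lee_fin ?powR_ge0.
Qed.

Lemma osc_energy_out phi x : ~ Omega x -> osc_energy phi x = 0%E.
Proof.
move=> Ox; apply: integral0_eq => z _.
by rewrite /osc indicE memNset// !mul0r powR0 ?mul0e// gt_eqF.
Qed.

Lemma measurable_osc_energy_kernel phi : radial_profile phi ->
  measurable_fun setT (fun a : B * B =>
    (((osc Omega f a.1 a.2 / enorm (a.2 : E)) `^ p)%:E * (phi (enorm (a.2 : E)))%:E)%E).
Proof.
move=> rphi; apply: emeasurable_funM; first exact: measurable_osc_quotient.
apply/measurable_EFinP.
exact: (measurableT_comp (@measurable_radial R n phi rphi) measurable_snd).
Qed.

Lemma measurable_osc_energy phi : radial_profile phi ->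
  measurable_fun [set: B] (osc_energy phi : B -> \bar R).
Proof.
move=> rphi; have [_ phi0 _ _] := rphi.
apply: (@measurable_integral2 _ _ B B R mu
  (fun x z => (((osc Omega f x z / enorm (z : E)) `^ p)%:E * (phi (enorm (z : E)))%:E)%E)).
  exact: measurable_osc_energy_kernel.
by move=> x z; rewrite mule_ge0 ?lee_fin ?powR_ge0.
Qed.

(** The increment of a mollification is the mollification of the increments. On the support of the
    kernel both w + x and w + x + z lie in [Omega], which is the reason for the margin 2d; Jensen's
    inequality is then used with the kernel as probability density. *)
Lemma moll_increment (d : R) (x z : E) : 0 < d -> inner_set Omega (2 * d) x -> `|z| < d ->
  (((`|moll d f (x + z) - moll d f x| / enorm z) `^ p)%:E <=
   \int[mu]_w (((osc Omega f ((w : E) + x) z / enorm z) `^ p)%:E * (moll_kernel d (w : E))%:E))%E.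
Proof.
move=> d0 xin zd; have mk := @measurable_moll_kernel R n d d0.
have mosc : measurable_fun [set: B] (fun w : B => osc Omega f ((w : E) + x) z).
  have mo := measurable_osc_left oO mf z.
  have := measurable_shift_fun x mo; exact.
have k0 (w : E) : 0 <= moll_kernel d w by exact: moll_kernel_ge0.
have e0 : 0 <= (enorm z)^-1 by rewrite invr_ge0 enorm_ge0.
have intk : (\int[mu]_w (moll_kernel d (w : E))%:E <= 1%:E)%E.
  rewrite -(integral_moll_kernel (0 : E) d0).
  by rewrite le_eqVlt; apply/orP; left; apply/eqP; apply: eq_integral => w _; rewrite subr0.
have step : (`|moll d f (x + z) - moll d f x|%:E <=
    \int[mu]_w ((osc Omega f ((w : E) + x) z)%:E * (moll_kernel d (w : E))%:E))%E.
  rewrite !moll_shift//.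
  have i1 := integrable_moll_shift (x + z) d0 L1f; have i2 := integrable_moll_shift x d0 L1f.
  rewrite -RintegralB//.
  have i3 := L1B i1 i2.
  rewrite EFin_normr_Rintegral//.
  apply: (le_trans (le_abse_integral _ _ _)) => //; first exact: measurable_int i3.
  apply: ge0_le_integral => //.
  - by apply: measurableT_comp => //; exact: measurable_int i3.
  - by apply: emeasurable_funM; apply/measurable_EFinP.
  move=> w _; rewrite -EFinM lee_fin -mulrBr normrM ger0_norm// mulrC.
  have [wd|wd] := ltP `|w : E| d; last by rewrite moll_kernel_eq0// !mulr0.
  rewrite ler_wpM2r// /osc !indicE mem_set; last first.
    by apply: xin; rewrite addrK (lt_le_trans wd)// ler_peMl ?ler1n// ltW.
  rewrite mem_set; last first.
    apply: xin; rewrite (_ : w + x + z - x = w + z); last by rewrite addrAC addrK.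
    by rewrite (le_lt_trans (ler_normD _ _))// mulrDl mul1r ltrD.
  by rewrite !mul1r addrA.
apply: (@le_trans _ _ ((\int[mu]_w ((osc Omega f ((w : E) + x) z / enorm z)%:E *
    (moll_kernel d (w : E))%:E)) `^ p)%E).
  rewrite -poweR_EFin; apply: ler_poweR; first exact: ltW.
    by rewrite lee_fin mulr_ge0.
  rewrite EFinM muleC.
  rewrite (_ : integral _ _ _ = ((enorm z)^-1%:E *
      \int[mu]_w ((osc Omega f ((w : E) + x) z)%:E * (moll_kernel d (w : E))%:E))%E).
    by rewrite lee_wpmul2l// lee_fin.
  rewrite -ge0_integralZl ?lee_fin//; last 2 first.
  - by apply: emeasurable_funM; apply/measurable_EFinP.
  - by move=> w _; rewrite mule_ge0 ?lee_fin ?osc_ge0.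
  by apply: eq_integral => w _; rewrite -!EFinM; congr EFin; rewrite mulrA [_ * osc _ _ _ _]mulrC.
have := @jensen_poweR R _ B mu (fun w => (osc Omega f ((w : E) + x) z / enorm z)%:E)
  (fun w => moll_kernel d (w : E)) 1 p _ mk _ k0 ltr01 p1 intk.
rewrite powR1 mul1e; apply.
  by apply/measurable_EFinP; apply: measurable_funM.
by move=> w; rewrite lee_fin mulr_ge0 ?osc_ge0.
Qed.

Variable phi : nat -> R -> R.
Hypothesis rphi : forall k, radial_profile (phi k).
Hypothesis phi_mass : forall d : R, 0 < d -> \forall k \near \oo,
  ((2^-1)%:E <= \int[@lebesgue_measure R]_(s in `]0%R, d[) (phi k s * s ^+ n)%:E)%E.

(** The factor 1/(4(n+1)) is the slope in [cone_increment], and 1/2 is the share of the mass of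
    [phi k] that eventually lies near 0. *)
Definition cone_const : R := (4 * n.+1%:R)^-1 `^ p * (cone_mass R n / 2).

Lemma cone_const_gt0 : 0 < cone_const.
Proof.
by rewrite mulr_gt0 ?divr_gt0 ?cone_mass_gt0// powR_gt0// invr_gt0 mulr_gt0.
Qed.

(** The cone belongs to the index of the largest partial derivative at [x], which dominates the i-th
    one. How large k must be depends on x; Fatou's lemma tolerates this. *)
Lemma partial_moll_energy (d : R) (x : E) (i : 'I_n.+1) : 0 < d ->
  inner_set Omega (2 * d) x -> \forall k \near \oo,
  ((cone_const * `|partial i (moll d f) x| `^ p)%:E <=
    \int[mu]_w (osc_energy (phi k) ((w : E) + x) * (moll_kernel d (w : E))%:E))%E.
Proof.
move=> d0 xin; have mk := @measurable_moll_kernel R n d d0.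
have k0 (w : E) : 0 <= moll_kernel d w by exact: moll_kernel_ge0.
have dF y j : derivable (moll d f) y (e_ j) by exact: moll_derivable.
have cF j : continuous (partial j (moll d f)) by exact: partial_moll_continuous.
have [i0 maxi] := exists_max_index (fun j => `|partial j (moll d f) x|).
have [e e0 eP] := cone_increment dF cF maxi.
(* Below [e] the cone estimate holds; below [d] the increment stays within the margin of the inner
   set. *)
pose e' := Num.min e d; have e'0 : 0 < e' by rewrite lt_min e0 d0.
have := phi_mass e'0; apply: filterS => k mk2.
have [mphi phi0 _ _] := rphi k.
have mrad := @measurable_radial R n _ (rphi k).
set a := `|partial i0 (moll d f) x| / (4 * n.+1%:R).
have a0 : 0 <= a by rewrite divr_ge0// mulr_ge0.
set K := axis_cone i0 `&` [set z : E | enorm z < e'].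
have mK : measurable (K : set B).
  apply: measurableI; first exact: measurable_axis_cone.
  have := @measurable_enorm R n measurableT _ (measurable_itv `]-oo, e'[); rewrite setTI.
  by congr (measurable _); apply/seteqP; split=> z /=; rewrite in_itv/=.
have cone := radial_cone_integral_ge (rphi k) (measurable_axis_cone i0)
   (fun t z => @axis_coneZ R n i0 t z) e'0.
have cmass : ((cone_mass R n / 2)%:E <= \int[mu]_(z in K) (phi k (enorm (z : E)))%:E)%E.
  apply: le_trans cone; rewrite EFinM; apply: lee_pmul; rewrite ?lee_fin ?invr_ge0//.
  - exact: ltW (cone_mass_gt0 _ _).
  - exact: axis_cone_mass.
apply: (@le_trans _ _ ((a `^ p)%:E * (cone_mass R n / 2)%:E)%E).
  rewrite -EFinM lee_fin /cone_const mulrAC ler_wpM2r//.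
    by rewrite divr_ge0// ltW// cone_mass_gt0.
  by apply: powR_quotient_le => //; exact: ltW.
have ap0 : (0 <= (a `^ p)%:E)%E by rewrite lee_fin powR_ge0.
apply: (le_trans (lee_wpmul2l ap0 cmass)).
pose F (z w : B) : \bar R := ((((osc Omega f ((w : E) + x) z / enorm (z : E)) `^ p)%:E *
   (phi k (enorm (z : E)))%:E) * (moll_kernel d (w : E))%:E)%E.
have F0 z w : (0 <= F z w)%E by rewrite !mule_ge0 ?lee_fin ?powR_ge0.
have mF : measurable_fun setT (fun c : B * B => F c.1 c.2).
  apply: emeasurable_funM; last first.
    by apply/measurable_EFinP; exact: (measurableT_comp mk measurable_snd).
  have mg : measurable_fun setT ((fun c : B * B => (((c.2 : E) + x : E), c.1)) : B * B -> B * B).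
    apply: measurable_fun_pair; last exact: measurable_fst.
    by apply: measurable_vadd => //; exact: measurable_cst.
  exact: (measurableT_comp (measurable_osc_energy_kernel (rphi k)) mg).
apply: (@le_trans _ _ (\int[mu]_z \int[mu]_w F z w)%E).
  rewrite integral_indicl -ge0_integralZl//; last 2 first.
  - apply: emeasurable_funM; apply/measurable_EFinP => //.
  - by move=> z _; rewrite mule_ge0 ?lee_fin.
  apply: ge0_le_integral => //.
  - by move=> z _; rewrite !mule_ge0 ?lee_fin.
  - apply: measurable_funeM; apply: emeasurable_funM; apply/measurable_EFinP => //.
  - exact: (measurable_integral2 mu mF F0).
  move=> z _; rewrite indicE; case: (boolP ((z : E) \in K)) => [/set_mem [Kz ze]|_]; last first.
    by rewrite mul0e mule0 integral_ge0.
  rewrite mul1e.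
  have zd : `|z : E| < d.
    by apply: (le_lt_trans (norm_le_enorm _)); apply: (lt_le_trans ze); rewrite ge_min lexx orbT.
  have ze' : `|z : E| < e.
    by apply: (le_lt_trans (norm_le_enorm _)); apply: (lt_le_trans ze); rewrite ge_min lexx.
  have en0 : 0 < enorm (z : E).
    apply: (lt_le_trans _ (norm_le_enorm _)); apply: (lt_le_trans _ (norm_coord_le _ i0)).
    by rewrite normr_gt0 gt_eqF//; case: Kz.
  have h1 : ((a `^ p)%:E <= ((`|moll d f (x + z) - moll d f x| / enorm (z : E)) `^ p)%:E)%E.
    rewrite lee_fin ge0_ler_powR ?nnegrE ?(ltW p0) ?divr_ge0 ?(ltW en0)//.
    by rewrite ler_pdivlMr//; exact: eP.
  have h2 := le_trans h1 (moll_increment d0 xin zd).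
  have mI : measurable_fun [set: B] (fun w : B =>
      (((osc Omega f ((w : E) + x) z / enorm (z : E)) `^ p)%:E * (moll_kernel d (w : E))%:E)%E).
    apply: emeasurable_funM; last by apply/measurable_EFinP.
    apply/measurable_EFinP; apply: (measurableT_comp (measurable_powR p)).
    apply: measurable_funM => //.
    by have := measurable_shift_fun x (measurable_osc_left oO mf z).
  rewrite (_ : (\int[mu]_w F z w = (phi k (enorm (z : E)))%:E *
     \int[mu]_w (((osc Omega f ((w : E) + x) z / enorm (z : E)) `^ p)%:E * (moll_kernel d (w : E))%:E))%E).
    by rewrite muleC lee_wpmul2l ?lee_fin.
  rewrite -ge0_integralZl ?lee_fin//; last by move=> w _; rewrite mule_ge0 ?lee_fin ?powR_ge0.
  by apply: eq_integral => w _; rewrite /F muleA [X in (X * _)%E]muleC.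
rewrite (integral_swap mu mu mF F0) le_eqVlt; apply/orP; left; apply/eqP.
apply: eq_integral => w _; rewrite /F /osc_energy ge0_integralZr ?lee_fin//.
  exact: (measurableT_comp (measurable_osc_energy_kernel (rphi k)) (measurable_pair1 _)).
by move=> z _; rewrite mule_ge0 ?lee_fin ?powR_ge0.
Qed.

Definition lower_const : R := cone_const `^ (q / p).

Lemma lower_const_gt0 : 0 < lower_const.
Proof. by rewrite powR_gt0// cone_const_gt0. Qed.

Let qp1 : 1 <= q / p.
Proof. by rewrite ler_pdivlMr// mul1r. Qed.

Lemma partial_moll_energy_pow (d : R) (x : E) (i : 'I_n.+1) : 0 < d ->
  inner_set Omega (2 * d) x -> \forall k \near \oo,
  ((lower_const * `|partial i (moll d f) x| `^ q)%:E <=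
    \int[mu]_w (osc_energy (phi k) ((w : E) + x) `^ (q / p) * (moll_kernel d (w : E))%:E))%E.
Proof.
move=> d0 xin; have := partial_moll_energy i d0 xin; apply: filterS => k h.
have mk := @measurable_moll_kernel R n d d0.
have k0 (w : E) : 0 <= moll_kernel d w by exact: moll_kernel_ge0.
have intk : (\int[mu]_w (moll_kernel d (w : E))%:E <= 1%:E)%E.
  rewrite -(integral_moll_kernel (0 : E) d0).
  by rewrite le_eqVlt; apply/orP; left; apply/eqP; apply: eq_integral => w _; rewrite subr0.
have cc0 := ltW cone_const_gt0.
rewrite (_ : lower_const * _ = (cone_const * `|partial i (moll d f) x| `^ p) `^ (q / p)); last first.
  rewrite powRM ?powR_ge0// -powRrM [p * _]mulrC divfK// gt_eqF//.
rewrite -poweR_EFin.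
have mS : measurable_fun [set: B] (fun w : B => osc_energy (phi k) ((w : E) + x)).
  exact: (measurable_shift_efun x (measurable_osc_energy (rphi k))).
apply: (@le_trans _ _ ((\int[mu]_w (osc_energy (phi k) ((w : E) + x) *
   (moll_kernel d (w : E))%:E)) `^ (q / p))%E).
  apply: ler_poweR => //; last by rewrite lee_fin mulr_ge0 ?powR_ge0.
  exact: le_trans qp1.
have := @jensen_poweR R _ B mu (fun w => osc_energy (phi k) ((w : E) + x))
  (fun w => moll_kernel d (w : E)) 1 (q / p) mS mk _ k0 ltr01 qp1 intk.
by rewrite powR1 mul1e; apply => w; exact: osc_energy_ge0.
Qed.

Variables (A : set E) (M : \bar R).
Hypothesis mA : measurable (A : set B).
Hypothesis energy_le : forall k v,
  (\int[mu]_x ((\1_A x)%:E * osc_energy (phi k) ((x : E) + v) `^ (q / p)) <= M)%E.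

(** Fatou's lemma in k at a fixed mollification radius. After Tonelli's theorem the kernel averages
    integrals of translated energies over [A], each at most [M]. *)
Lemma partial_moll_Lq (d : R) (i : 'I_n.+1) : 0 < d ->
  (\int[mu]_x ((\1_(A `&` inner_set Omega (2 * d)) x)%:E *
     (lower_const * `|partial i (moll d f) x| `^ q)%:E) <= M)%E.
Proof.
move=> d0; have mk := @measurable_moll_kernel R n d d0.
have k0 (w : E) : 0 <= moll_kernel d w by exact: moll_kernel_ge0.
have mI := measurable_inner_set Omega (2 * d).
pose F k (x w : B) : \bar R := ((\1_A x)%:E *
   (osc_energy (phi k) ((w : E) + x) `^ (q / p) * (moll_kernel d (w : E))%:E))%E.
have F0 k x w : (0 <= F k x w)%E by rewrite !mule_ge0 ?lee_fin ?poweR_ge0.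
have madd : measurable_fun setT ((fun a : B * B => (a.2 : E) + a.1) : B * B -> B).
  exact: measurable_vadd.
have mF k : measurable_fun setT (fun a : B * B => F k a.1 a.2).
  apply: emeasurable_funM.
    by apply/measurable_EFinP; exact: (measurableT_comp (measurable_indic mA) measurable_fst).
  apply: emeasurable_funM; last first.
    by apply/measurable_EFinP; exact: (measurableT_comp mk measurable_snd).
  apply: (measurableT_comp (measurable_poweR _)).
  exact: (measurableT_comp (measurable_osc_energy (rphi k)) madd).
have mP : measurable_fun [set: B] (partial i (moll d f) : B -> R).
  exact: measurable_partial_moll.
have lc0 := ltW lower_const_gt0.
apply: (@fatou_bound _ B R mu (fun k x => \int[mu]_w F k x w)%E).
- by move=> k; exact: (measurable_integral2 mu (mF k) (F0 k)).
- by move=> k x; apply: integral_ge0 => w _; exact: F0.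
- apply: emeasurable_funM; first by apply/measurable_EFinP/measurable_indic; exact: measurableI.
  apply/measurable_EFinP; apply: measurable_funM => //.
  by apply: (measurableT_comp (measurable_powR q)); apply: measurableT_comp.
- by move=> x; rewrite mule_ge0 ?lee_fin ?mulr_ge0 ?powR_ge0.
- apply: aeW => x; apply: le_limn_einf; rewrite indicE.
  case: (boolP ((x : E) \in A `&` inner_set Omega (2 * d))) => [/set_mem[Ax xin]|_]; last first.
    by apply: nearW => k; rewrite mul0e; apply: integral_ge0 => w _; exact: F0.
  have := partial_moll_energy_pow i d0 xin; apply: filterS => k h.
  rewrite mul1e; apply: (le_trans h); rewrite le_eqVlt; apply/orP; left; apply/eqP.
  by apply: eq_integral => w _; rewrite /F [\1_A x]indicE mem_set// mul1e.
move=> k; rewrite (integral_swap mu mu (mF k) (F0 k)).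
have M0 : (0 <= M)%E.
  apply: (le_trans _ (energy_le 0%N 0)); apply: integral_ge0 => x _.
  by rewrite mule_ge0 ?poweR_ge0 ?lee_fin.
have mAS v : measurable_fun [set: B] (fun x : B =>
    ((\1_A x)%:E * osc_energy (phi k) ((x : E) + v)%R `^ (q / p))%E).
  apply: emeasurable_funM; first by apply/measurable_EFinP/measurable_indic.
  apply: (measurableT_comp (measurable_poweR _)).
  exact: (measurable_shift_efun v (measurable_osc_energy (rphi k))).
apply: (@le_trans _ _ (\int[mu]_w ((moll_kernel d (w : E))%:E * M))%E).
  apply: ge0_le_integral => //.
  - by move=> w _; apply: integral_ge0 => x _; exact: F0.
  - exact: (measurable_integral1 mu (mF k) (F0 k)).
  - by apply: emeasurable_funM => //; apply/measurable_EFinP.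
  move=> w _; rewrite /F.
  have e : (\int[mu]_x ((\1_A x)%:E * (osc_energy (phi k) ((w : E) + x)%R `^ (q / p) * (moll_kernel d (w : E))%:E)) =
     \int[mu]_x ((moll_kernel d (w : E))%:E * ((\1_A x)%:E * osc_energy (phi k) ((x : E) + w)%R `^ (q / p))))%E.
    by apply: eq_integral => x _; rewrite muleA muleC [(w : E) + _]addrC.
  have k0w : (0 <= (moll_kernel d (w : E))%:E)%E by rewrite lee_fin.
  rewrite e ge0_integralZl//; first by apply: lee_wpmul2l => //; exact: energy_le.
  by move=> x _; rewrite mule_ge0 ?poweR_ge0 ?lee_fin.
rewrite ge0_integralZr//; last 2 first.
- by apply/measurable_EFinP.
- by move=> w _; rewrite lee_fin.
rewrite (_ : integral _ _ _ = 1%E) ?mul1e//.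
by rewrite -(integral_moll_kernel (0 : E) d0); apply: eq_integral => w _; rewrite subr0.
Qed.

End lower_bound.

(** * Existence of weak derivatives *)

Section L1_complete.
Local Open Scope ereal_scope.
Context d (T : measurableType d) (R : realType) (mu : {measure set T -> \bar R}).

Lemma cvgn_of_summable_increments (v : nat -> R) :
  \sum_(k <oo) (`|v k.+1 - v k|%R)%:E < +oo -> cvgn v.
Proof.
move=> fin; pose w k := (v k.+1 - v k)%R.
have cw : cvgn (series w).
  apply: normed_cvg; apply: nondecreasing_is_cvgn.
    by apply: nondecreasing_series => k _ _; rewrite normr_ge0.
  exists (fine (\sum_(k <oo) (`|v k.+1 - v k|%R)%:E)) => _ [N _ <-].
  rewrite -lee_fin fineK; last first.
    by rewrite ge0_fin_numE//; apply: nneseries_ge0 => k _ _; rewrite lee_fin.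
  rewrite /series/= -sumEFin; apply: nneseries_lim_ge => k _.
  by rewrite lee_fin.
have -> : v = (fun k => (v 0%N + series w k)%R).
  apply/funext => k; rewrite /series/= telescope_sumr//.
  by rewrite addrC subrK.
by apply: is_cvgD => //; exact: is_cvg_cst.
Qed.

(** Riesz-Fischer: along a subsequence with increments at most 2^-k in L1 the values converge almost
    everywhere, and Fatou's lemma turns this into convergence in L1. *)
Lemma L1_complete (u : nat -> T -> R) :
  (forall k, mu.-integrable setT (EFin \o u k)) ->
  (forall e : R, (0 < e)%R -> exists N, forall m k, (N <= m)%N -> (N <= k)%N ->
    \int[mu]_x (`|u m x - u k x|%R)%:E <= e%:E) ->
  exists s : nat -> nat, exists g : T -> R,
  [/\ (forall k, k <= s k)%N, mu.-integrable setT (EFin \o g) &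
  forall e : R, (0 < e)%R -> exists N, forall k, (N <= k)%N ->
    \int[mu]_x (`|u (s k) x - g x|%R)%:E <= e%:E].
Proof.
move=> iu cu.
have mu_ k : measurable_fun setT (u k).
  by apply/measurable_EFinP; exact: measurable_int (iu k).
have /choice[N NP] : forall k : nat, exists j, forall m l, (j <= m)%N -> (j <= l)%N ->
    \int[mu]_x (`|u m x - u l x|%R)%:E <= ((2^-1 : R) ^+ k)%:E.
  by move=> k; apply: cu; rewrite exprn_gt0.
(* The sum makes [s] monotone and at least [N k]; the summand [k] makes it cofinal. *)
pose s k := (\sum_(j < k.+1) N j + k)%N.
have sN k : (N k <= s k)%N.
  by rewrite /s big_ord_recr/= -addnA -addnCA leq_addr.
have ss k : (s k <= s k.+1)%N.
  by rewrite /s [in leqRHS]big_ord_recr/= -addnA leq_add2l addnS leqW// leq_addl.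
pose v k := u (s k).
have inc k : \int[mu]_x (`|v k.+1 x - v k x|%R)%:E <= ((2^-1 : R) ^+ k)%:E.
  by apply: NP => //; exact: leq_trans (sN k) (ss k).
pose g x := fine (limn_esup (fun k => (v k x)%:E)).
have mg : measurable_fun setT g.
  apply: measurableT_comp => //; apply: measurable_fun_limn_esup => k.
  by apply/measurable_EFinP; exact: mu_.
have vg : {ae mu, forall x, v k x @[k --> \oo] --> g x}.
  have := @summable_ae_cvg0 _ _ _ mu (fun k x => `|v k.+1 x - v k x|%R).
  move=> /(_ _ _ _)/filterS; apply.
  - move=> x /cvgn_of_summable_increments cv.
    have cE : (v k x)%:E @[k --> \oo] --> (limn (v^~ x))%:E by apply/cvg_EFin => //; exact: nearW.
    by rewrite /g (cvg_limn_einf_sup cE).2.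
  - by move=> k; apply: measurableT_comp => //; apply: measurable_funB; exact: mu_.
  - by [].
  - apply: le_lt_trans (geometric_sum_lty R).
    by apply: lee_nneseries => k *; [apply: integral_ge0 => x _; rewrite lee_fin|exact: inc].
have mdist m k : measurable_fun setT (fun x => (`|u m x - v k x|%R)%:E).
  by apply/measurable_EFinP; apply: measurableT_comp => //; apply: measurable_funB; exact: mu_.
have close (e : R) : (0 < e)%R -> exists K, forall m, (K <= m)%N ->
    \int[mu]_x (`|u m x - g x|%R)%:E <= e%:E.
  move=> e0; have [K KP] := cu _ e0; exists K => m Km.
  apply: (@fatou_bound _ _ _ mu (fun k x => (`|u m x - v (k + K)%N x|%R)%:E)).
  - by move=> k; exact: mdist.
  - by move=> k x; rewrite lee_fin.
  - by apply/measurable_EFinP; apply: measurableT_comp => //; apply: measurable_funB.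
  - by move=> x; rewrite lee_fin.
  - apply: filterS vg => x vgx.
    have vgK : v (k + K)%N x @[k --> \oo] --> g x by rewrite (cvg_shiftn K (fun k => v k x : R^o)).
    have cE : (`|u m x - v (k + K)%N x|%R)%:E @[k --> \oo] --> (`|u m x - g x|%R)%:E.
      apply: cvg_EFin; first exact: nearW.
      by apply: cvg_norm; apply: cvgB => //; exact: cvg_cst.
    by rewrite (cvg_limn_einf_sup cE).1.
  - move=> k; apply: KP => //; apply: (leq_trans (leq_addl k K)).
    by rewrite /s leq_addl.
have sk k : (k <= s k)%N by rewrite /s leq_addl.
exists s, g; split=> //; last first.
  by move=> e e0; have [K KP] := close _ e0; exists K => k Kk; apply: KP; exact: leq_trans (sk k).
have [K /(_ K (leqnn K)) KP] := close _ ltr01.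
apply/integrableP; split; first exact/measurable_EFinP.
have /integrableP[_ iuK] := iu K.
apply: (@le_lt_trans _ _ (\int[mu]_x ((`|u K x|%R)%:E + (`|u K x - g x|%R)%:E))).
  apply: ge0_le_integral => //.
  - by apply/measurable_EFinP; apply: measurableT_comp.
  - apply: emeasurable_funD; apply/measurable_EFinP; apply: measurableT_comp => //.
    by apply: measurable_funB.
  by move=> x _ /=; rewrite lee_fin -{1}[g x](subKr (u K x)) (le_trans (ler_normB _ _)).
rewrite ge0_integralD//.
- by rewrite lte_add_pinfty//; exact: (le_lt_trans KP (ltry _)).
- by apply/measurable_EFinP; apply: measurableT_comp.
- by apply/measurable_EFinP; apply: measurableT_comp => //; apply: measurable_funB.
Qed.

End L1_complete.

(** * Quantitative strict convexity of sqrt(1 + a^2) *)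

Section bracket.
Context (R : realType).
Implicit Types a b q : R.

Definition bracket a : R := Num.sqrt (1 + a ^+ 2).

(** [X] and [Y] are the values at a and b, [Z] is twice the value at the midpoint. The bound follows
    from (X+Y)^2 - Z^2 = 2(XY - 1 - ab) and (XY)^2 - (1+ab)^2 = (a-b)^2. *)
Lemma sqrt_gap_ge (a b X Y Z : R) : 0 < X -> 0 < Y -> 0 <= Z ->
  X ^+ 2 = 1 + a ^+ 2 -> Y ^+ 2 = 1 + b ^+ 2 -> Z ^+ 2 = 4 + (a + b) ^+ 2 ->
  2 * (a - b) ^+ 2 <= (X + Y - Z) * (X + Y) ^+ 3.
Proof.
move=> X0 Y0 Z0 X2 Y2 Z2.
have XY0 : 0 < X * Y by rewrite mulr_gt0.
have id : (X * Y) ^+ 2 = (1 + a * b) ^+ 2 + (a - b) ^+ 2.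
  by rewrite exprMn X2 Y2; lra.
have cs : 1 + a * b <= X * Y.
  rewrite leNgt; apply/negP => h; have : (X * Y) ^+ 2 < (1 + a * b) ^+ 2.
    by rewrite ltr_pXn2r ?nnegrE ?(ltW XY0)// (le_trans (ltW XY0))// ltW.
  by rewrite id ltNge lerDl sqr_ge0.
have w0 : 0 < X + Y by rewrite addr_gt0.
have e1 : (X + Y - Z) * (X + Y + Z) = 2 * (X * Y - 1 - a * b) by lra.
have ZW : Z <= X + Y.
  rewrite leNgt; apply/negP => h.
  have : (X + Y - Z) * (X + Y + Z) < 0.
    by rewrite nmulr_rlt0 ?subr_lt0// addr_gt0// (lt_trans w0).
  by rewrite e1 ltNge mulr_ge0//; lra.
set G := X + Y - Z; have G0 : 0 <= G by rewrite subr_ge0.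
set C := X * Y - 1 - a * b; have C0 : 0 <= C by rewrite /C; lra.
have h1 : C <= G * (X + Y).
  have : G * (X + Y + Z) <= G * (2 * (X + Y)) by rewrite ler_wpM2l//; lra.
  by rewrite e1 -/C; lra.
have id2 : C * (X * Y + (1 + a * b)) = (a - b) ^+ 2 by rewrite /C; lra.
have h2 : X * Y + (1 + a * b) <= (X + Y) ^+ 2 / 2.
  by have := sqr_ge0 (X - Y); lra.
have h3 : (a - b) ^+ 2 <= C * ((X + Y) ^+ 2 / 2) by rewrite -id2 ler_wpM2l.
have h4 : C * ((X + Y) ^+ 2 / 2) <= G * (X + Y) * ((X + Y) ^+ 2 / 2).
  by rewrite ler_wpM2r// divr_ge0// sqr_ge0.
have := le_trans h3 h4; rewrite (_ : G * (X + Y) * _ = G * (X + Y) ^+ 3 / 2); last by lra.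
lra.
Qed.

Lemma weighted_amgm (e x y : R) : 0 < e -> 2 * x ^+ 2 <= y -> `|x| <= e + y / (8 * e).
Proof.
move=> e0 xy; rewrite -(ler_pM2r e0) mulrDl invfM -!mulrA mulVf ?gt_eqF// mulr1.
rewrite -(real_normK (num_real x)) in xy; have := sqr_ge0 (2 * e - `|x|); move: xy; clear; lra.
Qed.

(** Where the sum of the brackets is at most [K], the convexity gap controls |a - b|. Elsewhere that
    sum is at most K^(1-q) times its q-th power, a tail that is small for large K when q > 1. *)
Lemma sqrt_gap_dist (a b e K q : R) : 0 < e -> 0 < K -> 1 <= q ->
  `|a - b| <= e + K ^+ 3 / (8 * e) * (bracket a + bracket b - 2 * bracket (2^-1 * (a + b)))
    + K `^ (1 - q) * (bracket a + bracket b) `^ q.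
Proof.
move=> e0 K0 q1.
have pos c : 0 < 1 + c ^+ 2 :> R by rewrite ltr_wpDr ?sqr_ge0.
have sq0 c : 0 < bracket c by rewrite sqrtr_gt0.
have sq2 c : bracket c ^+ 2 = 1 + c ^+ 2 by rewrite sqr_sqrtr// ltW.
have lebracket c : `|c| <= bracket c.
  by rewrite -sqrtr_sqr ler_wsqrtr// lerDr.
have gap := @sqrt_gap_ge a b (bracket a) (bracket b) (2 * bracket (2^-1 * (a + b))) (sq0 a) (sq0 b) _ (sq2 a) (sq2 b).
have z2 : (2 * bracket (2^-1 * (a + b))) ^+ 2 = 4 + (a + b) ^+ 2 by rewrite exprMn sq2; lra.
have z0 : 0 <= 2 * bracket (2^-1 * (a + b)) by rewrite mulr_ge0 ?sqrtr_ge0.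
move: gap => /(_ z0 z2); set G := (X in 2 * _ <= X * _).
set w := bracket a + bracket b; have w0 : 0 < w by rewrite addr_gt0.
move=> gap; have G0 : 0 <= G.
  rewrite leNgt; apply/negP => G0; have : G * w ^+ 3 < 0 by rewrite nmulr_rlt0// exprn_gt0.
  by apply/negP; rewrite -leNgt (le_trans _ gap)// mulr_ge0 ?sqr_ge0.
have Ke0 : 0 <= K ^+ 3 / (8 * e) by rewrite divr_ge0 ?exprn_ge0 ?mulr_ge0 ?(ltW K0) ?(ltW e0).
have p0 : 0 <= K `^ (1 - q) * w `^ q by rewrite mulr_ge0 ?powR_ge0.
have [wK|Kw] := leP w K.
  have h1 : 2 * (a - b) ^+ 2 <= G * K ^+ 3.
    by apply: (le_trans gap); rewrite ler_wpM2l// lerXn2r ?nnegrE// ltW.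
  suff h : `|a - b| <= e + K ^+ 3 / (8 * e) * G by apply: (le_trans h); rewrite lerDl.
  by rewrite mulrAC [_ * G]mulrC; exact: weighted_amgm.
have h1 : `|a - b| <= w by rewrite (le_trans (ler_normB _ _))// lerD.
have h2 : w <= K `^ (1 - q) * w `^ q.
  have e1 : w = w `^ (1 - q) * w `^ q.
    by rewrite -powRD ?subrK ?powRr1 ?(ltW w0)//; apply/implyP => _; rewrite gt_eqF.
  rewrite {1}e1 ler_wpM2r ?powR_ge0// -(opprB q 1) !powRN lef_pV2 ?posrE ?powR_gt0//.
  by rewrite ge0_ler_powR ?nnegrE ?subr_ge0// ltW.
apply: (le_trans (le_trans h1 h2)); rewrite lerDr addr_ge0 ?(ltW e0)//; exact: mulr_ge0 Ke0 G0.
Qed.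

Lemma powR_mid_le a b q : 1 < q -> `|2^-1 * (a + b)| `^ q <= 2^-1 * (`|a| `^ q + `|b| `^ q).
Proof.
move=> q1; have q0 : 0 < q by exact: lt_trans q1.
have ab : `|2^-1 * (a + b)| <= 2^-1 * `|a| + 2^-1 * `|b|.
  by rewrite normrM ger0_norm ?invr_ge0// -mulrDr ler_wpM2l ?invr_ge0// ler_normD.
have := @ge0_ler_powR R q (ltW q0) _ _ _ _ ab; rewrite !nnegrE normr_ge0 addr_ge0 ?mulr_ge0 ?invr_ge0//.
move=> /(_ isT isT)/le_trans; apply.
rewrite mulrDr {2 4}(_ : 2^-1 = 1 - 2^-1); last by rewrite {2}(splitr 1) div1r addrK.
by apply: (convex_powR (ltW q1) (Itv01 _ _)) => //=;
  rewrite ?inE/= ?in_itv/= ?normr_ge0// ?invr_ge0// invf_le1 ?ler1n.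
Qed.

Lemma norm_le_powR a q : 1 <= q -> `|a| <= 1 + `|a| `^ q.
Proof.
move=> q1; have [a1|a1] := leP `|a| 1; first by rewrite (le_trans a1)// lerDl powR_ge0.
rewrite -[leLHS]powRr1 ?normr_ge0// ler_wpDl// ler_powR//; exact: ltW.
Qed.

Lemma bracket_le a : bracket a <= 1 + `|a|.
Proof.
rewrite /bracket -[leRHS]ger0_norm ?addr_ge0// -sqrtr_sqr ler_wsqrtr//.
have := real_normK (num_real a); have := normr_ge0 a; move: `|a| => y y0; lra.
Qed.

Lemma bracket_sum_powR_le a b q : 0 < q ->
  (bracket a + bracket b) `^ q <= 3 `^ q * (2 `^ q + `|a| `^ q + `|b| `^ q).
Proof.
move=> q0; have sa := bracket_le a; have sb := bracket_le b.
have a0 := normr_ge0 a; have b0 := normr_ge0 b.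
have := sqrtr_ge0 (1 + a ^+ 2); have := sqrtr_ge0 (1 + b ^+ 2) => sb0 sa0.
pose m := Num.max 2 (Num.max `|a| `|b|).
have am : `|a| <= m by rewrite /m !le_max lexx orbT.
have bm : `|b| <= m by rewrite /m !le_max lexx !orbT.
have m2 : 2 <= m by rewrite /m le_max lexx.
have wm : bracket a + bracket b <= 3 * m by lra.
have m0 : 0 <= m by exact: le_trans m2.
apply: (@le_trans _ _ ((3 * m) `^ q)).
  by rewrite ge0_ler_powR ?nnegrE ?(ltW q0) ?addr_ge0 ?mulr_ge0.
rewrite powRM// ler_wpM2l ?powR_ge0//.
have p2 := powR_ge0 2 q; have pa := powR_ge0 `|a| q; have pb := powR_ge0 `|b| q.
rewrite /m /Num.max; case: ifP => _; [case: ifP => _|]; lra.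
Qed.

Lemma measurable_bracket : measurable_fun setT bracket.
Proof.
apply: continuous_measurable_fun => a; rewrite /bracket.
apply: (@continuous_comp _ _ _ (fun a : R => 1 + a ^+ 2) Num.sqrt); last exact: sqrt_continuous.
by apply: continuousD; [exact: cst_continuous|exact: exprn_continuous].
Qed.

End bracket.

Lemma cauchy_constant_le (R : realType) (P e : R) : 0 <= P -> 0 < e ->
  (3 * (P + 1) / e)^-1 * P <= e / 3.
Proof.
move=> P0 e0; have P1 : 0 < P + 1 by rewrite ltr_wpDl.
rewrite invfM invrK mulrAC ler_pdivlMr// invfM -mulrA mulrAC -mulrA.
rewrite (_ : _ * _ = e * (P / (P + 1))); last first.
  rewrite [3^-1 * _]mulrC -!mulrA [X in _ * X](_ : _ = P * e); last by lra.
  by lra.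
by rewrite ler_piMr ?(ltW e0)// ler_pdivrMr// mul1r lerDl.
Qed.

Lemma cauchy_constant_le2 (R : realType) (c e : R) : 0 <= c -> 0 < e ->
  e / (3 * (c + 1)) * c <= e / 3.
Proof.
move=> c0 e0; have P1 : 0 < c + 1 by rewrite ltr_wpDl.
rewrite invfM mulrA -mulrA ler_piMr ?divr_ge0 ?(ltW e0)//.
by rewrite mulrC ler_pdivrMr// mul1r lerDl.
Qed.

(** * An L1 limit from convex combinations of an L^q-bounded sequence *)

Section hull.
Context d (T : measurableType d) (R : realType) (mu : {measure set T -> \bar R}).

(** Only midpoints are taken: they generate the dyadic convex combinations, match midpoint
    convexity, and allow induction. *)
Inductive midhull (h : nat -> T -> R) (m : nat) : (T -> R) -> Prop :=
| midhull_tail k : (m <= k)%N -> midhull h m (h k)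
| midhull_mid u v : midhull h m u -> midhull h m v -> midhull h m (fun x => 2^-1 * (u x + v x)).

Lemma midhull_le h m k u : (m <= k)%N -> midhull h k u -> midhull h m u.
Proof.
move=> mk; elim=> [l kl|v w _ IHv _ IHw]; first exact: midhull_tail (leq_trans mk kl).
exact: midhull_mid.
Qed.

Variables (D : set T) (q M : R) (h : nat -> T -> R).
Hypotheses (mD : measurable D) (muD : (mu D < +oo)%E) (q1 : 1 < q).
Hypotheses (mh : forall k, measurable_fun setT (h k)) (h0 : forall k x, ~ D x -> h k x = 0).
Hypothesis hM : forall k, (\int[mu]_(x in D) (`|h k x| `^ q)%:E <= M%:E)%E.

Let q0 : 0 < q. Proof. exact: lt_trans q1. Qed.

Lemma midhull_bound m u : midhull h m u ->
  [/\ measurable_fun setT u, forall x, ~ D x -> u x = 0 &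
    (\int[mu]_(x in D) (`|u x| `^ q)%:E <= M%:E)%E].
Proof.
have mpow (v : T -> R) : measurable_fun setT v -> measurable_fun D (fun x => (`|v x| `^ q)%:E).
  move=> mv; apply: measurable_funTS; apply/measurable_EFinP.
  by apply: (measurableT_comp (measurable_powR q)); exact: measurableT_comp.
elim=> [k _|v w _ [mv v0 vM] _ [mw w0 wM]]; first by split; [exact: mh|exact: h0|exact: hM].
split.
- by apply: measurable_funM => //; exact: measurable_funD.
- by move=> x Dx; rewrite v0// w0// addr0 mulr0.
have mvw : measurable_fun setT (fun x => 2^-1 * (v x + w x)).
  by apply: measurable_funM => //; exact: measurable_funD.
apply: (@le_trans _ _ (\int[mu]_(x in D) (2^-1%:E * ((`|v x| `^ q)%:E + (`|w x| `^ q)%:E)))%E).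
  apply: ge0_le_integral => //.
  - exact: mpow.
  - by apply: emeasurable_funM => //; apply: emeasurable_funD; exact: mpow.
  by move=> x _; rewrite -EFinD -EFinM lee_fin powR_mid_le.
rewrite ge0_integralZl//; last 2 first.
- by apply: emeasurable_funD; exact: mpow.
- by move=> x _; rewrite -EFinD lee_fin addr_ge0 ?powR_ge0.
rewrite ge0_integralD//; last 2 first.
- exact: mpow.
- exact: mpow.
apply: (@le_trans _ _ (2^-1%:E * (M%:E + M%:E))%E).
  by rewrite lee_wpmul2l ?lee_fin ?invr_ge0// leeD.
by rewrite -EFinD -EFinM lee_fin; lra.
Qed.

Lemma midhull_integrable m u : midhull h m u -> mu.-integrable D (EFin \o (fun x => `|u x| `^ q)).
Proof.
case/midhull_bound => mv _ uM; apply/integrableP; split.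
  apply: measurable_funTS; apply/measurable_EFinP.
  by apply: (measurableT_comp (measurable_powR q)); exact: measurableT_comp.
under eq_integral do rewrite /= ger0_norm ?powR_ge0//.
exact: le_lt_trans uM (ltry _).
Qed.

Lemma integrable_cstD (c : R) : mu.-integrable D (EFin \o (fun=> c)).
Proof.
apply: measurable_bounded_integrable => //.
by exists `|c|; split; [exact: num_real|move=> x cx y _; exact: ltW].
Qed.

Lemma integrable_bracket m u : midhull h m u -> mu.-integrable D (EFin \o (fun x => bracket (u x))).
Proof.
move=> hu; have [mv _ _] := midhull_bound hu.
have i1 := integrableD mD (integrable_cstD 2) (midhull_integrable hu).
apply: (le_integrable mD _ _ i1).
  apply: measurable_funTS; apply/measurable_EFinP; apply: measurableT_comp => //.
  exact: measurable_bracket.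
move=> x _ /=; rewrite lee_fin ger0_norm ?sqrtr_ge0// [leRHS]ger0_norm ?addr_ge0 ?powR_ge0//.
have := bracket_le (u x); have := norm_le_powR (u x) (ltW q1); lra.
Qed.

Let J u := \int[mu]_(x in D) bracket (u x).

(** [sqrt_gap_dist] integrated. The bound on q-th powers holds on the whole hull and e, K are free,
    so only the convexity gap of [J] remains to be made small. *)
Lemma midhull_gap m u v : midhull h m u -> midhull h m v ->
  forall e K : R, 0 < e -> 0 < K ->
  (\int[mu]_(x in D) (`|u x - v x|)%:E <=
   (e * fine (mu D) + K ^+ 3 / (8 * e) * (J u + J v - 2 * J (fun x => 2^-1 * (u x + v x))) +
    K `^ (1 - q) * (3 `^ q * (2 `^ q * fine (mu D) + M + M)))%:E)%E.
Proof.
move=> hu hv e K e0 K0; have hw := midhull_mid hu hv.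
have [mu_ _ uM] := midhull_bound hu; have [mv _ vM] := midhull_bound hv.
have ju := integrable_bracket hu; have jv := integrable_bracket hv; have jw := integrable_bracket hw.
have pu := midhull_integrable hu; have pv := midhull_integrable hv.
have iG : mu.-integrable D (EFin \o (fun x => bracket (u x) + bracket (v x) - 2 * bracket (2^-1 * (u x + v x)))).
  exact: (integrableB mD (integrableD mD ju jv) (integrableZl mD 2 jw)).
have iP : mu.-integrable D (EFin \o (fun x => 3 `^ q * (2 `^ q + `|u x| `^ q + `|v x| `^ q))).
  exact: (integrableZl mD (3 `^ q) (integrableD mD (integrableD mD (integrable_cstD (2 `^ q)) pu) pv)).
have i1 := integrableD mD (integrable_cstD e) (integrableZl mD (K ^+ 3 / (8 * e)) iG).
have i2 := integrableZl mD (K `^ (1 - q)) iP.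
have iR := integrableD mD i1 i2.
pose F x := e + K ^+ 3 / (8 * e) * (bracket (u x) + bracket (v x) - 2 * bracket (2^-1 * (u x + v x))) +
  K `^ (1 - q) * (3 `^ q * (2 `^ q + `|u x| `^ q + `|v x| `^ q)).
have FJ : (\int[mu]_(x in D) F x <=
   (e * fine (mu D) + K ^+ 3 / (8 * e) * (J u + J v - 2 * J (fun x => 2^-1 * (u x + v x))) +
    K `^ (1 - q) * (3 `^ q * (2 `^ q * fine (mu D) + M + M)))).
  rewrite /F (RintegralD mD i1 i2) (RintegralD mD (integrable_cstD e) (integrableZl mD (K ^+ 3 / (8 * e)) iG)).
  rewrite Rintegral_cst// !RintegralZl//; last first.
    exact: (integrableD mD (integrableD mD (integrable_cstD (2 `^ q)) pu) pv).
  rewrite (RintegralB mD (integrableD mD ju jv) (integrableZl mD 2 jw)) (RintegralD mD ju jv) RintegralZl//.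
  rewrite lerD2l ler_wpM2l ?powR_ge0// ler_wpM2l ?powR_ge0//.
  rewrite (RintegralD mD (integrableD mD (integrable_cstD (2 `^ q)) pu) pv).
  rewrite (RintegralD mD (integrable_cstD (2 `^ q)) pu) Rintegral_cst//.
  have bnd w : midhull h m w -> \int[mu]_(x in D) (`|w x| `^ q) <= M.
    move=> hw'; have [_ _ wM] := midhull_bound hw'.
    by rewrite -lee_fin /Rintegral fineK// integrable_fin_num//; exact: midhull_integrable hw'.
  by rewrite lerD ?bnd// lerD2l bnd.
apply: (@le_trans _ _ (\int[mu]_(x in D) F x)%:E); last by rewrite lee_fin.
rewrite /Rintegral fineK; last by apply: integrable_fin_num => //.
apply: ge0_le_integral => //.
- apply: measurable_funTS; apply/measurable_EFinP; apply: measurableT_comp => //.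
  exact: measurable_funB.
- exact: measurable_int iR.
move=> x _; rewrite lee_fin /F.
apply: (le_trans (sqrt_gap_dist (u x) (v x) e0 K0 (ltW q1))).
by rewrite lerD2l ler_wpM2l ?powR_ge0// bracket_sum_powR_le.
Qed.

Lemma midhull_J_bound m u : midhull h m u -> J u <= 2 * fine (mu D) + M.
Proof.
move=> hu; have pu := midhull_integrable hu; have ju := integrable_bracket hu.
have i1 := integrableD mD (integrable_cstD 2) pu.
have [_ _ uM] := midhull_bound hu.
apply: (@le_trans _ _ (\int[mu]_(x in D) (2 + `|u x| `^ q))).
  apply: le_Rintegral => // x _.
  have := bracket_le (u x); have := norm_le_powR (u x) (ltW q1); lra.
rewrite (RintegralD mD (integrable_cstD 2) pu) Rintegral_cst// lerD2l.
by rewrite -lee_fin /Rintegral fineK// integrable_fin_num.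
Qed.

Lemma J_ge0 u : 0 <= J u.
Proof. by apply: Rintegral_ge0 => x _; exact: sqrtr_ge0. Qed.

(* The hulls of the tails shrink, so the infima of the strictly convex functional J over them
   increase and converge; hence the midpoint defect of J tends to 0 along almost minimizers. *)
Lemma midhull_minimizers : exists u : nat -> T -> R, (forall m, midhull h m (u m)) /\
  forall e : R, 0 < e -> exists N, forall m k, (N <= m)%N -> (N <= k)%N ->
  J (u m) + J (u k) - 2 * J (fun x => 2^-1 * (u m x + u k x)) <= e.
Proof.
pose V m := [set J u | u in midhull h m].
have V0 m : V m !=set0 by exists (J (h m)); exists (h m) => //; exact: midhull_tail.
have Vlb m : has_lbound (V m) by exists 0 => _ [u _ <-]; exact: J_ge0.
have /choice[u uP] : forall m : nat, exists u, midhull h m u /\ J u <= inf (V m) + m.+1%:R^-1.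
  move=> m; have m0 : 0 < m.+1%:R^-1 :> R by rewrite invr_gt0.
  have [_ [u hu <-] /ltW Ju] := inf_adherent m0 (conj (V0 m) (Vlb m)).
  by exists u.
exists u; split; first by move=> m; exact: (uP m).1.
pose W := [set inf (V m) | m in [set: nat]].
have Wub : has_ubound W.
  exists (2 * fine (mu D) + M) => _ [m _ <-].
  apply: (@le_trans _ _ (J (h m))).
    by apply: ge_inf => //; exists (h m) => //; exact: midhull_tail.
  by apply: midhull_J_bound; exact: (midhull_tail h (leqnn m)).
have W0 : W !=set0 by exists (inf (V 0%N)); exists 0%N.
move=> e e0; have e40 : 0 < e / 4 by rewrite divr_gt0.
have [_ [N0 _ <-] N0P] := sup_adherent e40 (conj W0 Wub).
have [N1 N1P] : exists N1 : nat, forall m, (N1 <= m)%N -> m.+1%:R^-1 <= e / 4 :> R.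
  exists (Num.truncn (e / 4)^-1) => m Nm.
  rewrite -[leRHS]invrK lef_pV2 ?posrE ?invr_gt0// ltW// (lt_le_trans (truncnS_gt _))//.
  by rewrite ler_nat.
exists (maxn N0 N1) => m k; rewrite !geq_max => /andP[m0 m1] /andP[k0 k1].
have [hm Jm] := uP m; have [hk Jk] := uP k.
have hw := midhull_mid (midhull_le m0 hm) (midhull_le k0 hk).
have Vm : inf (V m) <= sup W by apply: ub_le_sup => //; exists m.
have Vk : inf (V k) <= sup W by apply: ub_le_sup => //; exists k.
have Vw : inf (V N0) <= J (fun x => 2^-1 * (u m x + u k x)) by apply: ge_inf => //; eexists; [exact: hw|].
have := N1P _ m1; have := N1P _ k1; move: Jm Jk Vm Vk Vw N0P.
move: (J (u m)) (J (u k)) (J _) (inf _) (inf _) (inf _) (sup _) (m.+1%:R^-1) (k.+1%:R^-1).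
by clear; move=> *; lra.
Qed.

(** In the Cauchy estimate [e1] absorbs the measure of [D], then [K] makes the tail small, and only
    then is the gap made small relative to the factor [k0]. Passing to a subsequence keeps the m-th
    term in the m-th hull, since the hulls are nested. *)
Lemma midhull_L1_limit : exists u : nat -> T -> R, exists g : T -> R,
  [/\ forall m, midhull h m (u m), mu.-integrable setT (EFin \o g),
      forall m, mu.-integrable setT (EFin \o u m) &
  forall e : R, (0 < e)%R -> exists N, forall k, (N <= k)%N ->
    (\int[mu]_x (`|u k x - g x|%R)%:E <= e%:E)%E].
Proof.
have [u [hu cu]] := midhull_minimizers.
have onD (F : T -> R) : (forall x, ~ D x -> F x = 0) ->
    (\int[mu]_x (F x)%:E = \int[mu]_(x in D) (F x)%:E)%E.
  move=> F0; rewrite [RHS]integral_mkcond; apply: eq_integral => x _.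
  by rewrite patchE; case: ifPn => // /negP Dx; rewrite F0// => Dx'; apply: Dx; rewrite inE.
have iu m : mu.-integrable setT (EFin \o u m).
  have [mum u0 _] := midhull_bound (hu m).
  have pu := midhull_integrable (hu m).
  apply/integrableP; split; first exact/measurable_EFinP.
  rewrite (_ : integral _ _ _ = \int[mu]_(x in D) (`|u m x|)%:E)%E; last first.
    by apply: onD => x Dx; rewrite u0// normr0.
  have /integrableP[_] := integrableD mD (integrable_cstD 1) pu.
  apply: le_lt_trans; apply: ge0_le_integral => //.
  - by apply: measurable_funTS; apply/measurable_EFinP; apply: measurableT_comp.
  - apply: measurableT_comp => //; apply: emeasurable_funD; first exact: measurable_cst.
    exact: measurable_int pu.
  move=> x _; rewrite /= lee_fin [leRHS]ger0_norm ?addr_ge0 ?powR_ge0//.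
  exact: norm_le_powR (ltW q1).
have Mge0 : 0 <= M.
  rewrite -lee_fin; apply: le_trans (hM 0%N); apply: integral_ge0 => x _.
  by rewrite lee_fin powR_ge0.
have cauchy (e : R) : 0 < e -> exists N, forall m k, (N <= m)%N -> (N <= k)%N ->
    (\int[mu]_x (`|u m x - u k x|%R)%:E <= e%:E)%E.
  move=> e0; set c := fine (mu D); have c0 : 0 <= c by rewrite fine_ge0.
  pose e1 := e / (3 * (c + 1)).
  have e10 : 0 < e1 by rewrite divr_gt0 ?mulr_gt0// ltr_wpDl.
  pose P := 3 `^ q * (2 `^ q * c + M + M).
  have P0 : 0 <= P by rewrite mulr_ge0 ?powR_ge0// !addr_ge0// mulr_ge0 ?powR_ge0.
  (* The exponent is chosen so that K^(1-q) equals e/(3(P+1)). *)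
  pose K := (3 * (P + 1) / e) `^ ((q - 1)^-1).
  have K0 : 0 < K by rewrite powR_gt0// divr_gt0 ?mulr_gt0// ltr_wpDl.
  have KP : K `^ (1 - q) * P <= e / 3.
    rewrite /K -powRrM -(opprB q 1) mulrN mulVf ?gt_eqF ?subr_gt0// powRN powRr1; last first.
      by rewrite divr_ge0 ?mulr_ge0 ?addr_ge0// ltW.
    by apply: cauchy_constant_le.
  pose k0 := K ^+ 3 / (8 * e1).
  have k00 : 0 < k0 by rewrite divr_gt0 ?exprn_gt0// mulr_gt0.
  have [N NP] := cu (e / 3 / k0) (divr_gt0 (divr_gt0 e0 (ltr0Sn R 2)) k00).
  exists N => m k Nm Nk.
  have [um0 uk0] : (forall x, ~ D x -> u m x = 0) /\ (forall x, ~ D x -> u k x = 0).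
    by have [_ ? _] := midhull_bound (hu m); have [_ ? _] := midhull_bound (hu k).
  rewrite onD; last by move=> x Dx; rewrite um0// uk0// subr0 normr0.
  have hm0 := midhull_le (leq0n m) (hu m); have hk0 := midhull_le (leq0n k) (hu k).
  apply: (le_trans (midhull_gap hm0 hk0 e10 K0)); rewrite lee_fin -/c -/P -/k0.
  have g1 := NP m k Nm Nk; rewrite -(ler_pM2l k00) [leRHS]mulrC divfK ?gt_eqF// in g1.
  have g2 : e1 * c <= e / 3 by exact: cauchy_constant_le2.
  by rewrite [leRHS](_ : e = e / 3 + e / 3 + e / 3); [rewrite !lerD|lra].
have [s [g [sk ig sg]]] := L1_complete iu cauchy.
exists (fun k => u (s k)), g; split => //.
by move=> m; exact: midhull_le (sk m) (hu (s m)).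
Qed.

End hull.

(** * Integration by parts, bounds and existence for weak derivatives *)

Section weak_gradient.
Context (R : realType) (n : nat).
Local Notation E := 'rV[R]_n.+1.
Local Notation B := (borel_space R n).
Local Notation mu := (@lebB R n).
Local Notation e_ i := (delta_mx 0 i : E).

Lemma L1_bounded_support (f : E -> R) (M r : R) : 0 < r -> measurable_fun [set: B] (f : B -> R) ->
  (forall x, `|f x| <= M) -> (forall x, r < `|x| -> f x = 0) -> L1 f.
Proof.
move=> r0 mf fM f0; have mQ := @measurable_norm_lt R n 0 (r + 1).
have M0 : 0 <= M by exact: le_trans (fM 0).
have r10 : 0 < r + 1 by rewrite ltr_wpDr.
apply/integrableP; split; first exact/measurable_EFinP.
apply: (@le_lt_trans _ _ (\int[mu]_x (M%:E * (\1_[set y : E | (`|y - 0| < r + 1)%R] x)%:E))%E).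
  apply: ge0_le_integral => //.
  - by apply: measurableT_comp => //; apply/measurable_EFinP.
  - by apply: emeasurable_funM => //; apply/measurable_EFinP/measurable_indic.
  move=> x _ /=; rewrite lee_fin indicE; have [xr|rx] := leP `|x : E| r.
    by rewrite mem_set ?mulr1//= subr0 (le_lt_trans xr)// ltrDl.
  by rewrite f0// normr0 mulr_ge0.
rewrite ge0_integralZl ?lee_fin//; last by apply/measurable_EFinP/measurable_indic.
rewrite integral_indic// setIT lte_mul_pinfty ?lee_fin//.
by apply: (le_lt_trans (lebB_cube_le 0 r10)); rewrite ltry.
Qed.

Lemma norm_delta_le (i : 'I_n.+1) : `|e_ i| <= 1.
Proof.
by apply/(norm_le_coordP _ ler01) => j; rewrite mxE; case: (_ && _); rewrite ?normr1 ?normr0.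
Qed.

(** Difference quotients have integral 0 by translation invariance, and dominated convergence passes
    to the derivative. *)
Lemma integral_partial_eq0 (psi : E -> R) (r : R) i : 0 < r ->
  continuous psi -> (forall x j, derivable psi x (e_ j)) -> (forall j, continuous (partial j psi)) ->
  (forall x, r < `|x| -> psi x = 0) ->
  \int[mu]_x partial i psi x = 0.
Proof.
move=> r0 cpsi dpsi cp p0.
have [M M0 pM] := bounded_of_support cpsi p0.
have L1psi : L1 psi.
  by apply: (L1_bounded_support r0 _ pM p0); exact: continuous_measurable_borel.
have [M' M'0 pM'] : exists2 M', 0 < M' & forall j x, `|partial j psi x| <= M'.
  have /choice[m mP] : forall j, exists m, 0 < m /\ forall x, `|partial j psi x| <= m.
    by move=> j; have [m m0 mP] := bounded_of_support (cp j) (partial_support j p0); exists m.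
  exists (1 + \sum_j m j); first by rewrite ltr_wpDr// sumr_ge0// => j _; rewrite ltW// (mP j).1.
  move=> j x; apply: (le_trans ((mP j).2 x)); rewrite (bigD1 j)//= addrCA lerDl addr_ge0//.
  by rewrite sumr_ge0// => l _; rewrite ltW// (mP l).1.
pose t (k : nat) : R := k.+1%:R^-1.
have t0 k : 0 < t k by rewrite invr_gt0.
have t1 k : t k <= 1 by rewrite invf_le1// ler1n.
pose D (k : nat) (x : E) := (t k)^-1 * (psi (x + t k *: e_ i) - psi x).
have L1D k : L1 (D k) by apply: L1Z; apply: L1B => //; exact: L1_shift.
have int0 k : (\int[mu]_x (D k x)%:E = 0)%E.
  have : \int[mu]_x D k x = 0.
    rewrite /D RintegralZl//; last by apply: L1B => //; exact: L1_shift.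
    rewrite RintegralB//; last exact: L1_shift.
    rewrite (_ : \int[mu]_x psi (x + t k *: e_ i) = \int[mu]_x psi x) ?subrr ?mulr0//.
    rewrite /Rintegral (@integral_shift _ _ (t k *: e_ i) (EFin \o psi))//.
    exact: measurable_int L1psi.
  have fin := integrable_fin_num measurableT (L1D k).
  by move=> h; rewrite -(fineK fin); exact: (congr1 EFin h).
(* The steps [t k] are at most 1, so all difference quotients vanish from radius r + 2 on. *)
pose u (x : E) : R := (n.+1%:R * M') * \1_[set y : E | `|y - 0| < r + 2] x.
have mQ := @measurable_norm_lt R n 0 (r + 2).
have L1u : L1 u.
  apply: (@L1_bounded_support _ (n.+1%:R * M') (r + 2)).
  - by rewrite addr_gt0.
  - by apply: measurable_funM => //; exact: measurable_indic.
  - move=> x; rewrite normrM !ger0_norm ?mulr_ge0 ?(ltW M'0)//.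
    by rewrite ler_piMr ?mulr_ge0 ?(ltW M'0)// indicE; case: (_ \in _).
  - move=> x rx; rewrite /u indicE memNset ?mulr0//= subr0; apply/negP.
    by rewrite -leNgt ltW.
have dom : {ae mu, forall (x : B) k, setT x -> (`|(EFin \o D k) x| <= (EFin \o u) x)%E}.
  apply: aeW => x k _; rewrite /= lee_fin /u indicE.
  have [xr|rx] := ltP `|x : E| (r + 2).
    rewrite mem_set ?mulr1/= ?subr0// /D normrM ger0_norm ?invr_ge0 ?(ltW (t0 k))//.
    rewrite ler_pdivrMl// mulrC.
    apply: (le_trans (mvt_coord_le (q := x) (q' := (x : E) + t k *: e_ i) dpsi (fun y j _ => pM' j y))).
    rewrite ler_wpM2l ?mulr_ge0 ?(ltW M'0)// addrC addKr normrZ (ger0_norm (ltW (t0 k))).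
    by rewrite ler_piMr ?(ltW (t0 k))// norm_delta_le.
  have rx1 : r < `|x : E| by rewrite (lt_le_trans _ rx)// ltrDl.
  have rx2 : r < `|(x : E) + t k *: e_ i|.
    have h : `|x : E| <= `|(x : E) + t k *: e_ i| + t k.
      rewrite -{1}[x](addrK (t k *: e_ i)) (le_trans (ler_normB _ _))// lerD2l.
      by rewrite normrZ (ger0_norm (ltW (t0 k))) ler_piMr ?(ltW (t0 k))// norm_delta_le.
    rewrite -lerBlDr in h; apply: (lt_le_trans _ h); rewrite ltrBrDr (lt_le_trans _ rx)//.
    by rewrite ltrD2l (le_lt_trans (t1 k))// ltr1n.
  rewrite memNset /=; last by rewrite subr0; apply/negP; rewrite -leNgt.
  by rewrite /D !p0// subr0 !mulr0 normr0.
have mD k : measurable_fun [set: B] (EFin \o D k) by exact: measurable_int (L1D k).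
have mP : measurable_fun [set: B] (EFin \o partial i psi).
  by apply/measurable_EFinP; apply: continuous_measurable_borel; exact: cp.
have ae_cvg : {ae mu, forall x : B, setT x -> (EFin \o D k) x @[k --> \oo] --> (EFin \o partial i psi) x}.
  apply: aeW => x _; apply: cvg_EFin; first exact: nearW.
  have H : (h^-1 * (psi (h *: e_ i + x) - psi x)) @[h --> (0 : R)^'] --> partial i psi x := dpsi x i.
  have tc : (forall k, t k != 0) /\ t k @[k --> \oo] --> (0 : R).
    by split; [move=> k; rewrite gt_eqF|exact: cvg_harmonic].
  have De : (fun k => (t k)^-1 * (psi (t k *: e_ i + x) - psi x)) = (fun k => D k x).
    by apply/funext => k; rewrite /D [(x : E) + _]addrC.
  by have := (cvgr_dnbhsP _ _ _).1 H t tc; rewrite De.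
have [_ _ /= lim] := @dominated_convergence _ B R mu setT measurableT
  (fun k => EFin \o D k) (EFin \o partial i psi) (EFin \o u) mD mP ae_cvg L1u dom.
have : (\int[mu]_x (partial i psi x)%:E = 0)%E.
  have e0 : (fun k => \int[mu]_x (D k x)%:E)%E = (fun=> 0%E) by apply/funext.
  move: lim; rewrite e0 => lim.
  exact: (cvg_unique (@ereal_hausdorff R) lim (cvg_cst _)).
by rewrite /Rintegral => ->.
Qed.

Lemma test_functionP (Omega : set E) phi : test_function Omega phi -> exists r M : R,
  [/\ 0 < r /\ 0 < M, continuous phi, forall x j, derivable phi x (e_ j),
      forall j, continuous (partial j phi) &
      [/\ forall x, `|phi x| <= M, forall j x, `|partial j phi x| <= M &
          forall x, r < `|x| -> phi x = 0]].
Proof.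
case=> Ckphi cK _; have [cphi dphi] := Ckphi 1%N.
have [r0 [_ rP]] := compact_bounded cK.
pose r := `|r0| + 1; have r0' : 0 < r by rewrite ltr_wpDl.
have p0 x : r < `|x| -> phi x = 0.
  move=> rx; apply: contrapT => /eqP px.
  suff : `|x| <= r by rewrite leNgt rx.
  by apply: rP; [rewrite /r (le_lt_trans (ler_norm _))// ltrDl|apply: subset_closure].
have cpart j : continuous (partial j phi) by have [_ []] := dphi j.
have [M M0 pM] := bounded_of_support cphi p0.
have /choice[m mP] : forall j, exists m, 0 < m /\ forall x, `|partial j phi x| <= m.
  by move=> j; have [m m0 mP] := bounded_of_support (cpart j) (partial_support j p0); exists m.
have S0 : 0 <= \sum_j m j by rewrite sumr_ge0// => j _; rewrite ltW// (mP j).1.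
exists r, (M + \sum_j m j); split => //.
- by split => //; rewrite ltr_wpDr.
- by move=> x j; have [] := dphi j.
split=> // [x|j x]; first by rewrite (le_trans (pM x))// lerDl.
apply: (le_trans ((mP j).2 x)); rewrite (bigD1 j)//= addrCA lerDl addr_ge0 ?(ltW M0)//.
by rewrite sumr_ge0// => l _; rewrite ltW// (mP l).1.
Qed.

(** Near each point of [K] all sufficiently small margins work; compactness makes the choice
    uniform. *)
Lemma compact_inner_set (Omega K : set E) : open Omega -> compact K -> K `<=` Omega ->
  exists2 t : R, 0 < t & K `<=` inner_set Omega t.
Proof.
move=> oO /compact_near_coveringP cK KO.
have := cK R 0^'+ (fun t x => inner_set Omega t x) _.
move=> /(_ _)[].
- move=> x /KO Ox; have /nbhs_ballP[e /= e0 eO] := open_nbhs_nbhs (conj oO Ox).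
  exists (ball x (e / 2), [set t | t < e / 2]) => /=.
    split; first by apply: nbhsx_ballx; rewrite divr_gt0.
    by apply: nbhs_right_lt; rewrite divr_gt0.
  move=> [y t]/= [xy te] z zy; apply: eO; rewrite -ball_normE/= in xy *.
  rewrite (le_lt_trans (ler_distD y _ _))// [e]splitr ltrD// distrC.
  exact: lt_trans te.
- move=> t0 /= t00 H; exists (t0 / 2); first by rewrite divr_gt0.
  apply: H => /=; last by rewrite divr_gt0.
  by rewrite sub0r normrN ger0_norm ?divr_ge0 ?(ltW t00)// gtr_pMr// invf_lt1// ltr1n.
Qed.

Lemma test_function_out (Omega : set E) phi i x : test_function Omega phi ->
  ~ closure [set x | phi x != 0] x -> phi x = 0 /\ partial i phi x = 0.
Proof.
move=> T Kx; set K := closure _ in Kx.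
have oK : open (~` K) by apply: closed_openC; exact: closed_closure.
have zero y : ~ K y -> phi y = 0.
  by move=> Ky; apply: contrapT => /eqP py; apply: Ky; apply: subset_closure.
split; first exact: zero.
rewrite /partial (@near_eq_derive _ _ _ phi (cst 0)) ?derive_cst//.
have : nbhs x (~` K) by apply: open_nbhs_nbhs.
by apply: filterS => y /zero.
Qed.

(** The product of the C^1 mollification and the test function has compact support, so its partial
    derivative integrates to 0. *)
Lemma moll_parts (Omega : set E) (f phi : E -> R) d i : 0 < d -> L1 f -> test_function Omega phi ->
  [/\ L1 (fun x => partial i (moll d f) x * phi x), L1 (fun x => moll d f x * partial i phi x) &
  \int[mu]_x (partial i (moll d f) x * phi x) = - \int[mu]_x (moll d f x * partial i phi x)].
Proof.
move=> d0 L1f /test_functionP[r [M [[r0 M0] cphi dphi cpart [pM dM p0]]]].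
have dF x j : derivable (moll d f) x (e_ j) by exact: moll_derivable.
have cF : continuous (moll d f) by exact: moll_continuous.
have cdF j : continuous (partial j (moll d f)) by exact: partial_moll_continuous.
have cM (a b : E -> R) : continuous a -> continuous b -> continuous (fun x => a x * b x).
  by move=> ca cb x; exact: (continuousM (ca x) (cb x)).
have compL1 (a : E -> R) : continuous a -> (forall x, r < `|x| -> a x = 0) -> L1 a.
  move=> ca a0; have [m m0 am] := bounded_of_support ca a0.
  by apply: (L1_bounded_support r0 _ am a0); exact: continuous_measurable_borel.
pose psi x := moll d f x * phi x.
have dpsi x j : is_derive x (e_ j) psi (partial j (moll d f) x * phi x + moll d f x * partial j phi x).
  have h1 : is_derive x (e_ j) (moll d f) (partial j (moll d f) x) by apply: DeriveDef.
  have h2 : is_derive x (e_ j) phi (partial j phi x) by apply: DeriveDef.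
  have := @is_deriveM R E (moll d f) phi x (e_ j) _ _ h1 h2.
  move=> H; apply: (@is_derive_eq R E R^o _ _ _ _ _ H).
  by rewrite addrC /GRing.scale/= [phi x * _]mulrC.
have psiE j : partial j psi = (fun x => partial j (moll d f) x * phi x + moll d f x * partial j phi x).
  by apply/funext => x; have := dpsi x j => H; rewrite /partial derive_val.
have i1 : L1 (fun x => partial i (moll d f) x * phi x).
  by apply: compL1; [exact: cM|move=> x /p0 ->; rewrite mulr0].
have i2 : L1 (fun x => moll d f x * partial i phi x).
  by apply: compL1; [exact: cM|move=> x /(partial_support i p0) ->; rewrite mulr0].
split => //.
have := @integral_partial_eq0 psi r i r0.
rewrite psiE RintegralD// => H; apply/eqP; rewrite -subr_eq0 opprK; apply/eqP; apply: H.
- exact: cM.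
- by move=> x j; have [] := dpsi x j.
- by move=> j; rewrite psiE => x; exact: (cvgD (cM _ _ (cdF j) cphi x) (cM _ _ cF (cpart j) x)).
- by move=> x rx; rewrite /psi p0// mulr0.
Qed.

(** For a positive limit the power is exp(q log a); a limit 0 is treated where it occurs. *)
Lemma powR_cvg (q : R) (u : nat -> R) (a : R) : 0 < a ->
  u k @[k --> \oo] --> a -> u k `^ q @[k --> \oo] --> a `^ q.
Proof.
move=> a0 ua; have -> : a `^ q = expR (q * ln a) by rewrite /powR gt_eqF.
have u0 : \forall k \near \oo, 0 < u k by exact: cvgr_gt ua _ a0.
have e : \forall k \near \oo, expR (q * ln (u k)) = u k `^ q.
  by apply: filterS u0 => k uk; rewrite /powR gt_eqF.
apply: cvg_trans (near_eq_cvg e) _.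
have lnu : ln (u k) @[k --> \oo] --> ln a.
  by apply: (@cvg_comp _ _ _ u (@ln R) _ (nbhs a)) => //; exact: continuous_ln.
apply: (@cvg_comp _ _ _ (fun k => q * ln (u k)) (@expR R) _ (nbhs (q * ln a))).
  by apply: cvgM => //; exact: cvg_cst.
exact: continuous_expR.
Qed.

Let step (k : nat) : R := k.+1%:R^-1.
Let step0 k : 0 < step k. Proof. by rewrite invr_gt0. Qed.

Variables (Omega : set E) (f : E -> R) (i : 'I_n.+1) (q L : R).
Hypotheses (oO : open Omega) (L1f : L1 f) (L0 : 0 < L).

Section lower_bound.
Variables (G : E -> R) (A : set E) (M : \bar R).
Hypotheses (q0 : 0 < q) (mA : measurable (A : set B)).
Hypotheses (mG : measurable_fun [set: B] (G : B -> R)) (weakG : weak_test Omega i f G).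
Hypothesis L1G : forall t, 0 < t -> L1 (fun x => \1_(inner_set Omega t) x * G x).
Hypothesis hM : forall d, 0 < d ->
  (\int[mu]_x ((\1_(A `&` inner_set Omega (2 * d)) x)%:E *
     (L * `|partial i (moll d f) x| `^ q)%:E) <= M)%E.

Let pw (x : R) := L * `|x| `^ q.

Let pw0 x : 0 <= pw x.
Proof. by rewrite mulr_ge0 ?powR_ge0// ltW. Qed.

Let measurable_pw d (T : measurableType d) (h : T -> R) : measurable_fun setT h ->
  measurable_fun setT (pw \o h).
Proof.
move=> mh; apply: measurable_funM => //.
by apply: (measurableT_comp (measurable_powR q)); exact: measurableT_comp.
Qed.

(** At points of the inner set with margin 2t, the derivative of the mollified [f] is the
    mollification of the integrable truncation [G']. It converges to [G] almost everywhere along a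
    subsequence, and Fatou's lemma transfers the bound. *)
Lemma weak_partial_inner_Lq t : 0 < t ->
  (\int[mu]_x ((\1_(A `&` inner_set Omega (2 * t)) x)%:E * (pw (G x))%:E) <= M)%E.
Proof.
move=> t0; pose d k := t / 2 * step k.
have d0 k : 0 < d k by rewrite mulr_gt0 ?divr_gt0.
have dt k : d k <= t / 2.
  by rewrite ler_piMr ?divr_ge0 ?(ltW t0)// invf_le1// ler1n.
have dc : d k @[k --> \oo] --> (0 : R).
  by rewrite -[X in _ --> X](mulr0 (t / 2)); apply: cvgMl_tmp => //; exact: cvg_harmonic.
pose G' x := \1_(inner_set Omega t) x * G x.
have L1G' : L1 G' := L1G t0.
have mG' := L1_measurable L1G'.
have [s [ss sG]] := @L1_cvg_ae_subsequence _ B R mu (fun k => moll (d k) G') G'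
  (fun k => measurable_moll (d0 k) L1G') mG' (moll_cvg_L1 d0 dc L1G').
have mI u : measurable (A `&` inner_set Omega u : set B).
  by apply: measurableI => //; exact: measurable_inner_set.
apply: (@fatou_bound _ B R mu (fun k x => ((\1_(A `&` inner_set Omega (2 * d (s k))) x)%:E *
   (pw (partial i (moll (d (s k)) f) x))%:E))%E).
- move=> k; apply: emeasurable_funM; first by apply/measurable_EFinP/measurable_indic; exact: mI.
  by apply/measurable_EFinP/measurable_pw; exact: measurable_partial_moll.
- by move=> k x; rewrite mule_ge0 ?lee_fin.
- apply: emeasurable_funM; first by apply/measurable_EFinP/measurable_indic; exact: mI.
  by apply/measurable_EFinP/measurable_pw.
- by move=> x; rewrite mule_ge0 ?lee_fin.
- apply: filterS sG => x cx; rewrite indicE.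
  case: (boolP ((x : E) \in A `&` inner_set Omega (2 * t))) => [/set_mem[Ax xin]|_]; last first.
    rewrite mul0e; apply: le_limn_einf; apply: nearW => k.
    by rewrite mule_ge0 ?lee_fin.
  have innert (y : E) : `|y - x| < t -> inner_set Omega t y.
    move=> yx z zy; apply: xin; rewrite -(subrK y z) -addrA (le_lt_trans (ler_normD _ _))//.
    by rewrite mulrDl mul1r ltrD.
  have e k : ((\1_(A `&` inner_set Omega (2 * d (s k))) x)%:E * (pw (partial i (moll (d (s k)) f) x))%:E =
      (pw (moll (d (s k)) G' x))%:E)%E.
    have t2 : t / 2 < t by rewrite gtr_pMr// invf_lt1// ltr1n.
    have dts : d (s k) < t by exact: le_lt_trans (dt _) t2.
    rewrite indicE mem_set ?mul1e; last first.
      by split=> //; apply: inner_set_sub xin; rewrite ler_wpM2l// ltW.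
    have := @moll_weak_partial R n Omega i f G G' (d (s k)) x oO (d0 _) L1f L1G' weakG.
    move=> /(_ _ _)[].
    + move=> y yx; apply: (inner_setS t0); apply: innert; exact: le_lt_trans yx dts.
    + move=> y yx; rewrite /G' indicE mem_set ?mul1r//.
      by apply: innert; exact: lt_trans dts.
    by move=> _ v; rewrite /partial v.
  have GG : G' x = G x.
    by rewrite /G' indicE mem_set ?mul1r//; apply: innert; rewrite subrr normr0.
  rewrite mul1e; under eq_fun do rewrite e.
  (* If [G x] is 0 the lower limit only has to be nonnegative, so continuity of the power at 0 is
     avoided. *)
  have [Gx0|Gx0] := eqVneq (G x) 0.
    rewrite Gx0 /pw normr0 powR0 ?gt_eqF// mulr0; apply: le_limn_einf; apply: nearW => k.
    by rewrite lee_fin; exact: (pw0 (moll (d (s k)) G' x)).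
  have cE : (pw (moll (d (s k)) G' x))%:E @[k --> \oo] --> (pw (G' x))%:E.
    apply: cvg_EFin; first exact: nearW.
    apply: cvgM; first exact: cvg_cst.
    by apply: powR_cvg; [rewrite normr_gt0 GG|exact: cvg_norm].
  by rewrite (cvg_limn_einf_sup cE).1 GG.
- by move=> k; exact: hM.
Qed.

(** The inner sets exhaust the open set [Omega] as the margin tends to 0, and Fatou's lemma applies
    once more. *)
Lemma weak_partial_Lq :
  (\int[mu]_x ((\1_(A `&` Omega) x)%:E * (pw (G x))%:E) <= M)%E.
Proof.
have mO := measurable_open_borel oO.
apply: (@fatou_bound _ B R mu (fun k x => ((\1_(A `&` inner_set Omega (2 * step k)) x)%:E * (pw (G x))%:E))%E).
- move=> k; apply: emeasurable_funM; last by apply/measurable_EFinP/measurable_pw.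
  by apply/measurable_EFinP/measurable_indic; apply: measurableI => //; exact: measurable_inner_set.
- by move=> k x; rewrite mule_ge0 ?lee_fin.
- apply: emeasurable_funM; last by apply/measurable_EFinP/measurable_pw.
  by apply/measurable_EFinP/measurable_indic; apply: measurableI.
- by move=> x; rewrite mule_ge0 ?lee_fin.
- apply: aeW => x; apply: le_limn_einf; rewrite indicE.
  case: (boolP ((x : E) \in A `&` Omega)) => [/set_mem[Ax Ox]|_]; last first.
    by apply: nearW => k; rewrite mul0e mule_ge0 ?lee_fin.
  have /nbhs_ballP[e /= e0 eO] := open_nbhs_nbhs (conj oO Ox).
  have c0 : step k @[k --> \oo] --> (0 : R) by exact: cvg_harmonic.
  have /cvgrPdist_lt/(_ (e / 2)) := c0; rewrite divr_gt0// => /(_ isT).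
  apply: filterS => k; rewrite sub0r normrN ger0_norm ?(ltW (step0 k))// => ke.
  rewrite indicE mem_set//; split=> // y yx; apply: eO; rewrite -ball_normE/= distrC.
  by rewrite (lt_trans yx)// mulrC -ltr_pdivlMr.
- by move=> k; exact: weak_partial_inner_Lq.
Qed.

End lower_bound.

Section existence.
Variable M : R.
Hypothesis q1 : 1 < q.
Hypothesis Ofin : (mu Omega < +oo)%E.
Hypothesis hM : forall d, 0 < d ->
  (\int[mu]_x ((\1_(inner_set Omega (2 * d)) x)%:E *
     (L * `|partial i (moll d f) x| `^ q)%:E) <= M%:E)%E.

(** The truncated derivatives of mollifications are bounded in L^q, so their hulls contain a
    sequence that converges in L1. The approximate integration by parts identity is affine in the
    function and thus holds on whole hulls; this is why convex combinations can take the place of a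
    weak limit. *)
Lemma weak_partial_exists : exists2 g, L1 g & weak_test Omega i f g.
Proof.
have mO := measurable_open_borel oO.
pose h k x := \1_(inner_set Omega (2 * step k)) x * partial i (moll (step k) f) x.
have mI k : measurable (inner_set Omega (2 * step k) : set B) by exact: measurable_inner_set.
have mh k : measurable_fun [set: B] (h k : B -> R).
  by apply: measurable_funM; [exact: measurable_indic|exact: measurable_partial_moll].
have h0 k x : ~ Omega x -> h k x = 0.
  move=> Ox; rewrite /h indicE memNset ?mul0r// => /inner_setS H; apply: Ox; apply: H.
  by rewrite mulr_gt0.
have q0 : 0 < q by exact: lt_trans q1.
have hM' k : (\int[mu]_(x in Omega) (`|h k x| `^ q)%:E <= (M / L)%:E)%E.
  have mhq : measurable_fun [set: B] (fun x => (`|h k x| `^ q)%:E).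
    apply/measurable_EFinP; apply: (measurableT_comp (measurable_powR q)).
    exact: measurableT_comp.
  have le1 : (L%:E * \int[mu]_(x in Omega) (`|h k x| `^ q)%:E <= M%:E)%E.
    rewrite -ge0_integralZl//; last 2 first.
    - exact: measurable_funTS.
    - by rewrite lee_fin ltW.
    apply: le_trans (hM (step0 k)).
    rewrite integral_indicl; apply: ge0_le_integral => //.
    - by move=> x _; rewrite mule_ge0 ?mule_ge0 ?lee_fin ?(ltW L0).
    - apply: emeasurable_funM; first by apply/measurable_EFinP/measurable_indic.
      by apply: emeasurable_funM.
    - apply: emeasurable_funM; first by apply/measurable_EFinP/measurable_indic.
      apply/measurable_EFinP; apply: measurable_funM => //.
      apply: (measurableT_comp (measurable_powR q)); apply: measurableT_comp => //.
      exact: measurable_partial_moll.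
    move=> x _; rewrite /h !indicE; case: (boolP (_ \in inner_set _ _)) => _.
      rewrite mul1r mul1e -!EFinM lee_fin ler_piMl ?mulr_ge0 ?powR_ge0 ?(ltW L0)//.
      by case: (_ \in _).
    by rewrite mul0e mul0r normr0 powR0 ?gt_eqF// !mule0.
  by rewrite EFinM muleC lee_pdivlMl.
have [u [g [hu ig iu ug]]] := @midhull_L1_limit _ B R mu Omega q (M / L) h mO Ofin q1 mh h0 hM'.
exists g => // phi Tphi.
have [r [Mp [[r0 Mp0] cphi dphi cpart [pM dM p0]]]] := test_functionP Tphi.
have [_ cK KO] := Tphi.
have [t t0 Kt] := compact_inner_set oO cK KO.
have mphi : measurable_fun [set: B] (phi : B -> R) by exact: continuous_measurable_borel.
have mdphi : measurable_fun [set: B] (partial i phi : B -> R) by exact: continuous_measurable_borel.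
have L1bM (a b : E -> R) : measurable_fun [set: B] (b : B -> R) -> (forall x, `|b x| <= Mp) -> L1 a ->
    L1 (fun x => a x * b x).
  move=> mb bM L1a; have := integrable_boundedM mb bM L1a.
  by apply: eq_integrable => // x _; rewrite /= mulrC.
have L1fd := L1bM f _ mdphi (dM i) L1f.
have L1gp := L1bM g _ mphi pM ig.
pose c := \int[mu]_x (f x * partial i phi x).
have bdd (a b : E -> R) (e : R) : L1 a -> (forall x, `|b x| <= Mp) -> measurable_fun [set: B] (b : B -> R) ->
    (\int[mu]_x (`|a x|)%:E <= e%:E)%E -> `|\int[mu]_x (a x * b x)| <= e * Mp.
  move=> L1a bM mb ae; have L1ab := L1bM a b mb bM L1a.
  rewrite -lee_fin EFin_normr_Rintegral//; apply: (le_trans (le_abse_integral _ _ _)) => //.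
    exact: measurable_int L1ab.
  apply: (@le_trans _ _ (\int[mu]_x ((`|a x|)%:E * Mp%:E))%E).
    apply: ge0_le_integral => //.
    - by apply: measurableT_comp => //; exact: measurable_int L1ab.
    - apply: emeasurable_funM => //; apply/measurable_EFinP; apply: measurableT_comp => //.
      exact: L1_measurable.
    by move=> x _; rewrite lee_fin normrM ler_wpM2l.
  rewrite ge0_integralZr ?lee_fin ?(ltW Mp0)//; last first.
    by apply/measurable_EFinP; apply: measurableT_comp => //; exact: L1_measurable.
  by rewrite EFinM lee_wpmul2r// lee_fin ltW.
have c0 : step k @[k --> \oo] --> (0 : R) by exact: cvg_harmonic.
(* Far along the sequence the test function is supported in the inner set, where the truncation is
   invisible, and [moll_parts] applies; midpoints inherit the bound by the triangle inequality. *)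
have tail (e : R) : 0 < e -> exists N, forall v, midhull (T := B) h N v ->
    L1 (fun x => v x * phi x) /\ `|\int[mu]_x (v x * phi x) + c| <= e * Mp.
  move=> e0; have [N1 N1P] := moll_cvg_L1 step0 c0 L1f e0.
  have [N2 N2P] : exists N2 : nat, forall m, (N2 <= m)%N -> 2 * step m <= t.
    move/cvgrPdist_lt: c0 => /(_ (t / 2)); rewrite divr_gt0// => /(_ isT)[N2 _ N2P].
    exists N2 => m /N2P /=; rewrite sub0r normrN ger0_norm ?(ltW (step0 m))// => mt.
    by rewrite mulrC -ler_pdivlMr// ltW.
  exists (maxn N1 N2) => v; elim=> {v} [k|v w _ [L1v vc] _ [L1w wc]].
    rewrite geq_max => /andP[N1k N2k].
    have [p1 p2 p3] := @moll_parts Omega f phi (step k) i (step0 k) L1f Tphi.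
    have hE : (fun x => h k x * phi x) = (fun x => partial i (moll (step k) f) x * phi x).
      apply/funext => x; rewrite /h indicE; case: (boolP (_ \in _)) => [_|]; first by rewrite mul1r.
      move=> /negP xin; rewrite (test_function_out i Tphi _).1 ?mulr0// => Kx.
      by apply: xin; rewrite inE; apply: inner_set_sub (Kt _ Kx); exact: N2P.
    rewrite hE; split=> //; rewrite p3 addrC -RintegralB//.
    rewrite (_ : \int[mu]_x (f x * _ - _) = \int[mu]_x ((f x - moll (step k) f x) * partial i phi x)); last first.
      by apply: eq_Rintegral => x _; rewrite mulrBl.
    apply: bdd => //.
      by apply: L1B => //; exact: L1_moll.
    apply: le_trans (N1P _ N1k); rewrite le_eqVlt; apply/orP; left; apply/eqP.
    by apply: eq_integral => x _; rewrite distrC.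
  have e1 : (fun x => 2^-1 * (v x + w x) * phi x) = (fun x => 2^-1 * (v x * phi x + w x * phi x)).
    by apply/funext => x; rewrite -mulrA mulrDl.
  have L1s := L1D L1v L1w.
  rewrite e1; split; first exact: L1Z.
  rewrite RintegralZl// RintegralD//.
  rewrite (_ : _ + c = 2^-1 * ((\int[mu]_x (v x * phi x) + c) + (\int[mu]_x (w x * phi x) + c))); last by lra.
  rewrite normrM ger0_norm ?invr_ge0// mulrC ler_pdivrMr//.
  by rewrite (le_trans (ler_normD _ _))// mulrDr mulr1 lerD.
have gc : \int[mu]_x (g x * phi x) = - c.
  apply/eqP; rewrite -subr_eq0 opprK -normr_eq0 eq_le normr_ge0 andbT.
  apply/ler_addgt0Pr => e e0; rewrite add0r.
  pose e' := e / (2 * Mp); have e'0 : 0 < e' by rewrite divr_gt0 ?mulr_gt0.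
  have [N NP] := tail _ e'0; have [N' N'P] := ug _ e'0.
  pose m := maxn N N'.
  have [L1um um] := NP (u m) (midhull_le (leq_maxl N N') (hu m)).
  have := N'P m (leq_maxr N N') => ugm.
  have L1d : L1 (fun x => u m x - g x) by apply: L1B => //; exact: iu.
  have := bdd _ phi _ L1d pM mphi ugm.
  rewrite (_ : \int[mu]_x ((u m x - g x) * phi x) = \int[mu]_x (u m x * phi x) - \int[mu]_x (g x * phi x)); last first.
    by rewrite -RintegralB//; apply: eq_Rintegral => x _; rewrite mulrBl.
  move=> h1; rewrite (_ : _ + c = (\int[mu]_x (u m x * phi x) + c) -
    (\int[mu]_x (u m x * phi x) - \int[mu]_x (g x * phi x))); last by lra.
  apply: (le_trans (ler_normB _ _)); apply: (le_trans (lerD um h1)).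
  rewrite -mulrDl /e' invfM mulrA -mulrDl.
  by rewrite -splitr divfK ?gt_eqF.
have out x : ~ Omega x -> phi x = 0 /\ partial i phi x = 0.
  by move=> Ox; apply: test_function_out Tphi _ => Kx; apply: Ox; exact: KO.
have onO (F : E -> R) : (forall x, ~ Omega x -> F x = 0) ->
    (\int[mu]_(x in Omega) (F x)%:E = \int[mu]_x (F x)%:E)%E.
  move=> F0; rewrite integral_mkcond; apply: eq_integral => x _.
  by rewrite patchE; case: ifPn => // /negP Ox; rewrite F0// => Ox'; apply: Ox; rewrite inE.
rewrite !onO; last 2 first.
- by move=> x /out[-> _]; rewrite mulr0.
- by move=> x /out[_ ->]; rewrite mulr0.
have f1 := integrable_fin_num measurableT L1fd; have f2 := integrable_fin_num measurableT L1gp.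
rewrite -(fineK f1) -(fineK f2) -EFinN; congr EFin.
by move: gc; rewrite /c /Rintegral => ->; rewrite opprK.
Qed.

End existence.

End weak_gradient.

(** The Morrey norm on [Omega] is an infimum that need not be attained; it is replaced by the real
    numbers above it. An infinite [X] is covered too. *)
Lemma le_scale (R : realType) (X Y : \bar R) (C : R) : 0 < C -> (0 <= X)%E ->
  (forall m : R, 0 < m -> (X < m%:E)%E -> (Y <= (C * m)%:E)%E) -> (Y <= C%:E * X)%E.
Proof.
move=> C0 X0 H; case: X X0 H => [x x0 H|_ _|//]; last by rewrite gt0_muley ?lte_fin// leey.
apply/lee_addgt0Pr => e e0; rewrite -EFinM -EFinD.
have := H (x + e / C); rewrite ltr_wpDl// ?divr_gt0// lte_fin ltrDl divr_gt0// => /(_ isT isT).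
by rewrite mulrDr [C * (e / C)]mulrC divfK// gt_eqF.
Qed.

(** * Morrey norms and Borel versions *)

Section morrey_balls.
Context (R : realType) (n : nat).
Local Notation E := 'rV[R]_n.+1.
Local Notation B := (borel_space R n).
Local Notation L := (lebesgue_space R n).
Local Notation mu := (@lebB R n).
Variables (alpha q : R).
Hypothesis q0 : 0 < q.

Lemma measurable_eball (x : E) (rad : R) : measurable (eball x rad : set B).
Proof.
have := measurable_affine 1 (- x) (measurableT) (measurable_enorm measurableT (measurable_itv `]-oo, rad[)).
rewrite !setTI; congr (measurable _); apply/seteqP; split=> y /=; by rewrite in_itv/= scale1r.
Qed.

Lemma lebB_eball (x : E) (rad : R) : mu (eball x rad) = mu (eball (0 : E) rad).
Proof.
have := lebB_affine (- x) (eball (0 : E) rad) ltr01; rewrite expr1n invr1 mul1e => <-.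
by congr lebB; apply/seteqP; split=> y; rewrite /eball/= scale1r subr0.
Qed.

Lemma lebB_eball_gt0 (x : E) (rad : R) : 0 < rad -> (0 < mu (eball x rad))%E.
Proof.
move=> r0; have d0 : 0 < rad / n.+1%:R by rewrite divr_gt0.
apply: (@lt_le_trans _ _ (((rad / n.+1%:R) ^+ n.+1)%:E)); first by rewrite lte_fin exprn_gt0.
apply: (le_trans (lebB_cube_ge x d0)); apply: le_measure; rewrite ?inE.
- exact: measurable_norm_lt.
- exact: measurable_eball.
move=> y /= yx; apply: (le_lt_trans (enorm_le_norm _)).
by rewrite mulrC -ltr_pdivlMr.
Qed.

Lemma lebB_eball_fin (x : E) (rad : R) : 0 < rad -> (mu (eball x rad) < +oo)%E.
Proof.
move=> r0; apply: (@le_lt_trans _ _ ((2 * rad) ^+ n.+1)%:E); last exact: ltry.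
apply: (le_trans _ (lebB_cube_le x r0)); apply: le_measure; rewrite ?inE.
- exact: measurable_eball.
- exact: measurable_norm_lt.
by move=> y /= yx; exact: le_lt_trans (norm_le_enorm _) yx.
Qed.

(** What a Morrey norm at most [m] says about the integral of the q-th power over a ball of radius
    [rad]. By translation invariance it does not depend on the centre. *)
Definition morrey_bound (m rad : R) : R :=
  (m * fine (mu (eball (0 : E) rad)) `^ (q^-1 - alpha^-1)) `^ q.

Lemma morrey_boundZ (c m rad : R) : 0 <= c -> 0 <= m ->
  c * morrey_bound m rad = morrey_bound (c `^ q^-1 * m) rad.
Proof.
move=> c0 m0; rewrite /morrey_bound -mulrA [RHS]powRM ?powR_ge0 ?mulr_ge0 ?powR_ge0//.
by rewrite -powRrM mulVf ?gt_eqF// powRr1.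
Qed.

Lemma morrey_norm_leP (g : E -> \bar R) (m : R) : 0 <= m ->
  ((morrey_norm alpha q g <= m%:E)%E <-> forall x rad, 0 < rad ->
   (\int[lebn]_(y in eball x rad) (`|g y| `^ q) <= (morrey_bound m rad)%:E)%E).
Proof.
move=> m0.
have key x rad : 0 < rad -> ((lebn (eball x rad) `^ (alpha^-1 - q^-1) *
    'N[lebn]_(q%:E)[g \_ (eball x rad)] <= m%:E)%E <->
    (\int[lebn]_(y in eball x rad) (`|g y| `^ q) <= (morrey_bound m rad)%:E)%E).
  move=> r0; set I := integral _ _ _.
  have I0 : (0 <= I)%E by apply: integral_ge0 => y _; exact: poweR_ge0.
  have -> : ('N[lebn]_(q%:E)[g \_ (eball x rad)] = I `^ q^-1)%E.
    rewrite unlock /I [in RHS]integral_mkcond; congr (_ `^ _)%E.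
    apply: eq_integral => y _; rewrite !patchE; case: ifP => // _.
    by rewrite abse0 poweR0r// gt_eqF.
  have b0 : 0 < fine (mu (eball (0 : E) rad)).
    by rewrite fine_gt0// lebB_eball_gt0//= lebB_eball_fin.
  have -> : lebn (eball x rad) = (fine (mu (eball (0 : E) rad)))%:E.
    rewrite fineK; first exact: lebB_eball.
    by rewrite ge0_fin_numE// lebB_eball_fin.
  set b := fine _ in b0 *; rewrite poweR_EFin.
  have -> : b `^ (alpha^-1 - q^-1) = (b `^ (q^-1 - alpha^-1))^-1 by rewrite -powRN opprB.
  rewrite lee_pdivrMl ?powR_gt0// -EFinM mulrC /morrey_bound -/b.
  set c := m * _; have c0 : 0 <= c by rewrite mulr_ge0 ?powR_ge0.
  split=> h.
    have := ler_poweR (ltW q0) (poweR_ge0 _ _) h.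
    by rewrite -poweRrM mulVf ?gt_eqF// poweRe1// poweR_EFin.
  have qi0 : 0 <= q^-1 by rewrite invr_ge0 ltW.
  have := ler_poweR qi0 I0 h.
  by rewrite poweR_EFin -powRrM mulfV ?gt_eqF// powRr1.
split=> [h x rad r0|h].
  by apply/key => //; apply: le_trans h; apply: ereal_sup_ubound; exists (x, rad).
by apply: ge_ereal_sup => _ [[x rad] /= r0 <-]; apply/key => //; exact: h.
Qed.

(** Subsets of null sets are Caratheodory measurable, so a Borel function may be changed arbitrarily
    on a null set and stays Lebesgue measurable. *)
Lemma measurable_ae_borel d (T : measurableType d) (F h : E -> T) (Z : set E) :
  measurable (Z : set B) -> mu Z = 0%E -> measurable_fun [set: B] (h : B -> T) ->
  (forall x, ~ Z x -> F x = h x) -> measurable_fun [set: L] (F : L -> T).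
Proof.
move=> mZ Z0 mh Fh _ Y mY; rewrite setTI.
have -> : F @^-1` Y = ((h @^-1` Y) `&` ~` Z) `|` (F @^-1` Y `&` Z).
  apply/seteqP; split=> x /=.
    by move=> FY; case: (pselect (Z x)) => Zx; [right|left; rewrite -Fh].
  by case=> [[hY /Fh ->]|[]].
apply: measurableU.
  apply: measurable_borel_lebesgue; apply: measurableI; last exact: measurableC.
  by have := mh measurableT _ mY; rewrite setTI.
apply: le_caratheodory_measurable => X.
have N0 : (lebesgue_outer (X `&` (F @^-1` Y `&` Z)) <= 0)%E.
  by rewrite -[leRHS]Z0; apply: le_lebesgue_outer => x [_ []].
rewrite -[leRHS]add0e; apply: leeD; first exact: N0.
by apply: le_outer_measure => x [].
Qed.

Lemma integral_ae_borel (D : set E) (F h : E -> \bar R) (Z : set E) :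
  measurable (D : set B) ->
  measurable (Z : set B) -> mu Z = 0%E -> measurable_fun [set: B] (h : B -> \bar R) ->
  (forall x, ~ Z x -> F x = h x) ->
  (\int[lebn]_(x in D) F x = \int[mu]_(x in D) h x)%E.
Proof.
move=> mD mZ Z0 mh Fh.
have mF := measurable_ae_borel mZ Z0 mh Fh.
rewrite -(integral_lebn mD (measurable_funTS mh)).
apply: ae_eq_integral.
- exact: measurable_borel_lebesgue.
- exact: measurable_funTS.
- by apply: measurable_funTS; apply: (measurable_ae_borel mZ Z0 mh).
exists Z; split => //; first exact: measurable_borel_lebesgue.
by move=> x /= nh; apply: contrapT => Zx; apply: nh => _; exact: Fh.
Qed.

Lemma integral_ae_borel_pow (D : set E) (F h : E -> \bar R) (Z : set E) :
  measurable (D : set B) ->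
  measurable (Z : set B) -> mu Z = 0%E -> measurable_fun [set: B] (h : B -> \bar R) ->
  (forall x, ~ Z x -> F x = h x) ->
  (\int[lebn]_(x in D) (`|F x| `^ q) = \int[mu]_x ((\1_D x)%:E * (`|h x| `^ q)))%E.
Proof.
move=> mD mZ Z0 mh Fh; rewrite -integral_indicl; apply: (@integral_ae_borel _ _ _ Z) => //.
- by apply: (measurableT_comp (measurable_poweR q)); exact: measurableT_comp.
- by move=> x Zx; rewrite Fh.
Qed.

Definition morrey_le (h : E -> \bar R) (m : R) := forall x rad, 0 < rad ->
  (\int[mu]_y ((\1_(eball x rad) y)%:E * (`|h y| `^ q)) <= (morrey_bound m rad)%:E)%E.

Variable Omega : set E.
Hypothesis mO : measurable (Omega : set B).

Lemma morrey_norm_ge0 (g : E -> \bar R) : (0 <= morrey_norm alpha q g)%E.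
Proof.
apply: (le_trans _ (ereal_sup_ubound _)); last first.
  by exists ((0 : E), 1) => //=; exact: ltr01.
by rewrite mule_ge0 ?poweR_ge0 ?Lnorm_ge0.
Qed.

Lemma morrey_norm_on_ge0 (F : E -> \bar R) : (0 <= morrey_norm_on Omega alpha q F)%E.
Proof. by apply: le_ereal_inf_tmp => _ [g _ <-]; exact: morrey_norm_ge0. Qed.

(** Some extension has norm below [m]. Almost everywhere on [Omega] the version agrees with it, and
    outside [Omega] the version is 0, so it is no larger in absolute value. *)
Lemma morrey_norm_on_lt (F h : E -> \bar R) (Z : set E) (m : R) : 0 < m ->
  measurable (Z : set B) -> mu Z = 0%E -> measurable_fun [set: B] (h : B -> \bar R) ->
  (forall x, ~ Z x -> Omega x -> F x = h x) -> (forall x, ~ Omega x -> h x = 0%E) ->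
  (morrey_norm_on Omega alpha q F < m%:E)%E -> morrey_le h m.
Proof.
move=> m0 mZ Z0 mh Fh h0 Nm x rad r0.
have [_ [g [[mg _] gF] <-] gm] := ereal_inf_lt Nm.
have := (morrey_norm_leP g (ltW m0)).1 (ltW gm) x rad r0.
have mB := measurable_eball x rad.
apply: le_trans; pose F' := fun y => if y \in Omega then F y else 0%E.
have Fh' y : ~ Z y -> F' y = h y.
  move=> Zy; rewrite /F'; case: ifPn => [/set_mem Oy|/negP Oy]; first exact: Fh.
  by rewrite h0// => Oy'; apply: Oy; rewrite inE.
rewrite -(integral_ae_borel_pow mB mZ Z0 mh Fh').
have mF' := measurable_ae_borel mZ Z0 mh Fh'.
apply: ge0_le_integral.
- exact: measurable_borel_lebesgue.
- by move=> y _; exact: poweR_ge0.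
- apply: measurable_funTS; apply: (measurableT_comp (measurable_poweR q)).
  exact: (measurableT_comp (@abse_measurable R setT) mF').
- apply: measurable_funTS; apply: (measurableT_comp (measurable_poweR q)).
  exact: (measurableT_comp (@abse_measurable R setT) mg).
move=> y _; apply: ler_poweR => //; first exact: ltW.
by rewrite /F'; case: ifPn => [/set_mem Oy|_]; [rewrite gF|rewrite abse0].
Qed.

(** The witness is the extension by zero of [F] itself and not [h], since an extension must agree
    with [F] at every point of [Omega]. *)
Lemma morrey_norm_on_le (F h : E -> \bar R) (Z : set E) (m : R) : 0 <= m ->
  measurable (Z : set B) -> mu Z = 0%E -> measurable_fun [set: B] (h : B -> \bar R) ->
  (forall x, ~ Z x -> Omega x -> F x = h x) -> (forall x, ~ Omega x -> h x = 0%E) ->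
  morrey_le h m -> morrey_on Omega alpha q F /\ (morrey_norm_on Omega alpha q F <= m%:E)%E.
Proof.
move=> m0 mZ Z0 mh Fh h0 hm; pose F' := fun y => if y \in Omega then F y else 0%E.
have Fh' y : ~ Z y -> F' y = h y.
  move=> Zy; rewrite /F'; case: ifPn => [/set_mem Oy|/negP Oy]; first exact: Fh.
  by rewrite h0// => Oy'; apply: Oy; rewrite inE.
have N : (morrey_norm alpha q F' <= m%:E)%E.
  apply/morrey_norm_leP => // x rad r0.
  by rewrite (integral_ae_borel_pow (measurable_eball x rad) mZ Z0 mh Fh'); exact: hm.
have ext : morrey_extension Omega alpha q F F'.
  split; first split.
  - exact: (measurable_ae_borel mZ Z0 mh Fh').
  - exact: le_lt_trans N (ltry _).
  by move=> x Ox; rewrite /F' mem_set.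
split; first by exists F'.
by apply: le_trans N; apply: ereal_inf_lbound; exists F'.
Qed.

Lemma morrey_on_lt (F : E -> \bar R) : morrey_on Omega alpha q F ->
  exists2 m : R, 0 < m & (morrey_norm_on Omega alpha q F < m%:E)%E.
Proof.
case=> g [[mg gN] gF].
have N := ereal_inf_lbound (ex_intro2 _ _ g (conj (conj mg gN) gF) erefl) :
  (morrey_norm_on Omega alpha q F <= morrey_norm alpha q g)%E.
have g0 := morrey_norm_ge0 g; have gfin : (morrey_norm alpha q g \is a fin_num)%E.
  by rewrite ge0_fin_numE.
exists (fine (morrey_norm alpha q g) + 1).
  by rewrite ltr_wpDl// fine_ge0.
by apply: (le_lt_trans N); rewrite -{1}(fineK gfin) lte_fin ltrDl.
Qed.

End morrey_balls.

(** * Borel versions and their transfer to weak derivatives *)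

Section representatives.
Context (R : realType) (n : nat).
Local Notation E := 'rV[R]_n.+1.
Local Notation B := (borel_space R n).
Local Notation L := (lebesgue_space R n).
Local Notation mu := (@lebB R n).
Variables (Omega : set E).
Hypothesis oO : open Omega.

Let mO : measurable (Omega : set B). Proof. exact: measurable_open_borel. Qed.

(** Being 0 outside [Omega] makes [f'] a function on the whole space that can be translated and
    mollified. *)
Definition borel_version (f f' : E -> R) (Z : set E) :=
  [/\ measurable (Z : set B), mu Z = 0%E, measurable_fun [set: B] (f' : B -> R),
      forall x, ~ Z x -> Omega x -> f x = f' x & forall x, ~ Omega x -> f' x = 0].

Lemma borel_version_exists (f : E -> R) : measurable_fun (Omega : set L) (f : L -> R) ->
  exists f' Z, borel_version f f' Z.
Proof.
move=> mf; have mOL : measurable (Omega : set L) by exact: measurable_borel_lebesgue.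
have [Z [mZ Z0 mf']] := borel_representative ((measurable_restrictT (f : L -> R) mOL).1 mf).
exists ((f \_ Omega) \_ (~` Z)), Z; split => //.
- by move=> x Zx Ox; rewrite !patchE mem_set// mem_set.
- by move=> x Ox; rewrite !patchE; case: ifP => // _; rewrite memNset.
Qed.

Lemma borel_version_measurable (f f' : E -> R) Z : borel_version f f' Z ->
  measurable_fun (Omega : set L) (f : L -> R).
Proof.
case=> mZ Z0 mf' ff' f'0.
have mOL : measurable (Omega : set L) by exact: measurable_borel_lebesgue.
apply/(measurable_restrictT (f : L -> R) mOL).
apply: (measurable_ae_borel (d := _) mZ Z0 mf') => x Zx; rewrite patchE.
by case: ifPn => [/set_mem Ox|/negP Ox]; [exact: ff'|rewrite f'0// => Ox'; apply: Ox; rewrite inE].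
Qed.

Lemma borel_version_integral (f f' : E -> R) Z (phi : E -> R) : borel_version f f' Z ->
  measurable_fun [set: B] (phi : B -> R) ->
  (\int[lebn]_(x in Omega) (f x * phi x)%:E = \int[mu]_(x in Omega) (f' x * phi x)%:E)%E.
Proof.
case=> mZ Z0 mf' ff' f'0 mphi.
rewrite -(integral_ae_borel (F := fun x => ((if x \in Omega then f x else 0) * phi x)%:E) mO mZ Z0).
- by apply: eq_integral => x; rewrite inE => Ox; rewrite mem_set.
- by apply/measurable_EFinP; exact: measurable_funM.
move=> x Zx; case: ifPn => [/set_mem Ox|/negP Ox]; first by rewrite ff'.
by rewrite f'0 ?mul0r// => Ox'; apply: Ox; rewrite inE.
Qed.

Lemma weak_partial_test (f f' g g' : E -> R) Zf Zg i : borel_version f f' Zf ->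
  borel_version g g' Zg -> weak_partial Omega i f g -> weak_test Omega i f' g'.
Proof.
move=> vf vg [_ _ W] phi Tphi.
have [r [Mp [_ cphi _ cpart _]]] := test_functionP Tphi.
have := W phi Tphi; rewrite (borel_version_integral vf); last exact: continuous_measurable_borel.
by rewrite (borel_version_integral vg)//; exact: continuous_measurable_borel.
Qed.

Lemma locally_integrable_on_L1 (f f' : E -> R) Z : borel_version f f' Z -> L1 f' ->
  locally_integrable_on Omega f.
Proof.
move=> vf L1f; split; first exact: borel_version_measurable vf.
move=> K KO cK; have [mZ Z0 mf' ff' f'0] := vf.
have mK : measurable (K : set B).
  rewrite -[K]setCK; apply: measurableC; apply: measurable_open_borel.
  apply: closed_openC; apply: compact_closed => //; exact: norm_hausdorff.
rewrite (_ : integral _ _ _ = \int[lebn]_(x in K) `|(if x \in Omega then f x else 0)|%:E)%E; last first.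
  by apply: eq_integral => x; rewrite inE => /KO Ox; rewrite mem_set.
rewrite (integral_ae_borel (h := fun x => `|f' x|%:E) mK mZ Z0); last 2 first.
- by apply/measurable_EFinP; exact: measurableT_comp.
- move=> x Zx; case: ifPn => [/set_mem Ox|/negP Ox]; first by rewrite ff'.
  by rewrite f'0// => Ox'; apply: Ox; rewrite inE.
have /integrableP[_ L1f'] := integrableS measurableT mK (@subsetT _ K) L1f.
by apply: le_lt_trans L1f'.
Qed.

Lemma test_weak_partial (f f' g g' : E -> R) Zf Zg i : borel_version f f' Zf ->
  borel_version g g' Zg -> L1 f' -> L1 g' -> weak_test Omega i f' g' -> weak_partial Omega i f g.
Proof.
move=> vf vg L1f L1g W; split.
- exact: locally_integrable_on_L1 vf L1f.
- exact: locally_integrable_on_L1 vg L1g.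
move=> phi Tphi; have [r [Mp [_ cphi _ cpart _]]] := test_functionP Tphi.
have := W phi Tphi; rewrite (borel_version_integral vf); last exact: continuous_measurable_borel.
by rewrite (borel_version_integral vg)//; exact: continuous_measurable_borel.
Qed.

(** The inner set is closed and bounded, hence compact, so local integrability on [Omega] applies to
    it. *)
Lemma L1_inner (f f' : E -> R) Z (t D : R) : borel_version f f' Z ->
  (forall x, Omega x -> `|x| <= D) -> 0 < t -> locally_integrable_on Omega f ->
  L1 (fun x => \1_(inner_set Omega t) x * f' x).
Proof.
move=> vf OD t0 [_ lf]; have [mZ Z0 mf' ff' f'0] := vf.
have mI : measurable (inner_set Omega t : set B) by exact: measurable_inner_set.
have cI := @closed_inner_set R n Omega t.
have cK : compact (inner_set Omega t).
  apply: bounded_closed_compact => //; exists D; split; first exact: num_real.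
  by move=> M DM x /= Ix; exact: (le_trans (OD _ (inner_setS t0 Ix)) (ltW DM)).
have fin := lf _ (inner_setS t0) cK.
apply/integrableP; split.
  by apply/measurable_EFinP; apply: measurable_funM => //; exact: measurable_indic.
apply: le_lt_trans fin.
rewrite (_ : (\int[lebn]_(x in inner_set Omega t) _) = \int[mu]_(x in inner_set Omega t) (`|f' x|)%:E)%E.
  rewrite [in leRHS]integral_indicl le_eqVlt; apply/orP; left; apply/eqP; apply: eq_integral => x _.
  by rewrite /= normrM indicE; case: (_ \in _); rewrite ?normr1 ?normr0 ?mul1r ?mul0r ?mul1e ?mul0e.
rewrite -(integral_ae_borel (F := fun x => (`|(if x \in Omega then f x else 0)|)%:E) mI mZ Z0).
- by apply: eq_integral => x; rewrite inE => /(inner_setS t0) Ox; rewrite mem_set.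
- by apply/measurable_EFinP; exact: measurableT_comp.
move=> x Zx; case: ifPn => [/set_mem Ox|/negP Ox]; first by rewrite ff'.
by rewrite f'0// => Ox'; apply: Ox; rewrite inE.
Qed.

(** A bounded [Omega] lies in one ball, on which 1 + |h|^q is integrable by the Morrey bound and
    dominates |h|. *)
Lemma L1_morrey_le (alpha q m D : R) (h : E -> R) : 1 <= q ->
  measurable_fun [set: B] (h : B -> R) ->
  (forall x, Omega x -> `|x| <= D) -> (forall x, ~ Omega x -> h x = 0) ->
  morrey_le alpha q (EFin \o h) m -> L1 h.
Proof.
move=> q1 mh OD h0 hm; have q0 : 0 < q by exact: lt_le_trans q1.
pose rad := n.+1%:R * (`|D| + 1); have rad0 : 0 < rad by rewrite mulr_gt0// ltr_wpDl.
have Oball : Omega `<=` eball (0 : E) rad.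
  move=> x /OD xD; rewrite /eball/= subr0 (le_lt_trans (enorm_le_norm _))//.
  by rewrite ltr_pM2l// (le_lt_trans xD)// (le_lt_trans (ler_norm _))// ltrDl.
have mB := @measurable_eball R n 0 rad.
have mhq : measurable_fun [set: B] (fun y => ((\1_(eball (0 : E) rad) y)%:E * (`|(EFin \o h) y| `^ q))%E).
  apply: emeasurable_funM; first by apply/measurable_EFinP; exact: measurable_indic.
  apply: (measurableT_comp (measurable_poweR q)); apply: measurableT_comp => //.
  exact/measurable_EFinP.
apply/integrableP; split; first exact/measurable_EFinP.
apply: (@le_lt_trans _ _ (\int[mu]_y ((\1_(eball (0 : E) rad) y)%:E +
   ((\1_(eball (0 : E) rad) y)%:E * (`|(EFin \o h) y| `^ q))))%E).
  apply: ge0_le_integral => //.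
  - by apply: measurableT_comp => //; exact/measurable_EFinP.
  - by apply: emeasurable_funD => //; apply/measurable_EFinP; exact: measurable_indic.
  move=> y _; have [Oy|Oy] := pselect (Omega y); last first.
    by rewrite /= h0// normr0 adde_ge0 ?mule_ge0 ?poweR_ge0 ?lee_fin.
  rewrite indicE mem_set ?mul1e/=; last exact: Oball.
  by rewrite lee_fin; exact: norm_le_powR.
rewrite ge0_integralD//; last 2 first.
- by apply/measurable_EFinP; exact: measurable_indic.
- by move=> y _; rewrite mule_ge0 ?poweR_ge0 ?lee_fin.
rewrite integral_indic// setIT lte_add_pinfty//.
  exact: lebB_eball_fin.
exact: le_lt_trans (hm 0 rad rad0) (ltry _).
Qed.

End representatives.

(** * Kernels of the approximate identity as radial profiles *)

Section profile.
Context (R : realType) (n : nat).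
Local Notation lambda := (@lebesgue_measure R).

(** The kernel is prescribed for positive arguments only; the value 0 elsewhere yields a function on
    the line that fits [radial_profile]. *)
Definition profile (rho : R -> R) : R -> R := rho \_ [set` `]0, +oo[%R].

Lemma profileE (rho : R -> R) s : 0 < s -> profile rho s = rho s.
Proof. by move=> s0; rewrite /profile patchE mem_set//= in_itv/= s0. Qed.

Lemma profile_radial (rho : R -> R) : (forall s, 0 < s -> 0 <= rho s) ->
  locally_integrable `]0, +oo[ rho -> (forall s t, 0 < s -> s <= t -> rho t <= rho s) ->
  radial_profile (profile rho).
Proof.
move=> rho0 [mrho _ _] decr; split.
- by apply/(measurable_restrictT rho) => //; exact: measurable_itv.
- move=> s; rewrite /profile patchE; case: ifPn => // /set_mem/=.
  by rewrite in_itv/= andbT; exact: rho0.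
- move=> s s0; rewrite /profile patchE memNset//= in_itv/= andbT.
  by apply/negP; rewrite -leNgt.
move=> s t s0 st; rewrite !profileE//; first exact: decr.
exact: lt_le_trans st.
Qed.

Lemma profile_integral (rho : R -> R) (d : R) : 0 <= d ->
  (\int[lambda]_(s in [set` `]d, +oo[%R]) (profile rho s * s ^+ n)%:E =
   \int[lambda]_(s in [set` `]d, +oo[%R]) (rho s * s ^+ n)%:E)%E.
Proof.
move=> d0; apply: eq_integral => s; rewrite inE/= in_itv/= andbT => ds.
by rewrite profileE// (le_lt_trans d0).
Qed.

(** The total mass is 1 and the mass beyond d/2 is eventually at most 1/2, so at least 1/2 lies
    below d. *)
Lemma approx_id_mass (nu0 : R) (rho : R -> R -> R) (nu : nat -> R) :
  radial_decreasing_approx_id n nu0 rho ->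
  (forall k, 0 < nu k < nu0) -> (forall k, nu k < k.+1%:R^-1) ->
  forall d, 0 < d -> \forall k \near \oo,
  ((2^-1)%:E <= \int[lambda]_(s in `]0%R, d[) (profile (rho (nu k)) s * s ^+ n)%:E)%E.
Proof.
move=> [Hrho tail] nu1 nu2 d d0; have d20 : 0 < d / 2 by rewrite divr_gt0.
have /fine_cvgP[fin /cvgrPdist_lt/(_ 2^-1)] := tail _ d20.
rewrite invr_gt0 ltr0n => /(_ isT) small.
have [e /= e0 eP] := filterI fin small.
have : (k.+1%:R^-1 : R) @[k --> \oo] --> (0 : R) by exact: cvg_harmonic.
move/cvgrPdist_lt => /(_ _ e0); apply: filterS => k.
rewrite sub0r normrN ger0_norm ?invr_ge0// => ke.
have /andP[nuk0 nuk1] := nu1 k.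
have [] := eP (nu k) _ nuk0.
  by rewrite /= sub0r normrN ger0_norm ?(ltW nuk0)//; exact: lt_trans (nu2 k) ke.
move=> finI; rewrite sub0r normrN => smallI.
have nuin : nu k \in `]0, nu0[ by rewrite in_itv/= nuk0.
have [rho0 lirho decr int1] := Hrho _ nuin.
have rphi := profile_radial rho0 lirho decr.
have [mphi phi0 _ _] := rphi.
pose F s := (profile (rho (nu k)) s * s ^+ n)%:E.
have mF : measurable_fun setT F.
  by apply/measurable_EFinP; apply: measurable_funM => //; exact: exprn_measurable.
have F0 (D : set R) s : D `<=` [set t | 0 < t] -> D s -> (0 <= F s)%E.
  by move=> D0 Ds; rewrite lee_fin mulr_ge0// exprn_ge0// ltW//; exact: D0.
have p1 : [set` `]0, d / 2]%R] `<=` [set t : R | 0 < t].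
  by move=> t /=; rewrite in_itv/= => /andP[].
have p2 : [set` `]d / 2, +oo[%R] `<=` [set t : R | 0 < t].
  by move=> t /=; rewrite in_itv/= andbT; exact: lt_trans.
have p3 : [set` `]0, d[%R] `<=` [set t : R | 0 < t].
  by move=> t /=; rewrite in_itv/= => /andP[].
have split1 : [set` `]0, +oo[%R] = [set` `]0, d / 2]%R] `|` [set` `]d / 2, +oo[%R].
  apply/seteqP; split => t /=; rewrite !in_itv/= !andbT.
    by move=> t0; case: (leP t (d / 2)) => h; [left; rewrite t0|right].
  by case=> [/andP[]//|]; exact: lt_trans.
have tot : (\int[lambda]_(s in [set` `]0, +oo[%R]) F s = 1)%E by rewrite profile_integral.
have lt2 : (\int[lambda]_(s in [set` `]d / 2, +oo[%R]) F s <= (2^-1)%:E)%E.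
  rewrite profile_integral ?(ltW d20)// -(fineK finI) lee_fin.
  by rewrite (le_trans (ler_norm _))// ltW.
rewrite split1 ge0_integral_setU// in tot; last 3 first.
- exact: measurable_funTS.
- by move=> s [/(F0 _ _ p1)|/(F0 _ _ p2)].
- apply/disj_setPS => t /=; rewrite !in_itv/= andbT => -[/andP[_ t1] t2].
  by move: t2; rewrite ltNge t1.
have le1 : (\int[lambda]_(s in [set` `]0, d / 2]%R]) F s <= \int[lambda]_(s in `]0%R, d[) F s)%E.
  apply: ge0_subset_integral => //.
  - exact: measurable_funTS.
  - by move=> s; exact: F0.
  move=> t /=; rewrite !in_itv/= => /andP[-> td]/=; apply: (le_lt_trans td).
  by rewrite gtr_pMr// invf_lt1// ltr1n.
apply: le_trans le1.
have : (1 <= \int[lambda]_(s in [set` `]0, d / 2]%R]) F s + (2^-1)%:E)%E.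
  by rewrite -tot leeD2l.
rewrite -leeBlDr// -EFinB; apply: le_trans; rewrite lee_fin.
by lra.
Qed.

End profile.

(** * The difference-quotient functional of a Borel version *)

Section bbm_version.
Context (R : realType) (n : nat).
Local Notation E := 'rV[R]_n.+1.
Local Notation B := (borel_space R n).
Local Notation mu := (@lebB R n).
Variables (Omega : set E) (alpha q p : R).
Hypotheses (oO : open Omega) (p1 : 1 <= p) (pq : p <= q).

Let mO : measurable (Omega : set B). Proof. exact: measurable_open_borel. Qed.
Let p0 : 0 < p. Proof. exact: lt_le_trans p1. Qed.
Let q0 : 0 < q. Proof. exact: lt_le_trans pq. Qed.

Lemma bbm_function_version (f f' : E -> R) Z (rho : R -> R) x : borel_version Omega f f' Z ->
  radial_profile (profile rho) -> ~ Z x -> Omega x ->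
  bbm_function Omega p rho f x = (bbm_integral Omega f' p (profile rho) x `^ p^-1)%E.
Proof.
move=> [mZ Z0 mf' ff' f'0] rphi Zx Ox; rewrite /bbm_function /bbm_integral; congr (_ `^ _)%E.
pose h (y : E) := (`|f' x - f' y| `^ p / enorm (x - y) `^ p * profile rho (enorm (x - y)))%:E.
rewrite -(integral_ae_borel (F := fun y => if y \in Omega then
   (`|f x - f y| `^ p / enorm (x - y) `^ p * rho (enorm (x - y)))%:E else h y) (h := h) mO mZ Z0).
- by apply: eq_integral => y; rewrite inE => Oy; rewrite mem_set.
- have mxy : measurable_fun [set: B] (fun y : B => enorm (x - (y : E))).
    have := measurableT_comp (@measurable_enorm R n) (measurable_affine 1 (- x)).
    rewrite (_ : _ \o _ = (fun y : B => enorm (x - (y : E))))//.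
    by apply/funext => y /=; rewrite scale1r -enormN opprB.
  apply/measurable_EFinP; apply: measurable_funM; last first.
    have [mphi _ _ _] := rphi; exact: (measurableT_comp mphi mxy).
  apply: measurable_funM.
    apply: (measurableT_comp (measurable_powR p)); apply: measurableT_comp => //.
    exact: measurable_funB.
  apply: (measurableT_comp (@measurable_inv R setT)).
  exact: (measurableT_comp (measurable_powR p) mxy).
move=> y Zy; case: ifPn => // /set_mem Oy; rewrite /h ff'// ff'//.
(* On the diagonal both integrands are 0 because 0^p = 0 and 0^-1 = 0, so the value of [rho] at 0
   does not enter. *)
have [->|xy] := eqVneq (enorm (x - y)) 0; first by rewrite powR0 ?gt_eqF// invr0 mulr0 !mul0r.
by rewrite profileE// lt_neqAle eq_sym xy enorm_ge0.
Qed.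

Definition energy_root (f' : E -> R) (phi : R -> R) (x : E) : \bar R :=
  (osc_energy Omega f' p phi x `^ p^-1)%E.

Lemma energy_root_pow (f' : E -> R) (phi : R -> R) x :
  (`|energy_root f' phi x| `^ q = osc_energy Omega f' p phi x `^ (q / p))%E.
Proof. by rewrite gee0_abs ?poweR_ge0// -poweRrM mulrC. Qed.

Lemma measurable_energy_root (f' : E -> R) (phi : R -> R) : L1 f' -> radial_profile phi ->
  measurable_fun [set: B] (energy_root f' phi : B -> \bar R).
Proof.
move=> L1f rphi; apply: (measurableT_comp (measurable_poweR _)).
exact: (measurable_osc_energy p oO L1f rphi).
Qed.

Lemma bbm_energy_root (f f' : E -> R) Z (rho : R -> R) x : borel_version Omega f f' Z ->
  radial_profile (profile rho) -> ~ Z x -> Omega x ->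
  bbm_function Omega p rho f x = energy_root f' (profile rho) x.
Proof.
move=> vf rphi Zx Ox; rewrite (bbm_function_version vf)//; have [_ _ mf' _ _] := vf.
by rewrite bbm_integralE.
Qed.

Lemma energy_root_out (f' : E -> R) (phi : R -> R) x : ~ Omega x -> energy_root f' phi x = 0%E.
Proof. by move=> Ox; rewrite /energy_root osc_energy_out// poweR0r// invr_eq0 gt_eqF. Qed.

Lemma bbm_norm_lt (f f' : E -> R) Z (rho : R -> R) (m : R) : borel_version Omega f f' Z ->
  L1 f' -> radial_profile (profile rho) -> 0 < m ->
  (morrey_norm_on Omega alpha q (bbm_function Omega p rho f) < m%:E)%E ->
  morrey_le alpha q (energy_root f' (profile rho)) m.
Proof.
move=> vf L1f rphi m0; have [mZ Z0 _ _ _] := vf.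
apply: (morrey_norm_on_lt q0 m0 mZ Z0 (measurable_energy_root L1f rphi)).
- by move=> x Zx Ox; exact: bbm_energy_root vf rphi Zx Ox.
- by move=> x; exact: energy_root_out.
Qed.

Lemma bbm_norm_le (f f' : E -> R) Z (rho : R -> R) (m : R) : borel_version Omega f f' Z ->
  L1 f' -> radial_profile (profile rho) -> 0 <= m ->
  morrey_le alpha q (energy_root f' (profile rho)) m ->
  (morrey_norm_on Omega alpha q (bbm_function Omega p rho f) <= m%:E)%E.
Proof.
move=> vf L1f rphi m0 hm; have [mZ Z0 _ _ _] := vf.
apply: (morrey_norm_on_le q0 m0 mZ Z0 (measurable_energy_root L1f rphi) _ _ hm).2.
- by move=> x Zx Ox; exact: bbm_energy_root vf rphi Zx Ox.
- by move=> x; exact: energy_root_out.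
Qed.

Lemma integral_eball_shift (x v : E) (rad : R) (F : E -> \bar R) :
  measurable_fun [set: B] (F : B -> \bar R) -> (forall y, 0 <= F y)%E ->
  (\int[mu]_y ((\1_(eball x rad) y)%:E * F ((y : E) + v)%R) =
   \int[mu]_y ((\1_(eball (x + v)%R rad) y)%:E * F y))%E.
Proof.
move=> mF F0; rewrite -(ge0_integral_shift v (f := fun y => ((\1_(eball (x + v)%R rad) y)%:E * F y)%E)).
- apply: eq_integral => y _; congr (_%:E * _)%E; rewrite !indicE; congr (_ %:R).
  by congr nat_of_bool; apply/idP/idP; rewrite !inE /eball/= opprD addrACA subrr addr0.
- by apply: emeasurable_funM => //; apply/measurable_EFinP; apply: measurable_indic; exact: measurable_eball.
- by move=> y; rewrite mule_ge0 ?lee_fin.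
Qed.

(** Translates of a ball are balls of the same radius, and the Morrey bound sees the radius only.
    This supplies the translation-uniform hypotheses of both halves. *)
Lemma morrey_le_shift (h : E -> \bar R) (m : R) x rad v : measurable_fun [set: B] (h : B -> \bar R) ->
  0 < rad -> morrey_le alpha q h m ->
  (\int[mu]_y ((\1_(eball x rad) y)%:E * (`|h ((y : E) + v)%R| `^ q)) <= (morrey_bound n alpha q m rad)%:E)%E.
Proof.
move=> mh r0 hm; rewrite (integral_eball_shift x v rad (F := fun y => (`|h y| `^ q)%E)).
- exact: hm.
- by apply: (measurableT_comp (measurable_poweR q)); exact: measurableT_comp.
- by move=> y; exact: poweR_ge0.
Qed.

End bbm_version.

(** * From ball-wise estimates to Morrey norms of the gradient *)

Section gradient_bounds.
Context (R : realType) (n : nat).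
Local Notation E := 'rV[R]_n.+1.
Local Notation B := (borel_space R n).
Local Notation L := (lebesgue_space R n).
Local Notation mu := (@lebB R n).
Variables (Omega : set E) (alpha q p D : R).
Hypotheses (oO : open Omega) (D0 : 0 < D) (OD : forall x, Omega x -> `|x| <= D).
Hypotheses (q1 : 1 < q) (p1 : 1 <= p) (pq : p <= q).

Let mO : measurable (Omega : set B). Proof. exact: measurable_open_borel. Qed.
Let q0 : 0 < q. Proof. exact: lt_trans q1. Qed.

Lemma measurable_enorm_row (G' : 'I_n.+1 -> E -> R) :
  (forall i, measurable_fun [set: B] (G' i : B -> R)) ->
  measurable_fun [set: B] (fun x : B => enorm (\row_i G' i (x : E))).
Proof.
move=> mG; apply: (measurableT_comp (@measurable_enorm R n)).
apply: measurable_to_borel => i; rewrite [X in measurable_fun _ X](_ : _ = (G' i : B -> R))//.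
by apply/funext => x /=; rewrite mxE.
Qed.

(** The finite union of the null sets of the components serves the Euclidean norm of the
    gradient. *)
Lemma gradient_version (G : E -> E) : (forall i, measurable_fun (Omega : set L) (fun x : L => G x 0 i)) ->
  exists (G' : 'I_n.+1 -> E -> R) (Z : 'I_n.+1 -> set E) (Z' : set E),
  (forall i, borel_version Omega (fun x => G x 0 i) (G' i) (Z i)) /\
  borel_version Omega (fun x => enorm (G x)) (fun x => enorm (\row_i G' i x)) Z'.
Proof.
move=> mG; have /choice[GZ GZP] : forall i, exists GZ : (E -> R) * set E,
    borel_version Omega (fun x => G x 0 i) GZ.1 GZ.2.
  by move=> i; have [g [Z gZ]] := borel_version_exists oO (mG i); exists (g, Z).
pose Z' := \bigcup_(i in [set` enum 'I_n.+1]) (GZ i).2.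
have [mZ' Z'0] : measurable (Z' : set B) /\ mu Z' = 0%E.
  rewrite /Z' bigcup_seq.
  apply: (@big_rec _ (fun A : set E => measurable (A : set B) /\ mu A = 0%E)) => [|i A _ [mA A0]].
    by split; [exact: measurable0|exact: (measure0 mu)].
  have [mZ Z0 _ _ _] := GZP i; split; first exact: measurableU.
  apply/eqP; rewrite -measure_le0; apply: (le_trans (measureU2 mu mZ mA)).
  by rewrite [X in (X + _)%E]Z0 [X in (_ + X)%E]A0 adde0.
exists (fun i => (GZ i).1), (fun i => (GZ i).2), Z'; split => //; split => //.
- by apply: (@measurable_enorm_row (fun i => (GZ i).1)) => i; case: (GZP i).
- move=> x Zx Ox; congr enorm; apply/rowP => i; rewrite mxE.
  case: (GZP i) => _ _ _ h _; apply: h => // Zi; apply: Zx; by exists i => //=; rewrite mem_enum inE.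
move=> x Ox; rewrite (_ : \row_i _ = 0).
  by rewrite -(scale0r (0 : E)) enormZ normr0 mul0r.
by apply/rowP => i; rewrite !mxE; case: (GZP i) => _ _ _ _; apply.
Qed.

Lemma coord_le_enorm_row (a : 'I_n.+1 -> R) i : `|a i| <= enorm (\row_j a j).
Proof.
apply: le_trans (norm_le_enorm _); apply: le_trans (norm_coord_le _ i).
by rewrite mxE.
Qed.

Lemma enorm_row_powR (a : 'I_n.+1 -> R) :
  enorm (\row_j a j) `^ q <= n.+1%:R `^ q * \sum_i `|a i| `^ q.
Proof.
have [i0 maxi] := exists_max_index (fun i => `|a i|).
have h : enorm (\row_j a j) <= n.+1%:R * `|a i0|.
  apply: (le_trans (enorm_le_norm _)); rewrite ler_wpM2l//.
  by apply/norm_le_coordP => // i; rewrite mxE.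
have := @ge0_ler_powR R q (ltW q0) _ _ _ _ h; rewrite !nnegrE enorm_ge0 mulr_ge0//.
move=> /(_ isT isT)/le_trans; apply; rewrite powRM// ler_wpM2l ?powR_ge0//.
by rewrite (bigD1 i0)//= lerDl sumr_ge0// => i _; exact: powR_ge0.
Qed.

Definition enorm_const : R := (n.+1%:R `^ q * n.+1%:R) `^ q^-1.

Lemma enorm_const_gt0 : 0 < enorm_const.
Proof. by rewrite powR_gt0// mulr_gt0// powR_gt0. Qed.

Lemma morrey_le_enorm (G' : 'I_n.+1 -> E -> R) (m : R) : 0 <= m ->
  (forall i, measurable_fun [set: B] (G' i : B -> R)) ->
  (forall i, morrey_le alpha q (EFin \o G' i) m) ->
  morrey_le alpha q (fun x => (enorm (\row_i G' i x))%:E) (enorm_const * m).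
Proof.
move=> m0 mG Gm x rad r0; have mB := @measurable_eball R n x rad.
have mterm i : measurable_fun [set: B] (fun y => ((\1_(eball x rad) y)%:E * (`|(EFin \o G' i) y| `^ q))%E).
  apply: emeasurable_funM; first by apply/measurable_EFinP; exact: measurable_indic.
  apply: (measurableT_comp (measurable_poweR q)); apply: measurableT_comp => //.
  exact/measurable_EFinP.
have K0 : 0 <= n.+1%:R `^ q * n.+1%:R :> R by rewrite mulr_ge0 ?powR_ge0.
rewrite -morrey_boundZ//.
apply: (@le_trans _ _ (\int[mu]_y ((n.+1%:R `^ q)%:E *
   \sum_i ((\1_(eball x rad) y)%:E * (`|(EFin \o G' i) y| `^ q))))%E).
  apply: ge0_le_integral => //.
  - by move=> y _; rewrite mule_ge0 ?poweR_ge0 ?lee_fin.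
  - apply: emeasurable_funM; first by apply/measurable_EFinP; exact: measurable_indic.
    apply: (measurableT_comp (measurable_poweR q)); apply: measurableT_comp => //.
    by apply/measurable_EFinP; exact: measurable_enorm_row.
  - by apply: measurable_funeM; exact: emeasurable_sum.
  move=> y _; rewrite -ge0_sume_distrr; last by move=> i _; exact: poweR_ge0.
  rewrite muleCA lee_wpmul2l ?lee_fin//.
  rewrite (eq_bigr (fun i => (`|G' i y| `^ q)%:E))// sumEFin -EFinM lee_fin.
  by rewrite ger0_norm ?enorm_ge0// enorm_row_powR.
rewrite ge0_integralZl ?lee_fin ?powR_ge0//; last 2 first.
- exact: emeasurable_sum.
- by move=> y _; apply: sume_ge0 => i _; rewrite mule_ge0 ?poweR_ge0 ?lee_fin.
rewrite ge0_integral_sum//; last by move=> i y _; rewrite mule_ge0 ?poweR_ge0 ?lee_fin.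
rewrite -mulrA EFinM lee_wpmul2l ?lee_fin ?powR_ge0//.
apply: (@le_trans _ _ (\sum_(i < n.+1) (morrey_bound n alpha q m rad)%:E)%E).
  by apply: lee_sum => i _; exact: Gm.
by rewrite sumEFin lee_fin sumr_const card_ord mulr_natl.
Qed.

Lemma energy_shift (f' : E -> R) (phi : R -> R) (m : R) x rad v : L1 f' -> radial_profile phi ->
  0 < rad -> morrey_le alpha q (energy_root Omega p f' phi) m ->
  (\int[mu]_y ((\1_(eball x rad) y)%:E * osc_energy Omega f' p phi ((y : E) + v)%R `^ (q / p)) <=
    (morrey_bound n alpha q m rad)%:E)%E.
Proof.
move=> L1f rphi r0 hm.
have := morrey_le_shift x v (measurable_energy_root p oO L1f rphi) r0 hm.
by apply: le_trans; rewrite le_eqVlt; apply/orP; left; apply/eqP; apply: eq_integral => y _; rewrite energy_root_pow.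
Qed.

(** The absolute value and the summand 1 make the factor positive at once. *)
Definition upper_factor (c : R) : R := (`|upper_const n c q p| + 1) `^ q^-1.

Lemma upper_factor_gt0 c : 0 < upper_factor c.
Proof. by rewrite powR_gt0// ltr_wpDl. Qed.

(** The Borel version of |grad f| is integrable because [Omega] is bounded, and it dominates every
    component; [bbm_Lq] is then applied on each ball with the bounds for its translates. *)
Lemma bbm_norm_upper (f f' : E -> R) Zf (G : E -> E) (c m : R) (rho : R -> R) :
  borel_version Omega f f' Zf -> L1 f' -> weak_gradient Omega f G ->
  0 < c -> c <= 1 -> uniform_domain c Omega ->
  radial_profile (profile rho) ->
  (\int[@lebesgue_measure R]_(s in [set` `]0%R, +oo[%R]) (profile rho s * s ^+ n)%:E <= 1)%E ->
  0 < m -> (morrey_norm_on Omega alpha q (fun x => (enorm (G x))%:E) < m%:E)%E ->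
  (morrey_norm_on Omega alpha q (bbm_function Omega p rho f) <= (upper_factor c * m)%:E)%E.
Proof.
move=> vf L1f wG c0 c1 unif rphi mass1 m0 Gm.
have mG i : measurable_fun (Omega : set L) (fun x : L => G x 0 i) by have [_ []] := wG i.
have [G' [Z [Z' [vG [mZ Z0 mg gg g0]]]]] := gradient_version mG.
pose g x := enorm (\row_i G' i x).
have gle : morrey_le alpha q (EFin \o g) m.
  apply: (morrey_norm_on_lt q0 m0 mZ Z0 _ _ _ Gm).
  - exact/measurable_EFinP.
  - by move=> x Zx Ox; rewrite /= gg.
  - by move=> x Ox; rewrite /= /g g0.
have L1g : L1 g by exact: (L1_morrey_le (ltW q1) mg OD g0 gle).
have L1G i : L1 (G' i).
  apply: (le_integrable measurableT _ _ L1g).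
    by apply/measurable_EFinP; case: (vG i).
  by move=> x _; rewrite /= lee_fin [leRHS]ger0_norm ?enorm_ge0// coord_le_enorm_row.
have weakG i := weak_partial_test oO vf (vG i) (wG i).
have fac0 : 0 <= upper_factor c * m by rewrite mulr_ge0 ?ltW ?upper_factor_gt0.
apply: (bbm_norm_le oO p1 pq vf L1f rphi fac0) => x rad r0.
have mB := @measurable_eball R n x rad.
have bound0 : 0 <= morrey_bound n alpha q m rad by exact: powR_ge0.
have gv v : (\int[mu]_y ((\1_(eball x rad) y)%:E * (g ((y : E) + v))%:E `^ q) <=
    (morrey_bound n alpha q m rad)%:E)%E.
  have mge : measurable_fun [set: B] (EFin \o g : B -> \bar R) by exact/measurable_EFinP.
  have := morrey_le_shift x v mge r0 gle; apply: le_trans.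
  rewrite le_eqVlt; apply/orP; left; apply/eqP; apply: eq_integral => y _.
  by rewrite /= ger0_norm// enorm_ge0.
have := bbm_Lq oO L1f L1G L1g (fun i y => coord_le_enorm_row (fun j => G' j y) i) weakG c0 c1 unif D0 OD
  (ltW q1) mB p1 pq rphi mass1 gv.
have -> : morrey_bound n alpha q (upper_factor c * m) rad =
    (`|upper_const n c q p| + 1) * morrey_bound n alpha q m rad.
  by rewrite morrey_boundZ ?(ltW m0)// addr_ge0.
move=> H; apply: (@le_trans _ _ ((upper_const n c q p)%:E * (morrey_bound n alpha q m rad)%:E)%E).
  apply: le_trans H; rewrite le_eqVlt; apply/orP; left; apply/eqP; apply: eq_integral => y _.
  congr (_ * _)%E; rewrite energy_root_pow//.
  have [Oy|Oy] := pselect (Omega y).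
    rewrite indicE mem_set// mul1e bbm_integralE//; last exact: lt_le_trans p1.
    by have [_ _] := vf.
  by rewrite osc_energy_out// indicE memNset// mul0e poweR0r// gt_eqF// divr_gt0// (lt_le_trans _ p1).
by rewrite -EFinM lee_fin ler_wpM2r// (le_trans (ler_norm _))// lerDl.
Qed.

Section lower.
Variables (f f' : E -> R) (Zf : set E) (m : R) (phi : nat -> R -> R).
Hypotheses (vf : borel_version Omega f f' Zf) (L1f : L1 f') (m0 : 0 < m).
Hypothesis rphi : forall k, radial_profile (phi k).
Hypothesis phi_mass : forall d : R, 0 < d -> \forall k \near \oo,
  ((2^-1)%:E <= \int[@lebesgue_measure R]_(s in `]0%R, d[) (phi k s * s ^+ n)%:E)%E.
Hypothesis energy_m : forall k, morrey_le alpha q (energy_root Omega p f' (phi k)) m.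

Lemma partial_moll_morrey x rad d i : 0 < rad -> 0 < d ->
  (\int[mu]_y ((\1_(eball x rad `&` inner_set Omega (2 * d)) y)%:E *
     (lower_const n p q * `|partial i (moll d f') y| `^ q)%:E) <= (morrey_bound n alpha q m rad)%:E)%E.
Proof.
move=> r0 d0; apply: (partial_moll_Lq oO L1f p1 pq rphi phi_mass) => //.
- exact: measurable_eball.
- by move=> k v; exact: energy_shift.
Qed.

(** A given weak derivative is only locally integrable, so [weak_partial_Lq] is fed with its
    truncations to inner sets. *)
Lemma weak_partial_morrey (g g' : E -> R) Zg i : borel_version Omega g g' Zg ->
  locally_integrable_on Omega g -> weak_test Omega i f' g' ->
  morrey_le alpha q (EFin \o g') ((lower_const n p q)^-1 `^ q^-1 * m).
Proof.
move=> vg lg W x rad r0; have [mZ Z0 mg' gg' g'0] := vg.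
have lc0 : 0 < lower_const n p q by exact: lower_const_gt0.
have mB := @measurable_eball R n x rad.
have := weak_partial_Lq oO L1f lc0 q0 mB mg' W (fun t t0 => L1_inner vg OD t0 lg)
   (fun d d0 => partial_moll_morrey x i r0 d0).
rewrite -morrey_boundZ ?invr_ge0 ?(ltW lc0) ?(ltW m0)// => H.
rewrite EFinM lee_pdivlMl//; apply: le_trans H.
rewrite -ge0_integralZl//; last 3 first.
- apply: emeasurable_funM; first by apply/measurable_EFinP; exact: measurable_indic.
  apply: (measurableT_comp (measurable_poweR q)); apply: measurableT_comp => //.
  exact/measurable_EFinP.
- by move=> y _; rewrite mule_ge0 ?poweR_ge0 ?lee_fin.
- by rewrite lee_fin ltW.
rewrite le_eqVlt; apply/orP; left; apply/eqP; apply: eq_integral => y _.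
rewrite muleCA EFinM; have [Oy|Oy] := pselect (Omega y).
  by congr (_%:E * _)%E; rewrite !indicE in_setI (mem_set Oy) andbT.
by rewrite /= g'0// normr0 powR0 ?gt_eqF// !mule0.
Qed.

(** The bound on one ball that contains [Omega] is enough for existence. The components are cut off
    outside [Omega], so that they are their own Borel versions. *)
Lemma weak_gradient_exists : exists G : E -> E, weak_gradient Omega f G.
Proof.
pose rad := n.+1%:R * (D + 1); have r0 : 0 < rad by rewrite mulr_gt0// addr_gt0.
have Oball : Omega `<=` eball (0 : E) rad.
  move=> x /OD xD; rewrite /eball/= subr0 (le_lt_trans (enorm_le_norm _))//.
  by rewrite ltr_pM2l// (le_lt_trans xD)// ltrDl.
have Ofin : (mu Omega < +oo)%E.
  apply: le_lt_trans (lebB_eball_fin (0 : E) r0); apply: le_measure; rewrite ?inE//.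
  exact: measurable_eball.
have lc0 : 0 < lower_const n p q by exact: lower_const_gt0.
have hM i d : 0 < d -> (\int[mu]_y ((\1_(inner_set Omega (2 * d)) y)%:E *
     (lower_const n p q * `|partial i (moll d f') y| `^ q)%:E) <= (morrey_bound n alpha q m rad)%:E)%E.
  move=> d0; have := partial_moll_morrey 0 i r0 d0; rewrite setIidr//.
  apply: subset_trans Oball; apply: inner_setS; exact: mulr_gt0.
have /choice[g gP] : forall i, exists g : E -> R, L1 g /\ weak_test Omega i f' g.
  by move=> i; have [g L1g W] := weak_partial_exists oO L1f lc0 q1 Ofin (hM i); exists g.
have L1gO i : L1 (fun x => \1_Omega x * g i x).
  apply: (le_integrable measurableT _ _ (gP i).1).
    apply/measurable_EFinP; apply: measurable_funM; first exact: measurable_indic.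
    exact: L1_measurable (gP i).1.
  by move=> x _; rewrite /= lee_fin normrM indicE; case: (_ \in _); rewrite ?normr1 ?normr0 ?mul1r ?mul0r.
exists (fun x => \row_i (\1_Omega x * g i x)).
move=> i.
have e : (fun x : E => \1_Omega x * g i x) = (fun x : E => (\row_i (\1_Omega (x : E) * g i x)) 0 i : R).
  by apply/funext => x; rewrite mxE.
have W : weak_test Omega i f' (fun x => \1_Omega x * g i x).
  move=> psi Tpsi; rewrite ((gP i).2 psi Tpsi); congr (- _)%E; apply: eq_integral => x xO.
  by rewrite indicE xO mul1r.
have vG : borel_version Omega (fun x => \1_Omega x * g i x) (fun x => \1_Omega x * g i x) set0.
  split => //; first exact: L1_measurable (L1gO i).
  by move=> x Ox; rewrite indicE memNset// mul0r.
have := test_weak_partial oO vf vG L1f (L1gO i) W.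
by rewrite {1}e.
Qed.

End lower.

End gradient_bounds.

(** * Upper and lower limits at 0 from the right *)

Section right_limits.
Context (R : realType).
Local Open Scope ereal_scope.

Lemma limf_esup_right_le (N : R -> \bar R) (nu0 : R) (M : \bar R) : (0 < nu0)%R ->
  (forall nu, (0 < nu < nu0)%R -> N nu <= M) -> limf_esup N 0^'+ <= M.
Proof.
move=> nu00 NM; rewrite limf_esupE; apply: (le_trans (ereal_inf_lbound _)).
  exists [set nu : R | (0 < nu < nu0)%R] => //.
  have h1 : \forall nu \near (0 : R)^'+, (0 < nu)%R by exact: nbhs_right_gt.
  have h2 : \forall nu \near (0 : R)^'+, (nu < nu0)%R by exact: nbhs_right_lt.
  by apply: filterS (filterI h1 h2) => nu [/= -> ->].
by apply: ge_ereal_sup => _ [nu /= h <-]; exact: NM.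
Qed.

(** Every right neighbourhood of 0 contains values below [m]. This reduces the lower limit to a
    sequence of kernels, as Fatou's lemma requires. *)
Lemma limf_einf_right_lt (N : R -> \bar R) (nu0 : R) (m : \bar R) : (0 < nu0)%R -> limf_einf N 0^'+ < m ->
  exists nu : nat -> R, forall k,
    [/\ (0 < nu k < nu0)%R, (nu k < k.+1%:R^-1)%R & N (nu k) < m].
Proof.
move=> nu00 Nm; suff /choice[nu nuP] : forall k : nat, exists nu : R,
    [/\ (0 < nu < nu0)%R, (nu < k.+1%:R^-1)%R & N nu < m] by exists nu.
move=> k; pose V := [set nu : R | [/\ (0 < nu)%R, (nu < nu0)%R & (nu < k.+1%:R^-1)%R]].
have FV : (0 : R)^'+ V.
  have h1 : \forall nu \near (0 : R)^'+, (0 < nu)%R by exact: nbhs_right_gt.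
  have h2 : \forall nu \near (0 : R)^'+, (nu < nu0)%R by exact: nbhs_right_lt.
  have h3 : \forall nu \near (0 : R)^'+, (nu < k.+1%:R^-1)%R.
    by apply: nbhs_right_lt; rewrite invr_gt0.
  by apply: filterS (filterI h1 (filterI h2 h3)) => nu [/= ? []].
have : ereal_inf (N @` V) < m.
  apply: le_lt_trans Nm; rewrite limf_einfE; apply: ereal_sup_ubound; by exists V.
move=> /ereal_inf_lt[_ [nu [nu1 nu2 nu3] <-] Nnu].
by exists nu; split => //; rewrite nu1.
Qed.

Lemma limf_einf_le_esup (N : R -> \bar R) : limf_einf N 0^'+ <= limf_esup N 0^'+.
Proof.
rewrite limf_einfE limf_esupE; apply: ge_ereal_sup => _ [V FV <-].
apply: le_ereal_inf_tmp => _ [W FW <-].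
have [x [Vx Wx]] := filter_ex (filterI FV FW).
apply: (@le_trans _ _ (N x)); first by apply: ereal_inf_lbound; exists x.
by apply: ereal_sup_ubound; exists x.
Qed.

Lemma limf_einf_ge0 (N : R -> \bar R) : (forall nu, 0 <= N nu) -> 0 <= limf_einf N 0^'+.
Proof.
move=> N0; rewrite limf_einfE; apply: (le_trans _ (ereal_sup_ubound _)); last first.
  by exists setT => //; exact: filterT.
by apply: le_ereal_inf_tmp => _ [x _ <-].
Qed.

End right_limits.

(** * Assembly of the two estimates and the characterization *)

Section main.
Context (R : realType) (n : nat).
Local Notation E := 'rV[R]_n.+1.
Local Notation B := (borel_space R n).
Local Notation L := (lebesgue_space R n).
Variables (Omega : set E) (alpha q p D : R) (nu0 : R) (rho : R -> R -> R) (f : E -> R).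
Hypotheses (oO : open Omega) (D0 : 0 < D) (OD : forall x, Omega x -> `|x| <= D).
Hypotheses (q1 : 1 < q) (p1 : 1 <= p) (pq : p <= q).
Hypotheses (nu00 : 0 < nu0) (Hrho : radial_decreasing_approx_id n nu0 rho).

Let mO : measurable (Omega : set B). Proof. exact: measurable_open_borel. Qed.
Let q0 : 0 < q. Proof. exact: lt_trans q1. Qed.
Let N nu := morrey_norm_on Omega alpha q (bbm_function Omega p (rho nu) f).

Lemma morrey_on_measurable (g : E -> R) : morrey_on Omega alpha q (EFin \o g) ->
  measurable_fun (Omega : set L) (g : L -> R).
Proof.
case=> h [[mh _] hg]; apply/measurable_EFinP.
apply: (eq_measurable_fun (h : L -> \bar R)); last exact: measurable_funTS.
by move=> x; rewrite inE => Ox; exact: hg.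
Qed.

Lemma morrey_on_version (g : E -> R) : morrey_on Omega alpha q (EFin \o g) ->
  exists g' Z, borel_version Omega g g' Z /\ L1 g'.
Proof.
move=> Mg; have [g' [Z vg]] := borel_version_exists oO (morrey_on_measurable Mg).
exists g', Z; split => //; have [mZ Z0 mg' gg' g'0] := vg.
have [m m0 Nm] := morrey_on_lt Mg.
apply: (L1_morrey_le (ltW q1) mg' OD g'0 (m := m) (alpha := alpha)).
apply: (morrey_norm_on_lt q0 m0 mZ Z0 _ _ _ Nm).
- exact/measurable_EFinP.
- by move=> x Zx Ox /=; rewrite gg'.
- by move=> x Ox /=; rewrite g'0.
Qed.

Lemma profile_rho nu : 0 < nu < nu0 -> radial_profile (profile (rho nu)) /\
  (\int[@lebesgue_measure R]_(s in [set` `]0%R, +oo[%R]) (profile (rho nu) s * s ^+ n)%:E <= 1)%E.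
Proof.
move=> nuin; have [H _] := Hrho; have [|rho0 lirho decr int1] := H nu; first by rewrite in_itv.
by split; [exact: profile_radial|rewrite profile_integral// int1].
Qed.

Lemma bbm_limsup_le (G : E -> E) (c : R) : 0 < c -> c <= 1 -> uniform_domain c Omega ->
  morrey_on Omega alpha q (EFin \o f) -> weak_gradient Omega f G ->
  (limf_esup N 0^'+ <= (upper_factor n q p c)%:E *
     morrey_norm_on Omega alpha q (fun x => (enorm (G x))%:E))%E.
Proof.
move=> c0 c1 unif Mf wG; have [f' [Zf [vf L1f]]] := morrey_on_version Mf.
apply: le_scale; [exact: upper_factor_gt0|exact: morrey_norm_on_ge0|].
move=> m m0 Gm; apply: (limf_esup_right_le nu00) => nu nuin.
have [rphi mass1] := profile_rho nuin.
exact: (bbm_norm_upper oO D0 OD q1 p1 pq vf L1f wG c0 c1 unif rphi mass1 m0 Gm).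
Qed.

Definition lower_factor : R := enorm_const n q * (lower_const n p q)^-1 `^ q^-1.

Lemma lower_factor_gt0 : 0 < lower_factor.
Proof.
by rewrite mulr_gt0 ?enorm_const_gt0// powR_gt0// invr_gt0 lower_const_gt0.
Qed.

(** Turns a strict bound on the lower limit into the input of the lower estimates: kernels that
    concentrate at 0, with one Morrey bound for all energies. *)
Lemma liminf_profiles (m : R) : 0 < m -> (limf_einf N 0^'+ < m%:E)%E ->
  forall f' Zf, borel_version Omega f f' Zf -> L1 f' ->
  exists phi : nat -> R -> R, [/\ forall k, radial_profile (phi k),
    forall d : R, 0 < d -> \forall k \near \oo,
      ((2^-1)%:E <= \int[@lebesgue_measure R]_(s in `]0%R, d[) (phi k s * s ^+ n)%:E)%E &
    forall k, morrey_le alpha q (energy_root Omega p f' (phi k)) m].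
Proof.
move=> m0 Nm f' Zf vf L1f; have [nu nuP] := limf_einf_right_lt nu00 Nm.
have nu1 k : 0 < nu k < nu0 by case: (nuP k).
have nu2 k : nu k < k.+1%:R^-1 by case: (nuP k).
exists (fun k => profile (rho (nu k))); split.
- by move=> k; exact: (profile_rho (nu1 k)).1.
- exact: (approx_id_mass Hrho nu1 nu2).
move=> k; apply: (bbm_norm_lt oO p1 pq vf L1f (profile_rho (nu1 k)).1 m0).
by case: (nuP k).
Qed.

Lemma gradient_le_bbm (G : E -> E) : morrey_on Omega alpha q (EFin \o f) -> weak_gradient Omega f G ->
  (morrey_norm_on Omega alpha q (fun x => (enorm (G x))%:E) <= lower_factor%:E * limf_einf N 0^'+)%E.
Proof.
move=> Mf wG; have [f' [Zf [vf L1f]]] := morrey_on_version Mf.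
apply: le_scale; [exact: lower_factor_gt0|by apply: limf_einf_ge0 => nu; exact: morrey_norm_on_ge0|].
move=> m m0 Nm; have [phi [rphi mass em]] := liminf_profiles m0 Nm vf L1f.
have lG i : locally_integrable_on Omega (fun x => G x 0 i) by case: (wG i).
have [G' [Z [Z' [vG [mZ Z0 mg gg g0]]]]] := @gradient_version R n Omega oO G (fun i => (lG i).1).
set K := (lower_const n p q)^-1 `^ q^-1.
have Gm i : morrey_le alpha q (EFin \o G' i) (K * m).
  exact: (weak_partial_morrey oO OD q1 p1 pq L1f m0 rphi mass em (vG i) (lG i)
    (weak_partial_test oO vf (vG i) (wG i))).
have Km : 0 <= K * m by rewrite mulr_ge0 ?powR_ge0 ?ltW.
have mG i : measurable_fun [set: B] (G' i : B -> R) by case: (vG i).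
have := morrey_le_enorm q1 Km mG Gm; rewrite mulrA => H.
apply: (morrey_norm_on_le q0 _ mZ Z0 _ _ _ H).2.
- by rewrite mulr_ge0 ?ltW// lower_factor_gt0.
- exact/measurable_EFinP.
- by move=> x Zx Ox; rewrite gg.
- by move=> x Ox; rewrite g0.
Qed.

Lemma sobolev_of_bbm : morrey_on Omega alpha q (EFin \o f) -> (limf_einf N 0^'+ < +oo)%E ->
  sobolev_morrey Omega alpha q f.
Proof.
move=> Mf Nfin; split => //; have [f' [Zf [vf L1f]]] := morrey_on_version Mf.
have N0 : (0 <= limf_einf N 0^'+)%E by apply: limf_einf_ge0 => nu; exact: morrey_norm_on_ge0.
have fN : (limf_einf N 0^'+ \is a fin_num)%E by rewrite ge0_fin_numE.
pose m := fine (limf_einf N 0^'+) + 1.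
have m0 : 0 < m by rewrite ltr_wpDl// fine_ge0.
have Nm : (limf_einf N 0^'+ < m%:E)%E by rewrite -(fineK fN) lte_fin ltrDl.
have [phi [rphi mass em]] := liminf_profiles m0 Nm vf L1f.
have [G wG] := weak_gradient_exists oO D0 OD q1 p1 pq vf L1f rphi mass em.
exists G => // i; have [_ lG _] := wG i.
have [g' [Z vg]] := borel_version_exists oO lG.1; have [mZ Z0 mg' gg' g'0] := vg.
have H := weak_partial_morrey oO OD q1 p1 pq L1f m0 rphi mass em vg lG (weak_partial_test oO vf vg (wG i)).
apply: (morrey_norm_on_le q0 _ mZ Z0 _ _ _ H).1.
- by rewrite mulr_ge0 ?powR_ge0 ?ltW.
- exact/measurable_EFinP.
- by move=> x Zx Ox /=; rewrite gg'.
- by move=> x Ox /=; rewrite g'0.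
Qed.

(** Makes the right-hand side of the upper estimate finite for Sobolev functions, whose gradient is
    known to be in the Morrey space by components only. *)
Lemma gradient_norm_fin (G : E -> E) : weak_gradient Omega f G ->
  (forall i, morrey_on Omega alpha q (fun x => (G x 0 i)%:E)) ->
  (morrey_norm_on Omega alpha q (fun x => (enorm (G x))%:E) < +oo)%E.
Proof.
move=> wG MG.
have lG i : locally_integrable_on Omega (fun x => G x 0 i) by case: (wG i).
have [G' [Z [Z' [vG [mZ Z0 mg gg g0]]]]] := @gradient_version R n Omega oO G (fun i => (lG i).1).
have /choice[m mP] : forall i, exists m : R, 0 < m /\
    (morrey_norm_on Omega alpha q (fun x => (G x 0 i)%:E) < m%:E)%E.
  by move=> i; have [m m0 Nm] := morrey_on_lt (MG i); exists m.
pose M := \sum_i m i.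
have mM i : m i <= M.
  by rewrite /M (bigD1 i)//= lerDl sumr_ge0// => j _; rewrite ltW// (mP j).1.
have M0 : 0 < M := lt_le_trans (mP ord0).1 (mM ord0).
have Gm i : morrey_le alpha q (EFin \o G' i) M.
  have [mZi Zi0 mGi GGi Gi0] := vG i.
  apply: (morrey_norm_on_lt q0 M0 mZi Zi0 _ _ _ (lt_le_trans (mP i).2 _)).
  - exact/measurable_EFinP.
  - by move=> x Zx Ox /=; rewrite GGi.
  - by move=> x Ox /=; rewrite Gi0.
  - by rewrite lee_fin.
have mG i : measurable_fun [set: B] (G' i : B -> R) by case: (vG i).
have H := morrey_le_enorm q1 (ltW M0) mG Gm.
apply: (@le_lt_trans _ _ (enorm_const n q * M)%:E); last exact: ltry.
apply: (morrey_norm_on_le q0 _ mZ Z0 _ _ _ H).2.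
- by rewrite mulr_ge0 ?ltW// enorm_const_gt0.
- exact/measurable_EFinP.
- by move=> x Zx Ox; rewrite gg.
- by move=> x Ox; rewrite g0.
Qed.

End main.

(** The constants of the theorem may depend on [Omega] but precede eps. Any eps for which [Omega] is
    an (eps,oo)-domain serves; if there is none, the claim is vacuous and 1 is a placeholder. *)
Lemma uniform_constant (R : realType) (n : nat) (Omega : set 'rV[R]_n.+1) :
  exists c : R, [/\ 0 < c, c <= 1 & forall eps, 0 < eps -> eps <= 1 ->
    eps_infty_domain eps Omega -> uniform_domain c Omega].
Proof.
have [[e [e0 e1 De]]|nD] := pselect (exists e : R, [/\ 0 < e, e <= 1 & eps_infty_domain e Omega]).
  exists (e / n.+1%:R ^+ 2); split.
  - by rewrite divr_gt0// exprn_gt0.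
  - by rewrite ler_pdivrMr ?exprn_gt0// mul1r (le_trans e1)// exprn_ege1// ler1n.
  - by move=> _ _ _ _; exact: uniform_eps_domain.
by exists 1; split => // eps e0 e1 De; exfalso; apply: nD; exists eps.
Qed.

Theorem theorem6p3 (R : realType) (n : nat) (Omega : set 'rV[R]_n.+1)
    (alpha r p : R)
    (bOmega : bounded_set Omega)
    (r_gt1 : 1 < r) (r_le_alpha : r <= alpha) (p_ge1 : 1 <= p) (p_le_r : p <= r) :
  exists C1 C2 : R, [/\ 0 < C1, 0 < C2 &
    forall (eps : R) (nu0 : R) (rho : R -> R -> R) (f : 'rV[R]_n.+1 -> R),
      0 < eps -> eps <= 1 -> eps_infty_domain eps Omega ->
      0 < nu0 -> radial_decreasing_approx_id n nu0 rho ->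
      let N nu := morrey_norm_on Omega alpha r
                    (bbm_function Omega p (rho nu) f) in
      (sobolev_morrey Omega alpha r f <->
         morrey_on Omega alpha r (EFin \o f) /\ (limf_einf N 0^'+ < +oo)%E) /\
      (sobolev_morrey Omega alpha r f ->
       forall G : 'rV[R]_n.+1 -> 'rV[R]_n.+1, weak_gradient Omega f G ->
         let gradN := morrey_norm_on Omega alpha r (fun x => (enorm (G x))%:E) in
         [/\ (C1%:E * gradN <= limf_einf N 0^'+)%E,
             (limf_einf N 0^'+ <= limf_esup N 0^'+)%E
           & (limf_esup N 0^'+ <= C2%:E * gradN)%E])].
Proof.
have [c [c0 c1 cP]] := uniform_constant Omega.
have [D D0 OD] : exists2 D : R, 0 < D & forall x, Omega x -> `|x| <= D.
  have [M [_ MP]] := bOmega; exists (`|M| + 1); first by rewrite ltr_wpDl.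
  by move=> x Ox; apply: MP => //; rewrite (le_lt_trans (ler_norm _))// ltrDl.
have r0 : 0 < r := lt_trans ltr01 r_gt1.
have lf0 : 0 < lower_factor n r p by exact: lower_factor_gt0.
have uf0 : 0 < upper_factor n r p c by exact: upper_factor_gt0.
(* The first constant is inverted because [gradient_le_bbm] has its factor on the side of the lower
   limit. *)
exists (lower_factor n r p)^-1, (upper_factor n r p c); split; [by rewrite invr_gt0|by []|].
move=> eps nu0 rho f e0 e1 De nu00 Hrho N.
have oO : open Omega := De.1; have unif := cP eps e0 e1 De.
split; last first.
  move=> [Mf _] G wG gradN; split.
  - by rewrite lee_pdivrMl//; exact: (gradient_le_bbm oO OD r_gt1 p_ge1 p_le_r nu00 Hrho Mf wG).
  - exact: limf_einf_le_esup.
  - exact: (bbm_limsup_le oO D0 OD r_gt1 p_ge1 p_le_r nu00 Hrho c0 c1 unif Mf wG).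
split=> [[Mf [G wG MG]]|[Mf Nfin]].
  split => //; apply: (le_lt_trans (limf_einf_le_esup _)).
  apply: (le_lt_trans (bbm_limsup_le oO D0 OD r_gt1 p_ge1 p_le_r nu00 Hrho c0 c1 unif Mf wG)).
  apply: lte_mul_pinfty; rewrite ?lee_fin ?ltW//.
  exact: (gradient_norm_fin oO r_gt1 wG MG).
exact: (sobolev_of_bbm oO D0 OD r_gt1 p_ge1 p_le_r nu00 Hrho Mf Nfin).
Qed.
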